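(* Let $\Gamma$ be the line (path) graph on $K$ vertices. (i) If $\lambda<1$: when $K=\ln(n)/\ln(1/\lambda)-\omega(\ln(\ln(n)))$, detection and reconstruction are impossible; when $K=\ln(n)/\ln(1/\lambda)+\omega(1)$ and $K=o(n/\ln(n))$, both detection and reconstruction are easy. (ii) If $\lambda>1$: detection and reconstruction are impossible if $K=o(\sqrt n)$; detection is easy if $K=\omega(\sqrt n)$; and reconstruction is impossible for $K=o(n)$.
   Context: Model: $n$ nodes; $\lambda>0$ fixed. Under $H_0$ (law $\mathbb{P}_0$) the observed graph $G$ is $\mathcal G(n,\lambda/n)$. Under $H_1$ (law $\mathbb{P}_1$), $G=G_0\cup G'$ where $G_0\sim\mathcal G(n,\lambda/n)$ and $G'$ is the image of $\Gamma$ (vertex set $[K]$) under an injective map $\sigma:[K]\to[n]$ chosen uniformly at random independently of $G_0$; $\mathcal K=\sigma([K])$. The overlap of an estimator $\hat{\mathcal K}$ (a $K$-set computed from $G$) is $\mathrm{ov}(\hat{\mathcal K})=\sum_{i\in[n]}\mathbb{P}_1(i\in\hat{\mathcal K}\cap\mathcal K)$. ''Detection impossible'' means the total variation distance between $\mathbb{P}_0$ and $\mathbb{P}_1$ tends to $0$; ''detection easy'' means some polynomial-time test has both error probabilities tending to $0$; ''reconstruction impossible'' means every estimator has $\mathrm{ov}(\hat{\mathcal K})=o(K)$; ''reconstruction easy'' means some polynomial-time estimator has $\mathrm{ov}(\hat{\mathcal K})=K(1-o(1))$. Asymptotics as $n\to\infty$. *)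

(* Defs.v *)
From HB Require Import structures.
From mathcomp Require Import all_boot all_order all_algebra.
From mathcomp Require Import all_classical all_reals all_analysis.


Import Order.TTheory GRing.Theory Num.Theory.
Import numFieldNormedType.Exports.
Local Open Scope ring_scope.

(* Graphs on the vertex set 'I_n : a graph is its set of edges, each   *)
(* edge being a 2-element subset of 'I_n.                              *)

Definition graph (n : nat) := {set {set 'I_n}}.

Definition pairs (n : nat) : graph n := [set e : {set 'I_n} | #|e| == 2%N].

Definition path_graph (K : nat) : graph K :=
  [set e : {set 'I_K} | [exists i : 'I_K, exists j : 'I_K,
                           (val j == (val i).+1) && (e == [set i; j])]].

Definition injections (K n : nat) : {set {ffun 'I_K -> 'I_n}} :=
  [set s : {ffun 'I_K -> 'I_n} | injectiveb s].

Definition planted (K n : nat) (s : {ffun 'I_K -> 'I_n}) : graph n :=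
  [set (fun e : {set 'I_K} => s @: e) e | e in path_graph K].

Definition hidden (K n : nat) (s : {ffun 'I_K -> 'I_n}) : {set 'I_n} :=
  [set s i | i : 'I_K].

Section Model.
Context {R : realType}.

(* edge probability lambda/n of G(n, lambda/n) (clamped at 1 for tiny n) *)
Definition edge_prob (lam : R) (n : nat) : R := Num.min 1 (lam / n%:R).

Definition ER_prob (p : R) (n : nat) (E : graph n) : R :=
  if E \subset pairs n then p ^+ #|E| * (1 - p) ^+ (#|pairs n| - #|E|) else 0.

(* joint law of (sigma, G_0) under H_1 : sigma uniform over injections,
   independent of G_0 ~ G(n, lambda/n) *)
Definition joint1 (lam : R) (K n : nat) (s : {ffun 'I_K -> 'I_n}) (G0 : graph n) : R :=
  (s \in injections K n)%:R / #|injections K n|%:R * ER_prob (edge_prob lam n) n G0.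

Definition P0 (lam : R) (n : nat) (G : graph n) : R := ER_prob (edge_prob lam n) n G.

Definition P1 (lam : R) (K n : nat) (G : graph n) : R :=
  \sum_(s : {ffun 'I_K -> 'I_n}) \sum_(G0 : graph n | G0 :|: planted K n s == G)
      joint1 lam K n s G0.

Definition TV (lam : R) (K n : nat) : R :=
  2^-1 * \sum_(G : graph n) `|P0 lam n G - P1 lam K n G|.

(* error probabilities of a test T (T G = true means "decide H_1") *)
Definition err0 (lam : R) (n : nat) (T : graph n -> bool) : R :=
  \sum_(G : graph n | T G) P0 lam n G.

Definition err1 (lam : R) (K n : nat) (T : graph n -> bool) : R :=
  \sum_(G : graph n | ~~ T G) P1 lam K n G.

Definition overlap (lam : R) (K n : nat) (est : graph n -> {set 'I_n}) : R :=
  \sum_(i : 'I_n) \sum_(s : {ffun 'I_K -> 'I_n}) \sum_(G0 : graph n)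
     joint1 lam K n s G0 * (i \in est (G0 :|: planted K n s) :&: hidden K n s)%:R.

End Model.

(* tape symbols : None = blank *)
Definition sym := option bool.

(* moves : 0 = left, 1 = right, 2 = stay *)
Record TM := MkTM {
  tm_Q : nat;  (* the states are 'I_(tm_Q.+1), ord0 is the initial state *)
  tm_delta : {ffun 'I_tm_Q.+1 * sym -> option ('I_tm_Q.+1 * sym * 'I_3)}
  (* None = halt *)
}.

(* configuration : state, left part of tape (reversed), head symbol, right part *)
Definition config (M : TM) := ('I_(tm_Q M).+1 * seq sym * sym * seq sym)%type.

Definition step (M : TM) (c : config M) : option (config M) :=
  let: (q, l, h, r) := c in
  match tm_delta M (q, h) with
  | None => None
  | Some (q', w, m) =>
      if val m == 0%N then
        match l with
        | [::] => Some (q', [::], None, w :: r)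
        | x :: l' => Some (q', l', x, w :: r)
        end
      else if val m == 1%N then
        match r with
        | [::] => Some (q', w :: l, None, [::])
        | x :: r' => Some (q', w :: l, x, r')
        end
      else Some (q', l, w, r)
  end.

Fixpoint run (M : TM) (fuel : nat) (c : config M) : option (config M) :=
  match fuel with
  | 0 => None
  | f.+1 => match step M c with None => Some c | Some c' => run M f c' end
  end.

Definition init (M : TM) (x : seq bool) : config M :=
  match map Some x with
  | [::] => (ord0, [::], None, [::])
  | h :: t => (ord0, [::], h, t)
  end.

(* input encoding of an instance : K in unary, then the adjacency bits of G
   (pairs i < j in lexicographic order) *)
Definition encode (K n : nat) (G : graph n) : seq bool :=
  nseq K true ++ false ::
  flatten [seq [seq ([set i; j] \in G) | j <- enum 'I_n & (val i < val j)%N]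
          | i <- enum 'I_n].

Definition halts_within (M : TM) (fuel : nat) (x : seq bool) : Prop :=
  run M fuel (init M x) <> None.

Definition tm_accepts (M : TM) (fuel : nat) (x : seq bool) : bool :=
  match run M fuel (init M x) with
  | Some (_, _, h, _) => h == Some true
  | None => false
  end.

(* set output : the bit string read from the head rightwards, as the
   indicator of a subset of 'I_n *)
Definition tm_set_output (M : TM) (fuel : nat) (n : nat) (x : seq bool) : {set 'I_n} :=
  match run M fuel (init M x) with
  | Some (_, _, h, r) => [set i : 'I_n | nth None (h :: r) (val i) == Some true]
  | None => [set i : 'I_n | false]
  end.

Section Notions.
Local Open Scope classical_set_scope.
Context {R : realType}.

Definition detection_impossible (lam : R) (K : nat -> nat) : Prop :=
  (fun n => TV lam (K n) n) @ \oo --> (0 : R).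

Definition detection_easy (lam : R) (K : nat -> nat) : Prop :=
  exists (M : TM) (c d : nat),
    (forall n (G : graph n), halts_within M (c * n.+1 ^ d) (encode (K n) n G)) /\
    (fun n => err0 lam n (fun G : graph n => tm_accepts M (c * n.+1 ^ d) (encode (K n) n G)))
      @ \oo --> (0 : R) /\
    (fun n => err1 lam (K n) n (fun G : graph n => tm_accepts M (c * n.+1 ^ d) (encode (K n) n G)))
      @ \oo --> (0 : R).

Definition reconstruction_impossible (lam : R) (K : nat -> nat) : Prop :=
  forall est : forall n, graph n -> {set 'I_n},
    (forall n (G : graph n), #|est n G| = K n) ->
    forall eps : R, 0 < eps ->
      \forall n \near \oo, overlap lam (K n) n (est n) <= eps * (K n)%:R.

Definition reconstruction_easy (lam : R) (K : nat -> nat) : Prop :=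
  exists (M : TM) (c d : nat),
    (forall n (G : graph n), halts_within M (c * n.+1 ^ d) (encode (K n) n G)) /\
    (forall n (G : graph n), #|tm_set_output M (c * n.+1 ^ d) n (encode (K n) n G)| = K n) /\
    forall eps : R, 0 < eps ->
      \forall n \near \oo,
        (1 - eps) * (K n)%:R <=
        overlap lam (K n) n (fun G : graph n => tm_set_output M (c * n.+1 ^ d) n (encode (K n) n G)).

End Notions.

(* Main.v *)
(** The likelihood ratio of the planted model has second moment
    [E p^-|pi & pi'|] over two independent placements [pi], [pi'] of the path.
    Revealing the second path vertex by vertex turns this into a sum over
    non-backtracking chains in which a step along [pi] contributes a factor [1/lam]
    and a fresh visit to [pi] has probability [K/n]; so it tends to [1] as soon
    as [K^2/n * sum_(i <= K) lam^-i] tends to [0].  The same estimate, weighted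
    by the number of common vertices, bounds the overlap of any estimator.  For
    [lam > 1] and larger [K] only a window of about [n^(1/8)] path vertices
    around a given position is hidden from the estimator: both ends of the
    window are then forgotten geometrically fast, so that the hidden vertex is
    almost uniform.

    For [lam < 1] the estimator peels off leaves: path vertices at distance [m]
    from the ends survive [m] rounds of removing the vertices with fewer than
    two neighbours.  A surviving vertex outside the path forces a cycle, a
    connection between two path vertices, a long branch hanging from the path or
    a path of [K - O(1)] vertices in the noise graph, and all of these are rare.
    For [lam > 1] the test counts pairs of adjacent edges, corrected by a
    multiple of [m (m - 1)], where [m] is the number of edges: the corrected
    count is a degenerate quadratic form with variance [O(n)], and planting
    increases its mean by about [2K].

    Polynomial running time is obtained from a compiler of a small imperative
    language, with registers and bit arrays bounded by the input size, into
    one-tape Turing machines. *)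

Require Import Defs.
From HB Require Import structures.
From mathcomp Require Import all_boot all_order all_algebra.
From mathcomp Require Import all_classical all_reals all_analysis.
From mathcomp Require Import zify ring lra.
Import Order.TTheory GRing.Theory Num.Theory.
Import numFieldNormedType.Exports.
Set Implicit Arguments.
Unset Strict Implicit.
Unset Printing Implicit Defensive.
Local Open Scope nat_scope.

(** * Structured Turing machines *)

(** Competing errors fix the scales. Deep peeling certifies a long path but erases the planted one,
    so two depths occur: [K.-1./2] rounds find the components containing a path of about [K]
    vertices, and only about [sqrt (2 K)] rounds select vertices inside them, which costs [o(K)]
    path vertices. The supercritical test must resolve a shift of order [K], possibly far below the
    mean [lam ^ 2 * n] of the wedge count, while a machine cannot store the real number [lam]; the
    correction centres the statistic under the null law whatever the edge probability is, so the
    threshold involves [K] alone. When [K] is comparable to [n] the correction absorbs the gain, and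
    the number of edges is tested against an integer multiple of [n - 1] instead. The window must be
    long enough for [lam ^ (- t)] to beat [1 / n], yet [t] must be small compared with [K], and
    [t ^ 2] small compared with [n]; [t] near [n ^ (1/8)] does this once [K > n ^ (1/4)], and for
    smaller [K] the global second moment suffices. *)

Definition tape := (seq sym * sym * seq sym)%type.

Definition act (w : sym) (m : 'I_3) (t : tape) : tape :=
  let: (l, h, r) := t in
  if val m == 0 then
    match l with
    | [::] => ([::], None, w :: r)
    | x :: l' => (l', x, w :: r)
    end
  else if val m == 1 then
    match r with
    | [::] => (w :: l, None, [::])
    | x :: r' => (w :: l, x, r')
    end
  else (l, w, r).

Arguments act : simpl never.

Definition mleft : 'I_3 := @Ordinal 3 0 isT.
Definition mright : 'I_3 := @Ordinal 3 1 isT.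
Definition mstay : 'I_3 := @Ordinal 3 2 isT.

(** A machine over an arbitrary finite state type, so that machines can be glued by disjoint sums of
    states, with two exits [inr true] and [inr false], so that a sub-machine can report the outcome
    of a test. *)
Record proc := Proc {
  pQ : finType;
  p0 : pQ;
  pd : pQ -> sym -> (pQ + bool) * sym * 'I_3
}.

Definition pstep (P : proc) (q : pQ P) (t : tape) : (pQ P + bool) * tape :=
  let: (q', w, m) := pd q t.1.2 in (q', act w m t).

(* Exit states [inr b] are absorbing, so the number of steps need not be exact. *)
Fixpoint piter (P : proc) (k : nat) (c : (pQ P + bool) * tape) :=
  if k is k'.+1 then
    match c.1 with
    | inl q => piter k' (pstep q c.2)
    | inr _ => c
    end
  else c.

Lemma piter_exit P k b t : @piter P k (inr b, t) = (inr b, t).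
Proof. by case: k. Qed.

Lemma piterD P a b c : @piter P (a + b) c = piter b (piter a c).
Proof. by elim: a c => [|a IH] [[q|e] t] //=; rewrite piter_exit. Qed.

Definition within (P : proc) (T : nat) (c c' : (pQ P + bool) * tape) :=
  exists2 k, k <= T & piter k c = c'.

Lemma within0 P T c : @within P T c c.
Proof. by exists 0. Qed.

Lemma within_trans P T1 T2 c1 c2 c3 :
  @within P T1 c1 c2 -> within T2 c2 c3 -> within (T1 + T2) c1 c3.
Proof.
move=> [k1 h1 e1] [k2 h2 e2]; exists (k1 + k2); first exact: leq_add.
by rewrite piterD e1.
Qed.

Lemma within_le P T1 T2 c1 c2 : T1 <= T2 -> @within P T1 c1 c2 -> within T2 c1 c2.
Proof. by move=> h [k hk e]; exists k => //; exact: leq_trans h. Qed.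

Lemma within_step P T q t c :
  within T (@pstep P q t) c -> within T.+1 (inl q, t) c.
Proof. by move=> [k hk e]; exists k.+1. Qed.

Definition computes (P : proc) (T : nat) (t : tape) (b : bool) (t' : tape) :=
  within T (inl (p0 P), t) (inr b, t').

Lemma computes_le P T1 T2 t b t' :
  T1 <= T2 -> computes P T1 t b t' -> computes P T2 t b t'.
Proof. exact: within_le. Qed.

Section Link.
Variables (I : finType) (Ps : I -> proc) (nxt : I -> bool -> I + bool) (i0 : I).

Let Q : finType := {i : I & pQ (Ps i)}.

Definition enter (x : I + bool) : Q + bool :=
  match x with
  | inl j => inl (Tagged (fun i => pQ (Ps i)) (p0 (Ps j)))
  | inr b => inr b
  end.

(** Gluing along a control graph: [nxt i b] names the component started, or the exit taken, when
    component [i] exits with [b]. Sequence, branching and loop are instances. An exit is redirected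
    inside the transition that produces it, so gluing costs no step. *)
Definition link : proc := @Proc Q (Tagged (fun i => pQ (Ps i)) (p0 (Ps i0)))
  (fun x h => let: existT i q := x in
     let: (q', w, m) := pd q h in
     (match q' with
      | inl q' => inl (Tagged (fun i => pQ (Ps i)) q')
      | inr b => enter (nxt i b)
      end, w, m)).

Lemma link_within i T q t b t' :
  within T (inl q : pQ (Ps i) + bool, t) (inr b, t') ->
  @within link T (inl (Tagged (fun i => pQ (Ps i)) q), t) (enter (nxt i b), t').
Proof.
move=> [k hk] e; have [k' hk' e'] : exists2 k', k' <= k &
  @piter link k' (inl (Tagged (fun i => pQ (Ps i)) q), t) = (enter (nxt i b), t').
  elim: k q t e {hk} => [//|k IH] q t /=.
  rewrite {1}/pstep; case E: (pd q t.1.2) => [[q' w] m] /=.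
  case: q' E => [q'|b'] E.
    move=> /IH [k' hk' e']; exists k'.+1 => //=.
    by rewrite /pstep /= E.
  rewrite piter_exit => -[<- <-]; exists 1 => //=.
  by rewrite /pstep /= E.
by exists k' => //; exact: leq_trans hk.
Qed.

Lemma link_enter i T t b t' :
  computes (Ps i) T t b t' ->
  @within link T (enter (inl i), t) (enter (nxt i b), t').
Proof. exact: link_within. Qed.

End Link.

Definition seqp (P1 P2 : proc) : proc :=
  @link bool (fun i => if i then P1 else P2)
    (fun i b => if i then inl false else inr b) true.

Lemma seqp_computes P1 P2 T1 T2 t1 b1 t2 b2 t3 :
  computes P1 T1 t1 b1 t2 -> computes P2 T2 t2 b2 t3 ->
  computes (seqp P1 P2) (T1 + T2) t1 b2 t3.
Proof.
move=> h1 h2; rewrite /computes.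
apply: within_trans (@link_enter bool (fun i => if i then P1 else P2)
    (fun i b => if i then inl false else inr b) true true _ _ _ _ h1) _.
exact: (@link_enter bool (fun i => if i then P1 else P2)
    (fun i b => if i then inl false else inr b) true false _ _ _ _ h2).
Qed.

Definition ifp (P P1 P2 : proc) : proc :=
  @link (option bool)
    (fun i => match i with None => P | Some true => P1 | Some false => P2 end)
    (fun i b => if i is None then inl (Some b) else inr b) None.

Lemma ifp_computes P P1 P2 T T' t (b : bool) t2 b' t3 :
  computes P T t b t2 -> computes (if b then P1 else P2) T' t2 b' t3 ->
  computes (ifp P P1 P2) (T + T') t b' t3.
Proof.
move=> h1 h2; rewrite /computes.
set Ps := (fun i : option bool =>
   match i with None => P | Some true => P1 | Some false => P2 end).
set nx := (fun (i : option bool) (b : bool) =>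
   if i is None then inl (Some b) else inr b).
apply: within_trans (@link_enter _ Ps nx None None _ _ _ _ h1) _.
apply: (@link_enter _ Ps nx None (Some b) _ _ _ _ _).
by case: (b) h2.
Qed.

Definition whilep (P B : proc) : proc :=
  @link bool (fun i => if i then P else B)
    (fun i b => if i then (if b then inl false else inr false) else inl true) true.

(** The invariant is indexed by the number of completed rounds and the guard has to decide [i < m];
    the number of rounds is thus known beforehand, and termination and running time come
    together. *)
Lemma whilep_computes (P B : proc) (T TB : nat) (W : nat -> tape -> Prop) (m : nat) :
  (forall i t, W i t -> exists2 t', W i t' & computes P T t (i < m) t') ->
  (forall i t, W i t -> i < m -> exists t' b, W i.+1 t' /\ computes B TB t b t') ->
  forall t, W 0 t -> exists2 t', W m t' &
    computes (whilep P B) (m * (T + TB) + T) t false t'.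
Proof.
set Ps := (fun i : bool => if i then P else B).
set nx := (fun i b : bool =>
   if i then (if b then inl false else inr false) else inl true : bool + bool).
move=> hP hB.
suff key : forall d i t, W i t -> i + d = m -> exists2 t', W m t' &
  @within (link Ps nx true) (d * (T + TB) + T) (@enter _ Ps (inl true), t) (inr false, t').
  by move=> t /key; apply; rewrite add0n.
elim=> [|d IH] i t Wt.
  rewrite addn0 => e; have [t' Wt' c] := hP _ _ Wt.
  exists t'; first by rewrite -e.
  have := @link_enter _ Ps nx true true _ _ _ _ c.
  by rewrite e ltnn mul0n.
move=> e; have [t' Wt' c] := hP _ _ Wt.
have lim : i < m by rewrite -e addnS ltnS leq_addr.
have [t2 [b [Wt2 c2]]] := hB _ _ Wt' lim.
have [|t3 Wt3 c3] := IH _ _ Wt2; first by rewrite addSnnS.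
exists t3 => //; rewrite mulSn -!addnA.
have := @link_enter _ Ps nx true true _ _ _ _ c; rewrite lim => c'.
apply: within_trans c' _; apply: within_trans c3.
exact: (@link_enter _ Ps nx true false _ _ _ _ c2).
Qed.

Section ToTM.
Variable P : proc.
Let S : finType := (pQ P + bool)%type.

(** A [TM] starts in state [ord0], whereas [enum_rank] may put the start state anywhere; the
    additional index [ord0] is a copy of the start state that is never entered again. *)
Definition tm_dec (i : 'I_(#|S|).+1) : S :=
  if unlift ord0 i is Some j then enum_val j else inl (p0 P).
Definition tm_enc (s : S) : 'I_(#|S|).+1 := lift ord0 (enum_rank s).

Lemma tm_encK s : tm_dec (tm_enc s) = s.
Proof. by rewrite /tm_dec /tm_enc liftK enum_rankK. Qed.

Definition tm_of : TM := @MkTM #|S|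
  [ffun x => match tm_dec x.1 with
             | inl q => let: (q', w, m) := pd q x.2 in Some (tm_enc q', w, m)
             | inr _ => None
             end].

(** The extra unit of fuel is the one that [run] spends on noticing that the machine has halted. *)
Lemma run_tm_of k i q t b t' :
  tm_dec i = inl q -> piter k (inl q : S, t) = (inr b, t') ->
  exists j, run tm_of k.+1 (i, t.1.1, t.1.2, t.2) = Some (j, t'.1.1, t'.1.2, t'.2).
Proof.
elim: k i q t => [|k IH] i q t // di.
have st : step tm_of (i, t.1.1, t.1.2, t.2) =
    let: (q', w, m) := pd q t.1.2 in
    let t2 := act w m t in Some (tm_enc q', t2.1.1, t2.1.2, t2.2).
  case: t di => [[l h] r] di /=; rewrite ffunE /= di.
  case: (pd q h) => [[q' w] m] /=.
  rewrite /act; case: ifP => _; first by case: (l).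
  by case: ifP => _ //; case: (r).
rewrite -[run _ _ _]/(match step tm_of (i, t.1.1, t.1.2, t.2) with
  None => Some _ | Some c' => run tm_of k.+1 c' end).
rewrite st /= /pstep; case: (pd q t.1.2) => [[q' w] m].
case: q' => [q'|b'].
  by move=> h; apply: (IH _ q') => //; rewrite tm_encK.
rewrite piter_exit => -[_ <-]; exists (tm_enc (inr b')).
by rewrite /= ffunE /= tm_encK.
Qed.

End ToTM.

Lemma run_mono M f f' c c' : f <= f' -> run M f c = Some c' -> run M f' c = Some c'.
Proof.
elim: f f' c => [|f IH] [|f'] c //= h.
by case: (step M c) => // c1; apply: IH.
Qed.

(** * Transducers *)

(** The list [s] starts at the head. A missing head cell is read as a blank, so [[::]] and
    [[:: None]] give the same tape. *)
Definition tape_of (l s : seq sym) : tape := (l, head None s, behead s).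

Lemma act_right w l s : act w mright (tape_of l s) = tape_of (w :: l) (behead s).
Proof. by case: s => [|? [|? ?]]. Qed.

Lemma act_left w l s :
  act w mleft (tape_of l s) = tape_of (behead l) (head None l :: w :: behead s).
Proof. by case: l => [|? ?]. Qed.

Lemma act_stay w l s : act w mstay (tape_of l s) = tape_of l (w :: behead s).
Proof. by []. Qed.

Section Transducer.
Variables (Q : finType) (f : Q -> bool -> Q * seq bool) (q0 : Q) (fin : Q -> bool).

Fixpoint trans (q : Q) (u : seq bool) : Q * seq bool :=
  if u is b :: u' then
    let: (q', e) := f q b in let: (q'', o) := trans q' u' in (q'', e ++ o)
  else (q, [::]).

Let m := \max_(x : Q * bool) size (f x.1 x.2).2.

Lemma size_emit q b : size (f q b).2 <= m.
Proof. exact: (leq_bigmax (q, b)). Qed.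

Let st : finType := ('I_6 * Q * bool * 'I_m.+1)%type.
Definition mkst (ph : 'I_6) q b j : st := (ph, q, b, j).

(* Phases: 0 = about to consume a bit, 1 = running right over the remaining
   input, 2 = running right over the output, 3 = appending, 4 and 5 = running
   back left over the output and the input. *)
Definition tproc : proc := @Proc st (mkst (inord 0) q0 false ord0)
  (fun x h => let: (ph, q, b, j) := x in
    match val ph, h with
    | 0, None => (inr (fin q), None, mright)
    | 0, Some b => (inl (mkst (inord 1) q b ord0), None, mright)
    | 1, None => (inl (mkst (inord 2) q b ord0), None, mright)
    | 1, h => (inl (mkst (inord 1) q b ord0), h, mright)
    | 2, None => (inl (mkst (inord 3) q b ord0), None, mstay)
    | 2, h => (inl (mkst (inord 2) q b ord0), h, mright)
    | 3, h => if val j < size (f q b).2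
              then (inl (mkst (inord 3) q b (inord (val j).+1)),
                    Some (nth false (f q b).2 (val j)), mright)
              else (inl (mkst (inord 4) (f q b).1 false ord0), None, mleft)
    | 4, None => (inl (mkst (inord 5) q false ord0), None, mleft)
    | 4, h => (inl (mkst (inord 4) q false ord0), h, mleft)
    | _, None => (inl (mkst (inord 0) q false ord0), None, mright)
    | _, h => (inl (mkst (inord 5) q false ord0), h, mleft)
    end).

Notation wn := (@within tproc).
Notation S ph q b := (inl (mkst (inord ph) q b ord0) : pQ tproc + bool).

Lemma walk_right ph q b l u z : ph = 1 \/ ph = 2 ->
  wn (size u) (S ph q b, tape_of l (map Some u ++ z))
              (S ph q b, tape_of (rev (map Some u) ++ l) z).
Proof.
move=> hph; elim: u l => [|x u IH] l; first exact: within0.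
apply: within_step; rewrite rev_cons cat_rcons.
case: hph IH => -> IH.
  by rewrite /pstep /= inordK // act_right; exact: IH.
by rewrite /pstep /= inordK // act_right; exact: IH.
Qed.

Lemma walk_left ph q L R u : ph = 4 \/ ph = 5 ->
  wn (size u) (S ph q false, tape_of (behead (map Some u ++ None :: L))
                                     (head None (map Some u ++ None :: L) :: R))
              (S ph q false, tape_of L (None :: rev (map Some u) ++ R)).
Proof.
move=> hph; elim: u R => [|x u IH] R; first exact: within0.
apply: within_step; rewrite [map _ _]/= rev_cons cat_rcons.
case: hph IH => -> IH.
  by rewrite /pstep /= inordK // act_left; exact: IH.
by rewrite /pstep /= inordK // act_left; exact: IH.
Qed.

(** The output may run over the end of the visited tape, so the number of blanks behind it stays
    existential. *)
Lemma append q b l k : exists k', wn (size (f q b).2).+1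
  (S 3 q b, tape_of l (nseq k None))
  (S 4 (f q b).1 false,
   tape_of (behead (rev (map Some (f q b).2) ++ l))
           (head None (rev (map Some (f q b).2) ++ l) :: nseq k' None)).
Proof.
set e := (f q b).2; have he := size_emit q b; rewrite -/e in he.
suff key : forall d j k l0, j + d = size e ->
  l0 = rev (map Some (take j e)) ++ l -> exists k', wn d.+1
  (inl (mkst (inord 3) q b (inord j)) : pQ tproc + bool, tape_of l0 (nseq k None))
  (S 4 (f q b).1 false, tape_of (behead (rev (map Some e) ++ l))
           (head None (rev (map Some e) ++ l) :: nseq k' None)).
  have [//|//|k' hk'] := key (size e) 0 k l; first by rewrite take0.
  exists k'; move: hk'; congr (wn _ (inl (mkst _ _ _ _), _) _).
  by apply: val_inj; rewrite /= inordK.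
elim=> [|d IH] j k0 l0 hj ->.
  exists (k0.-1.+1); apply: within_step.
  rewrite /pstep /= !inordK //; last by rewrite ltnS (leq_trans _ he) // -hj leq_addr.
  rewrite -hj addn0 ltnn -/e act_left take_oversize; last by rewrite -hj addn0.
  by case: k0 => [|k0]; exact: within0.
have ltj : j < size e by rewrite -hj addnS ltnS leq_addr.
have hj1 : j.+1 < m.+1 by rewrite ltnS (leq_trans ltj he).
have [||k' hk'] := IH j.+1 k0.-1 (Some (nth false e j) :: rev (map Some (take j e)) ++ l).
- by rewrite addSnnS.
- by rewrite (take_nth false ltj) map_rcons rev_rcons.
exists k'; apply: within_step.
rewrite /pstep /= !inordK // ?(ltnW hj1) // -/e ltj act_right.
by case: k0 hk' => [|k0].
Qed.

(** The tape holds the unread input, a blank separator (the head of [z], a missing cell counting as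
    blank), the output so far, and blanks. The bit read is replaced by a blank, which is what stops
    the return walk. *)
Lemma tproc_cycle q b u v l z k : head None z = None ->
  behead z = map Some v ++ nseq k None ->
  exists l' z' k', [/\ head None z' = None,
    behead z' = map Some (v ++ (f q b).2) ++ nseq k' None &
    wn (2 * (size u + size v + size (f q b).2) + 8)
      (S 0 q false, tape_of l (map Some (b :: u) ++ z))
      (S 0 (f q b).1 false, tape_of l' (map Some u ++ z'))].
Proof.
move=> hz1 hz2; have [k' hk'] := append q b (rev (map Some v) ++ None :: rev (map Some u) ++ None :: l) k.-1.+1.
set e := (f q b).2 in hk' *.
exists (None :: l), (None :: map Some (v ++ e) ++ nseq k' None), k'; split=> //.
pose T := 1 + (size u + (1 + (size v + (1 + ((size e).+1 + (size (rev e ++ rev v) +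
   (1 + (size (rev u) + 1)))))))).
apply: (@within_le _ T); first by rewrite /T !size_cat !size_rev; lia.
rewrite /T; apply: within_trans.
  apply: within_step; rewrite /pstep /= inordK //= act_right; exact: within0.
apply: within_trans; first by apply: walk_right; left.
apply: within_trans.
  apply: within_step; rewrite /pstep /= inordK //= hz1 act_right hz2; exact: within0.
apply: within_trans; first by apply: walk_right; right.
apply: within_trans.
  apply: within_step; rewrite /pstep /= inordK //=.
  have -> : head None (nseq k None) = None :> sym by case: (k).
  rewrite act_stay; have -> : None :: behead (nseq k None) = nseq k.-1.+1 None :> seq sym by case: (k).
  exact: within0.
apply: within_trans; first exact: hk'.
rewrite catA.
have -> : rev (map Some e) ++ rev (map Some v) = map Some (rev (v ++ e)).
  by rewrite rev_cat map_cat !map_rev.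
have -> : size (rev e ++ rev v) = size (rev (v ++ e)) by rewrite rev_cat.
apply: within_trans; first by apply: walk_left; left.
apply: within_trans.
  apply: within_step; rewrite /pstep /= inordK //= act_left; exact: within0.
rewrite -[rev (map Some u)]map_rev -(map_rev _ (rev (v ++ e))) revK.
apply: within_trans; first by apply: walk_left; right.
apply: within_step; rewrite /pstep /= inordK //= act_right /=.
by rewrite -map_rev revK; exact: within0.
Qed.

(** Once the input is exhausted the head steps from the separator onto the output, which then lies
    where an input is expected: transducers can be chained, the tape merely drifting to the right.
    Each input bit costs one walk over input and output and back. *)
Lemma tproc_computes u l k : exists l' k',
  computes tproc (size u * (2 * (size u + size (trans q0 u).2) + 8)).+1
    (tape_of l (map Some u ++ nseq k None)) (fin (trans q0 u).1)
    (tape_of l' (map Some (trans q0 u).2 ++ nseq k' None)).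
Proof.
pose B s := 2 * s + 8.
suff key : forall w q v l z k s, size w + size v + size (trans q w).2 <= s ->
  head None z = None -> behead z = map Some v ++ nseq k None ->
  exists l' k', wn (size w * B s).+1 (S 0 q false, tape_of l (map Some w ++ z))
    (inr (fin (trans q w).1), tape_of l' (map Some (v ++ (trans q w).2) ++ nseq k' None)).
  have [//|||l' [k' h]] := key u q0 [::] l (nseq k None) k.-1 (size u + size (trans q0 u).2).
  - by rewrite addn0.
  - by case: (k).
  - by case: (k).
  by exists l', k'; exact: h.
elim=> [|b w IH] q v l0 z k0 s hs hz1 hz2.
  exists (None :: l0), k0; apply: within_step.
  by rewrite /pstep /= inordK //= hz1 act_right hz2 cats0; exact: within0.
have [l1 [z1 [k1 [hz1' hz2' h]]]] := tproc_cycle q b w l0 hz1 hz2.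
move: hs; rewrite /=; case E: (f q b) h hz2' => [q' e] /= h hz2'.
case E2: (trans q' w) => [q'' o] /=; rewrite size_cat => hs.
have [|l2 [k2 h2]] := IH q' (v ++ e) l1 z1 k1 s _ hz1' hz2'.
  by rewrite E2 size_cat /=; lia.
exists l2, k2; rewrite E2 /= -catA in h2.
rewrite mulSn -addnS; apply: within_trans h2.
by apply: within_le h; rewrite /B; lia.
Qed.

End Transducer.

(** * A small imperative language *)

Record store := Store { reg : nat -> nat; arr : nat -> nat -> bool }.

Definition upd (T : Type) (f : nat -> T) (x : nat) (v : T) :=
  fun y => if y == x then v else f y.

Definition setr (s : store) x v := Store (upd (reg s) x v) (arr s).
Definition seta (s : store) a i b := Store (reg s) (upd (arr s) a (upd (arr s a) i b)).

Inductive test := EqR of nat & nat | GetA of nat & nat.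

Inductive cmd :=
  | Skip
  | Put of nat & bool
  | Inc of nat
  | SetA of nat & nat & bool
  | Seq of cmd & cmd
  | If of test & cmd & cmd
  | For of nat & cmd.

(* Registers and arrays are indexed by the cells [0 .. N-1]; a register whose
   value is at least [N] points nowhere, and every test on it fails. *)
Definition tden (N : nat) (t : test) (s : store) : bool :=
  match t with
  | EqR x y => (reg s x == reg s y) && (reg s x < N)
  | GetA a x => (reg s x < N) && arr s a (reg s x)
  end.

(** Registers holding [0] or [N] serve as booleans, since [EqR x x] says that [x] points to a cell.
    [For] leaves its counter at [N], the value at which the guard of the compiled loop fails. *)
Fixpoint den (N : nat) (c : cmd) (s : store) : store :=
  match c with
  | Skip => s
  | Put x b => setr s x (if b then 0 else N)
  | Inc x => setr s x (reg s x).+1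
  | SetA a x b => seta s a (reg s x) b
  | Seq c1 c2 => den N c2 (den N c1 s)
  | If t c1 c2 => if tden N t s then den N c1 s else den N c2 s
  | For x c => setr (foldl (fun s i => den N c (setr s x i)) s (iota 0 N)) x N
  end.

Fixpoint nowrite (x : nat) (c : cmd) : bool :=
  match c with
  | Skip | SetA _ _ _ => true
  | Put y _ | Inc y => y != x
  | Seq c1 c2 | If _ c1 c2 => nowrite x c1 && nowrite x c2
  | For y c => (y != x) && nowrite x c
  end.

Fixpoint noset (a : nat) (c : cmd) : bool :=
  match c with
  | Skip | Put _ _ | Inc _ => true
  | SetA b _ _ => b != a
  | Seq c1 c2 | If _ c1 c2 => noset a c1 && noset a c2
  | For _ c => noset a c
  end.

Lemma updE T (f : nat -> T) x v y : upd f x v y = if y == x then v else f y.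
Proof. by []. Qed.

Lemma nowrite_reg N x c s : nowrite x c -> reg (den N c s) x = reg s x.
Proof.
elim: c s => //=.
- by move=> y b s; rewrite updE eq_sym => /negbTE ->.
- by move=> y s; rewrite updE eq_sym => /negbTE ->.
- by move=> c1 IH1 c2 IH2 s /andP[h1 h2]; rewrite IH2 // IH1.
- by move=> t c1 IH1 c2 IH2 s /andP[h1 h2]; case: ifP => _; [rewrite IH1|rewrite IH2].
move=> y c IH s /andP[h1 h2]; rewrite updE eq_sym (negbTE h1).
elim: (iota 0 N) s => //= i l IHl s; rewrite IHl IH //=.
by rewrite updE eq_sym (negbTE h1).
Qed.

Lemma noset_arr N a c s : noset a c -> arr (den N c s) a = arr s a.
Proof.
elim: c s => //=.
- by move=> b x v s; rewrite /upd eq_sym => /negbTE ->.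
- by move=> c1 IH1 c2 IH2 s /andP[h1 h2]; rewrite IH2 // IH1.
- by move=> t c1 IH1 c2 IH2 s /andP[h1 h2]; case: ifP => _; [rewrite IH1|rewrite IH2].
move=> y c IH s h; elim: (iota 0 N) s => //= i l IHl s; by rewrite IHl IH.
Qed.

Fixpoint wf (kr ka : nat) (c : cmd) : bool :=
  match c with
  | Skip => true
  | Put x _ | Inc x => x < kr
  | SetA a x _ => (a < ka) && (x < kr)
  | Seq c1 c2 => wf kr ka c1 && wf kr ka c2
  | If t c1 c2 => [&& (match t with EqR x y => (x < kr) && (y < kr)
                              | GetA a x => (a < ka) && (x < kr) end),
                    wf kr ka c1 & wf kr ka c2]
  | For x c => [&& x < kr, nowrite x c & wf kr ka c]
  end.

(** * Block transducers: one pass over the cells with a carried bit *)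

Section BlockTransducer.
Variables (k : nat) (beta : bool -> seq bool -> bool * seq bool).

Fixpoint thread (m : bool) (bs : seq (seq bool)) : bool * seq (seq bool) :=
  if bs is v :: bs' then
    let: (m1, o) := beta m v in let: (m2, os) := thread m1 bs' in (m2, o :: os)
  else (m, [::]).

Definition bQ : finType := (bool * (k.-bseq bool))%type.

(** Collects the [k] bits of a block before [beta] sees them; the buffer fits into the finite state
    because [k] is fixed by the program, not by the input. *)
Definition bstep (q : bQ) (b : bool) : bQ * seq bool :=
  let v := rcons q.2 b in
  if size v == k then ((let: (m, o) := beta q.1 v in ((m, [bseq]), o)))
  else ((q.1, insubd [bseq] v), [::]).

Lemma trans_block m bs : 0 < k -> all (fun v => size v == k) bs ->
  trans bstep (m, [bseq]) (flatten bs) =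
  let: (m', os) := thread m bs in ((m', [bseq]), flatten os).
Proof.
move=> k0; elim: bs m => [|v bs IH] m //= /andP[/eqP sv hbs].
suff key : forall (w : seq bool) (buf : k.-bseq bool), 0 < size w -> size buf + size w = k ->
    forall r, trans bstep (m, buf) (w ++ r) =
      let: (m1, o) := beta m (buf ++ w) in
      let: (q, o') := trans bstep (m1, [bseq]) r in (q, o ++ o').
  rewrite key ?sv //=; case: (beta m v) => m1 o; rewrite IH //.
  by case: (thread m1 bs).
elim=> [//|b w IHw] buf _ /= hs r.
rewrite /bstep /= size_rcons.
case: w IHw hs => [|b' w] IHw hs.
  have -> : (size buf).+1 == k by apply/eqP; rewrite /= in hs; lia.
  by rewrite cats1; case: (beta _ _).
have -> : (size buf).+1 == k = false by apply/eqP => /=; rewrite /= in hs; lia.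
have sb : size (rcons buf b) <= k by rewrite size_rcons; rewrite /= in hs; lia.
have vb : insubd ([bseq] : k.-bseq bool) (rcons buf b) = rcons buf b :> seq bool.
  by have := val_insubd ([bseq] : k.-bseq bool) (rcons buf b); rewrite sb.
rewrite IHw ?vb //; last by rewrite size_rcons /=; rewrite /= in hs; lia.
rewrite cat_rcons; case: (beta _ _) => m1 o.
by case: (trans _ _ _).
Qed.

Definition bproc (m0 : bool) : proc :=
  tproc bstep (m0, [bseq] : k.-bseq bool) (fun q => q.1).

Lemma bproc_computes m0 bs l j : 0 < k -> all (fun v => size v == k) bs ->
  all (fun v => size v <= k) (thread m0 bs).2 ->
  exists l' j', computes (bproc m0) (size bs * k * (2 * (size bs * k + size bs * k) + 8)).+1
    (tape_of l (map Some (flatten bs) ++ nseq j None)) (thread m0 bs).1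
    (tape_of l' (map Some (flatten (thread m0 bs).2) ++ nseq j' None)).
Proof.
move=> k0 hbs hos.
have [l' [j' h]] := tproc_computes bstep (m0, [bseq]) (fun q => q.1) (flatten bs) l j.
exists l', j'; move: h; rewrite trans_block //.
have sth : size (thread m0 bs).2 = size bs.
  elim: (bs) (m0) => //= v b IH m; case: (beta _ _) => m1 o.
  by have := IH m1; case: (thread m1 b) => /= ? ? ->.
case: (thread m0 bs) hos sth => m' os /= hos sth; apply: computes_le.
have s1 : size (flatten bs) = size bs * k.
  elim: (bs) hbs => //= v b IH /andP[/eqP sv /IH sb].
  by rewrite size_cat sv sb mulSn.
have s2 : size (flatten os) <= size bs * k.
  rewrite -sth; elim: (os) hos => //= v b IH /andP[sv /IH sb].
  by rewrite size_cat mulSn leq_add.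
by rewrite s1 ltnS leq_mul2l leq_add2r leq_mul2l leq_add2l s2 !orbT.
Qed.

End BlockTransducer.

(** * Compilation of commands *)

Section Compile.
Variables (kr ka N : nat).
Hypothesis (kr0 : 0 < kr).
Let k := kr + ka.

(** A register is written one-hot across the blocks: its bit is on only in the block of the cell it
    points to. A value of at least [N] leaves no mark, so all such values are represented by the
    same tape. *)
Definition blk (s : store) (i : nat) : seq bool :=
  [seq reg s r == i | r <- iota 0 kr] ++ [seq arr s a i | a <- iota 0 ka].
Definition blks (s : store) := [seq blk s i | i <- iota 0 N].
Definition holds (s : store) (t : tape) :=
  exists l j, t = tape_of l (map Some (flatten (blks s)) ++ nseq j None).

Lemma size_blk s i : size (blk s i) = k.
Proof. by rewrite size_cat !size_map !size_iota. Qed.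

Lemma nth_blk_reg s i x : x < kr -> nth false (blk s i) x = (reg s x == i).
Proof.
move=> hx; rewrite nth_cat size_map size_iota hx (nth_map 0) ?size_iota //.
by rewrite nth_iota.
Qed.

Lemma nth_blk_arr s i a : a < ka -> nth false (blk s i) (kr + a) = arr s a i.
Proof.
move=> ha; rewrite nth_cat size_map size_iota ltnNge leq_addr /= addKn.
by rewrite (nth_map 0) ?size_iota // nth_iota.
Qed.

Lemma blk_setr s x v i : x < kr -> blk (setr s x v) i = set_nth false (blk s i) x (v == i).
Proof.
move=> hx; apply: (@eq_from_nth _ false).
  by rewrite size_set_nth !size_blk; apply/esym/maxn_idPr; rewrite /k; lia.
move=> j; rewrite size_blk => hj; rewrite nth_set_nth /=.
have [hr|hr] := ltnP j kr.
  by rewrite nth_blk_reg //= updE; case: (j == x); rewrite ?nth_blk_reg.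
have -> : j == x = false by apply/eqP; lia.
have [ea ha] : j = kr + (j - kr) /\ j - kr < ka by rewrite /k in hj; split; lia.
by rewrite ea !nth_blk_arr.
Qed.

Lemma blk_seta s a v i b : a < ka ->
  blk (seta s a v b) i = if v == i then set_nth false (blk s i) (kr + a) b else blk s i.
Proof.
move=> ha; apply: (@eq_from_nth _ false).
  case: ifP => _; rewrite ?size_set_nth !size_blk //.
  by apply/esym/maxn_idPr; rewrite /k; lia.
move=> j; rewrite size_blk => hj.
have [hr|hr] := ltnP j kr.
  rewrite nth_blk_reg //=; case: ifP => _; rewrite ?nth_set_nth /= ?nth_blk_reg //.
  by have -> : j == kr + a = false by apply/eqP; lia.
have [ea ha'] : j = kr + (j - kr) /\ j - kr < ka by rewrite /k in hj; split; lia.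
rewrite ea nth_blk_arr //= /upd.
case: (v =P i) => [->|hv]; last first.
  rewrite nth_blk_arr //; case: eqP => // ->; by case: eqP => // h; case: hv.
rewrite nth_set_nth /= eqn_add2l; case: (j - kr == a); first by rewrite eqxx.
by rewrite nth_blk_arr.
Qed.

Definition base_cost := (N * k * (2 * (N * k + N * k) + 8)).+1.

Lemma base_ok beta m0 s s' b t :
  thread beta m0 (blks s) = (b, blks s') -> holds s t ->
  exists2 t', holds s' t' & computes (bproc k beta m0) base_cost t b t'.
Proof.
move=> E [l [j ->]].
have [|||l' [j' h]] := @bproc_computes k beta m0 (blks s) l j.
- by rewrite /k ltn_addr.
- by apply/allP => v /mapP[i _ ->]; rewrite size_blk.
- by rewrite E; apply/allP => v /mapP[i _ ->]; rewrite size_blk.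
move: h; rewrite E /= size_map size_iota => h.
by exists (tape_of l' ([seq Some i | i <- flatten (blks s')] ++ nseq j' None)) => //; exists l', j'.
Qed.

(** The carried bit singles out the first block in [b_put], moves the mark of a register to the next
    block in [b_inc], and collects a disjunction in [b_test]. *)
Definition b_put x (b : bool) (m : bool) (v : seq bool) := (false, set_nth false v x (m && b)).
Definition b_inc x (m : bool) (v : seq bool) := (nth false v x, set_nth false v x m).
Definition b_seta a x (b : bool) (m : bool) (v : seq bool) :=
  (m, if nth false v x then set_nth false v (kr + a) b else v).
Definition b_test (t : test) (m : bool) (v : seq bool) :=
  (m || match t with
        | EqR x y => nth false v x && nth false v y
        | GetA a x => nth false v x && nth false v (kr + a)
        end, v).

Lemma thread_put x b s : x < kr ->
  thread (b_put x b) true (blks s) = (N == 0, blks (setr s x (if b then 0 else N))).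
Proof.
move=> hx; rewrite /blks; case: {-1}N (erefl N) => [|N'] eN //=.
rewrite blk_setr //.
have -> : (if b then 0 else N'.+1) == 0 = b by case: b.
have key : forall l, (forall i, i \in l -> 0 < i < N) ->
  thread (b_put x b) false [seq blk s i | i <- l] =
  (false, [seq blk (setr s x (if b then 0 else N)) i | i <- l]).
  elim=> [//|i l IH] hl /=; rewrite IH; last by move=> j hj; apply: hl; rewrite in_cons hj orbT.
  rewrite blk_setr //; congr (_, set_nth _ _ _ _ :: _).
  by have /andP[h1 h2] := hl i (mem_head _ _); apply/esym/eqP; case: (b); lia.
rewrite eN in key; rewrite key // => i; rewrite mem_iota; lia.
Qed.

Lemma thread_inc x s : x < kr -> exists b,
  thread (b_inc x) false (blks s) = (b, blks (setr s x (reg s x).+1)).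
Proof.
move=> hx; rewrite /blks.
have key : forall n i0, thread (b_inc x) ((reg s x).+1 == i0) [seq blk s i | i <- iota i0 n] =
  ((reg s x).+1 == i0 + n, [seq blk (setr s x (reg s x).+1) i | i <- iota i0 n]).
  elim=> [|n IH] i0 /=; first by rewrite addn0.
  rewrite nth_blk_reg // -eqSS IH addSnnS; congr (_, _ :: _).
  by rewrite blk_setr.
by exists ((reg s x).+1 == 0 + N); rewrite -key.
Qed.

Lemma thread_seta a x b s : a < ka -> x < kr ->
  thread (b_seta a x b) false (blks s) = (false, blks (seta s a (reg s x) b)).
Proof.
move=> ha hx; rewrite /blks; elim: (iota 0 N) => //= i l ->; congr (_, _ :: _).
by rewrite nth_blk_reg // blk_seta.
Qed.

Definition twf (t : test) := match t with
  | EqR x y => (x < kr) && (y < kr) | GetA a x => (a < ka) && (x < kr) end.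

Lemma thread_test t s : twf t -> thread (b_test t) false (blks s) = (tden N t s, blks s).
Proof.
move=> ht.
pose g i := match t with
  | EqR x y => (reg s x == i) && (reg s y == i) | GetA a x => (reg s x == i) && arr s a i end.
have -> : tden N t s = has g (iota 0 N).
  apply/idP/hasP.
    case: t ht @g => [x y|a x] ht g /= /andP[h1 h2].
      by exists (reg s x); rewrite ?mem_iota //= /g eqxx eq_sym.
    by exists (reg s x); rewrite ?mem_iota //= /g eqxx.
  case=> i; rewrite mem_iota /= add0n => hi.
  by rewrite /g; case: t {ht g} => [x y|a x] /= /andP[/eqP ->] h; rewrite hi // andbT eq_sym.
rewrite /blks.
have key : forall l m, thread (b_test t) m [seq blk s i | i <- l] =
  (m || has g l, [seq blk s i | i <- l]).
  elim=> [|i l IH] m /=; first by rewrite orbF.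
  rewrite IH orbA; congr (_ || _ || _, _).
  rewrite /g; case: t {g IH} ht => [x y|a x] /= /andP[h1 h2].
    by rewrite !nth_blk_reg.
  by rewrite nth_blk_reg // nth_blk_arr.
by rewrite key.
Qed.

End Compile.

Section CompileCmd.
Variables (kr ka : nat).
Hypothesis (kr0 : 0 < kr).
Let k := kr + ka.

(** In a loop, the last increment pushes the mark of the counter off the blocks, which makes the
    guard [EqR x x] fail after exactly [N] rounds. *)
Fixpoint comp (c : cmd) : proc :=
  match c with
  | Skip => bproc k (fun m v => (m, v)) false
  | Put x b => bproc k (b_put x b) true
  | Inc x => bproc k (b_inc x) false
  | SetA a x b => bproc k (b_seta kr a x b) false
  | Seq c1 c2 => seqp (comp c1) (comp c2)
  | If t c1 c2 => ifp (bproc k (b_test kr t) false) (comp c1) (comp c2)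
  | For x c => seqp (bproc k (b_put x true) true)
                 (whilep (bproc k (b_test kr (EqR x x)) false)
                         (seqp (comp c) (bproc k (b_inc x) false)))
  end.

Fixpoint cost (c : cmd) (N : nat) : nat :=
  match c with
  | Skip | Put _ _ | Inc _ | SetA _ _ _ => base_cost kr ka N
  | Seq c1 c2 => cost c1 N + cost c2 N
  | If _ c1 c2 => base_cost kr ka N + (cost c1 N + cost c2 N)
  | For _ c => base_cost kr ka N +
      (N * (base_cost kr ka N + (cost c N + base_cost kr ka N)) + base_cost kr ka N)
  end.


Lemma comp_computes N c s t : wf kr ka c -> holds kr ka N s t ->
  exists t' b, holds kr ka N (den N c s) t' /\ computes (comp c) (cost c N) t b t'.
Proof.
elim: c s t => [|x b|x|a x b|c1 IH1 c2 IH2|te c1 IH1 c2 IH2|x c IH] s t /=.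
- move=> _ hs.
  have [|t' h1 h2] := @base_ok kr ka N kr0 (fun m v => (m, v)) false s s false t _ hs.
    by rewrite /blks; elim: (iota 0 N) => //= i l ->.
  by exists t', false.
- move=> hx hs.
  by have [t' h1 h2] := base_ok kr0 (@thread_put kr ka N kr0 x b s hx) hs; exists t', (N == 0).
- move=> hx hs; have [b hb] := @thread_inc kr ka N kr0 x s hx.
  by have [t' h1 h2] := base_ok kr0 hb hs; exists t', b.
- move=> /andP[ha hx] hs.
  by have [t' h1 h2] := base_ok kr0 (@thread_seta kr ka N kr0 a x b s ha hx) hs; exists t', false.
- move=> /andP[w1 w2] hs; have [t1 [b1 [h1 c1']]] := IH1 _ _ w1 hs.
  have [t2 [b2 [h2 c2']]] := IH2 _ _ w2 h1.
  by exists t2, b2; split=> //; apply: seqp_computes c1' c2'.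
- move=> /and3P[wt w1 w2] hs.
  have [t1 h1 c1'] := base_ok kr0 (@thread_test kr ka N te s wt) hs.
  case: ifP c1' => _ c1'.
    have [t2 [b2 [h2 c2']]] := IH1 _ _ w1 h1; exists t2, b2; split=> //.
    by apply: ifp_computes c1' _; apply: computes_le c2'; rewrite leq_addr.
  have [t2 [b2 [h2 c2']]] := IH2 _ _ w2 h1; exists t2, b2; split=> //.
  by apply: ifp_computes c1' _; apply: computes_le c2'; rewrite leq_addl.
move=> /and3P[hx nw wc] hs.
have [t1 h1 c1] := base_ok kr0 (@thread_put kr ka N kr0 x true s hx) hs.
pose S i := foldl (fun s i => den N c (setr s x i)) s (iota 0 i).
pose W i t := holds kr ka N (setr (S i) x i) t.
have [||//|t2 h2 c2] := @whilep_computes (bproc k (b_test kr (EqR x x)) false)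
  (seqp (comp c) (bproc k (b_inc x) false)) (base_cost kr ka N)
  (cost c N + base_cost kr ka N) W N _ _ t1.
- move=> i t0 w; have wt : twf kr ka (EqR x x) by rewrite /= hx.
  have [t' h' c'] := base_ok kr0 (@thread_test kr ka N _ _ wt) w.
  by exists t' => //; move: c'; rewrite /= !updE !eqxx.
- move=> i t0 w _; have [t' [b' [h' c']]] := IH _ _ wc w.
  have [b hb] := @thread_inc kr ka N kr0 x (den N c (setr (S i) x i)) hx.
  have [t3 h3 c3] := base_ok kr0 hb h'.
  exists t3, b; split; last exact: seqp_computes c' c3.
  move: h3; rewrite nowrite_reg //= updE eqxx.
  by rewrite /W /S -[in iota 0 i.+1]addn1 iotaD foldl_cat.
exists t2, false; split; first exact: h2.
exact: seqp_computes c1 c2.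
Qed.

(** Freshly expanded blocks contain no register mark, which is how a register with value [size x]
    looks; array 0 is the input. *)
Definition start (x : seq bool) : store :=
  Store (fun _ => size x) (fun a i => (a == 0) && nth false x i).

Definition expand : proc :=
  tproc (fun (_ : unit) b => (tt, nseq kr false ++ b :: nseq ka.-1 false)) tt (fun _ => true).

Lemma expand_computes x : 0 < ka -> exists2 t, holds kr ka (size x) (start x) t &
  computes expand (size x * (2 * (size x + size x * k) + 8)).+1 (tape_of [::] (map Some x)) true t.
Proof.
move=> ka0.
have E : trans (fun (_ : unit) b => (tt, nseq kr false ++ b :: nseq ka.-1 false)) tt x =
  (tt, flatten (blks kr ka (size x) (start x))).
  have blkE b i : i < size x -> nth false x i = b ->
      nseq kr false ++ b :: nseq ka.-1 false = blk kr ka (start x) i.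
    move=> hi hb; rewrite /blk; congr (_ ++ _).
      apply: (@eq_from_nth _ false); rewrite ?size_nseq ?size_map ?size_iota // => j hj.
      rewrite nth_nseq hj (nth_map 0) ?size_iota //=.
      by apply/esym/negbTE; rewrite neq_ltn hi orbT.
    case: ka ka0 => //= ka' _; rewrite hb; congr (_ :: _).
    apply: (@eq_from_nth _ false); rewrite ?size_nseq ?size_map ?size_iota // => j hj.
    by rewrite nth_nseq hj (nth_map 0) ?size_iota //= nth_iota.
  rewrite /blks.
  have key : forall w i0, drop i0 x = w -> trans (fun (_ : unit) b => (tt, nseq kr false ++ b :: nseq ka.-1 false)) tt w =
    (tt, flatten [seq blk kr ka (start x) i | i <- iota i0 (size w)]).
    elim=> [//|b w IHw] i0 hd /=.
    have hi : i0 < size x by rewrite ltnNge; apply/negP => /drop_oversize; rewrite hd.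
    have [e1 e2] : nth false x i0 = b /\ drop i0.+1 x = w by move: hd; rewrite (drop_nth false hi) => -[-> ->].
    by rewrite (IHw _ e2) (blkE _ _ hi e1).
  by rewrite (key x 0) // drop0.
have [l' [j' h]] := tproc_computes (fun (_ : unit) b => (tt, nseq kr false ++ b :: nseq ka.-1 false)) tt (fun _ => true) x [::] 0.
move: h; rewrite E /= cats0.
have -> : size (flatten (blks kr ka (size x) (start x))) = size x * k.
  rewrite size_flatten /shape -map_comp (@eq_map _ _ _ (fun _ => k)); last first.
    by move=> i /=; rewrite size_blk.
  by elim: (size x) (0) => //= N IH i; rewrite IH mulSn.
by move=> h; eexists; last exact: h; exists l', j'.
Qed.

Definition outproc : proc := bproc k (fun m v => (m, [:: nth false v (kr + 1)])) false.

Lemma outproc_computes N s t : 1 < ka -> holds kr ka N s t -> exists l j,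
  computes outproc (base_cost kr ka N) t false
    (tape_of l (map Some [seq arr s 1 i | i <- iota 0 N] ++ nseq j None)).
Proof.
move=> ka1 [l [j ->]].
have E : thread (fun m v => (m, [:: nth false v (kr + 1)])) false (blks kr ka N s) =
  (false, [seq [:: arr s 1 i] | i <- iota 0 N]).
  by rewrite /blks; elim: (iota 0 N) => //= i l0 ->; rewrite nth_blk_arr.
have [|||l' [j' h]] := @bproc_computes k (fun m v => (m, [:: nth false v (kr + 1)])) false (blks kr ka N s) l j.
- by rewrite /k ltn_addr.
- by apply/allP => v /mapP[i _ ->]; rewrite size_blk.
- by rewrite E; apply/allP => v /mapP[i _ ->] /=; rewrite /k ltn_addr.
exists l', j'; move: h; rewrite E /= size_map size_iota.
suff -> : flatten [seq [:: arr s 1 i] | i <- iota 0 N] = [seq arr s 1 i | i <- iota 0 N] by [].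
by elim: (iota 0 N) => //= i l0 ->.
Qed.

End CompileCmd.

(** * Polynomial time bounds *)

Definition poly_bounded (g : nat -> nat) := exists C d, forall N, g N <= C * N.+1 ^ d.

Lemma poly_const C : poly_bounded (fun _ => C).
Proof. by exists C, 0 => N; rewrite expn0 muln1. Qed.

Lemma poly_id : poly_bounded id.
Proof. by exists 1, 1 => N; rewrite expn1 mul1n. Qed.

Lemma poly_add f g : poly_bounded f -> poly_bounded g -> poly_bounded (fun N => f N + g N).
Proof.
move=> [C [d h]] [C' [d' h']]; exists (C + C'), (d + d') => N.
rewrite mulnDl leq_add //; [apply: leq_trans (h N) _|apply: leq_trans (h' N) _].
  by rewrite leq_mul // leq_pexp2l // leq_addr.
by rewrite leq_mul // leq_pexp2l // leq_addl.
Qed.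

Lemma poly_mul f g : poly_bounded f -> poly_bounded g -> poly_bounded (fun N => f N * g N).
Proof.
move=> [C [d h]] [C' [d' h']]; exists (C * C'), (d + d') => N.
by rewrite expnD mulnACA leq_mul.
Qed.

Lemma poly_cost kr ka c : poly_bounded (cost kr ka c).
Proof.
have pb : poly_bounded (base_cost kr ka).
  have pNk : poly_bounded (fun N => N * (kr + ka)) by apply: poly_mul poly_id (poly_const _).
  rewrite /base_cost.
  have [C [d h]] := poly_add (poly_const 1) (poly_mul pNk (poly_add (poly_mul (poly_const 2) (poly_add pNk pNk)) (poly_const 8))).
  by exists C, d => N; apply: leq_trans (h N).
elim: c => //=.
- by move=> c1 h1 c2 h2; exact: poly_add.
- by move=> _ c1 h1 c2 h2; apply: poly_add => //; exact: poly_add.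
move=> _ c h; apply: poly_add => //; apply: poly_add => //.
by apply: poly_mul poly_id _; apply: poly_add => //; exact: poly_add.
Qed.

Theorem program_tm (kr ka : nat) (c : cmd) : 0 < kr -> 1 < ka -> wf kr ka c ->
  exists (M : TM) (g : nat -> nat), poly_bounded g /\
    forall (x : seq bool) (f : nat), g (size x) <= f ->
    exists q l h r, run M f (init M x) = Some (q, l, h, r) /\
      forall i, i < size x ->
        nth None (h :: r) i = Some (arr (den (size x) c (start x)) 1 i).
Proof.
move=> kr0 ka1 w; have ka0 : 0 < ka by exact: ltnW.
set P := seqp (expand kr ka) (seqp (comp kr ka c) (outproc kr ka)).
exists (tm_of P), (fun N => (N * (2 * (N + N * (kr + ka)) + 8)).+1 +
  (cost kr ka c N + base_cost kr ka N) + 1); split.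
  apply: poly_add; last exact: poly_const.
  apply: poly_add; last first.
    apply: poly_add; first exact: poly_cost.
    exact: (poly_cost kr ka Skip).
  have [C [d h]] := poly_add (poly_const 1) (poly_mul poly_id (poly_add
    (poly_mul (poly_const 2) (poly_add poly_id (poly_mul poly_id (poly_const (kr + ka))))) (poly_const 8))).
  by exists C, d => N; apply: leq_trans (h N).
move=> x f hf; set N := size x in hf *.
have [t1 h1 c1] := expand_computes kr x ka0.
have [t2 [b2 [h2 c2]]] := comp_computes kr0 w h1.
have [l [j c3]] := outproc_computes kr0 ka1 h2.
have [T hT eT] := seqp_computes c1 (seqp_computes c2 c3).
have [//|i hi] := @run_tm_of P T ord0 _ _ _ _ _ eT.
  by rewrite /tm_dec unlift_none.
set o := map Some [seq arr _ _ _ | _ <- _] in hi.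
exists i, l, (head None (o ++ nseq j None)), (behead (o ++ nseq j None)).
split.
  have -> : init (tm_of P) x = (ord0, [::], head None (map Some x), behead (map Some x)).
    by rewrite /init; case: (x).
  by apply: run_mono hi; apply: leq_trans hf; rewrite addn1 ltnS.
move=> i0 hi0; have so : size o = N by rewrite !size_map size_iota.
have -> : head None (o ++ nseq j None) :: behead (o ++ nseq j None) = o ++ nseq j None.
  by case: (o) so => // so; move: hi0; rewrite -/N -so.
by rewrite nth_cat so hi0 /o -map_comp (nth_map 0) ?size_iota //= nth_iota.
Qed.

(** * Reading the input *)

Arguments den : simpl never.

Lemma den_seq N c1 c2 s : den N (Seq c1 c2) s = den N c2 (den N c1 s).
Proof. by []. Qed.
Lemma den_if N t c1 c2 s :
  den N (If t c1 c2) s = if tden N t s then den N c1 s else den N c2 s.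
Proof. by []. Qed.
Lemma den_put N x b s : den N (Put x b) s = setr s x (if b then 0 else N).
Proof. by []. Qed.
Lemma den_inc N x s : den N (Inc x) s = setr s x (reg s x).+1.
Proof. by []. Qed.
Lemma den_seta N a x b s : den N (SetA a x b) s = seta s a (reg s x) b.
Proof. by []. Qed.
Lemma den_skip N s : den N Skip s = s.
Proof. by []. Qed.
Definition denE := (den_seq, den_if, den_put, den_inc, den_seta, den_skip).

Lemma reg_setr s x v y : reg (setr s x v) y = if y == x then v else reg s y.
Proof. by []. Qed.
Lemma reg_seta s a i b y : reg (seta s a i b) y = reg s y.
Proof. by []. Qed.
Lemma arr_setr s x v : arr (setr s x v) = arr s.
Proof. by []. Qed.
Lemma arr_seta s a i b a' j :
  arr (seta s a i b) a' j = if (a' == a) && (j == i) then b else arr s a' j.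
Proof. by rewrite /= /upd; case: (a' =P a) => [->|_] //=. Qed.

Lemma for_inv N x c s (I : nat -> store -> Prop) :
  I 0 s -> (forall i s, i < N -> I i s -> I i.+1 (den N c (setr s x i))) ->
  exists2 s', I N s' & den N (For x c) s = setr s' x N.
Proof.
move=> I0 IS; exists (foldl (fun s i => den N c (setr s x i)) s (iota 0 N)) => //.
suff key : forall n, n <= N -> I n (foldl (fun s i => den N c (setr s x i)) s (iota 0 n)).
  exact: key.
elim=> [//|n IH] hn; rewrite -addn1 iotaD foldl_cat /= addn1.
by apply: IS => //; apply: IH; exact: ltnW.
Qed.

Lemma tri_uniq a b m : a * a.+1 <= m -> m < a.+1 * a.+2 -> b * b.+1 <= m ->
  m < b.+1 * b.+2 -> a = b.
Proof. by move=> h1 h2 h3 h4; case: (ltngtP a b) => // h; nia. Qed.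

Section Input.
Variables (K n : nat) (adj : nat -> nat -> bool).

Definition upto (a : nat) : seq (nat * nat) :=
  flatten [seq [seq (a', b) | b <- iota a'.+1 (n - a'.+1)] | a' <- iota 0 a].

Definition cells : seq bool := nseq K true ++ false :: [seq adj e.1 e.2 | e <- upto n].
Definition edges := [seq e <- upto n | adj e.1 e.2].

Let N := size cells.

Lemma size_cells : N = K.+1 + size (upto n).
Proof. by rewrite /N /cells size_cat size_nseq /= size_map addnS. Qed.

Lemma uptoS a : upto a.+1 = upto a ++ [seq (a, b) | b <- iota a.+1 (n - a.+1)].
Proof.
have e : iota 0 a.+1 = iota 0 a ++ [:: a] by rewrite -addn1 iotaD.
by rewrite /upto e map_cat flatten_cat /= cats0.
Qed.

Lemma size_upto_le a c : a <= c -> size (upto a) <= size (upto c).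
Proof.
move=> /subnK <-; elim: (c - a) => // d IH; rewrite addSn uptoS size_cat.
exact: leq_trans IH (leq_addr _ _).
Qed.

Lemma upto_prefix a c : a <= c -> exists r, upto c = upto a ++ r.
Proof.
move=> /subnK <-; elim: (c - a) => [|d [r IH]]; first by exists [::]; rewrite cats0.
by rewrite addSn uptoS IH -catA; eexists.
Qed.

Lemma tri_upto : (size (upto n)).*2 = n * n.-1.
Proof.
have key a : a <= n -> (size (upto a)).*2 + (n - a) * (n - a).-1 = n * n.-1.
  elim: a => [|a IH] ha; first by rewrite subn0.
  rewrite -(IH (ltnW ha)) uptoS size_cat size_map size_iota doubleD.
  by nia.
by rewrite -(key n) // subnn mul0n addn0.
Qed.

Lemma n_le_cells : n <= N.
Proof. by rewrite size_cells; have := tri_upto; nia. Qed.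

Lemma cells_K i : i < K -> nth false cells i = true.
Proof. by move=> hi; rewrite nth_cat size_nseq hi nth_nseq hi. Qed.

Lemma cells_sep : nth false cells K = false.
Proof. by rewrite nth_cat size_nseq ltnn subnn. Qed.

Lemma cells_edge a c : a < n -> a < c < n ->
  nth false cells (K.+1 + size (upto a) + (c - a.+1)) = adj a c.
Proof.
move=> ha /andP[hac hcn]; rewrite nth_cat size_nseq.
have -> : K.+1 + size (upto a) + (c - a.+1) < K = false by lia.
have -> : K.+1 + size (upto a) + (c - a.+1) - K = (size (upto a) + (c - a.+1)).+1 by lia.
have [r Er] := upto_prefix ha; rewrite uptoS in Er; rewrite Er /=.
have hs : c - a.+1 < n - a.+1 by lia.
rewrite (nth_map (0, 0)) /= ?size_cat ?size_map ?size_iota; last by lia.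
rewrite -catA nth_cat ltnNge leq_addr /= addKn nth_cat size_map size_iota hs.
by rewrite (nth_map 0) ?size_iota //= nth_iota // subnKC.
Qed.

(* [K] is read off as the first [false] cell. *)
Definition get_K r := Seq (Put r true) (For 7 (If (GetA 0 r) (Inc r) Skip)).

Lemma get_KP r s : r != 7 -> (forall i, i < N -> arr s 0 i = nth false cells i) ->
  reg (den N (get_K r) s) r = K.
Proof.
move=> rx hA; rewrite /get_K den_seq.
have [||s' [h1 h2] ->] := @for_inv N 7 (If (GetA 0 r) (Inc r) Skip) (den N (Put r true) s)
  (fun i s' => reg s' r = minn i K /\ arr s' = arr s).
- by split=> //; rewrite den_put reg_setr eqxx min0n.
- move=> i s' hi [h1 h2]; rewrite !denE /= !updE (negbTE rx) h1 h2.
  have mK : minn i K < N by rewrite size_cells in hi *; lia.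
  rewrite mK hA //=; case: (ltnP i K) => hiK.
    rewrite cells_K //=; split=> //.
    by rewrite updE eqxx; apply/esym/minn_idPl.
  rewrite cells_sep /=; split=> //.
  by rewrite updE (negbTE rx) h1 (minn_idPr hiK); apply/esym/minn_idPr; exact: leqW.
by rewrite reg_setr (negbTE rx) h1; apply/minn_idPr; rewrite size_cells; lia.
Qed.

(* Register 1 holds [K].  The cells after (or up to) position [K] are counted
   in rows of lengths 1, 2, 3, ...; [len] receives the number of complete rows. *)
Definition tri b len :=
  Seq (Put len true) (Seq (Put 12 true) (Seq (Inc 12) (Seq (Put 11 true) (Seq (Put 6 b)
  (For 7 (Seq
     (If (EqR 6 6) (Seq (Inc 11) (If (EqR 11 12) (Seq (Put 11 true) (Seq (Inc 12) (Inc len))) Skip)) Skip)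
     (If (EqR 7 1) (Put 6 (~~ b)) Skip))))))).

(** Both uses take a triangular root by counting. With [b = false] the [n (n - 1) / 2] adjacency
    cells are counted, which recovers [n - 1] from the length of the input; with [b = true] the
    [K + 1] cells up to the separator are counted, which gives [troot K]. Register 6 says whether
    counting is on. *)
Lemma triP (b : bool) len s : (len == 0) || (len == 2) -> reg s 1 = K -> 1 < N ->
  let s' := den N (tri b len) s in
  let m := if b then K.+1 else size (upto n) in
  [/\ reg s' 12 = (reg s' len).+1, reg s' len * (reg s' len).+1 <= m.*2
    & m.*2 < (reg s' len).+1 * (reg s' len).+2].
Proof.
move=> hlen hp N1 s' m.
have ne x : x \in [:: 1; 6; 7; 11; 12] -> ((len == x) = false) * ((x == len) = false).
  by case/orP: hlen => /eqP ->; rewrite !inE => /or4P[|||/orP[]] => /eqP ->.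
have ne1 := (ne 1 isT, ne 6 isT, ne 7 isT, ne 11 isT, ne 12 isT).
pose cnt i := if b then minn i K.+1 else i - K.+1.
rewrite /s' /tri !den_seq; set s0 := den N (Put 6 b) _.
have [||s1 h1 ->] := @for_inv N 7 (Seq
     (If (EqR 6 6) (Seq (Inc 11) (If (EqR 11 12) (Seq (Put 11 true) (Seq (Inc 12) (Inc len))) Skip)) Skip)
     (If (EqR 7 1) (Put 6 (~~ b)) Skip)) s0 (fun i s => [/\ reg s 1 = K,
   (reg s 6 < N) = (if b then i <= K else K < i), reg s 12 = (reg s len).+1,
   reg s 11 <= reg s len & reg s len * (reg s len).+1 + (reg s 11).*2 = (cnt i).*2]).
- rewrite /s0 !denE !reg_setr /= !ne1 !eqxx; split=> //.
  + by case: (b); rewrite // ?ltnn // (ltn_trans _ N1).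
  + by rewrite /cnt; case: (b); rewrite ?min0n ?sub0n.
- move=> i s2 hi [hp' e1 e2 e3 e4].
  have cnt1 : (reg s2 6 < N) -> cnt i.+1 = (cnt i).+1.
    by rewrite e1 /cnt; case: (b) => h; lia.
  have cnt0 : (reg s2 6 < N) = false -> cnt i.+1 = cnt i.
    by rewrite e1 /cnt; case: (b) => h; lia.
  have cN : cnt i.+1 <= N /\ (cnt i.+1 = N -> N = K.+1).
    by move: hi; rewrite /cnt size_cells; case: (b); lia.
  have flag : (if i == K then if ~~ b then 0 else N else reg s2 6) < N =
     (if b then i < K else K < i.+1).
    case: (i =P K) => [->|hiK]; first by case: (b) => /=; rewrite ?ltnn ?ltnSn // (ltn_trans _ N1).
    by rewrite e1; case: (b); lia.
  have fin X : reg X 1 = K -> reg X 7 = i -> reg X 6 = reg s2 6 -> reg X 12 = (reg X len).+1 ->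
     reg X 11 <= reg X len -> reg X len * (reg X len).+1 + (reg X 11).*2 = (cnt i.+1).*2 ->
     let s := den N (If (EqR 7 1) (Put 6 (~~ b)) Skip) X in [/\ reg s 1 = K,
   (reg s 6 < N) = (if b then i < K else K < i.+1), reg s 12 = (reg s len).+1,
   reg s 11 <= reg s len & reg s len * (reg s len).+1 + (reg s 11).*2 = (cnt i.+1).*2].
    move=> x1 x2 x3 x4 x5 x6; rewrite -flag den_if /= x2 x1 hi andbT.
    by case: (i == K); rewrite ?denE ?reg_setr /= ?ne1 //; split=> //; rewrite x3.
  rewrite den_seq; apply: fin; rewrite !den_if /= !updE eqxx /=.
  + by case: ifP => _ //=; rewrite !denE /= !updE /=; case: ifP => _ /=; rewrite ?denE /= !updE /= ?ne1 // hp'.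
  + by case: ifP => _ //=; rewrite !denE /= !updE /=; case: ifP => _ /=; rewrite ?denE /= !updE /= ?ne1.
  + by case: ifP => _ //=; rewrite !denE /= !updE /=; case: ifP => _ /=; rewrite ?denE /= !updE /= ?ne1.
  + case: ifP => hg //=; last by rewrite !updE /= ne1.
    rewrite !denE /= !updE /=; case: ifP => _ /=; rewrite ?denE /= !updE /= ?ne1 ?eqxx //; lia.
  + case: ifP => hg //=; last by rewrite !updE /= ne1.
    rewrite !denE /= !updE /=; case: ifP => hc /=; rewrite ?denE /= !updE /= ?ne1 ?eqxx //.
    (* [EqR 11 12] would miss a completed row whose length is not below [N]; such a row would need
       more cells than have been counted. *)
    rewrite ltn_neqAle e3 andbT; apply/eqP => e5; move: hc.
    rewrite e2 e5 eqxx /= => /negbT; rewrite -leqNgt => hN.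
    by move: e4 cN; rewrite e5 cnt1 //; nia.
  case: ifP => hg //=; last by rewrite !updE /= ne1 cnt0.
  rewrite !denE /= !updE /= cnt1 //; case: ifP => [/andP[/eqP h1 h2]|hc] /=;
    rewrite ?denE /= !updE /= ?ne1 ?eqxx //; lia.
have [hp' e1 e2 e3 e4] := h1; rewrite !reg_setr /= ne1.
have em : cnt N = m.
  rewrite /cnt /m; case: (b); rewrite ?size_cells; first by apply/minn_idPr; lia.
  by rewrite addKn.
by rewrite em in e4; split=> //; nia.
Qed.

Lemma get_L s : reg s 1 = K -> 1 < N ->
  reg (den N (tri false 0) s) 0 = n.-1 /\ reg (den N (tri false 0) s) 12 = n.-1.+1.
Proof.
move=> h1 N1; have [-> e2 e3] := @triP false 0 s isT h1 N1.
have -> : reg (den N (tri false 0) s) 0 = n.-1; last by [].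
apply: (tri_uniq e2 e3); rewrite tri_upto; case: (n) => [|n'] //=; nia.
Qed.

(** * Passes over the edges *)

(* Register 0 holds [n - 1]; [g] is on exactly while [i < j <= n - 1], and [p]
   is the cell of the pair [(i, j)]. *)
Definition row_body p i j g body :=
  Seq (If (EqR g g) (Seq (If (GetA 0 p) body Skip) (Inc p)) Skip)
  (Seq (If (EqR i j) (Put g true) Skip) (If (EqR j 0) (Put g false) Skip)).

Definition pass p i j g body :=
  Seq (get_K p) (Seq (Inc p)
  (For i (Seq (Put g false) (For j (row_body p i j g body))))).

(** Both loops run over all [N] values, since a loop has no other range. For [i < n] the flag [g]
    restricts [j] to [i < j < n]; for [i >= n] the pointer [p] has left the cells, so [GetA 0 p]
    fails and [body] is skipped. *)
Lemma passP p i j g body (Inv : seq (nat * nat) -> store -> Prop) s :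
  uniq [:: 0; 7; p; i; j; g] ->
  [&& nowrite 0 body, nowrite p body, nowrite i body, nowrite j body, nowrite g body & noset 0 body] ->
  (forall l s x v, x \in [:: 7; p; i; j; g] -> Inv l s -> Inv l (setr s x v)) ->
  (forall l s a b, Inv l s -> reg s i = a -> reg s j = b -> a < b < n -> adj a b ->
     Inv (rcons l (a, b)) (den N body s)) ->
  0 < n -> reg s 0 = n.-1 -> (forall x, x < N -> arr s 0 x = nth false cells x) ->
  Inv [::] s -> Inv edges (den N (pass p i j g body) s).
Proof.
move=> U W frame step n0 hL hA I0.
have [[u1 u2 u3 u4 u5] [u6 u7 u8 u9] [v1 v2 v3] [v4 v5] v6] :
  [/\ [/\ 0 != 7, 0 != p, 0 != i, 0 != j & 0 != g],
      [/\ 7 != p, 7 != i, 7 != j & 7 != g], [/\ p != i, p != j & p != g],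
      (i != j) /\ (i != g) & j != g].
  move: U; rewrite /= !inE !negb_or -!andbA !andbT.
  by case/and5P=> a1 a2 a3 a4 /and5P[a5 a6 a7 a8 /and5P[a9 a10 a11 a12 /and3P[a13 a14 a15]]].
have sy := (eq_sym p 0, eq_sym i 0, eq_sym j 0, eq_sym g 0, eq_sym i p, eq_sym j p, eq_sym g p,
  eq_sym j i, eq_sym g i, eq_sym g j).
have ne := (negbTE u2, negbTE u3, negbTE u4, negbTE u5, negbTE v1, negbTE v2, negbTE v3, negbTE v4,
  negbTE v5, negbTE v6).
case/and5P: W => w0 wp wi wj /andP[wg wa].
have nN := n_le_cells.
have N0 : 0 < N by exact: leq_trans nN.
pose pos a := K.+1 + size (upto a).
pose done a b := [seq e <- upto a ++ [seq (a, c) | c <- iota a.+1 (minn b n - a.+1)] | adj e.1 e.2].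
pose good s := (reg s 0 = n.-1) /\ (forall x, x < N -> arr s 0 x = nth false cells x).
pose J a b s := [/\ good s, reg s i = a &
  if a < n then [/\ (reg s g < N) = (a < b < n), reg s p = pos a + (minn b n - a.+1) & Inv (done a b) s]
  else N <= reg s p /\ Inv edges s].
pose O a s := good s /\ if a < n then reg s p = pos a /\ Inv [seq e <- upto a | adj e.1 e.2] s
  else N <= reg s p /\ Inv edges s.
have posN a : a < n -> pos a + (n - a.+1) = pos a.+1.
  by move=> ha; rewrite /pos uptoS size_cat size_map size_iota addnA.
have posn : pos n = N by rewrite size_cells.
have doneN a : a < n -> done a N = [seq e <- upto a.+1 | adj e.1 e.2].
  by move=> ha; rewrite /done uptoS (minn_idPr nN).
have done0 a : done a 0 = [seq e <- upto a | adj e.1 e.2].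
  by rewrite /done min0n sub0n cats0.
rewrite /pass (den_seq _ (get_K p)) (den_seq _ (Inc p)); set s1 := den N (Inc p) _.
have O0 : O 0 s1.
  split; [split|]; rewrite ?n0 /s1 den_inc reg_setr ?ne ?eqxx.
  - by rewrite nowrite_reg //= eq_sym u2.
  - by rewrite arr_setr => x hx; rewrite noset_arr // hA.
  - rewrite get_KP // 1?eq_sym // /pos addn0; split=> //.
    apply: (frame); first by rewrite !inE eqxx orbT.
    rewrite /get_K den_seq.
    have [||s2 h2 ->] := @for_inv N 7 (If (GetA 0 p) (Inc p) Skip) (den N (Put p true) s) (fun _ => Inv [::]).
    + by apply: (frame) => //; rewrite !inE eqxx orbT.
    + move=> x s2 _ h2; rewrite den_if; case: ifP => _; last exact: frame.
      by apply: (frame); [rewrite !inE eqxx orbT|exact: frame].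
    by apply: (frame).
have step_row a b s2 : a < N -> b < N -> J a b s2 ->
    J a b.+1 (den N (row_body p i j g body) (setr s2 j b)).
  move=> aN bN [[g0 gA] ei hJ]; rewrite /row_body den_seq.
  set c1 := If (EqR g g) _ _; set s3 := setr s2 j b.
  have c1nw y : y != p -> nowrite y body -> nowrite y c1.
    by move=> yp wy; rewrite /= wy /= andbT eq_sym.
  set s4 := den N c1 s3.
  have r0 : reg s4 0 = n.-1 by rewrite /s4 nowrite_reg ?c1nw // /s3 reg_setr ne.
  have ri : reg s4 i = a by rewrite /s4 nowrite_reg ?c1nw // 1?eq_sym // /s3 reg_setr ne.
  have rj : reg s4 j = b by rewrite /s4 nowrite_reg ?c1nw // 1?eq_sym // /s3 reg_setr eqxx.
  have rg : reg s4 g = reg s2 g.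
    by rewrite /s4 nowrite_reg ?c1nw // 1?eq_sym // /s3 reg_setr sy ne.
  have rA : arr s4 0 = arr s2 0 by rewrite /s4 noset_arr //= wa.
  have I4 : if a < n then reg s4 p = pos a + (minn b.+1 n - a.+1) /\ Inv (done a b.+1) s4
      else N <= reg s4 p /\ Inv edges s4.
    have fr l : Inv l s2 -> Inv l s3 by move=> h; apply: (frame) => //; rewrite !inE eqxx !orbT.
    have s3p : reg s3 p = reg s2 p by rewrite reg_setr ne.
    have s3g : reg s3 g = reg s2 g by rewrite reg_setr sy ne.
    rewrite /s4 /c1 den_if /= eqxx /= -/s3 -[upd _ _ _ g]/(reg s3 g) s3g.
    case: ltnP hJ => [an [hg hp hI]|an [hp hI]].
      rewrite hg; case: ifP => hab.
        have [h1 h2] := andP hab.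
        have eb : minn b n = b by apply/minn_idPl; exact: ltnW.
        have eb1 : minn b.+1 n = b.+1 by apply/minn_idPl.
        rewrite eb in hp; have pN : reg s3 p < N.
          rewrite s3p hp -posn; apply: (@leq_trans (pos a.+1)).
            by rewrite -posN // ltn_add2l ltn_sub2r // (leq_ltn_trans h1).
          by rewrite leq_add2l size_upto_le.
        have eD : done a b.+1 = done a b ++ (if adj a b then [:: (a, b)] else [::]).
          rewrite /done eb eb1 (_ : b.+1 - a.+1 = (b - a.+1) + 1); last by clear -h1; lia.
          rewrite iotaD map_cat catA filter_cat; congr (_ ++ _).
          by rewrite /= (subnKC h1).
        rewrite den_seq den_inc reg_setr eqxx den_if /= -[upd _ _ _ p]/(reg s3 p) pN /= gA //.
        rewrite -[upd (reg s2) j b p]/(reg s3 p) s3p hp cells_edge // eb1 eD.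
        case: ifP => hadj.
          rewrite nowrite_reg // s3p hp; split; first by clear -h1; lia.
          apply: (frame); first by rewrite !inE eqxx orbT.
          rewrite cats1; apply: step => //; first exact: fr.
          - by rewrite reg_setr ne.
          - by rewrite reg_setr eqxx.
        rewrite den_skip s3p hp cats0; split; first by clear -h1; lia.
        by apply: (frame); [rewrite !inE eqxx orbT|exact: fr].
      have eb : minn b.+1 n - a.+1 = minn b n - a.+1 by move: hab; clear; lia.
      by rewrite den_skip s3p hp /done eb; split=> //; exact: fr.
    case: ifP => _; last by rewrite den_skip s3p; split=> //; exact: fr.
    rewrite den_seq den_inc reg_setr eqxx den_if /= -[upd _ _ _ p]/(reg s3 p) s3p ltnNge hp /=.
    rewrite -[upd _ _ _ p]/(reg s3 p) den_skip s3p; split; first exact: leqW.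
    by apply: (frame); [rewrite !inE eqxx orbT|exact: fr].
  rewrite den_seq !den_if /= ri rj aN andbT.
  set s5 := if a == b then _ else _.
  have [f0 fi fj fp fA] : [/\ reg s5 0 = n.-1, reg s5 i = a, reg s5 j = b, reg s5 p = reg s4 p & arr s5 0 = arr s2 0].
    by rewrite /s5; case: ifP => _; rewrite ?denE ?reg_setr ?ne.
  have f5 : forall l, Inv l s4 -> Inv l s5.
    move=> l h; rewrite /s5; case: ifP => _ //; rewrite den_put.
    by apply: (frame) => //; rewrite !inE eqxx !orbT.
  have fg : reg s5 g = if a == b then 0 else reg s2 g.
    by rewrite /s5; case: ifP => _; rewrite ?denE ?reg_setr ?eqxx.
  rewrite fj f0 bN andbT; set s6 := if b == _ then _ else _.
  have [k0 ki kj kp kA] : [/\ reg s6 0 = n.-1, reg s6 i = a, reg s6 j = b, reg s6 p = reg s4 p & arr s6 0 = arr s2 0].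
    by rewrite /s6; case: ifP => _; rewrite ?denE ?reg_setr ?ne.
  have f6 : forall l, Inv l s4 -> Inv l s6.
    move=> l h; rewrite /s6; case: ifP => _; rewrite ?denE; last exact: f5.
    by apply: (frame); [rewrite !inE eqxx !orbT|exact: f5].
  have kg : reg s6 g = if b == n.-1 then N else if a == b then 0 else reg s2 g.
    by rewrite /s6; case: ifP => _; rewrite ?denE ?reg_setr ?eqxx.
  split=> //; first by split=> // x hx; rewrite kA; exact: gA.
  case: ltnP hJ I4 => [an [hg _ _] [hp hI]|an _ [hp hI]].
    rewrite kp kg; split=> //; last exact: f6.
    case: (b =P n.-1) => [->|hb]; first by rewrite ltnn prednK // ltnn andbF.
    case: (a =P b) => [ab|hab]; first by rewrite N0 ab; move: hb an; rewrite ab; clear; lia.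
    by rewrite hg; move: hb hab an; clear; lia.
  by rewrite kp; split=> //; exact: f6.
have [||s9 [_ h9] ->] := @for_inv N i (Seq (Put g false) (For j (row_body p i j g body))) s1 O.
- exact: O0.
- move=> a s2 aN [[g0 gA] hO]; rewrite den_seq den_put /=.
  set s3 := setr (setr s2 i a) g N.
  have fr l : Inv l s2 -> Inv l s3.
    by move=> h; do 2![apply: (frame); first by rewrite !inE eqxx !orbT].
  have J0 : J a 0 s3.
    split; rewrite /s3.
    - by split=> //; rewrite !reg_setr !ne.
    - by rewrite !reg_setr ne eqxx.
    case: ifP hO => [an|an] [hp hI].
      rewrite !reg_setr eqxx !ne ltnn min0n sub0n addn0 done0; split=> //.
      exact: fr.
    by rewrite !reg_setr !ne; split=> //; exact: fr.
  have [||s4 [[k0 kA] ki hJ] ->] := @for_inv N j (row_body p i j g body) s3 (J a).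
  + exact: J0.
  + by move=> b s4 bN; exact: step_row.
  split; first by split=> //; rewrite reg_setr ne.
  have fr4 l : Inv l s4 -> Inv l (setr s4 j N) by move=> h; apply: (frame) => //; rewrite !inE eqxx !orbT.
  rewrite reg_setr ne; case: ltnP hJ => [an [_ hp hI]|an [hp hI]].
    rewrite doneN // in hI; rewrite (minn_idPr nN) posN // in hp.
    case: ltnP => an1; first by split=> //; exact: fr4.
    have en : a.+1 = n by apply/eqP; rewrite eqn_leq an an1.
    by rewrite hp en posn; split=> //; apply: fr4; rewrite /edges -en.
  by rewrite ltnNge (leqW an) /=; split=> //; exact: fr4.
by rewrite ltnNge nN /= in h9; case: h9 => _ h; apply: (frame) => //; rewrite !inE eqxx !orbT.
Qed.

End Input.

(** * The peeling estimator *)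

Section Adjacency.
Variables (n : nat) (G : graph n).

Definition adjn (a b : nat) : bool :=
  if (insub a : option 'I_n) is Some i then
    if (insub b : option 'I_n) is Some j then [set i; j] \in G else false
  else false.

Definition gadj (u v : 'I_n) : bool := (u != v) && ([set u; v] \in G).

Lemma gadj_sym u v : gadj u v = gadj v u.
Proof. by rewrite /gadj eq_sym finset.setUC. Qed.

Lemma adjn_ord (i j : 'I_n) : adjn i j = ([set i; j] \in G).
Proof. by rewrite /adjn !valK. Qed.

Lemma encodeE K : encode K n G = cells K n adjn.
Proof.
rewrite /encode /cells; congr (_ ++ _ :: _).
rewrite /upto map_flatten -map_comp; congr flatten.
rewrite -[iota 0 n]val_enum_ord -map_comp; apply: eq_map => i /=.
rewrite -map_comp.
rewrite (@eq_map _ _ _ (fun j : 'I_n => adjn i j)); last by move=> j; rewrite adjn_ord.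
rewrite (map_comp (adjn i) val) -filter_map val_enum_ord; congr map.
rewrite -[n in iota 0 n](subnKC (ltn_ord i)) iotaD filter_cat add0n.
rewrite (_ : [seq x <- iota 0 i.+1 | i < x] = [::]); last first.
  apply/eqP; rewrite -(negbK (_ == _)) -has_filter; apply/hasPn => x.
  by rewrite mem_iota add0n ltnS -leqNgt => /andP[].
by apply/all_filterP/allP => x; rewrite mem_iota => /andP[].
Qed.

Lemma mem_upto a b : ((a, b) \in upto n n) = (a < b < n).
Proof.
apply/flatten_mapP/idP => [[c]|/andP[h1 h2]].
  rewrite mem_iota => /andP[_ hc] /mapP[d]; rewrite mem_iota => hd [-> ->].
  by move: hc hd; rewrite add0n; clear; lia.
exists a; first by rewrite mem_iota /= add0n; exact: ltn_trans h2.
by apply/mapP; exists b => //; rewrite mem_iota h1 /= subnKC // (ltn_trans h1).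
Qed.

Lemma mem_edges a b : ((a, b) \in edges n adjn) = [&& a < b, b < n & adjn a b].
Proof. by rewrite mem_filter mem_upto andbC andbA. Qed.

Lemma uniq_upto : uniq (upto n n).
Proof.
apply: (@allpairs_uniq_dep _ (fun=> nat) _ (fun a b => (a, b))).
- exact: iota_uniq.
- by move=> x _; exact: iota_uniq.
by case=> a b [c d] _ _ /= [-> ->].
Qed.

Lemma uniq_edges : uniq (edges n adjn).
Proof. exact: filter_uniq uniq_upto. Qed.

Lemma gadj_edges (u v : 'I_n) :
  gadj u v = ((val u, val v) \in edges n adjn) || ((val v, val u) \in edges n adjn).
Proof.
rewrite !mem_edges !ltn_ord /= !adjn_ord /gadj [in RHS](finset.setUC [set v]).
rewrite -andb_orl; congr (_ && _).
by rewrite -neq_ltn.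
Qed.

Definition peel1 (X : {set 'I_n}) : {set 'I_n} :=
  [set v in X | [exists w1 in X, exists w2 in X, [&& w1 != w2, gadj v w1 & gadj v w2]]].

Definition peelset (t : nat) : {set 'I_n} := iter t peel1 [set: 'I_n].

Definition touches (al : nat -> bool) v (e : nat * nat) :=
  ((e.1 == v) || (e.2 == v)) && (al e.1 && al e.2).

(** Every neighbour of [v] contributes exactly one listed pair, the one with the smaller end first;
    hence two listed pairs at [v] mean two distinct neighbours. *)
Lemma count_touches (al : nat -> bool) (X : {set 'I_n}) (v : 'I_n) :
  (forall u : 'I_n, al u = (u \in X)) ->
  (1 < count (touches al v) (edges n adjn)) = (v \in peel1 X).
Proof.
move=> hX; apply/idP/idP.
  rewrite -size_filter => h.
  set l := [seq x <- _ | _] in h.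
  have ul : uniq l by apply: filter_uniq; exact: uniq_edges.
  pose e1 := nth (0, 0) l 0; pose e2 := nth (0, 0) l 1.
  have m1 : e1 \in l by apply: mem_nth; exact: ltnW.
  have m2 : e2 \in l by apply: mem_nth.
  have ne : e1 != e2 by rewrite nth_uniq // ltnW.
  have other e : e \in l -> exists w : 'I_n, [/\ w \in X, v \in X, gadj v w &
      (e == (val v, val w)) || (e == (val w, val v))].
    case: e => a b; rewrite mem_filter /touches /= mem_edges.
    case/andP=> /andP[hv /andP[ha hb]] /and3P[hab hbn hadj].
    have han := ltn_trans hab hbn.
    case/orP: hv => /eqP ev; subst.
      exists (Ordinal hbn); rewrite -!hX ha hb eqxx; split=> //.
      by rewrite gadj_edges mem_edges hab hbn hadj.
    exists (Ordinal han); rewrite -!hX ha hb eqxx orbT; split=> //.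
    by rewrite gadj_edges !mem_edges hab hbn hadj orbT.
  have [w1 [x1 xv g1 d1]] := other _ m1; have [w2 [x2 _ g2 d2]] := other _ m2.
  rewrite inE xv; apply/existsP; exists w1; rewrite x1; apply/existsP; exists w2.
  rewrite x2 g1 g2 !andbT /=; apply: contraNneq ne => ew; subst w2.
  have [vw _] := andP g1.
  move: (m1); rewrite mem_filter => /andP[_ i1].
  move: (m2); rewrite mem_filter => /andP[_ i2]; move: i1 i2.
  by case/orP: d1 => /eqP ->; case/orP: d2 => /eqP -> //; rewrite !mem_edges;
    case/andP=> l1 _ /andP[l2 _]; move: l1 l2; clear; lia.
rewrite inE => /andP[xv /existsP[w1 /andP[x1 /existsP[w2 /andP[x2 /and3P[nw g1 g2]]]]]].
pose ed (w : 'I_n) := if v < w then (val v, val w) else (val w, val v).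
have ine w : w \in X -> gadj v w -> ed w \in [seq e <- edges n adjn | touches al v e].
  move=> xw g; rewrite mem_filter /ed; move: (g); rewrite gadj_edges !mem_edges.
  have [vw _] := andP g; rewrite -[val v]/(nat_of_ord v) -[val w]/(nat_of_ord w).
  case: (ltngtP v w) => [hvw|hvw|hvw] /=; rewrite ?orbF => h; last by rewrite (val_inj hvw) eqxx in vw.
    by rewrite /touches /= !hX xv xw eqxx mem_edges hvw.
  by rewrite /touches /= !hX xv xw eqxx orbT mem_edges hvw.
rewrite -size_filter; apply: (@leq_trans (size [:: ed w1; ed w2])) => //.
apply: uniq_leq_size.
  rewrite /= andbT inE; apply: contraNneq nw => e; apply/eqP/val_inj => /=.
  by move: e; rewrite /ed; case: ltnP => h1; case: ltnP => h2 [] // e1 e2; lia.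
by move=> e; rewrite !inE => /orP[] /eqP ->; exact: ine.
Qed.

End Adjacency.

(** * Programs for peeling and reachability *)

Section Peeling.
Variables (K n : nat) (G : graph n).
Let adj := adjn G.
Let N := size (cells K n adj).
Hypothesis (n0 : 0 < n).

Definition ready (s : store) := reg s 0 = n.-1 /\ arr s 0 = arr (start (cells K n adj)) 0.

Lemma ready_cells s : ready s -> forall x, x < N -> arr s 0 x = nth false (cells K n adj) x.
Proof. by move=> [_ ->]. Qed.

Lemma ready_den c s : nowrite 0 c -> noset 0 c -> ready s -> ready (den N c s).
Proof. by move=> w a [h1 h2]; split; rewrite ?nowrite_reg ?noset_arr. Qed.

Lemma ordN (v : 'I_n) : v < N.
Proof. exact: leq_trans (ltn_ord v) (n_le_cells K n adj). Qed.

Lemma for_map c s (F : nat -> (nat -> bool) -> bool) :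
  (forall s i, i < N -> reg s 8 = i -> forall a j,
     arr (den N c s) a j = if j == i then F a (fun a => arr s a i) else arr s a j) ->
  forall a j, j < N -> arr (den N (For 8 c) s) a j = F a (fun a => arr s a j).
Proof.
move=> hc a j hj.
have [||s' h ->] := @for_inv N 8 c s (fun i s' => forall a j,
   arr s' a j = if j < i then F a (fun a => arr s a j) else arr s a j).
- by [].
- move=> i s' hi IH a' j'; rewrite (hc _ i) ?reg_setr //=.
  rewrite !IH ltnS; case: (ltngtP j' i) => [h|h|->] //.
  by congr (F _ _); apply/funext => a2; rewrite IH ltnn.
by rewrite arr_setr h hj.
Qed.

(** Arrays 3 and 4 form a counter per vertex that saturates at two: met at least once, met at least
    twice. *)
Definition bump r := If (GetA 3 r) (SetA 4 r true) (SetA 3 r true).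
Definition peel_body :=
  If (GetA 2 4) (If (GetA 2 5) (Seq (bump 4) (bump 5)) Skip) Skip.
Definition peel := Seq (For 8 (Seq (SetA 3 8 false) (SetA 4 8 false)))
  (Seq (pass 3 4 5 6 peel_body) (For 8 (If (GetA 4 8) Skip (SetA 2 8 false)))).

Lemma bumpP r s v : reg s r = v -> v < N -> let s' := den N (bump r) s in
  [/\ reg s' = reg s, arr s' 2 = arr s 2 &
   forall u, arr s' 3 u = arr s 3 u || (u == v) /\ arr s' 4 u = arr s 4 u || (arr s 3 u && (u == v))].
Proof.
move=> rv vN; rewrite /bump den_if /= rv vN /=; case: ifP => h3.
  rewrite den_seta rv; split=> // u; rewrite !arr_seta /=.
  by case: (u =P v) => [->|_]; rewrite ?h3 ?orbT ?orbF ?andbT ?andbF ?orbF.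
rewrite den_seta rv; split=> // u; rewrite !arr_seta /=.
by case: (u =P v) => [->|_]; rewrite ?h3 ?orbT ?orbF ?andbF ?orbF.
Qed.

Lemma peelP s (X : {set 'I_n}) : ready s -> (forall v : 'I_n, arr s 2 v = (v \in X)) ->
  forall v : 'I_n, arr (den N peel s) 2 v = (v \in peel1 G X).
Proof.
move=> rs hX v; rewrite /peel den_seq (den_seq _ (pass _ _ _ _ _)).
set s1 := den N (For 8 _) s.
have e1 : forall a j, j < N -> arr s1 a j = if (a == 3) || (a == 4) then false else arr s a j.
  move=> a j hj; rewrite /s1 (@for_map _ _ (fun a f => if (a == 3) || (a == 4) then false else f a)) //.
  move=> s0 i hi ri a' j'; rewrite den_seq !den_seta reg_seta !arr_seta ri.
  case: (j' =P i) => [->|_]; rewrite ?andbF // !andbT.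
  by case: (a' == 4); case: (a' == 3).
pose al := arr s1 2.
have hal : forall u : 'I_n, al u = (u \in X) by move=> u; rewrite /al e1 ?ordN //= hX.
have rs1 : ready s1 by apply: ready_den.
pose Inv l s := arr s 2 = al /\ forall u, u < N ->
   arr s 3 u = (0 < count (touches al u) l) /\ arr s 4 u = (1 < count (touches al u) l).
have I2 : Inv (edges n adj) (den N (pass 3 4 5 6 peel_body) s1).
  apply: passP => //.
  - move=> l s2 a b [h2 h34] ri rj /andP[hab hbn] _.
    have bN : b < N by exact: leq_trans hbn (n_le_cells K n adj).
    have aN := ltn_trans hab bN.
    rewrite /peel_body !den_if /= ri rj aN bN h2 /=.
    have ct u : count (touches al u) (rcons l (a, b)) =
        count (touches al u) l + (((a == u) || (b == u)) && (al a && al b)).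
      by rewrite -cats1 count_cat /= addn0.
    have [ha|ha] := boolP (al a); last first.
      rewrite den_skip; split=> // u uN; rewrite ct (negbTE ha) /= andbF addn0; exact: h34.
    have [hb|hb] := boolP (al b); last first.
      rewrite den_skip; split=> // u uN; rewrite ct (negbTE hb) /= !andbF addn0; exact: h34.
    rewrite den_seq; have [r1 a1 b1] := bumpP ri aN.
    set s3 := den N (bump 4) s2 in r1 a1 b1 *.
    have rj3 : reg s3 5 = b by rewrite r1.
    have [r2 a2 b2] := bumpP rj3 bN.
    split; first by rewrite a2 a1.
    move=> u uN; have [f3 f4] := h34 u uN; have [c3 c4] := b1 u; have [d3 d4] := b2 u.
    rewrite d3 d4 c3 c4 f3 f4 ct ha hb !andbT [a == u]eq_sym [b == u]eq_sym.
    case: (u =P a) => [->|_] /=; last by case: (u == b); case: (count _ _) => [|[|k]].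
    have -> : a == b = false by apply/eqP; move: hab; clear; lia.
    by case: (count _ _) => [|[|k]].
  - by case: rs1.
  - exact: ready_cells.
  split=> // u uN; by rewrite !e1.
set s2 := den N (pass _ _ _ _ _) s1 in I2 *.
rewrite (@for_map _ _ (fun a f => if a == 2 then f 2 && f 4 else f a)) ?ordN //.
  have [-> h34] := I2; have [_ ->] := h34 _ (ordN v).
  rewrite (count_touches G v hal) hal /=.
  by rewrite andb_idl // inE => /andP[].
move=> s3 i hi ri a j; rewrite den_if /= ri hi /=.
case: ifP => h4; rewrite ?den_skip ?den_seta ?ri ?arr_seta.
  by case: (j =P i) => // ->; case: (a =P 2) => // ->; rewrite andbT.
by rewrite andbC; case: (j =P i) => // ->; case: (a =P 2) => // ->; rewrite andbF.
Qed.

Definition reach_body :=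
  Seq (If (GetA 6 4) (SetA 6 5 true) Skip) (If (GetA 6 5) (SetA 6 4 true) Skip).

Lemma reach_bodyP s a b : reg s 4 = a -> reg s 5 = b -> a < N -> b < N -> 
  let s' := den N reach_body s in forall u, arr s' 6 u =
   arr s 6 u || ((u == b) && arr s 6 a) || ((u == a) && (arr s 6 b)).
Proof.
move=> ra rb aN bN /= u; rewrite /reach_body den_seq !den_if /= ra aN /=.
set s1 := if arr s 6 a then _ else _.
have e1 : forall u, arr s1 6 u = arr s 6 u || ((u == b) && arr s 6 a).
  move=> u'; rewrite /s1; case: ifP => h; rewrite ?den_seta ?den_skip ?arr_seta ?rb /=.
    by case: (u' == b); rewrite ?orbT ?orbF.
  by rewrite andbF orbF.
have r1 : reg s1 = reg s by rewrite /s1; case: ifP.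
rewrite r1 rb bN /=; case: ifP => h.
  rewrite den_seta arr_seta r1 ra /= e1; rewrite e1 eqxx /= in h.
  case: (u =P a) => [->|_] /=; last by rewrite orbF.
  by case: (arr s 6 b) h => //=; rewrite ?orbT ?orbF // => ->.
rewrite den_skip e1; rewrite e1 eqxx /= in h.
by move/norP: (negbT h) => [/negbTE -> _]; rewrite andbF orbF.
Qed.

(** After [t] passes every vertex at distance at most [t] from [B] is marked. One pass may mark
    more, as marks spread while it runs, so the invariant bounds the marks from both sides. The [N]
    rounds suffice because a simple path has at most [n <= N] vertices. *)
Lemma reachP s (B : {set 'I_n}) : ready s -> (forall v : 'I_n, arr s 6 v = (v \in B)) ->
  forall v : 'I_n, arr (den N (For 13 (pass 3 4 5 6 reach_body)) s) 6 v =
    [exists b in B, connect (gadj G) b v].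
Proof.
move=> rs hB v.
pose cn (u : 'I_n) := [exists b in B, connect (gadj G) b u].
have cn_step u w : cn u -> gadj G u w -> cn w.
  move=> /existsP[b /andP[bB c]] g; apply/existsP; exists b; rewrite bB.
  exact: connect_trans c (connect1 g).
have [||s' [_ h1 h2] ->] := @for_inv N 13 (pass 3 4 5 6 reach_body) s
  (fun t s' => [/\ ready s', forall u : 'I_n, arr s' 6 u -> cn u &
    forall b p, b \in B -> path (gadj G) b p -> size p <= t -> arr s' 6 (last b p)]).
- split=> //.
    by move=> u; rewrite hB => uB; apply/existsP; exists u; rewrite uB connect0.
  by move=> b [|//] bB _ _; rewrite /= hB.
- move=> t s' tN [rs' h1 h2].
  have rs2 : ready (setr s' 13 t) by [].
  split; first by apply: ready_den.
  + pose R0 u := arr s' 6 u.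
    suff : (fun s => forall u : 'I_n, arr s 6 u -> cn u) (den N (pass 3 4 5 6 reach_body) (setr s' 13 t)) by [].
    apply: (@passP K n adj 3 4 5 6 reach_body (fun _ s => forall u : 'I_n, arr s 6 u -> cn u)) => //.
    * move=> l s2 a b I ra rb /andP[hab hbn] hadj u.
      have bN : b < N by exact: leq_trans hbn (n_le_cells K n adj).
      have aN := ltn_trans hab bN; have han := ltn_trans hab hbn.
      have g : gadj G (Ordinal han) (Ordinal hbn).
        by rewrite gadj_edges !mem_edges /= hab hbn [adjn G a b]hadj.
      rewrite (reach_bodyP ra rb aN bN) => /orP[/orP[|/andP[/eqP ub]]|/andP[/eqP ua]].
      -- exact: I.
      -- move=> ca; apply: (@cn_step (Ordinal han)); first exact: I.
         by rewrite (_ : u = Ordinal hbn) //; apply: val_inj.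
      -- move=> cb; apply: (@cn_step (Ordinal hbn)); first exact: I.
         by rewrite (_ : u = Ordinal han) 1?gadj_sym //; apply: val_inj.
    * by case: rs2.
    * exact: ready_cells.
  pose Inv (l : seq (nat * nat)) s2 := (forall u : 'I_n, arr s' 6 u -> arr s2 6 u) /\
     (forall u w : 'I_n, ((val u, val w) \in l) || ((val w, val u) \in l) -> arr s' 6 u -> arr s2 6 w).
  have [i1 i2] : Inv (edges n adj) (den N (pass 3 4 5 6 reach_body) (setr s' 13 t)).
    apply: passP => //.
    * move=> l s2 a b [I1 I2] ra rb /andP[hab hbn] hadj.
      have bN : b < N by exact: leq_trans hbn (n_le_cells K n adj).
      have aN := ltn_trans hab bN; have han := ltn_trans hab hbn.
      split=> [u hu|u w].
        by rewrite (reach_bodyP ra rb aN bN) I1.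
      rewrite !mem_rcons !in_cons (reach_bodyP ra rb aN bN).
      case/orP=> /orP[/eqP[e1 e2] hu|h hu].
      -- by rewrite -e2 -e1 eqxx (I1 u hu) orbT.
      -- by rewrite (I2 u) // h.
      -- by rewrite -e2 -e1 eqxx (I1 u hu) !orbT.
      -- by rewrite (I2 u) // h orbT.
    * by case: rs2.
    * exact: ready_cells.
  move=> b p; case/lastP: p => [|p w] bB.
    by move=> _ _; apply: i1; exact: (h2 b [::]).
  rewrite rcons_path size_rcons last_rcons ltnS => /andP[pp g] hs.
  by apply: (i2 (last b p)); [rewrite -gadj_edges|exact: h2].
rewrite arr_setr; apply/idP/idP; first exact: h1.
case/existsP=> b /andP[bB] /connectP[p pp ->].
case/shortenP: pp => p' pp' up' _; apply: h2 => //.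
have := max_card (mem (b :: p')); rewrite card_ord (card_uniqP up') /= => h.
exact: leq_trans (ltnW h) (n_le_cells K n adj).
Qed.

End Peeling.

Lemma ex_troot K : exists h, K.+1.*2 < h.+1 * h.+2.
Proof. by exists K.+1; rewrite -addnn; nia. Qed.

(** The index of the largest triangular number not above [K + 1], about [sqrt (2 K)]. It serves as
    peeling depth and as detection threshold: it tends to infinity, is [o(K)], and can be computed
    by counting. *)
Definition troot K := ex_minn (ex_troot K).

Lemma trootP K : troot K * (troot K).+1 <= K.+1.*2 < (troot K).+1 * (troot K).+2.
Proof.
rewrite /troot; case: ex_minnP => h -> min; rewrite andbT.
case: h min => // h min; rewrite leqNgt; apply/negP => /min; by rewrite ltnn.
Qed.

(** The deep peeling only certifies that a component contains a long path; which vertices of the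
    component are selected is left to the shallow peeling, which removes few vertices of the planted
    path. *)
Definition path_score n (G : graph n) (K : nat) : {set 'I_n} :=
  [set v in peelset G (minn (troot K) K.-1./2) |
     [exists b in peelset G K.-1./2, connect (gadj G) b v]].

Section Core.
Variables (K n : nat) (G : graph n).
Let adj := adjn G.
Let N := size (cells K n adj).
Hypothesis (K0 : 0 < K) (n0 : 0 < n).

Let KN : K < N.
Proof. by rewrite /N size_cells ltnS leq_addr. Qed.
Let N1 : 1 < N.
Proof. exact: leq_ltn_trans KN. Qed.
Let N0 : 0 < N.
Proof. exact: ltnW. Qed.
Let nN : n <= N := n_le_cells K n adj.

Definition prep := Seq (get_K 1) (Seq (tri false 0) (tri true 2)).

Lemma prepP s0 : arr s0 = arr (start (cells K n adj)) -> let s := den N prep s0 in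
  [/\ ready K G s, reg s 1 = K & reg s 2 = troot K].
Proof.
move=> hs0; rewrite /prep den_seq (den_seq _ (tri false 0)).
set s1 := den N (get_K 1) _; have e1 : reg s1 1 = K by apply: get_KP => // i _; rewrite hs0.
set s2 := den N (tri false 0) s1.
have [e2 _] : reg s2 0 = n.-1 /\ reg s2 12 = n.-1.+1 by apply: get_L.
have e2' : reg s2 1 = K by rewrite /s2 nowrite_reg.
have [_ t1 t2] := @triP K n adj true 2 s2 isT e2' N1.
split; first split.
- by rewrite nowrite_reg.
- by rewrite !noset_arr // hs0.
- by rewrite nowrite_reg.
have /andP[t3 t4] := trootP K; exact: (tri_uniq t1 t2 t3 t4).
Qed.

Definition save := For 8 (If (GetA 2 8) (SetA 5 8 true) (SetA 5 8 false)).
Definition stop := If (EqR 9 1) (Put 10 false) Skip.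
(** Register 9 takes the values [1, 3, 5, ...] and the flag in register 10 is switched off when [K]
    is met on the way, which ends the peeling after [K.-1./2] rounds without a division. *)
Definition tick := Seq stop (Seq (Inc 9) (Seq stop (Inc 9))).
Definition loop_body := Seq (If (EqR 13 2) save Skip) (Seq tick (If (EqR 10 10) peel Skip)).
Definition peel_loop := Seq (For 8 (SetA 2 8 true))
  (Seq (Put 9 true) (Seq (Inc 9) (Seq (Put 10 true) (For 13 loop_body)))).

Lemma saveP s j : j < N -> arr (den N save s) 5 j = arr s 2 j.
Proof.
move=> hj; rewrite /save (@for_map K n G _ _ (fun a f => if a == 5 then f 2 else f a)) //.
move=> s' i hi ri a j'; rewrite den_if /= ri hi /=.
case: ifP => h2; rewrite den_seta ri arr_seta andbC;
  by case: (j' =P i) => // ->; case: (a =P 5) => // ->.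
Qed.

Lemma tickP s : let s' := den N tick s in [/\ arr s' = arr s,
   forall y, y != 9 -> y != 10 -> reg s' y = reg s y, reg s' 9 = (reg s 9).+2 &
   reg s 1 = K -> (reg s' 10 < N) = [&& reg s 10 < N, reg s 9 != K & (reg s 9).+1 != K]].
Proof.
rewrite /tick /stop !denE /=.
split.
- by case: ifP => _; rewrite ?denE /=; case: ifP => _.
- move=> y /negbTE y9 /negbTE y10; rewrite /upd y9.
  by case: ifP => _; rewrite ?denE /= /upd ?y9 ?y10; case: ifP => _; rewrite ?denE /= /upd ?y9 ?y10.
- by rewrite /upd /=; case: ifP => _; rewrite ?denE /= /upd /=; case: ifP => _; rewrite ?denE /= /upd.
move=> e1; have eqK x : (x == K) && (x < N) = (x == K).
  by case: eqP => //= ->; rewrite KN.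
rewrite e1 eqK; case: (reg s 9 == K) => /=; rewrite ?denE /= /upd /= e1 eqK.
  by rewrite andbF; case: ifP => _; rewrite ?denE /= /upd /= ltnn.
by case: ((reg s 9).+1 == K); rewrite ?denE /= /upd /= ?ltnn ?andbF ?andbT.
Qed.

Lemma peel_loopP s : ready K G s -> reg s 1 = K -> reg s 2 = troot K ->
  let s' := den N peel_loop s in forall v : 'I_n,
  arr s' 2 v = (v \in peelset G K.-1./2) /\
  arr s' 5 v = (v \in peelset G (minn (troot K) K.-1./2)).
Proof.
move=> rs r1 r2 s' v; set r := K.-1./2; set h := troot K.
have hN : h < N.
  have /andP[t1 _] := trootP K; rewrite ltnNge; apply/negP => hN.
  by move: t1 hN KN N1; rewrite -/h; clear; nia.
have rN : r <= N by move: KN; rewrite /r; clear; lia.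
have hr t : t < r = (t.*2.+2 < K) by move: K0; rewrite /r; clear; lia.
rewrite /s' /peel_loop !den_seq; set s1 := den N (Put 10 true) _.
have [||s2 [_ h2 h3 h4 h5] ->] := @for_inv N 13 loop_body s1 (fun t s =>
  [/\ ready K G s, [/\ reg s 1 = K, reg s 2 = h & reg s 9 = t.*2.+1], (reg s 10 < N) = (t.*2 < K),
      forall v : 'I_n, arr s 2 v = (v \in peelset G (minn t r)) &
      h < t -> forall v : 'I_n, arr s 5 v = (v \in peelset G (minn h r))]).
- split=> //.
  + by do 4!apply: ready_den => //.
  + split; [by rewrite /s1 !nowrite_reg|by rewrite /s1 !nowrite_reg|by []].
  + by rewrite /s1 !denE /= /upd /= N0 double0 K0.
  + move=> u; have -> : u \in peelset G (minn 0 r) by rewrite min0n /peelset /= inE.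
    rewrite /s1 den_put arr_setr den_inc arr_setr den_put arr_setr.
    rewrite (@for_map K n G _ _ (fun a f => if a == 2 then true else f a)) ?ordN //.
    move=> s3 i hi ri a j; rewrite den_seta ri arr_seta andbC.
    by case: (j =P i) => // ->.
- move=> t s3 tN [rs3 [q1 q2 q9] q10 qa qh]; rewrite /loop_body !den_seq.
  set s4 := den N (If (EqR 13 2) save Skip) _.
  have rs4 : ready K G s4 by apply: ready_den.
  have regs4 y : y \in [:: 1; 2; 9; 10] -> reg s4 y = reg s3 y.
    by rewrite !inE => /or4P[] /eqP ->; rewrite /s4 nowrite_reg.
  have a2 : arr s4 2 = arr s3 2 by rewrite /s4 noset_arr.
  have a5 : h < t.+1 -> forall u : 'I_n, arr s4 5 u = (u \in peelset G (minn h r)).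
    rewrite ltnS leq_eqVlt /s4 den_if /= /upd /= q2 => /orP[/eqP ht|ht] u.
      by rewrite ht eqxx tN /= saveP ?ordN //= qa.
    have -> : t == h = false by apply/eqP; move: ht; clear; lia.
    by rewrite den_skip /= qh.
  have [k1 k2 k3 k4] := tickP s4; rewrite -/tick.
  set s5 := den N tick s4 in k1 k2 k3 k4 *.
  have rs5 : ready K G s5 by apply: ready_den.
  have f10 : (reg s5 10 < N) = (t < r).
    rewrite k4 ?regs4 // q10 q9 hr; clear -K0; lia.
  set s6 := den N (If _ _ _) s5.
  have g y : y \in [:: 1; 2; 9; 10] -> reg s6 y = reg s5 y.
    by rewrite !inE => /or4P[] /eqP ->; rewrite /s6 nowrite_reg.
  split.
  + by apply: ready_den.
  + by rewrite !g // k3 !k2 // !regs4 // q9; split.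
  + by rewrite g // f10 hr; clear; lia.
  + move=> u; rewrite /s6 den_if /= eqxx f10 /=; case: ltnP => tr.
      have e2 : forall w : 'I_n, arr s5 2 w = (w \in peelset G t).
        by move=> w; rewrite k1 a2 qa (minn_idPl (ltnW tr)).
      by rewrite (peelP n0 rs5 e2) (minn_idPl tr).
    by rewrite den_skip k1 a2 qa (minn_idPr tr) (minn_idPr (leqW tr)).
  + move=> ht u; have -> : arr s6 5 = arr s5 5 by rewrite /s6 noset_arr.
    by rewrite k1; exact: a5.
by rewrite /= h4 (minn_idPr rN) h5.
Qed.

Definition core := Seq prep (Seq peel_loop
  (Seq (For 8 (If (GetA 2 8) (SetA 6 8 true) Skip)) (For 13 (pass 3 4 5 6 reach_body)))).

Lemma coreP s0 : arr s0 = arr (start (cells K n adj)) -> let s := den N core s0 in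
  [/\ reg s 0 = n.-1, reg s 1 = K, reg s 2 = troot K, arr s 1 = (fun _ => false) &
      forall v : 'I_n, arr s 5 v && arr s 6 v = (v \in path_score G K)].
Proof.
move=> hs0; rewrite /core (den_seq _ prep) (den_seq _ peel_loop) (den_seq _ (For 8 _)).
have [rs e1 e2] := prepP hs0; set s1 := den N prep _ in rs e1 e2 *.
have hp := peel_loopP rs e1 e2; set s2 := den N peel_loop s1 in hp *.
have rs2 : ready K G s2 by apply: ready_den.
set s3 := den N (For 8 _) s2.
have rs3 : ready K G s3 by apply: ready_den.
have e6 (v : 'I_n) : arr s3 6 v = (v \in peelset G K.-1./2).
  rewrite /s3 (@for_map K n G _ _ (fun a f => if a == 6 then f 6 || f 2 else f a)) ?ordN //=.
    have -> : arr s2 6 = (fun _ => false) by rewrite /s2 /s1 !noset_arr // hs0.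
    by case: (hp v).
  move=> s' i hi ri a j; rewrite den_if /= ri hi /=.
  case: ifP => h2; rewrite ?den_seta ?den_skip ?ri ?arr_seta.
    by rewrite andbC; case: (j =P i) => // ->; case: (a =P 6) => // ->; rewrite orbT.
  by case: (j =P i) => // ->; case: (a =P 6) => // ->; rewrite orbF.
split.
- by rewrite nowrite_reg //; case: rs3.
- by rewrite nowrite_reg // /s3 nowrite_reg // /s2 nowrite_reg.
- by rewrite nowrite_reg // /s3 nowrite_reg // /s2 nowrite_reg.
- by rewrite noset_arr // /s3 noset_arr // /s2 noset_arr // /s1 noset_arr // hs0.
move=> v; rewrite (reachP n0 rs3 e6) noset_arr // /s3 noset_arr //.
by have [_ ->] := hp v; rewrite inE.
Qed.

Definition sweep body := Seq (Put 10 true)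
  (For 8 (Seq (If (EqR 10 10) body Skip) (If (EqR 8 0) (Put 10 false) Skip))).

Lemma sweepP body (Inv : nat -> store -> Prop) s :
  [&& nowrite 0 body, nowrite 8 body & nowrite 10 body] ->
  (forall i s x v, (x == 8) || (x == 10) -> Inv i s -> Inv i (setr s x v)) ->
  (forall i s, i < n -> reg s 8 = i -> Inv i s -> Inv i.+1 (den N body s)) ->
  reg s 0 = n.-1 -> Inv 0 s -> Inv n (den N (sweep body) s).
Proof.
move=> /and3P[w0 w8 w10] frame stp e0 I0; rewrite /sweep den_seq.
have [||s' [_ h] ->] := @for_inv N 8 (Seq (If (EqR 10 10) body Skip)
   (If (EqR 8 0) (Put 10 false) Skip)) (den N (Put 10 true) s)
   (fun i s => (reg s 0 = n.-1 /\ (reg s 10 < N) = (i < n)) /\ Inv (minn i n) s).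
- rewrite den_put /= /upd /= N0 n0 min0n; split=> //; exact: frame.
- move=> i s1 hi [[e1 e2] I1]; rewrite den_seq.
  set s2 := den N (If _ _ _) (setr s1 8 i).
  have r0 : reg s2 0 = n.-1 by rewrite /s2 nowrite_reg //= w0.
  have r8 : reg s2 8 = i by rewrite /s2 nowrite_reg //= w8.
  have r10 : (reg s2 10 < N) = (i < n) by rewrite /s2 nowrite_reg //= w10.
  have I2 : Inv (minn i.+1 n) s2.
    rewrite /s2 den_if /= /upd /= eqxx e2 /=; case: ltnP => hin.
      rewrite (minn_idPl hin); apply: stp => //; apply: frame => //.
      by rewrite (minn_idPl (ltnW hin)) in I1.
    by rewrite den_skip (minn_idPr (leqW hin)); rewrite (minn_idPr hin) in I1; exact: frame.
  rewrite den_if /= r8 r0 hi andbT; case: eqP => hi'.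
    rewrite den_put /= /upd /=; split; last exact: frame.
    by split=> //; rewrite ltnn hi' prednK // ltnn.
  rewrite den_skip; split=> //; split=> //; rewrite r10.
  by move: hi' n0; clear; lia.
by apply: frame => //; rewrite (minn_idPr nN) in h.
Qed.

End Core.

(** The first cell is [true] exactly when [K > 0]. For [K = 0] nothing runs, and array 1 stays
    empty, an output of the required size. *)
Definition guard c := Seq (Put 14 true) (If (GetA 0 14) c Skip).

Lemma guard0 n (adj : nat -> nat -> bool) c :
  let x := cells 0 n adj in den (size x) (guard c) (start x) = setr (start x) 14 0.
Proof. by []. Qed.

Lemma guardS K n (adj : nat -> nat -> bool) c : 0 < K ->
  let x := cells K n adj in
  den (size x) (guard c) (start x) = den (size x) c (setr (start x) 14 0).
Proof. by case: K. Qed.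

Lemma count_upd (f : nat -> bool) u n : u < n -> f u = false ->
  count (upd f u true) (iota 0 n) = (count f (iota 0 n)).+1.
Proof.
move=> hu fu.
have := count_predUI f (pred1 u) (iota 0 n).
rewrite (count_uniq_mem _ (iota_uniq 0 n)) mem_iota /= add0n hu addn1 => <-.
have -> : count (predI f (pred1 u)) (iota 0 n) = 0.
  by apply/eqP; rewrite -leqn0 leqNgt -has_count; apply/hasPn => x _ /=; case: eqP => [->|]; rewrite ?fu ?andbF.
by rewrite addn0; apply: eq_count => x /=; rewrite /upd orbC; case: eqP.
Qed.

Lemma card_count n (f : nat -> bool) : #|[set v : 'I_n | f v]| = count f (iota 0 n).
Proof. by rewrite -val_enum_ord count_map cardsE cardE size_filter /= -enumT. Qed.

Section Output.
Variables (K n : nat) (G : graph n).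
Let adj := adjn G.
Let x := cells K n adj.
Let N := size x.
Hypothesis (K0 : 0 < K) (Kn : K <= n).
Let n0 : 0 < n := leq_trans K0 Kn.
Let KN : K < N.
Proof. by rewrite /N size_cells ltnS leq_addr. Qed.
Let nN : n <= N := n_le_cells K n adj.

Definition take1 := If (EqR 11 1) Skip (Seq (SetA 1 8 true) (Inc 11)).
(** The first sweep takes vertices from the score until there are [K] of them; the second fills up
    with arbitrary vertices, because the output must have exactly [K] elements. *)
Definition rec_cmd := guard (Seq core (Seq (Put 11 true)
  (Seq (sweep (If (GetA 5 8) (If (GetA 6 8) take1 Skip) Skip))
       (sweep (If (GetA 1 8) Skip take1))))).

Definition det_cmd := guard (Seq core (Seq (Put 11 true) (Seq (Put 14 true)
  (sweep (If (GetA 5 8) (If (GetA 6 8)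
     (Seq (Inc 11) (If (EqR 11 2) (SetA 1 14 true) Skip)) Skip) Skip))))).


Definition out_set (s : store) : {set 'I_n} := [set v : 'I_n | arr s 1 v].

Lemma eqK c : (c == K) && (c < N) = (c == K).
Proof. by case: eqP => //= ->; rewrite KN. Qed.

Lemma take1P s v : reg s 8 = v -> reg s 1 = K -> let s' := den N take1 s in
  if reg s 11 == K then s' = s else
  [/\ reg s' 11 = (reg s 11).+1, reg s' 1 = K, arr s' 5 = arr s 5, arr s' 6 = arr s 6 &
      arr s' 1 = upd (arr s 1) v true].
Proof.
by move=> r8 r1 /=; rewrite /take1 den_if /= r1 eqK; case: eqP => _; rewrite ?denE //= r8.
Qed.

Lemma rec_cmdP : let s := den N rec_cmd (start x) in
  [/\ #|out_set s| = K,
      K <= #|path_score G K| -> out_set s \subset path_score G K &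
      #|path_score G K| <= K -> path_score G K \subset out_set s].
Proof.
rewrite /rec_cmd /N /x guardS // -/x -/N.
set c2 := sweep (If (GetA 1 8) Skip take1).
set c1 := sweep (If (GetA 5 8) (If (GetA 6 8) take1 Skip) Skip).
rewrite (den_seq _ core) (den_seq _ (Put 11 true)) (den_seq _ c1).
have [e0 e1 e2 ea hS] := @coreP K n G K0 n0 (setr (start x) 14 0) erefl.
set s1 := den _ core _ in e0 e1 e2 ea hS *; clearbody s1.
set s2 := den N (Put 11 true) s1.
pose S u := arr s1 5 u && arr s1 6 u.
pose Inv1 i s := [/\ reg s 1 = K, arr s 5 = arr s1 5 /\ arr s 6 = arr s1 6,
  (forall u, i <= u -> arr s 1 u = false) /\ (forall u, arr s 1 u -> S u),
  reg s 11 = count (arr s 1) (iota 0 n) /\ reg s 11 <= K &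
  reg s 11 < K -> forall u, u < i -> S u -> arr s 1 u].
have I1 : Inv1 n (den N c1 s2).
  apply: (@sweepP K n G K0 n0) => //.
  - move=> i s y v hy [k1 k2 k3 k4 k5]; split=> //=; rewrite /upd;
    by case/orP: hy => /eqP ->.
  - move=> i s hi r8 [k1 [k2 k3] [k4 k5] [k6 k7] k8].
    have iN : i < N by exact: leq_trans nN.
    have keep : ~~ S i -> Inv1 i.+1 s.
      move=> nS; split=> //.
        by split=> // u hu; apply: k4; exact: ltnW.
      by move=> h u; rewrite ltnS leq_eqVlt => /orP[/eqP ->|hu]; [rewrite (negbTE nS)|exact: k8].
    rewrite den_if /= r8 iN k2 /=.
    have [h5|h5] := boolP (arr s1 5 i); last by rewrite den_skip; apply: keep; rewrite /S (negbTE h5).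
    rewrite den_if /= r8 iN k3 /=.
    have [h6|h6] := boolP (arr s1 6 i); last by rewrite den_skip; apply: keep; rewrite /S (negbTE h6) andbF.
    have := take1P r8 k1; case: eqP => hK /=.
      move=> ->; split=> //; last by rewrite hK ltnn.
      by split=> // u hu; apply: k4; exact: ltnW.
    move=> [t1 t2 t3 t4 t5]; split=> //; rewrite ?t1 ?t3 ?t4 ?t5 //.
    + split=> u; rewrite /upd; first by case: eqP => [->|_ hu]; rewrite ?ltnn // k4 // ltnW.
      by case: eqP => [-> _|_]; [rewrite /S h5 h6|exact: k5].
    + rewrite count_upd // ?k4 // k6; split=> //; rewrite -k6 ltn_neqAle k7 andbT; exact/eqP.
    + move=> hlt u; rewrite ltnS leq_eqVlt /upd => /orP[/eqP ->|hu] hSu; first by rewrite eqxx.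
      by case: eqP => // _; apply: k8 => //; exact: ltnW.
  have c0 : count (fun _ => false) (iota 0 n) = 0 by elim: (iota 0 n).
  by rewrite /s2 den_put; split; rewrite ?arr_setr ?ea ?reg_setr ?c0.
set s3 := den N c1 s2 in I1 *.
have [k1 _ [_ k5] [k6 k7] k8] := I1.
have r30 : reg s3 0 = n.-1 by rewrite /s3 nowrite_reg.
pose Inv2 i s := [/\ reg s 1 = K, forall u, arr s3 1 u -> arr s 1 u,
  reg s 11 = count (arr s 1) (iota 0 n) /\ reg s 11 <= K &
  reg s 11 < K -> forall u, u < i -> arr s 1 u].
have [j1 j2 [j3 j4] j5] : Inv2 n (den N c2 s3).
  apply: (@sweepP K n G K0 n0) => //.
  - move=> i s y v hy [l1 l2 l3 l4]; split=> //=; rewrite /upd;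
    by case/orP: hy => /eqP ->.
  - move=> i s hi r8 [l1 l2 [l3 l4] l5].
    have iN : i < N by exact: leq_trans nN.
    rewrite den_if /= r8 iN /=.
    have [h1|h1] := boolP (arr s 1 i).
      rewrite den_skip; split=> // hlt u; rewrite ltnS leq_eqVlt => /orP[/eqP -> //|hu].
      exact: l5.
    have := take1P r8 l1; case: eqP => hK /=.
      by move=> ->; split=> //; rewrite hK ltnn.
    move=> [t1 t2 t3 t4 t5]; split=> //; rewrite ?t1 ?t5 //.
    + by move=> u hu; rewrite /upd; case: eqP => // _; exact: l2.
    + rewrite count_upd // ?(negbTE h1) // l3; split=> //; rewrite -l3 ltn_neqAle l4 andbT; exact/eqP.
    + move=> hlt u; rewrite ltnS leq_eqVlt /upd => /orP[/eqP ->|hu]; first by rewrite eqxx.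
      by case: eqP => // _; apply: l5 => //; exact: ltnW.
set s4 := den N c2 s3 in j1 j2 j3 j4 j5 *.
have c4 : #|out_set s4| = K.
  rewrite /out_set card_count -j3; apply/eqP; rewrite eqn_leq j4 leqNgt; apply/negP => hlt.
  have := j5 hlt => hall; move: hlt; rewrite j3 ltnNge => /negP; apply.
  have -> : count (arr s4 1) (iota 0 n) = n; last by [].
  rewrite -[RHS](size_iota 0 n); apply/eqP; rewrite -all_count; apply/allP => u.
  by rewrite mem_iota => /andP[_]; exact: hall.
have sub3 : out_set s3 \subset out_set s4.
  by apply/fintype.subsetP => v; rewrite !inE; exact: j2.
have sub3S : out_set s3 \subset path_score G K.
  by apply/fintype.subsetP => v; rewrite inE -hS; exact: k5.
have c3 : #|out_set s3| = reg s3 11 by rewrite /out_set card_count.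
have full : reg s3 11 < K -> path_score G K \subset out_set s3.
  by move=> hlt; apply/fintype.subsetP => v; rewrite -hS inE; exact: k8.
split=> //.
- move=> hK; have e3 : reg s3 11 = K.
    apply/eqP; rewrite eqn_leq k7 leqNgt; apply/negP => hlt.
    have := subset_leq_card (full hlt); rewrite c3 => h.
    by move: (leq_trans hK h); rewrite leqNgt hlt.
  have /eqP <- : out_set s3 == out_set s4 by rewrite eqEcard sub3 c4 c3 e3 leqnn.
  exact: sub3S.
move=> hK; apply: fintype.subset_trans sub3.
case: (ltnP (reg s3 11) K) => h; first exact: full.
have /eqP -> : out_set s3 == path_score G K; last exact: subxx.
by rewrite eqEcard sub3S c3; exact: leq_trans hK h.
Qed.

Lemma det_cmdP : arr (den N det_cmd (start x)) 1 0 = (troot K <= #|path_score G K|).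
Proof.
rewrite /det_cmd /N /x guardS // -/x -/N.
set c1 := sweep _.
rewrite (den_seq _ core) (den_seq _ (Put 11 true)) (den_seq _ (Put 14 true)).
have [e0 e1 e2 ea hS] := @coreP K n G K0 n0 (setr (start x) 14 0) erefl.
set s1 := den _ core _ in e0 e1 e2 ea hS *; clearbody s1.
set s2 := den N (Put 14 true) _.
pose S u := arr s1 5 u && arr s1 6 u.
set h := troot K in e2 *.
have h0 : 0 < h by have /andP[_] := trootP K; rewrite -/h; case: h {e2}; lia.
have hN : h < N.
  have /andP[t1 _] := trootP K; rewrite ltnNge; apply/negP => hN.
  by move: t1 hN KN K0; rewrite -/h; clear; nia.
pose Inv i s := [/\ reg s 2 = h, reg s 14 = 0, arr s 5 = arr s1 5 /\ arr s 6 = arr s1 6,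
  reg s 11 = count S (iota 0 i) & arr s 1 0 = (h <= reg s 11)].
have [_ _ _ k4 k5] : Inv n (den N c1 s2).
  apply: (@sweepP K n G K0 n0) => //.
  - move=> i s y v hy [k1 k2 k3 k4 k5]; split=> //=; rewrite /upd;
    by case/orP: hy => /eqP ->.
  - move=> i s hi r8 [k1 k2 [k3 k4] k5 k6].
    have iN : i < N by exact: leq_trans nN.
    have cS : count S (iota 0 i.+1) = count S (iota 0 i) + S i.
      by rewrite -addn1 iotaD count_cat /= addn0 add0n.
    rewrite !den_if /= r8 iN k3 k4 /=.
    have [h5|h5] := boolP (arr s1 5 i); last first.
      by rewrite den_skip; split=> //; rewrite cS /S (negbTE h5) addn0.
    have [h6|h6] := boolP (arr s1 6 i); last first.
      by rewrite den_skip; split=> //; rewrite cS /S (negbTE h6) andbF addn0.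
    have cS' : (reg s 11).+1 = count S (iota 0 i.+1) by rewrite cS /S h5 h6 addn1 k5.
    rewrite !denE /= /upd /= k1.
    have hle : (h <= (reg s 11).+1) = (h <= reg s 11) || ((reg s 11).+1 == h).
      by rewrite leq_eqVlt ltnS eq_sym orbC.
    case: ifP => [/andP[/eqP hh _]|hh].
      split=> //=; rewrite /upd /= ?k2 //.
      by rewrite hh leqnn.
    split=> //=; rewrite /upd /=.
    by rewrite k6 hle; case: eqP hh => [->|_ _]; rewrite ?hN // orbF.
  by rewrite /s2 !den_put; split; rewrite ?arr_setr ?ea ?reg_setr //= leqNgt h0.
rewrite k5 k4 -card_count; congr (_ <= #|pred_of_set _|); apply/setP => v.
by rewrite inE -hS.
Qed.

End Output.

(** * The wedge-count test *)

Definition incs k r := iter k (Seq (Inc r)) Skip.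

Arguments incs : simpl never.

Lemma incsP N k r s : let s' := den N (incs k r) s in
  [/\ arr s' = arr s, reg s' r = reg s r + k & forall y, y != r -> reg s' y = reg s y].
Proof.
elim: k s => [|k IH] s /=; first by rewrite den_skip addn0.
rewrite /incs /= den_seq den_inc; have [h1 h2 h3] := IH (setr s r (reg s r).+1).
split; first by rewrite h1.
  by rewrite h2 /= /upd eqxx addSnnS.
by move=> y hy; rewrite h3 // /= /upd (negbTE hy).
Qed.

Lemma nowrite_incs k r y : nowrite y (incs k r) = (k == 0) || (r != y).
Proof. by elim: k => //= k IH; rewrite /incs /= -/(incs k r) IH; case: (r == y); rewrite ?orbT ?orbF ?andbF. Qed.

Lemma noset_incs k r a : noset a (incs k r).
Proof. by elim: k => //= k IH; rewrite /incs /= -/(incs k r) IH. Qed.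

(* Registers 4, 5 and 24, 25 hold two edges; 17 counts twice the ordered pairs of
   distinct incident edges, 18 adds 8 for every [n + 1] ordered pairs of distinct
   edges (19 counts modulo [n + 1], which is in 12). *)
Definition all_pair := Seq (Inc 19) (If (EqR 19 12) (Seq (Put 19 true) (incs 8 18)) Skip).
Definition adj_pair := Seq (Inc 17) (Seq (Inc 17) all_pair).
Definition pair_body :=
  If (EqR 4 24) (If (EqR 5 25) Skip adj_pair)
    (If (EqR 5 25) adj_pair (If (EqR 4 25) adj_pair (If (EqR 5 24) adj_pair all_pair))).
Definition edge_body := Seq (incs 16 21) (pass 23 24 25 26 pair_body).
(** Without subtraction, register 8 scans all values: register 10 records that the value of [Y] has
    been passed, and the answer is written when the value of [X] is met. Hence the comparison also
    requires [X] to be below [N]. *)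
Definition compare X Y := Seq (Put 10 false)
  (For 8 (Seq (If (EqR 8 Y) (Put 10 true) Skip)
              (If (EqR 8 X) (If (EqR 10 10) (SetA 1 14 true) Skip) Skip))).
(** With [A] ordered incident pairs, [P] ordered pairs of distinct edges and [m] edges, this tests
    [A - 4 P / (n + 1) >= K / 2], up to rounding, or [16 m >= u (n - 1)]. The call [get_K 18] puts
    the summand [K] into the threshold register. *)
Definition wedge_cmd u :=
  Seq (get_K 1) (Seq (tri false 0) (Seq (Inc 12) (Seq (get_K 18)
  (Seq (Put 17 true) (Seq (Put 19 true) (Seq (Put 21 true) (Seq (Put 22 true) (Seq (Put 14 true)
  (Seq (pass 3 4 5 6 edge_body)
  (Seq (Put 10 true) (Seq (For 8 (Seq (If (EqR 8 0) (Put 10 false) Skip) (If (EqR 10 10) (incs u 22) Skip)))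
  (Seq (compare 17 18) (compare 21 22))))))))))))).

Definition incident (e f : nat * nat) :=
  (e != f) && [|| e.1 == f.1, e.2 == f.2, e.1 == f.2 | e.2 == f.1].

Section Wedge.
Variables (K n : nat) (G : graph n) (u : nat).
Let adj := adjn G.
Let x := cells K n adj.
Let N := size x.
Hypothesis (n4 : 3 < n).
Let n0 : 0 < n. Proof. exact: leq_trans n4. Qed.
Let nN : n <= N := n_le_cells K n adj.
(** Register 12 holds [n + 1] and must point to a cell for [EqR 19 12] to be decisive; small [n]
    would break this. *)
Let n1N : n.+1 < N.
Proof.
have h3 : n * 3 <= n * n.-1 by rewrite leq_mul2l; apply/orP; right; lia.
rewrite /N /x size_cells; move: h3 (tri_upto K n adj) n4; clear.
by move: (n * n.-1) (size _) => q r; lia.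
Qed.
Let E := edges n adj.

Lemma compareP X Y s : X \notin [:: 8; 10; 14] -> Y \notin [:: 8; 10; 14] -> reg s 14 = 0 ->
  arr (den N (compare X Y) s) 1 0 = arr s 1 0 || (reg s Y <= reg s X < N).
Proof.
rewrite !inE !negb_or => /and3P[/negbTE x8 /negbTE x10 /negbTE x14] /and3P[/negbTE y8 /negbTE y10 /negbTE y14] r14.
rewrite /compare den_seq.
have [||s' [_ _ _ [_ h]] ->] := @for_inv N 8 (Seq (If (EqR 8 Y) (Put 10 true) Skip)
    (If (EqR 8 X) (If (EqR 10 10) (SetA 1 14 true) Skip) Skip)) (den N (Put 10 false) s)
  (fun i s' => [/\ reg s' X = reg s X, reg s' Y = reg s Y, reg s' 14 = 0 &
    (reg s' 10 < N) = (reg s Y < i) /\ arr s' 1 0 = arr s 1 0 || ((reg s Y <= reg s X) && (reg s X < i))]).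
- by rewrite den_put /= /upd /= x10 y10 ltnn andbF orbF; split.
- move=> i s1 iN [h1 h2 h3 [h4 h5]]; rewrite den_seq.
  set s2 := den N (If (EqR 8 Y) _ _) _.
  have [g1 g2 g3 g4] : [/\ reg s2 X = reg s X, reg s2 Y = reg s Y, reg s2 14 = 0 & reg s2 8 = i].
    by rewrite /s2 den_if; case: ifP => _; rewrite ?den_put ?den_skip /= /upd /= ?x8 ?y8 ?x10 ?y10.
  have g5 : arr s2 1 0 = arr s1 1 0 by rewrite /s2 den_if; case: ifP.
  have g6 : (reg s2 10 < N) = (reg s Y < i.+1).
    rewrite /s2 den_if /= /upd /= y8 h2 iN andbT; case: eqP => [->|hi] /=.
      by rewrite ltnSn (leq_ltn_trans _ iN).
    by rewrite /upd /= h4; move: hi; clear; lia.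
  have e1 : (reg s Y <= reg s X) && (reg s X < i.+1) =
     ((reg s Y <= reg s X) && (reg s X < i)) || ((i == reg s X) && (reg s Y <= i)).
    by clear; lia.
  rewrite den_if /= g4 g1 iN andbT e1 orbA -h5 -g5.
  case: eqP => [ei|_] /=; last by rewrite den_skip orbF; split.
  rewrite den_if /= eqxx g6 ltnS /=; case: ifP => hY.
    by split=> //=; rewrite ?g6 ?ltnS ?hY ?arr_seta ?g3 ?orbT; split.
  by split=> //; rewrite g6 ltnS hY orbF; split.
by rewrite arr_setr h.
Qed.


Definition counters A P s := [/\ reg s 17 = A.*2, reg s 18 = K + 8 * (P %/ n.+1),
  reg s 19 = P %% n.+1, reg s 12 = n.+1 & reg s 0 = n.-1 /\ arr s = arr (start x)].

Lemma counters_setr A P s y v : y \notin [:: 0; 12; 17; 18; 19] ->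
  counters A P s -> counters A P (setr s y v).
Proof.
rewrite !inE !negb_or => /and5P[y0 y1 y2 y3 y4] [h1 h2 h3 h4 [h5 h6]].
by split; rewrite /= ?/upd 1?eq_sym ?(negbTE y0) ?(negbTE y1) ?(negbTE y2) ?(negbTE y3) ?(negbTE y4) //=;
  split=> //; rewrite /upd eq_sym (negbTE y0).
Qed.

Lemma all_pairP A P s : counters A P s -> counters A P.+1 (den N all_pair s).
Proof.
move=> [h1 h2 h3 h4 [h5 h6]]; rewrite /all_pair den_seq den_inc den_if /= /upd /= h3 h4.
have hlt : P %% n.+1 < n.+1 by rewrite ltn_mod.
have eP := divn_eq P n.+1.
case: ifP => [/andP[/eqP hc _]|hc].
  rewrite den_seq den_put; have [i1 i2 i3] := incsP N 8 18 (setr (setr s 19 (P %% n.+1).+1) 19 0).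
  have [d1 d2] : P.+1 %/ n.+1 = (P %/ n.+1).+1 /\ P.+1 %% n.+1 = 0.
    have -> : P.+1 = (P %/ n.+1).+1 * n.+1 by rewrite {1}eP mulSn -addnS hc addnC.
    by rewrite mulnK // modnMl.
  split; [by rewrite i3| |by rewrite i3 // d2|by rewrite i3|by split; rewrite ?i3 ?i1].
  by rewrite i2 d1 /= /upd /= h2 mulnS addnA addnAC.
have hc' : (P %% n.+1).+1 < n.+1.
  rewrite ltn_neqAle hlt andbT; apply/eqP => e; move: hc; rewrite e eqxx /=.
  by rewrite n1N.
have [d1 d2] : P.+1 %/ n.+1 = P %/ n.+1 /\ P.+1 %% n.+1 = (P %% n.+1).+1.
  have -> : P.+1 = P %/ n.+1 * n.+1 + (P %% n.+1).+1 by rewrite {1}eP addnS.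
  by rewrite divnMDl // (divn_small hc') addn0 modnMDl modn_small.
by split; rewrite /= /upd /= ?d1 ?d2.
Qed.

Lemma adj_pairP A P s : counters A P s -> counters A.+1 P.+1 (den N adj_pair s).
Proof.
move=> [h1 h2 h3 h4 h5]; rewrite /adj_pair den_seq den_inc (den_seq _ (Inc 17)) den_inc.
by apply: all_pairP; split=> //=; rewrite /upd /= h1 doubleS.
Qed.

Lemma pair_bodyP A P s a b c d : counters A P s -> reg s 4 = a -> reg s 5 = b ->
  reg s 24 = c -> reg s 25 = d -> a < N -> b < N ->
  counters (A + incident (a, b) (c, d)) (P + ((a, b) != (c, d))) (den N pair_body s).
Proof.
move=> hc e4 e5 e24 e25 aN bN; rewrite /pair_body /incident xpair_eqE /= den_if /= e4 e24 aN andbT.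
case: (a == c) => /=; rewrite den_if /= e5 e25 bN andbT.
  by case: (b == d) => /=; [rewrite den_skip !addn0|rewrite !addn1; exact: adj_pairP].
case: (b == d) => /=; first by rewrite !addn1; exact: adj_pairP.
rewrite den_if /= e4 e25 aN andbT; case: (a == d) => /=; first by rewrite !addn1; exact: adj_pairP.
rewrite den_if /= e5 e24 bN andbT; case: (b == c) => /=; first by rewrite !addn1; exact: adj_pairP.
by rewrite addn0 addn1; exact: all_pairP.
Qed.

Lemma edge_bodyP A P m a b s : counters A P s -> reg s 4 = a -> reg s 5 = b -> reg s 21 = 16 * m ->
  a < N -> b < N -> let s' := den N edge_body s in
  counters (A + count (incident (a, b)) E) (P + count (predC1 (a, b)) E) s' /\ reg s' 21 = 16 * m.+1.
Proof.
move=> hc e4 e5 e21 aN bN; rewrite /edge_body (den_seq _ (incs 16 21)).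
have [i1 i2 i3] := incsP N 16 21 s; set s1 := den N (incs 16 21) s in i1 i2 i3 *.
have hc1 : counters A P s1.
  by case: hc => h1 h2 h3 h4 [h5 h6]; split; rewrite ?i3 //; split; rewrite ?i3 ?i1.
pose Inv (l : seq (nat * nat)) s := [/\ counters (A + count (incident (a, b)) l)
   (P + count (predC1 (a, b)) l) s, reg s 4 = a & reg s 5 = b].
have [h1 _ _] : Inv E (den N (pass 23 24 25 26 pair_body) s1).
  apply: passP => //.
  - move=> l s2 y v hy [k1 k2 k3]; split.
    + by apply: counters_setr k1; move: hy; rewrite !inE => /or4P[||/eqP ->|/orP[]] // /eqP ->.
    + by rewrite /= /upd; move: hy; rewrite !inE => /or4P[||/eqP ->|/orP[]] // /eqP ->.
    + by rewrite /= /upd; move: hy; rewrite !inE => /or4P[||/eqP ->|/orP[]] // /eqP ->.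
  - move=> l s2 c d [k1 k2 k3] e24 e25 _ _; split; rewrite ?nowrite_reg //.
    rewrite -cats1 !count_cat /= !addn0 !addnA [(c, d) == _]eq_sym.
    exact: pair_bodyP.
  - by case: hc1 => _ _ _ _ [].
  - by case: hc1 => _ _ _ _ [_ ->].
  by split; rewrite ?i3 // /= !addn0.
split=> //; rewrite nowrite_reg // i2 e21; clear; lia.
Qed.

Lemma wedge_cmdP : let P := size E * (size E).-1 in
  let A := sumn [seq count (incident e) E | e <- E] in
  arr (den N (wedge_cmd u) (start x)) 1 0 =
    (K + 8 * (P %/ n.+1) <= A.*2 < N) || (u * n.-1 <= 16 * size E < N).
Proof.
move=> P A; rewrite /wedge_cmd.
rewrite (den_seq _ (get_K 1)) (den_seq _ (tri false 0)) (den_seq _ (Inc 12)) (den_seq _ (get_K 18)).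
set s1 := den N (get_K 1) (start x); have e1 : reg s1 1 = K by apply: get_KP.
have N1 : 1 < N by exact: leq_ltn_trans n1N.
have [e2 e2'] := get_L e1 N1; set s2 := den N (tri false 0) s1 in e2 e2' *.
set s3 := den N (get_K 18) _.
have a3 : arr s3 = arr (start x).
  by apply/funext => a; rewrite /s3 noset_arr // noset_arr // /s2 noset_arr // /s1 noset_arr.
have r18 : reg s3 18 = K.
  by apply: get_KP => // i _; rewrite den_inc arr_setr /s2 noset_arr // /s1 noset_arr.
have r12 : reg s3 12 = n.+1 by rewrite /s3 nowrite_reg // den_inc reg_setr eqxx e2' prednK.
have r0 : reg s3 0 = n.-1 by rewrite /s3 nowrite_reg // nowrite_reg.
clearbody s3; clear s1 e1 s2 e2 e2'.
do 5![rewrite (den_seq _ (Put _ _))]; set s4 := den N (Put 14 true) _.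
have c4 : counters 0 0 s4.
  by rewrite /s4 !den_put; split; rewrite /= ?/upd //= ?div0n ?muln0 ?addn0 ?mod0n.
have [r14 r21 r22] : [/\ reg s4 14 = 0, reg s4 21 = 0 & reg s4 22 = 0] by [].
clearbody s4; rewrite (den_seq _ (pass _ _ _ _ _)).
pose Inv (l : seq (nat * nat)) s := [/\ counters (sumn [seq count (incident e) E | e <- l])
   (sumn [seq count (predC1 e) E | e <- l]) s, reg s 21 = 16 * size l, reg s 14 = 0 & reg s 22 = 0].
have [c5 k21 k14 k22] : Inv E (den N (pass 3 4 5 6 edge_body) s4).
  apply: passP => //.
  - move=> l s y v hy [h1 h2 h3 h4].
    have hy' : y \notin [:: 0; 12; 17; 18; 19; 21; 14; 22].
      by move: hy; rewrite !inE => /or4P[||/eqP ->|/orP[]] // /eqP ->.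
    move: hy'; rewrite (mem_cat _ [:: 0; 12; 17; 18; 19] [:: 21; 14; 22]) negb_or => /andP[m1 m2].
    split; first exact: counters_setr.
    + by rewrite /= /upd; move: m2; rewrite !inE !negb_or => /and3P[h _ _]; rewrite eq_sym (negbTE h).
    + by rewrite /= /upd; move: m2; rewrite !inE !negb_or => /and3P[_ h _]; rewrite eq_sym (negbTE h).
    + by rewrite /= /upd; move: m2; rewrite !inE !negb_or => /and3P[_ _ h]; rewrite eq_sym (negbTE h).
  - move=> l s a b [h1 h2 h3 h4] e4 e5 /andP[hab hbn] _.
    have bN : b < N by exact: leq_trans nN.
    have [f1 f2] := edge_bodyP h1 e4 e5 h2 (ltn_trans hab bN) bN.
    split; [|by rewrite size_rcons|by rewrite nowrite_reg|by rewrite nowrite_reg].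
    by rewrite !map_rcons !sumn_rcons.
  - by case: c4 => _ _ _ _ [].
  - by case: c4 => _ _ _ _ [_ ->].
set s5 := den N (pass _ _ _ _ _) s4 in c5 k21 k14 k22 *; clearbody s5.
rewrite (den_seq _ (Put 10 true)) (den_seq _ (For 8 _)) (den_seq _ (compare 17 18)).
set s6 := den N (For 8 _) _.
have [[g1 g2 g3 g4 g5] g6] : [/\ reg s6 17 = reg s5 17, reg s6 18 = reg s5 18, reg s6 21 = reg s5 21,
   reg s6 14 = 0 & arr s6 1 = arr s5 1] /\ reg s6 22 = u * n.-1.
  have nw y : y \in [:: 17; 18; 21; 14] -> reg s6 y = reg s5 y.
    move=> hy; rewrite /s6 !nowrite_reg //= ?nowrite_incs; move: hy; rewrite !inE;
    by case/or4P=> /eqP ->; rewrite ?orbT.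
  split; first by split; rewrite ?nw // /s6 !noset_arr //= noset_incs.
  rewrite /s6; have [||s' [_ _ h] ->] := @for_inv N 8 (Seq (If (EqR 8 0) (Put 10 false) Skip)
      (If (EqR 10 10) (incs u 22) Skip)) (den N (Put 10 true) s5)
    (fun i s => [/\ reg s 0 = n.-1, (reg s 10 < N) = (i <= n.-1) & reg s 22 = u * minn i n.-1]).
  - rewrite den_put; split; rewrite /= ?/upd //= ?min0n ?muln0 //.
    + by case: c5 => _ _ _ _ [].
    + by rewrite (leq_ltn_trans _ N1).
  - move=> i s iN [h1 h2 h3]; rewrite den_seq.
    set s7 := den N (If (EqR 8 0) _ _) _.
    have f0 : reg s7 0 = n.-1 by rewrite /s7 nowrite_reg.
    have f22 : reg s7 22 = u * minn i n.-1 by rewrite /s7 nowrite_reg.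
    have f10 : (reg s7 10 < N) = (i < n.-1).
      rewrite /s7 den_if /= /upd /= h1 iN andbT; case: eqP => [->|hi] /=; first by rewrite /= /upd /= ?ltnn.
      by rewrite /= /upd /= h2 ltn_neqAle; case: eqP.
    rewrite den_if /= eqxx f10 /=; case: ltnP => hi.
      have [i1 i2 i3] := incsP N u 22 s7; split; [by rewrite i3|by rewrite i3 // f10 hi|].
        by rewrite i2 f22 (minn_idPl (ltnW hi)) (minn_idPl hi) mulnS addnC.
    rewrite den_skip; split=> //; rewrite ?f10 ?f22.
      by move: hi; clear; lia.
    by rewrite (minn_idPr hi) (minn_idPr (leqW hi)).
  by rewrite /= /upd /= h; congr (_ * _); apply/minn_idPr; move: nN; clear; lia.
clearbody s6; rewrite compareP //; last by rewrite nowrite_reg.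
rewrite compareP // !nowrite_reg // g1 g2 g3 g5 g6 k21.
have [-> -> _ _ [_ ->]] := c5; rewrite /=.
have -> : sumn [seq count (predC1 e) E | e <- E] = P.
  have cE e : e \in E -> count (predC1 e) E = (size E).-1.
    move=> eE; have := count_predC (pred1 e) E.
    rewrite (count_uniq_mem _ (uniq_edges G)) eE => h.
    by rewrite -(eq_count (a1 := predC (pred1 e))) // -h.
  rewrite (iffLR (eq_in_map _ (fun _ => (size E).-1) E) cE) /P.
  have sc (q : nat) (l : seq (nat * nat)) : sumn [seq q | _ <- l] = size l * q.
    by elim: l => //= e l ->; rewrite mulSn.
  exact: sc.
by [].
Qed.

End Wedge.

(** * Polynomial-time machines *)

Lemma program_poly_tm kr ka c : 0 < kr -> 1 < ka -> wf kr ka c ->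
  exists (M : TM) (a d : nat), forall n K (G : graph n), K <= n ->
    let x := cells K n (adjn G) in let s := den (size x) c (start x) in
    [/\ halts_within M (a * n.+1 ^ d) (encode K n G),
        tm_accepts M (a * n.+1 ^ d) (encode K n G) = arr s 1 0 &
        tm_set_output M (a * n.+1 ^ d) n (encode K n G) = out_set n s].
Proof.
move=> kr0 ka1 w; have [M [g [[C [d hg]] hM]]] := program_tm kr0 ka1 w.
exists M, (C * 2 ^ d), (2 * d) => n K G Kn x s.
have sx : size x = K.+1 + size (upto n n) by exact: size_cells.
have hN : size x < 2 * n.+1 ^ 2.
  by rewrite sx; have := tri_upto K n (adjn G); move: Kn; clear; move: (size _) => r; nia.
have [|q [l [h [r [hr ho]]]]] := hM x (C * 2 ^ d * n.+1 ^ (2 * d)).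
  apply: leq_trans (hg _) _; rewrite -mulnA leq_mul2l expnM -expnMn; apply/orP; right.
  by case: (d) => // d'; rewrite leq_exp2r.
rewrite encodeE -/x; split.
- by rewrite /halts_within hr.
- rewrite /tm_accepts hr; have := ho 0; rewrite /= => -> //; last by rewrite sx.
rewrite /tm_set_output hr; apply/setP => i; rewrite !inE ho; first by case: (arr _ _ _).
exact: leq_trans (ltn_ord i) (n_le_cells K n (adjn G)).
Qed.

Lemma tm_reconstruction : exists (M : TM) (a d : nat), forall n K (G : graph n), K <= n ->
  let o := tm_set_output M (a * n.+1 ^ d) n (encode K n G) in
  [/\ halts_within M (a * n.+1 ^ d) (encode K n G), #|o| = K,
      0 < K -> K <= #|path_score G K| -> o \subset path_score G K &
      0 < K -> #|path_score G K| <= K -> path_score G K \subset o].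
Proof.
have [||//|M [a [d h]]] := @program_poly_tm 15 7 rec_cmd; first by [].
  by [].
exists M, a, d => n K G Kn; have [h1 _ ->] := h n K G Kn.
have [K0|] := posnP K; last first.
  by move=> K0; have [k1 k2 k3] := rec_cmdP G K0 Kn; split.
split=> //; rewrite K0; apply/eqP; rewrite cards_eq0; apply/eqP/setP => v.
by rewrite !inE guard0.
Qed.

Lemma tm_detection : exists (M : TM) (a d : nat), forall n K (G : graph n), K <= n ->
  halts_within M (a * n.+1 ^ d) (encode K n G) /\
  (0 < K -> tm_accepts M (a * n.+1 ^ d) (encode K n G) = (troot K <= #|path_score G K|)).
Proof.
have [||//|M [a [d h]]] := @program_poly_tm 15 7 det_cmd; first by [].
  by [].
exists M, a, d => n K G Kn; have [h1 -> _] := h n K G Kn.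
by split=> // K0; exact: det_cmdP.
Qed.

Lemma tm_wedge u : exists (M : TM) (a d : nat), forall n K (G : graph n), K <= n ->
  halts_within M (a * n.+1 ^ d) (encode K n G) /\
  (3 < n -> let E := edges n (adjn G) in
   let N := K.+1 + size (upto n n) in
   tm_accepts M (a * n.+1 ^ d) (encode K n G) =
    (K + 8 * (size E * (size E).-1 %/ n.+1) <=
        (sumn [seq count (incident e) E | e <- E]).*2 < N) ||
    (u * n.-1 <= 16 * size E < N)).
Proof.
have w : wf 27 7 (wedge_cmd u).
  rewrite /= !andbT; have wi k : wf 27 7 (incs k 22) by elim: k.
  by rewrite wi nowrite_incs orbT.
have [||//|M [a [d h]]] := @program_poly_tm 27 7 (wedge_cmd u); first by [].
  by [].
exists M, a, d => n K G Kn; have [h1 -> _] := h n K G Kn.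
by split=> // n4; rewrite wedge_cmdP // size_cells.
Qed.

(** * Non-backtracking walks *)

Section Walks.
Variables (T : eqType) (e : rel T).
Hypotheses (e_sym : symmetric e) (e_irr : irreflexive e).

Fixpoint nb (s : seq T) : bool :=
  if s is x :: s1 then (if s1 is _ :: z :: _ then x != z else true) && nb s1 else true.

Lemma nb_uniq s : uniq s -> nb s.
Proof.
elim: s => [|x s IH] // /andP[hx hu]; rewrite /= (IH hu) andbT; case: s hx {hu IH} => [|y [|z s]] //.
by rewrite !inE !negb_or => /and3P[].
Qed.

Lemma nb_catl s t : nb (s ++ t) -> nb s.
Proof.
elim: s => [|x [|y [|z s]] IH] //=.
by case/andP => -> h; exact: IH.
Qed.

Lemma nb_last3 s a b c : nb (s ++ [:: a; b; c]) = nb (s ++ [:: a; b]) && (a != c).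
Proof.
elim: s => [|x s IH]; first by rewrite /= !andbT.
by rewrite /= IH andbA; congr (_ && _ && _); case: s {IH} => [|y [|z s]].
Qed.

Lemma rcons3 (s : seq T) a b c : rcons (rcons (rcons s a) b) c = s ++ [:: a; b; c].
Proof. by rewrite -!cats1 -!catA. Qed.

Lemma rcons2 (s : seq T) a b : rcons (rcons s a) b = s ++ [:: a; b].
Proof. by rewrite -!cats1 -!catA. Qed.

(** A non-backtracking walk that repeats a vertex exhibits a cycle in the component of [v], without
    a cycle having to be named; in this form the property passes easily from a vertex to its
    neighbours. *)
Definition cyc (v : T) := exists p, [/\ path e v p, nb (v :: p) & ~~ uniq (v :: p)].

(** Prepending [v] to the walk of [w] works unless that walk starts by stepping to [v]. Then its
    tail is a walk from [v]; if the tail repeats nothing, the repeated vertex is [w], and the tail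
    up to [w] closed by the edge back to [v] is a cycle. *)
Lemma cyc_step v w : e v w -> cyc w -> cyc v.
Proof.
move=> evw [[|x p] [hp hn hu]] //.
have [xv|xv] := eqVneq x v; last first.
  exists (w :: x :: p); split; first by rewrite /= evw.
    by rewrite /= eq_sym xv; exact: hn.
  by move: hu; rewrite (cons_uniq v) => /negbTE ->; rewrite andbF.
subst x; have hp' : path e v p by case/andP: hp.
have hn' : nb (v :: p) by case/andP: hn.
have [u|nu] := boolP (uniq (v :: p)); last by exists p.
have wp : w \in p.
  move: hu; rewrite cons_uniq u andbT negbK inE => /orP[/eqP h|//].
  by rewrite h e_irr in evw.
case/splitPr: wp hp' hn hn' u hu {hp} => c d hp hn hn' u hu.
have u' : uniq (v :: rcons c w).
  by move: u; rewrite -cat_rcons -cat_cons cat_uniq => /andP[].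
exists (rcons c w ++ [:: v]); split.
- rewrite cat_path /= andbT last_rcons e_sym evw andbT.
  by move: hp; rewrite -cat_rcons cat_path => /andP[].
- case/lastP: c hn u' {hp hn' u hu} => [|c z] hn u'; first by move: hn; rewrite /= eqxx.
  rewrite cats1 -!rcons_cons rcons3 nb_last3 -rcons2 !rcons_cons; apply/andP; split.
    exact: nb_uniq.
  move: u'; rewrite cons_uniq !(mem_rcons, inE) !negb_or => /andP[/and3P[_ h _] _].
  by rewrite eq_sym.
- by rewrite cons_uniq mem_cat inE eqxx orbT.
Qed.

(** Cut at its first repetition, the walk becomes a lollipop: a simple path whose end is joined to
    an earlier vertex, not the preceding one since the walk does not backtrack. It has as many edges
    as vertices, which makes such figures rare. *)
Lemma cyc_lolli v : cyc v -> exists p u, [/\ path e v p, uniq (v :: p), u \in v :: p, e (last v p) u &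
  (index u (v :: p)).+2 <= size p].
Proof.
case=> p [hp hn hu]; elim/last_ind: p hp hn hu => [|p y IH] //.
rewrite rcons_path => /andP[hp ey] hn hu.
have [u|nu] := boolP (uniq (v :: p)); last by apply: IH => //; move: hn; rewrite -cats1 -cat_cons => /nb_catl.
have yp : y \in v :: p.
  by move: hu; rewrite -rcons_cons rcons_uniq u andbT negbK.
exists p, y; split => //.
case/lastP: p hp ey hn hu u yp {IH} => [|p z] hp ey hn hu u yp.
  by move: yp ey; rewrite inE => /eqP ->; rewrite e_irr.
rewrite last_rcons in ey.
have zy : z != y by apply/eqP => h; rewrite h e_irr in ey.
case/lastP: p hp hn hu u yp => [|p x] hp hn hu u yp.
  move: hn; rewrite /= andbT => vy.
  by move: yp; rewrite !inE (eq_sym y) (negbTE vy) (eq_sym y) (negbTE zy).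
have xy : x != y.
  by move: hn; rewrite -!rcons_cons rcons3 nb_last3 => /andP[].
have yp' : y \in v :: p.
  move: yp; rewrite -!rcons_cons mem_rcons in_cons eq_sym (negbTE zy) /= -rcons_cons mem_rcons in_cons.
  by rewrite eq_sym (negbTE xy).
rewrite -!rcons_cons -!cats1 -catA index_cat yp' !size_cat /= !addn1.
by have := yp'; rewrite -index_mem /= ltnS.
Qed.

(** Used to merge the two branches of a surviving vertex into one simple path, unless a cycle can be
    reached. *)
Lemma theta v x p y q : path e v (x :: p) -> nb (v :: x :: p) -> path e v (y :: q) -> nb (v :: y :: q) ->
  x != y -> cyc v \/ uniq (rev (x :: p) ++ v :: y :: q).
Proof.
move=> hp np hq nq xy.
have [up|up] := boolP (uniq (v :: x :: p)); last by left; exists (x :: p).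
have [uq|uq] := boolP (uniq (v :: y :: q)); last by left; exists (y :: q).
have [/hasP[z0 zp zq]|hd] := boolP (has (mem (y :: q)) (x :: p)); last first.
  right; rewrite cat_uniq rev_uniq uq andbT; have [vp ux] : v \notin x :: p /\ uniq (x :: p) by apply/andP.
  rewrite ux andTb.
  apply/hasPn => z; rewrite inE => /orP[/eqP ->|hz]; first by rewrite mem_rev.
  by rewrite mem_rev; apply: contra hd => hz'; apply/hasP; exists z.
left.
(* Going out along the first walk up to its first vertex on the second one, and
   back along the second one, gives a cycle through [v]. *)
set P := x :: p in hp np up zp *; set Q := y :: q in hq nq uq zq *.
have : exists a z c, P = a ++ z :: c /\ z \in Q /\ ~~ has (mem Q) a.
  have zq' : z0 \in Q := zq; clear -zp zq'; elim: P zp => // w P IH zp.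
  have [wQ|wQ] := boolP (w \in Q); first by exists [::], w, P.
  have zp' : z0 \in P by move: zp; rewrite inE => /orP[/eqP h|//]; rewrite -h zq' in wQ.
  have [a [z [c [-> [hz ha]]]]] := IH zp'; exists (w :: a), z, c; split=> //; split=> //=.
  by rewrite negb_or wQ.
move=> [a [z [c [Pe [zQ ha]]]]].
case/splitPr Qe : Q / zQ => [b d].
have hpa : path e v (rcons a z) by move: hp; rewrite Pe -cat_rcons cat_path => /andP[].
have hqb : path e v (rcons b z) by move: hq; rewrite Qe -cat_rcons cat_path => /andP[].
have upa : uniq (v :: rcons a z) by move: up; rewrite Pe -cat_rcons -cat_cons cat_uniq => /andP[].
have uqb : uniq (v :: rcons b z) by move: uq; rewrite Qe -cat_rcons -cat_cons cat_uniq => /andP[].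
have szn : a ++ b != [::].
  apply/negP => /eqP; case: (a) Pe ha => [|//] /= Pe _; case: (b) Qe => [|//] /= Qe _.
  by move: Pe Qe; rewrite /P /Q => -[xz _] -[yz _]; rewrite xz yz eqxx in xy.
have vrb : path e z (rcons (rev b) v).
  move: hqb; rewrite -rev_path; rewrite last_rcons belast_rcons rev_cons.
  by rewrite (eq_path (e' := e)) // => s t; rewrite /= e_sym.
have uw : uniq (v :: a ++ z :: rev b).
  rewrite cons_uniq mem_cat negb_or inE negb_or mem_rev cat_uniq cons_uniq mem_rev rev_uniq.
  move: upa uqb; rewrite !cons_uniq !mem_rcons !inE !negb_or !rcons_uniq => /andP[/andP[vz va] /andP[za ua]].
  move=> /andP[/andP[_ vb] /andP[zb ub]]; rewrite va vz vb ua zb ub /= !andbT.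
  rewrite za andTb -[X in ~~ X]/(has (mem a) (rev b)); apply/hasPn => t; rewrite mem_rev => tb.
  by apply: contra ha => ta; apply/hasP; exists t => //; rewrite /= Qe mem_cat tb.
exists (rcons (a ++ z :: rev b) v); split.
- by rewrite rcons_cat /= cat_path -rcons_cons; move: hpa; rewrite rcons_path => /andP[-> /= ->].
- have : 2 <= size (a ++ z :: rev b).
    by move: szn; rewrite -size_eq0 !size_cat /= size_rev; clear; lia.
  case/lastP: (a ++ z :: rev b) uw => [|s t] //; case/lastP: s => [|s t'] // uw _.
  rewrite -!rcons_cons rcons3 nb_last3 -rcons2 !rcons_cons; apply/andP; split.
    exact: nb_uniq.
  move: uw; rewrite cons_uniq !(mem_rcons, inE) !negb_or => /andP[/and3P[_ h _] _].
  by rewrite eq_sym.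
- by rewrite cons_uniq mem_rcons inE eqxx.
Qed.

Lemma theta_walks v P Q : path e v P -> nb (v :: P) -> path e v Q -> nb (v :: Q) ->
  P != [::] -> Q != [::] -> head v P != head v Q -> cyc v \/ uniq (rev P ++ v :: Q).
Proof. by case: P => // x p; case: Q => // y q h1 h2 h3 h4 _ _ /= xy; exact: theta. Qed.

Lemma cyc_path v p : path e v p -> cyc v -> cyc (last v p).
Proof.
elim: p v => //= w p IH v /andP[evw hp] hv; apply: IH => //; apply: cyc_step hv.
by rewrite e_sym.
Qed.

Lemma sorted_two_walks v P Q : path e v P -> path e v Q -> sorted e (rev P ++ v :: Q).
Proof.
move=> hP hQ; have : sorted e (rcons (rev P) v).
  rewrite -rev_cons rev_sorted (eq_sorted (e' := e)) // => x y; exact: e_sym.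
rewrite -cat_rcons; case: (rev P) => [|x t] //=; rewrite cat_path last_rcons => -> //.
Qed.

End Walks.

(** * Vertices selected by the peeling score, on and off the planted path *)

Section Score.
Variables (n K : nat) (G0 : graph n) (s : {ffun 'I_K -> 'I_n}).
Hypothesis si : injective s.
Let G : graph n := G0 :|: planted K n s.
Let V : {set 'I_n} := hidden K n s.
Notation e0 := (gadj G0).
Notation e := (gadj G).

Lemma gadj_symm (H : graph n) : symmetric (gadj H).
Proof. by move=> u v; exact: gadj_sym. Qed.

Lemma gadj_irr (H : graph n) : irreflexive (gadj H).
Proof. by move=> u; rewrite /gadj eqxx. Qed.

Lemma planted_hidden u v : [set u; v] \in planted K n s -> u \in V /\ v \in V.
Proof.
case/imsetP=> f _ E; have hV x : x \in [set u; v] -> x \in V.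
  by rewrite E => /imsetP[i _ ->]; exact: imset_f.
by split; apply: hV; rewrite !inE eqxx ?orbT.
Qed.

Lemma adj_outside u v : (u \notin V) || (v \notin V) -> e u v -> e0 u v.
Proof.
move=> h; rewrite /gadj finset.in_setU => /andP[-> /orP[//|/planted_hidden[hu hv]]].
by rewrite hu hv in h.
Qed.

Lemma path_first_hit v p : v \notin V -> path e v p ->
  (path e0 v p /\ forall x, x \in p -> x \notin V) \/
  exists a z c, [/\ p = rcons a z ++ c, z \in V & path e0 v (rcons a z)].
Proof.
elim: p v => [|w p IH] v vV /=; first by left.
case/andP => evw hp; have e0vw : e0 v w by apply: adj_outside; rewrite ?vV.
have [wV|wV] := boolP (w \in V); first by right; exists [::], w, p; rewrite /= e0vw.
case: (IH w wV hp) => [[h1 h2]|[a [z [c [-> zV h]]]]].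
  left; split; first by rewrite e0vw.
  by move=> x; rewrite inE => /orP[/eqP ->//|]; exact: h2.
by right; exists (w :: a), z, c; rewrite /= e0vw.
Qed.

(** A survivor has two neighbours that survive one round less, so the walk can always continue to
    one that differs from [w], the vertex it came from. *)
Lemma peel_walk (H : graph n) m v w : v \in peelset H m ->
  exists p, [/\ size p = m, path (gadj H) v p & nb (w :: v :: p)].
Proof.
elim: m v w => [|m IH] v w; first by exists [::].
rewrite /peelset iterS inE => /andP[_ /existsP[w1 /andP[h1 /existsP[w2 /and3P[h2 w12 /andP[a1 a2]]]]]].
have [y [hy wy ay]] : exists y, [/\ y \in peelset H m, w != y & gadj H v y].
  have [e1|ne] := eqVneq w w1; last by exists w1.
  by exists w2; rewrite e1.
have [p [sp pp np]] := IH y v hy.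
by exists (y :: p); split; [rewrite /= sp|rewrite /= ay|rewrite /= wy].
Qed.

Lemma peel_two_walks (H : graph n) m v : 0 < m -> v \in peelset H m ->
  exists P Q, [/\ size P = m, size Q = m, path (gadj H) v P, path (gadj H) v Q &
     [/\ nb (v :: P), nb (v :: Q) & head v P != head v Q]].
Proof.
move=> m0 hv; have [[|x p] [sp pp np]] := peel_walk v hv; first by rewrite -sp in m0.
have [[|y q] [sq pq nq]] := peel_walk x hv; first by rewrite -sq in m0.
exists (x :: p), (y :: q); split=> //; split; [by case/andP: np|by case/andP: nq|by case/andP: nq].
Qed.

Let r := K.-1./2.
Let h := minn (troot K) r.

(** Ways for a vertex off the path to survive without a cycle: it lies on a noise path joining two
    vertices of [V], or on a noise path that leaves [V] and continues for [h] vertices beyond it. *)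
Definition two_feet v := exists a b z1 z2,
  [/\ z1 \in V, z2 \in V, uniq (rev (rcons a z1) ++ v :: rcons b z2) &
      sorted e0 (rev (rcons a z1) ++ v :: rcons b z2)].
Definition foot_and_tail v := exists a z q,
  [/\ z \in V, size q = h, uniq (rev (rcons a z) ++ v :: q) & sorted e0 (rev (rcons a z) ++ v :: q)].
Definition long_path := exists t : seq 'I_n, [/\ size t = r.*2.+1, uniq t & sorted e0 t].

(** Follow the two walks of length [h] from [v] until they hit [V]. Two hits give two feet, one hit
    a foot and a tail. With no hit but [V] in the component of [v], a simple path to [V] starts
    differently from one of the walks, which again gives a foot and a tail. Otherwise the component
    consists of noise edges, and the two walks of length [r] from the deep survivor [b] form a long
    path. Whenever the pieces overlap, there is a cycle. *)
Lemma score_outside v : 0 < h -> v \in path_score G K -> v \notin V ->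
  [\/ cyc e0 v, two_feet v, foot_and_tail v | long_path].
Proof.
move=> h0; rewrite inE => /andP[vh /existsP[b /andP[br bv]]] vV.
have e0s := gadj_symm G0; have e0i := gadj_irr G0; have es := gadj_symm G.
have [P [Q [sP sQ pP pQ [nP nQ PQ]]]] := peel_two_walks h0 vh.
have P0 : P != [::] by rewrite -size_eq0 sP -lt0n.
have Q0 : Q != [::] by rewrite -size_eq0 sQ -lt0n.
have hit_head a z c (W : seq 'I_n) : W = rcons a z ++ c -> head v (rcons a z) = head v W.
  by move=> ->; case: a.
have foot a z W : z \in V -> path e0 v (rcons a z) -> nb (v :: rcons a z) -> path e0 v W -> nb (v :: W) ->
    W != [::] -> size W = h -> head v (rcons a z) != head v W -> cyc e0 v \/ foot_and_tail v.
  move=> zV pa na pW nW W0 sW hh.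
  case: (theta_walks e0s pa na pW nW _ W0 hh) => [|c|u]; [by case: (a)|by left|right].
  by exists a, z, W; split=> //; exact: sorted_two_walks.
case: (path_first_hit vV pP) => [[pP0 _]|[a [z [c [Pe zV pa]]]]]; last first.
  have na : nb (v :: rcons a z) by move: nP; rewrite Pe -cat_cons => /nb_catl.
  have hda := hit_head _ _ _ _ Pe.
  case: (path_first_hit vV pQ) => [[pQ0 _]|[a' [z' [c' [Qe zV' pa']]]]].
    case: (foot a z Q) => //; [by rewrite hda|by constructor 1|by constructor 3].
  have na' : nb (v :: rcons a' z') by move: nQ; rewrite Qe -cat_cons => /nb_catl.
  have hda' := hit_head _ _ _ _ Qe.
  case: (theta_walks e0s pa na pa' na') => [|||cc|u].
  - by case: (a).
  - by case: (a').
  - by rewrite hda hda'.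
  - by constructor 1.
  - by constructor 2; exists a, a', z, z'; split=> //; exact: sorted_two_walks.
case: (path_first_hit vV pQ) => [[pQ0 _]|[a' [z' [c' [Qe zV' pa']]]]]; last first.
  have na' : nb (v :: rcons a' z') by move: nQ; rewrite Qe -cat_cons => /nb_catl.
  have hda' := hit_head _ _ _ _ Qe.
  case: (foot a' z' P) => //; [by rewrite hda' eq_sym|by constructor 1|by constructor 3].
have [/existsP[u /andP[uV /connectP[p0 pp0 ul]]]|ncon] := boolP [exists u in V, connect e v u].
  case/shortenP: pp0 ul => p pp up _ ul.
  case: (path_first_hit vV pp) => [[_ hV]|[a [z [c [pe zV pa]]]]].
    case: p up ul hV {pp} => [|x p] up ul hV; first by move: uV; rewrite ul /= (negbTE vV).
    by have := hV _ (mem_last x p); move: uV; rewrite ul /= => ->.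
  have na : nb (v :: rcons a z).
    by apply: nb_uniq; move: up; rewrite pe -cat_cons cat_uniq => /andP[].
  have [hh|hh] := eqVneq (head v (rcons a z)) (head v P); last first.
    case: (foot a z P) => //; [by constructor 1|by constructor 3].
  case: (foot a z Q) => //; [by rewrite hh|by constructor 1|by constructor 3].
have nV x : connect e v x -> x \notin V.
  by move=> vx; apply: contra ncon => xV; apply/existsP; exists x; rewrite xV.
have vb : connect e v b by rewrite (sym_connect_sym es).
have r0 : 0 < r by apply: leq_trans h0 _; exact: geq_minr.
have [P' [Q' [sP' sQ' pP' pQ' [nP' nQ' PQ']]]] := peel_two_walks r0 br.
have inG0 W : path e b W -> path e0 b W.
  move=> hW; case: (path_first_hit (nV _ vb) hW) => [[]//|[a [z [c [We zV pa]]]]].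
  have : connect e v z.
    apply: connect_trans vb _; apply/connectP; exists (rcons a z); rewrite ?last_rcons //.
    by move: hW; rewrite We cat_path => /andP[].
  by move/nV; rewrite zV.
have P0' : P' != [::] by rewrite -size_eq0 sP' -lt0n.
have Q0' : Q' != [::] by rewrite -size_eq0 sQ' -lt0n.
case: (theta_walks e0s (inG0 _ pP') nP' (inG0 _ pQ') nQ' P0' Q0' PQ') => [cb|u].
  constructor 1; case/connectP: bv => p pp ->.
  by apply: cyc_path cb => //; exact: inG0.
constructor 4; exists (rev P' ++ b :: Q'); split=> //; last by apply: sorted_two_walks => //; exact: inG0.
by rewrite size_cat size_rev /= sP' sQ' addnS addnn.
Qed.

Lemma planted_survive (H : graph n) m (i : 'I_K) : planted K n s \subset H -> m <= i -> i + m < K ->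
  s i \in peelset H m.
Proof.
move=> pH; elim: m i => [|m IH] i mi im; first by rewrite inE.
have iK := ltn_ord i.
have h1 : i.-1 < K by lia.
have h2 : i.+1 < K by lia.
have adj (j k : 'I_K) : k = j.+1 :> nat -> gadj H (s j) (s k).
  move=> jk; rewrite /gadj (inj_eq si); apply/andP; split.
    by apply/eqP => E; move: jk; rewrite E; clear; lia.
  apply: (fintype.subsetP pH); apply/imsetP; exists [set j; k].
    by rewrite inE; apply/existsP; exists j; apply/existsP; exists k; rewrite /= -jk !eqxx.
  by rewrite finset.imsetU1 finset.imset_set1.
rewrite /peelset iterS inE; apply/andP; split; first by apply: IH; lia.
apply/existsP; exists (s (Ordinal h1)); apply/andP; split; first by apply: IH => /=; lia.
apply/existsP; exists (s (Ordinal h2)); apply/andP; split; first by apply: IH => /=; lia.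
apply/and3P; split.
- by rewrite (inj_eq si); apply/eqP => /(congr1 val) /=; lia.
- by rewrite gadj_sym; apply: adj => /=; lia.
- exact: adj.
Qed.

Lemma planted_connect (H : graph n) (i j : 'I_K) : planted K n s \subset H -> connect (gadj H) (s i) (s j).
Proof.
move=> pH; wlog ij : i j / i <= j.
  move=> W; case: (leqP i j) => [|/ltnW] ij; first exact: W.
  by rewrite (sym_connect_sym (gadj_symm H)); apply: W.
elim: {j}(val j) {-2}j (erefl (val j)) ij => [|m IH] j jm ij.
  by have -> : i = j by apply: val_inj; rewrite /= jm; move: ij; rewrite -[nat_of_ord j]/(val j) jm; lia.
have [E|ne] := eqVneq i j; first by rewrite E.
have mK : m < K by have := ltn_ord j; rewrite -[nat_of_ord j]/(val j) jm; lia.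
have im : i <= m.
  have : val i != val j by rewrite val_eqE.
  by move: ij; rewrite -[nat_of_ord j]/(val j) jm /=; lia.
apply: connect_trans (IH (Ordinal mK) erefl im) _; apply: connect1.
rewrite /gadj (inj_eq si); apply/andP; split.
  by apply/eqP => /(congr1 val) /=; rewrite -[nat_of_ord j]/(val j) jm; lia.
apply: (fintype.subsetP pH); apply/imsetP; exists [set Ordinal mK; j].
  by rewrite inE; apply/existsP; exists (Ordinal mK); apply/existsP; exists j; rewrite /= -[nat_of_ord j]/(val j) jm !eqxx.
by rewrite finset.imsetU1 finset.imset_set1.
Qed.

Lemma score_inside (i : 'I_K) : h <= i -> i + h < K -> s i \in path_score G K.
Proof.
move=> h1 h2; have pG : planted K n s \subset G by rewrite finset.subsetUr.
rewrite inE planted_survive //=; apply/existsP.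
have rK : r < K by rewrite /r; have := ltn_ord i; lia.
exists (s (Ordinal rK)); rewrite planted_connect // andbT; apply: planted_survive => //=.
by rewrite /r; have := ltn_ord i; lia.
Qed.

(** Only positions within [h] of an end of the path can be lost; [F] numbers those at the left end
    from [0] and those at the right end from [h]. *)
Lemma card_hidden_missed : #|V :\: path_score G K| <= h.*2.
Proof.
pose B := [set i : 'I_K | (i < h) || (K <= i + h)].
apply: (@leq_trans #|s @: B|).
  apply: subset_leq_card; apply/fintype.subsetP => x; rewrite inE => /andP[xS /imsetP[i _ xi]].
  rewrite xi; apply: imset_f; rewrite inE; apply: contraR xS.
  by rewrite negb_or -leqNgt -ltnNge => /andP[a b]; rewrite xi; exact: score_inside.
rewrite card_imset //.
pose f (i : 'I_K) : 'I_(h.*2).+1 := inord (if i < h then i : nat else h + (K.-1 - i)).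
pose F (i : 'I_K) := if i < h then i : nat else h + (K.-1 - i).
have F1 i : i \in B -> F i < h.*2.
  by rewrite inE /F; have := ltn_ord i; case: ifP => // a b /= c; lia.
have F2 : {in B &, injective F}.
  move=> i j; rewrite !inE /F => hi hj E; apply: val_inj; move: E hi hj; rewrite /=.
  have := ltn_ord i; have := ltn_ord j; do 2 case: ifP => //; lia.
case: (posnP h.*2) => [h20|h2].
  rewrite h20 leqn0 cards_eq0; apply/eqP/finset.setP => i; rewrite [RHS]inE; apply/negbTE/negP => /F1.
  by rewrite h20.
rewrite -[h.*2]card_ord -(prednK h2).
apply: (@leq_card_in _ _ (fun i => inord (F i) : 'I_(h.*2).-1.+1)) => i j iB jB E; apply: F2 => //.
move/(congr1 val): E; rewrite /= !inordK //; rewrite prednK //; exact: F1.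
Qed.

End Score.

Local Open Scope ring_scope.

(** * Expectations over the Erdős–Rényi graph *)

Section ER.
Context {R : realType}.
Variables (p : R) (n : nat).
Notation P := (@ER_prob R p n).

Definition Ex (phi : graph n -> R) : R := \sum_(G : graph n) P G * phi G.

Lemma ex_ext phi psi : (forall G, phi G = psi G) -> Ex phi = Ex psi.
Proof. by move=> h; apply: eq_bigr => G _; rewrite h. Qed.

Lemma exD phi psi : Ex (fun G => phi G + psi G) = Ex phi + Ex psi.
Proof. by rewrite /Ex -big_split; apply: eq_bigr => G _; rewrite mulrDr. Qed.

Lemma exZ c phi : Ex (fun G => c * phi G) = c * Ex phi.
Proof. by rewrite /Ex mulr_sumr; apply: eq_bigr => G _; rewrite mulrCA. Qed.

Lemma ex_sum (I : Type) (r : seq I) (Q : pred I) phi :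
  Ex (fun G => \sum_(i <- r | Q i) phi i G) = \sum_(i <- r | Q i) Ex (phi i).
Proof.
rewrite /Ex exchange_big; apply: eq_bigr => G _; by rewrite mulr_sumr.
Qed.

(** Grouped by the number of edges, the sum is the binomial expansion of
    [(p + (1 - p)) ^+ #|pairs n|]. *)
Lemma ER_sum1 : \sum_(G : graph n) P G = 1.
Proof.
rewrite (bigID (fun G : graph n => G \subset pairs n)) /= [X in _ + X]big1 ?addr0; last first.
  by move=> G; rewrite /ER_prob => /negbTE ->.
set M := #|pairs n|.
pose f (G : graph n) : 'I_M.+1 := inord #|G|.
rewrite (partition_big f xpredT) //=.
have -> : 1 = (p + (1 - p)) ^+ M by rewrite addrC subrK expr1n.
rewrite addrC exprDn; apply: eq_bigr => i _.
rewrite (eq_bigr (fun _ => (1 - p) ^+ (M - i) * p ^+ i)); last first.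
  move=> G /andP[sG /eqP fG]; rewrite /ER_prob sG mulrC.
  suff -> : #|G| = i by [].
  by rewrite -fG inordK // ltnS subset_leq_card.
rewrite sumr_const; congr (_ *+ _).
transitivity #|[set A : {set {set 'I_n}} | A \subset pairs n & #|A| == i]|; last by rewrite cards_draws.
apply: eq_card => G; rewrite [RHS]inE /in_mem /=.
case sG : (G \subset pairs n) => //=.
have hG : (#|G| < M.+1)%N by rewrite ltnS subset_leq_card.
by apply/eqP/eqP => [<-|e]; [rewrite inordK|apply: val_inj; rewrite /= inordK].
Qed.

Lemma ex_cst c : Ex (fun _ => c) = c.
Proof. by rewrite /Ex -mulr_suml ER_sum1 mul1r. Qed.

Lemma sum_edge (e : {set 'I_n}) (F : graph n -> R) :
  \sum_(G : graph n) F G = \sum_(G : graph n | e \notin G) (F G + F (e |: G)).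
Proof.
rewrite (bigID (fun G : graph n => e \notin G)) big_split /=; congr (_ + _).
rewrite (reindex_onto (fun G => e |: G) (fun G => G :\ e)) /=; last first.
  by move=> G; rewrite negbK => eG; rewrite finset.setD1K.
apply: eq_bigl => G; rewrite negbK finset.setU11 /=.
apply/eqP/idP => [<-|eG]; first by rewrite finset.setD11.
by rewrite finset.setU1K.
Qed.

(** Independence in the form used throughout: given all other edges, [e] is present with probability
    [p]. *)
Lemma ER_edge e (G : graph n) : e \in pairs n -> e \notin G ->
  P G = (1 - p) * (P G + P (e |: G)) /\ P (e |: G) = p * (P G + P (e |: G)).
Proof.
move=> ep eG.
suff h : (1 - p) * P (e |: G) = p * P G by split; rewrite mulrDr; [rewrite h|rewrite -h]; ring.
rewrite /ER_prob finset.subUset finset.sub1set ep /=; case: ifP => sG; last by rewrite !mulr0.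
have lt : (#|G| < #|pairs n|)%N.
  by apply: proper_card; apply/properP; split=> //; exists e.
rewrite finset.cardsU1 eG add1n exprS -(subnSK lt) exprS.
by set a := p ^+ _; set b := (1 - p) ^+ _; ring.
Qed.

Lemma ex_split e phi : e \in pairs n -> Ex phi =
  \sum_(G : graph n | e \notin G) (P G + P (e |: G)) * ((1 - p) * phi G + p * phi (e |: G)).
Proof.
move=> ep; rewrite /Ex (sum_edge e); apply: eq_bigr => G eG.
have [h1 h2] := ER_edge ep eG; rewrite [in LHS]h1 [P (e |: G) * _](congr1 (fun x => x * _) h2); ring.
Qed.

Lemma ex_cond1 e phi : e \in pairs n ->
  Ex (fun G => (e \in G)%:R * phi G) = p * Ex (fun G => phi (e |: G)).
Proof.
move=> ep; rewrite !(ex_split _ ep) mulr_sumr; apply: eq_bigr => G eG.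
rewrite (negbTE eG) finset.setU11 finset.setUA finset.setUid /=; ring.
Qed.

(** Conditioning on [S \subset G] amounts to adding [S] to [G]; this turns planting into a
    reweighting of the null law. *)
Lemma ex_cond (S : graph n) phi : S \subset pairs n ->
  Ex (fun G => (S \subset G)%:R * phi G) = p ^+ #|S| * Ex (fun G => phi (S :|: G)).
Proof.
move: {2}#|S| (erefl #|S|) => k; elim: k S phi => [|k IH] S phi cS sS.
  move/eqP: cS; rewrite cards_eq0 => /eqP ->; rewrite cards0 expr0 mul1r.
  by apply: ex_ext => G; rewrite finset.sub0set mul1r finset.set0U.
have [e eS] : exists e, e \in S by apply/finset.set0Pn; rewrite -card_gt0 cS.
have ep : e \in pairs n by apply: (fintype.subsetP sS).
have cS' : #|S :\ e| = k by move: cS; rewrite (finset.cardsD1 e) eS => -[].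
have sS' : S :\ e \subset pairs n by apply: fintype.subset_trans sS; exact: finset.subD1set.
rewrite (ex_ext (psi := fun G => (S :\ e \subset G)%:R * ((e \in G)%:R * phi G))); last first.
  move=> G; rewrite mulrA -natrM mulnb; congr (_%:R * _).
  by rewrite -{1}(finset.setD1K eS) finset.subUset finset.sub1set andbC.
rewrite IH // cS' cS exprSr -mulrA; congr (_ * _).
rewrite (ex_ext (psi := fun G => (e \in G)%:R * phi (S :\ e :|: G))); last first.
  by move=> G; rewrite !inE eqxx.
rewrite ex_cond1 //; congr (_ * _); apply: ex_ext => G; congr phi.
by rewrite finset.setUCA finset.setUA finset.setD1K.
Qed.

Lemma pr_sub (S : graph n) : S \subset pairs n -> Ex (fun G => (S \subset G)%:R) = p ^+ #|S|.
Proof.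
move=> sS; have := ex_cond (fun _ => 1) sS; rewrite ex_cst mulr1 => <-.
by apply: ex_ext => G; rewrite mulr1.
Qed.

Hypothesis (p01 : 0 <= p <= 1).

Lemma ER_ge0 G : 0 <= P G.
Proof.
rewrite /ER_prob; case: ifP => // _; case/andP: p01 => h1 h2.
by rewrite mulr_ge0 ?exprn_ge0 // subr_ge0.
Qed.

Lemma ex_le phi psi : (forall G, phi G <= psi G) -> Ex phi <= Ex psi.
Proof. by move=> h; apply: ler_sum => G _; rewrite ler_wpM2l ?ER_ge0. Qed.

Lemma ex_le_supp phi psi : (forall G : graph n, G \subset pairs n -> phi G <= psi G) -> Ex phi <= Ex psi.
Proof.
move=> h; apply: ler_sum => G _.
have [sG|sG] := boolP (G \subset pairs n); first by rewrite ler_wpM2l ?ER_ge0 ?h.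
by rewrite /ER_prob (negbTE sG) !mul0r.
Qed.

Lemma ex_ge0 phi : (forall G, 0 <= phi G) -> 0 <= Ex phi.
Proof. by move=> h; apply: sumr_ge0 => G _; rewrite mulr_ge0 ?ER_ge0. Qed.

Definition indep_of (e : {set 'I_n}) (phi : graph n -> R) :=
  forall G : graph n, e \notin G -> phi (e |: G) = phi G.

Definition Z (e : {set 'I_n}) (G : graph n) : R := (e \in G)%:R - p.

Lemma ex_Z0 e phi : e \in pairs n -> indep_of e phi -> Ex (fun G => Z e G * phi G) = 0.
Proof.
move=> ep ind; rewrite (ex_split _ ep) big1 // => G eG.
rewrite /Z (negbTE eG) finset.setU11 ind //=; ring.
Qed.

Lemma ex_Z2 e phi : e \in pairs n -> indep_of e phi ->
  Ex (fun G => Z e G ^+ 2 * phi G) = p * (1 - p) * Ex phi.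
Proof.
move=> ep ind; rewrite !(ex_split _ ep) mulr_sumr; apply: eq_bigr => G eG.
rewrite /Z (negbTE eG) finset.setU11 ind //=; ring.
Qed.

Lemma indep_Z e f : e != f -> indep_of e (Z f).
Proof. by move=> ef G _; rewrite /Z finset.in_setU1 eq_sym (negbTE ef). Qed.

Lemma indepM e phi psi : indep_of e phi -> indep_of e psi -> indep_of e (fun G => phi G * psi G).
Proof. by move=> h1 h2 G eG; rewrite h1 ?h2. Qed.

Lemma indep_cst e c : indep_of e (fun _ => c).
Proof. by []. Qed.

End ER.

(** * The planted model *)

Section Planted.
Context {R : realType}.
Variables (lam : R) (K n : nat).
Hypothesis Kn : (K <= n)%N.
Let p := edge_prob lam n.
Notation E0 := (@Ex R p n).
Notation inj := (injections K n).

Definition av (F : {ffun 'I_K -> 'I_n} -> R) : R := #|inj|%:R^-1 * \sum_(s in inj) F s.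

Lemma inj_gt0 : (0 < #|inj|)%N.
Proof. by rewrite card_inj_ffuns !card_ord ffact_gt0. Qed.

Lemma av_cst c : av (fun _ => c) = c.
Proof.
rewrite /av sumr_const -[c *+ _]mulr_natl mulKf //.
by rewrite pnatr_eq0 -lt0n inj_gt0.
Qed.

Lemma av_ext F F' : (forall s : {ffun 'I_K -> 'I_n}, injective s -> F s = F' s) -> av F = av F'.
Proof. by move=> h; congr (_ * _); apply: eq_bigr => s; rewrite inE => /injectiveP; exact: h. Qed.

Lemma av_le F F' : (forall s : {ffun 'I_K -> 'I_n}, injective s -> F s <= F' s) -> av F <= av F'.
Proof.
move=> h; apply: ler_wpM2l; first by rewrite invr_ge0.
by apply: ler_sum => s; rewrite inE => /injectiveP; exact: h.
Qed.

Lemma planted_pairs (s : {ffun 'I_K -> 'I_n}) : injective s -> planted K n s \subset pairs n.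
Proof.
move=> si; apply/fintype.subsetP => e /imsetP[f]; rewrite inE.
case/existsP=> i /existsP[j /andP[/eqP ij /eqP ->]] ->.
rewrite inE finset.imsetU1 finset.imset_set1 cards2 (inj_eq si).
have -> // : i != j by apply/eqP => e1; move: ij; rewrite e1; clear; lia.
Qed.

Lemma sum_joint1 (F : {ffun 'I_K -> 'I_n} -> graph n -> R) :
  \sum_(s : {ffun 'I_K -> 'I_n}) \sum_(G0 : graph n) joint1 lam K n s G0 * F s G0 =
  av (fun s => E0 (F s)).
Proof.
rewrite /av mulr_sumr [RHS]big_mkcond; apply: eq_bigr => s _.
rewrite /joint1; case: ifP => h; last by rewrite big1 // => G _; rewrite !mul0r.
by rewrite /Ex mulr_sumr; apply: eq_bigr => G _; rewrite mul1r mulrA.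
Qed.

Lemma sum_P1 (F : graph n -> R) :
  \sum_(G : graph n) P1 lam K n G * F G = av (fun s => E0 (fun G0 => F (G0 :|: planted K n s))).
Proof.
rewrite -sum_joint1 /P1.
rewrite (eq_bigr (fun G => \sum_(s : {ffun 'I_K -> 'I_n}) \sum_(G0 : graph n | G0 :|: planted K n s == G)
   joint1 lam K n s G0 * F (G0 :|: planted K n s))); last first.
  move=> G _; rewrite mulr_suml; apply: eq_bigr => s _.
  by rewrite mulr_suml; apply: eq_bigr => G0 /eqP ->.
rewrite exchange_big; apply: eq_bigr => s _ /=.
by rewrite [RHS](partition_big (fun G0 => G0 :|: planted K n s) xpredT).
Qed.

Lemma overlapE est : overlap lam K n est =
  av (fun s => E0 (fun G0 => #|est (G0 :|: planted K n s) :&: hidden K n s|%:R)).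
Proof.
rewrite /overlap -sum_joint1 exchange_big; apply: eq_bigr => s _.
rewrite exchange_big; apply: eq_bigr => G0 _.
rewrite -mulr_sumr; congr (_ * _); rewrite -sum1_card natr_sum [RHS]big_mkcond.
by apply: eq_bigr => i _; case: (i \in _).
Qed.

Lemma err1E (T : graph n -> bool) :
  err1 lam K n T = av (fun s => E0 (fun G0 => (~~ T (G0 :|: planted K n s))%:R)).
Proof.
rewrite -(sum_P1 (fun G => (~~ T G)%:R)) /err1 big_mkcond; apply: eq_bigr => G _.
by case: (T G); rewrite ?mulr0 ?mulr1.
Qed.

Lemma err0E (T : graph n -> bool) : err0 lam n T = E0 (fun G0 => (T G0)%:R).
Proof.
rewrite /err0 /Ex big_mkcond; apply: eq_bigr => G _.
by rewrite /P0; case: (T G); rewrite ?mulr0 ?mulr1.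
Qed.

Hypothesis (p01 : 0 < p <= 1).
Let p0 : 0 < p. Proof. by case/andP: p01. Qed.
Let p01' : 0 <= p <= 1. Proof. by case/andP: p01 => h ->; rewrite ltW. Qed.

Definition lr (G : graph n) : R :=
  av (fun s => (planted K n s \subset G)%:R * p ^- #|planted K n s|).

Lemma P1E G : P1 lam K n G = P0 lam n G * lr G.
Proof.
have -> : P1 lam K n G = \sum_(G' : graph n) P1 lam K n G' * (G' == G)%:R.
  by rewrite (bigD1 G) //= eqxx mulr1 big1 ?addr0 // => G' /negbTE ->; rewrite mulr0.
rewrite sum_P1 /lr /av mulrCA; congr (_ * _); rewrite mulr_sumr.
apply: eq_bigr => s; rewrite inE => /injectiveP si.
have := ex_cond p (fun G' => (G' == G)%:R) (planted_pairs si).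
rewrite (ex_ext _ (psi := fun G0 => (G0 :|: planted K n s == G)%:R) (phi := fun G0 => (planted K n s :|: G0 == G)%:R)); last first.
  by move=> G0; rewrite finset.setUC.
move=> h; apply: (mulfI (x := p ^+ #|planted K n s|)); first by rewrite expf_neq0 // gt_eqF.
rewrite -h /Ex (bigD1 G) //= eqxx mulr1 big1 ?addr0; last first.
  by move=> G' /negbTE ->; rewrite !mulr0.
rewrite [RHS]mulrCA; congr (_ * _).
by rewrite mulrCA divff ?mulr1 // expf_neq0 // gt_eqF.
Qed.

(** The union of the two planted graphs is present with probability [p ^+ #|A :|: B|], while the
    weights divide by [p ^+ (#|A| + #|B|)]; what remains is the number of common edges. *)
Lemma ex_lr2 : E0 (fun G => lr G ^+ 2) =
  av (fun s => av (fun s' => p ^- #|planted K n s :&: planted K n s'|)).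
Proof.
rewrite (ex_ext _ (psi := fun G => av (fun s => av (fun s' =>
  ((planted K n s :|: planted K n s') \subset G)%:R * (p ^- #|planted K n s| * p ^- #|planted K n s'|))))); last first.
  move=> G; rewrite expr2 {1}/lr /av -mulrA; congr (_ * _); rewrite mulr_suml.
  apply: eq_bigr => s _; rewrite {1}/lr /av mulrCA; congr (_ * _); rewrite mulr_sumr.
  by apply: eq_bigr => s' _; rewrite finset.subUset -mulnb natrM; ring.
rewrite /av exZ ex_sum; congr (_ * _); apply: eq_bigr => s; rewrite inE => /injectiveP si.
rewrite exZ ex_sum; congr (_ * _); apply: eq_bigr => s'; rewrite inE => /injectiveP si'.
rewrite (ex_ext _ (psi := fun G => (p ^- #|planted K n s| * p ^- #|planted K n s'|) *
  ((planted K n s :|: planted K n s') \subset G)%:R)); last by move=> G; rewrite mulrC.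
rewrite exZ pr_sub; last by rewrite finset.subUset !planted_pairs.
set A := planted K n s; set B := planted K n s'.
have e : (#|A| + #|B| = #|A :|: B| + #|A :&: B|)%N by rewrite cardsUI.
have pn0 k : p ^+ k != 0 by rewrite expf_neq0 // gt_eqF.
rewrite -exprVn -!exprVn -exprD e exprD !exprVn -mulrA mulrCA.
by rewrite mulVf // mulr1.
Qed.

(** Cauchy-Schwarz in the linear form [2 x <= eps + x ^ 2 / eps], which avoids square roots; [eps]
    is chosen by the caller. *)
Lemma TV_le (eps : R) : 0 < eps ->
  TV lam K n <= 4^-1 * (eps + eps^-1 * (E0 (fun G => lr G ^+ 2) - 1)).
Proof.
move=> e0; rewrite /TV.
have lr1 : E0 lr = 1.
  rewrite /Ex (eq_bigr (fun G => P1 lam K n G * 1)); last by move=> G _; rewrite P1E mulr1.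
  rewrite (sum_P1 (fun _ => 1)); transitivity (av (fun _ => 1)); last exact: av_cst.
  by rewrite ex_cst.
have -> : \sum_(G : graph n) `|P0 lam n G - P1 lam K n G| = E0 (fun G => `|1 - lr G|).
  apply: eq_bigr => G _; rewrite P1E -[X in X - _]mulr1 -mulrBr normrM ger0_norm //.
  exact: ER_ge0.
have -> : E0 (fun G => lr G ^+ 2) - 1 = E0 (fun G => (1 - lr G) ^+ 2).
  rewrite (ex_ext _ (phi := fun G => (1 - lr G) ^+ 2) (psi := fun G => lr G ^+ 2 + (1 + (-2) * lr G))); last by move=> G; ring.
  by rewrite !exD exZ ex_cst lr1; ring.
have h : E0 (fun G => `|1 - lr G|) <= E0 (fun G => 2^-1 * (eps + eps^-1 * (1 - lr G) ^+ 2)).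
  apply: ex_le => // G; rewrite -[(1 - lr G) ^+ 2]real_normK ?num_real //; set x := `|_|.
  rewrite ler_pdivlMl // -subr_ge0 (_ : _ - _ = eps^-1 * (eps - x) ^+ 2).
    by rewrite mulr_ge0 ?sqr_ge0 // invr_ge0 ltW.
  by field; rewrite gt_eqF.
apply: le_trans (ler_wpM2l _ h) _; first by rewrite invr_ge0.
rewrite exZ exD exZ ex_cst; lra.
Qed.

End Planted.

(** * Replica bound for the overlap *)

Section Replica.
Context {R : realType}.
Variables (lam : R) (K n : nat).
Hypothesis Kn : (K <= n)%N.
Let p := edge_prob lam n.
Hypothesis (p01 : 0 < p <= 1).
Let p0 : 0 < p. Proof. by case/andP: p01. Qed.
Let p01' : 0 <= p <= 1. Proof. by case/andP: p01 => h ->; rewrite ltW. Qed.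
Notation E0 := (@Ex R p n).
Notation ff := {ffun 'I_K -> 'I_n}.
Notation inj := (injections K n).
Variables (Bk In : {set 'I_K}).

(** [Bk] is the set of positions hidden from the estimator and [In] the set of positions whose
    recovery is counted. Both are everything for the global bound; for the local bound [Bk] is a
    window and [In] its centre. *)
Definition bedges : graph K := [set e in path_graph K | ~~ [disjoint e & Bk]].
Definition redges : graph K := [set e in path_graph K | [disjoint e & Bk]].
Definition bplant (s : ff) : graph n := [set (fun e : {set 'I_K} => s @: e) e | e in bedges].
Definition rplant (s : ff) : graph n := [set (fun e : {set 'I_K} => s @: e) e | e in redges].
(* Equivalent placements differ only in the hidden block [Bk]. *)
Definition sim (s s' : ff) : bool := [forall i, (i \notin Bk) ==> (s i == s' i)].
Definition cls (s : ff) : {set ff} := [set s' in inj | sim s s'].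
Definition meet (s s' : ff) : nat := \sum_(a in In) \sum_(b in In) (s a == s' b).

Lemma planted_split (s : ff) : planted K n s = bplant s :|: rplant s.
Proof.
rewrite /planted /bplant /rplant -finset.imsetU.
have -> : path_graph K = bedges :|: redges; last by [].
apply/finset.setP => e; rewrite finset.in_setU [e \in bedges]inE [e \in redges]inE.
by case: (e \in path_graph K) => //=; case: [disjoint _ & _].
Qed.

Lemma sim_rplant s s' : sim s s' -> rplant s = rplant s'.
Proof.
move=> /forallP h; apply: eq_in_imset => e; rewrite inE => /andP[_ de].
apply: eq_in_imset => i ie; apply/eqP; have := h i.
by rewrite (disjointFr de ie).
Qed.

Lemma sim_sym s s' : sim s s' = sim s' s.
Proof. by apply: eq_forallb => i; rewrite eq_sym. Qed.

Lemma sim_trans s1 s2 s3 : sim s1 s2 -> sim s2 s3 -> sim s1 s3.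
Proof.
move=> /forallP h1 /forallP h2; apply/forallP => i; apply/implyP => hi.
by have := h1 i; have := h2 i; rewrite hi /= => /eqP <- /eqP ->.
Qed.

Lemma sim_refl s : sim s s.
Proof. by apply/forallP => i; rewrite eqxx implybT. Qed.

Lemma cls_eq s s' : sim s s' -> cls s = cls s'.
Proof.
move=> h; apply/finset.setP => t; rewrite !inE; case: (injectiveb t) => //=.
by apply/idP/idP; apply: sim_trans; rewrite // sim_sym.
Qed.

Lemma card_bplant (s : ff) : injective s -> #|bplant s| = #|bedges|.
Proof. by move=> si; rewrite card_imset //; exact: imset_inj. Qed.

Lemma bplant_pairs (s : ff) : injective s -> bplant s \subset pairs n.
Proof.
by move=> si; have := planted_pairs si; rewrite planted_split finset.subUset => /andP[].
Qed.

Variable est : graph n -> {set 'I_n}.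
Hypothesis est_card : forall G, #|est G| = K.

Definition hits (s : ff) (G : graph n) : R := \sum_(a in In) (s a \in est G)%:R.

(** Each placement occurs in the inner sums of the [#|cls s|] members of its class, which the
    inverse weight compensates. *)
Lemma sum_class (F : ff -> R) :
  \sum_(s in inj) F s = \sum_(s in inj) #|cls s|%:R^-1 * \sum_(s' in cls s) F s'.
Proof.
rewrite [RHS](eq_bigr (fun s => \sum_(s' in inj | sim s s') #|cls s'|%:R^-1 * F s')); last first.
  move=> s _; rewrite mulr_sumr; apply: eq_big => [s'|s'].
    by rewrite inE.
  by rewrite inE => /andP[_ h]; rewrite (cls_eq h).
rewrite [RHS](exchange_big_dep (mem inj)) /=; last by move=> i j _ /andP[].
apply: eq_bigr => s hs; rewrite -mulr_suml.
suff -> : \sum_(i in inj | (s \in inj) && sim i s) #|cls s|%:R^-1 = 1 :> R by rewrite mul1r.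
rewrite sumr_const -[_ *+ _]mulr_natl.
have -> : #|[pred i in inj | (s \in inj) && sim i s]| = #|cls s|.
  by apply: eq_card => i; rewrite [in RHS]inE [in LHS]inE /= hs sim_sym.
rewrite mulfV // pnatr_eq0 -lt0n card_gt0; apply/finset.set0Pn; exists s.
by rewrite inE hs sim_refl.
Qed.

(** Within a class the visible part [r] is fixed, so after the change of measure the set
    [est (G :|: r)] no longer depends on the placement. The hits become a sum over its [K] vertices
    of [Nv G i], the reweighted number of placements that put a counted position at [i]; the square
    of [Nv] expands into pairs of placements, that is, into the replica sum. *)
Lemma replica_class (s : ff) (eps D : R) : injective s -> 0 < eps ->
  (forall s1, s1 \in cls s -> \sum_(s2 in cls s) p ^- #|bplant s1 :&: bplant s2| * (meet s1 s2)%:R <= #|cls s|%:R * D) ->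
  \sum_(s' in cls s) E0 (fun G => hits s' (G :|: planted K n s')) <=
    #|cls s|%:R * (2^-1 * (eps * K%:R + eps^-1 * D)).
Proof.
move=> si e0 hD.
set c : R := #|cls s|%:R; have c0 : 0 < c.
  rewrite ltr0n card_gt0; apply/finset.set0Pn; exists s.
  by rewrite !inE sim_refl andbT; apply/injectiveP.
have injc s' : s' \in cls s -> injective s' by rewrite !inE => /andP[/injectiveP].
set b := #|bedges|; set r := rplant s.
have pb0 : p ^+ b != 0 by rewrite expf_neq0 // gt_eqF.
pose Nv (G : graph n) i : R := \sum_(s' in cls s) p ^- b * ((bplant s' \subset G)%:R * \sum_(a in In) (s' a == i)%:R).
have step1 s' : s' \in cls s -> E0 (fun G => hits s' (G :|: planted K n s')) =
    E0 (fun G => p ^- b * ((bplant s' \subset G)%:R * hits s' (G :|: r))).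
  move=> hs'; have si' := injc _ hs'.
  rewrite exZ ex_cond ?bplant_pairs // card_bplant // mulKf //.
  apply: ex_ext => G; rewrite planted_split; congr (hits _ _).
  have -> : rplant s' = r by apply/esym/sim_rplant; move: hs'; rewrite inE => /andP[].
  by rewrite finset.setUCA finset.setUA.
rewrite (eq_bigr _ step1) -ex_sum.
have step2 (G : graph n) : \sum_(s' in cls s) p ^- b * ((bplant s' \subset G)%:R * hits s' (G :|: r)) =
    \sum_(i in est (G :|: r)) Nv G i.
  rewrite /Nv exchange_big; apply: eq_bigr => s' _; rewrite -mulr_sumr; congr (_ * _).
  rewrite -mulr_sumr; congr (_ * _); rewrite /hits exchange_big; apply: eq_bigr => a _.
  have [h|h] := boolP (s' a \in _).
    rewrite (bigD1 (s' a)) //= eqxx big1 ?addr0 // => i /andP[_ /negbTE].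
    by rewrite eq_sym => ->.
  rewrite big1 // => i hi; case: eqP => // e; by rewrite e hi in h.
rewrite (ex_ext _ step2).
(* AM-GM in place of Cauchy-Schwarz. *)
have step3 (G : graph n) : \sum_(i in est (G :|: r)) Nv G i <= 2^-1 * (eps * c * K%:R + (eps * c)^-1 * \sum_i Nv G i ^+ 2).
  have ec : 0 < eps * c by rewrite mulr_gt0.
  apply: (@le_trans _ _ (\sum_(i in est (G :|: r)) 2^-1 * (eps * c + (eps * c)^-1 * Nv G i ^+ 2))).
    apply: ler_sum => i _; set x := Nv G i.
    rewrite ler_pdivlMl // -subr_ge0 (_ : _ - _ = (eps * c)^-1 * (eps * c - x) ^+ 2).
      by rewrite mulr_ge0 ?sqr_ge0 // invr_ge0 ltW.
    by field; rewrite !gt_eqF.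
  rewrite -mulr_sumr ler_wpM2l ?invr_ge0 // big_split /= sumr_const est_card -[_ *+ K]mulr_natr.
  rewrite lerD2l -mulr_sumr ler_wpM2l ?invr_ge0 ?(ltW ec) //.
  by rewrite [leRHS](bigID (mem (est (G :|: r)))) /= lerDl sumr_ge0 // => i _; rewrite sqr_ge0.
apply: le_trans (ex_le p01' step3) _.
rewrite exZ exD ex_cst exZ mulrCA ler_wpM2l ?invr_ge0 //.
have EN : E0 (fun G => \sum_i Nv G i ^+ 2) =
   \sum_(s1 in cls s) \sum_(s2 in cls s) p ^- #|bplant s1 :&: bplant s2| * (meet s1 s2)%:R.
  have sq (G : graph n) : \sum_i Nv G i ^+ 2 = \sum_(s1 in cls s) \sum_(s2 in cls s)
      (p ^- b * p ^- b * (meet s1 s2)%:R) * (bplant s1 :|: bplant s2 \subset G)%:R.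
    rewrite (eq_bigr (fun i => \sum_(s1 in cls s) \sum_(s2 in cls s)
      (p ^- b * p ^- b * (bplant s1 :|: bplant s2 \subset G)%:R) *
       (\sum_(a in In) \sum_(a' in In) ((s1 a == i) && (s2 a' == i))%:R))); last first.
      move=> i _; rewrite expr2 {1}/Nv mulr_suml; apply: eq_bigr => s1 _.
      rewrite /Nv mulr_sumr; apply: eq_bigr => s2 _.
      rewrite finset.subUset -mulnb natrM.
      have -> : \sum_(a in In) \sum_(a' in In) ((s1 a == i) && (s2 a' == i))%:R =
        (\sum_(a in In) (s1 a == i)%:R) * (\sum_(a in In) (s2 a == i)%:R) :> R.
        rewrite mulr_suml; apply: eq_bigr => a _; rewrite mulr_sumr; apply: eq_bigr => a' _.
        by rewrite -mulnb natrM.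
      ring.
    rewrite exchange_big; apply: eq_bigr => s1 _; rewrite exchange_big; apply: eq_bigr => s2 _ /=.
    rewrite -mulr_sumr mulrAC; congr (_ * _ * _); rewrite /meet natr_sum exchange_big.
    apply: eq_bigr => a _; rewrite natr_sum exchange_big; apply: eq_bigr => a' _ /=.
    have [e|e] := eqVneq (s1 a) (s2 a').
      rewrite (bigD1 (s1 a)) //= -e eqxx big1 ?addr0 // => i /negbTE.
      by rewrite eq_sym => ->.
    rewrite big1 // => i _; case: eqP => //= e1; case: eqP => // e2.
    by rewrite e1 e2 eqxx in e.
  rewrite (ex_ext _ sq) ex_sum; apply: eq_bigr => s1 h1; rewrite ex_sum; apply: eq_bigr => s2 h2.
  rewrite exZ pr_sub; last by rewrite finset.subUset !bplant_pairs //; exact: injc.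
  have e : (b + b = #|bplant s1 :|: bplant s2| + #|bplant s1 :&: bplant s2|)%N.
    by rewrite cardsUI !card_bplant //; exact: injc.
  rewrite -exprVn -!exprVn -exprD e exprD !exprVn [_ * (meet _ _)%:R]mulrC.
  set u := p ^+ #|_ :|: _|; have u0 : u != 0 by rewrite expf_neq0 // gt_eqF.
  by rewrite mulrAC mulrA mulfK // mulrC.
rewrite EN.
have hS : \sum_(s1 in cls s) \sum_(s2 in cls s) p ^- #|bplant s1 :&: bplant s2| * (meet s1 s2)%:R <= c * (c * D).
  apply: le_trans (ler_sum _ (fun s1 h => hD s1 h)) _.
  by rewrite sumr_const -[_ *+ _]mulr_natl.
have := ler_wpM2l (ltW (_ : 0 < (eps * c)^-1)) hS; rewrite invr_gt0 mulr_gt0 // => /(_ isT) h.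
rewrite mulrDr -[leRHS]/(_ + _); apply: lerD; first by rewrite mulrCA mulrA.
apply: le_trans h _; rewrite le_eqVlt; apply/orP; left; apply/eqP.
by field; rewrite !gt_eqF.
Qed.

Lemma replica_overlap (eps D : R) : 0 < eps ->
  (forall s : ff, injective s -> forall s1, s1 \in cls s ->
     \sum_(s2 in cls s) p ^- #|bplant s1 :&: bplant s2| * (meet s1 s2)%:R <= #|cls s|%:R * D) ->
  av (fun s => E0 (fun G => hits s (G :|: planted K n s))) <=
    2^-1 * (eps * K%:R + eps^-1 * D).
Proof.
move=> e0 hD; rewrite /av sum_class.
rewrite ler_pdivrMl ?ltr0n ?inj_gt0 // mulr_natl -sumr_const.
apply: ler_sum => s; rewrite inE => /injectiveP si.
rewrite ler_pdivrMl; last first.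
  rewrite ltr0n card_gt0; apply/finset.set0Pn; exists s.
  by rewrite !inE sim_refl andbT; apply/injectiveP.
by apply: replica_class => //; exact: hD.
Qed.

End Replica.

(** * Weighted non-backtracking chains *)

Lemma sum_unique_le1 (R : realType) (I : finType) (Q P : pred I) :
  (forall x y, P x -> P y -> x = y) -> \sum_(i | Q i) (P i)%:R <= 1 :> R.
Proof.
move=> h; case: (pickP (fun i => Q i && P i)) => [x /andP[Qx Px]|h0].
  rewrite (bigD1 x) //= Px big1 ?addr0 // => i /andP[_ ix].
  by case Pi : (P i) => //; rewrite (h _ _ Pi Px) eqxx in ix.
by rewrite big1 // => i Qi; have := h0 i; rewrite Qi /= => ->.
Qed.

Section Chain.
Context {R : realType}.
Variables (K n : nat) (s : {ffun 'I_K -> 'I_n}) (p : R) (D : {set 'I_n}) (T : 'I_n -> 'I_n -> R).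
Hypotheses (si : injective s) (p01 : 0 < p <= 1).
Let p0 : 0 < p. Proof. by case/andP: p01. Qed.
Definition wt (u v : 'I_n) : R := if [set u; v] \in planted K n s then p^-1 else 1.

(** Weight of a walk in [D] that never steps straight back. Injective placements are such walks, and
    unlike them the walks can be summed one step at a time. [T] weighs the last two vertices, which
    allows tying the walk to a prescribed endpoint. *)
Fixpoint chain (prev cur : 'I_n) (ys : seq 'I_n) : R :=
  if ys is y :: ys' then ((y \in D) && (y != prev))%:R * (wt cur y * chain cur y ys') else T prev cur.

Definition chains k prev cur : R := \sum_(ys : k.-tuple 'I_n) chain prev cur ys.

Lemma wt_gt0 u v : 0 < wt u v.
Proof. by rewrite /wt; case: ifP; rewrite ?invr_gt0. Qed.

Lemma wt_sym u v : wt u v = wt v u.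
Proof. by rewrite /wt finset.setUC. Qed.

Lemma planted_edgeP u v : [set u; v] \in planted K n s ->
  exists i j : 'I_K, val j = (val i).+1 /\ ((u = s i /\ v = s j) \/ (u = s j /\ v = s i)).
Proof.
case/imsetP => e; rewrite inE => /existsP[i /existsP[j /andP[/eqP ij /eqP ->]]].
rewrite finset.imsetU1 finset.imset_set1 => E; exists i, j; split=> //.
have hu : u \in [set s i; s j] by rewrite -E !inE eqxx.
have hv : v \in [set s i; s j] by rewrite -E !inE eqxx orbT.
have hi : s i \in [set u; v] by rewrite E !inE eqxx.
have hj : s j \in [set u; v] by rewrite E !inE eqxx orbT.
have ne : s i <> s j by move/si => e1; move: ij; rewrite e1; clear; lia.
move: hu hv hi hj; rewrite !inE => /orP[/eqP hu|/eqP hu] /orP[/eqP hv|/eqP hv] /orP h1 /orP h2.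
- by case: h2 => /eqP h2; case: ne; rewrite h2 ?hu ?hv.
- by left.
- by right.
- by case: h1 => /eqP h1; case: ne; rewrite h1 ?hu ?hv.
Qed.

Lemma wt_out u v : u \notin hidden K n s -> wt u v = 1.
Proof.
move=> hu; rewrite /wt; case: ifP => // /planted_edgeP[i [j [_ h]]].
by case/negP: hu; case: h => -[-> _]; apply: imset_f.
Qed.

Lemma wt_in (i : 'I_K) y : wt (s i) y = 1 \/
  (exists j : 'I_K, y = s j /\ ((val j = (val i).+1) \/ (val i = (val j).+1)) /\ wt (s i) y = p^-1).
Proof.
rewrite /wt; case: ifP => [/planted_edgeP[i' [j [e h]]]|]; last by left.
right; case: h => -[h1 h2]; move/si: h1 => h1; rewrite h1.
  by exists j; split; [|split; [left|]].
by exists i'; split; [|split; [right|]].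
Qed.

Lemma wt_le (i : 'I_K) (j : 'I_K) :
  wt (s i) (s j) <= 1 + p^-1 * ((val i).+1 == val j)%:R + p^-1 * (val i == (val j).+1)%:R.
Proof.
have i0 : 0 <= p^-1 by rewrite invr_ge0 ltW.
case: (wt_in i (s j)) => [->|[j' [/si <- [h ->]]]].
  by rewrite -addrA lerDl addr_ge0 // mulr_ge0.
case: h => ->; rewrite eqxx mulr1.
  by rewrite (addrC 1) -addrA lerDl addr_ge0 // mulr_ge0.
by rewrite lerDr addr_ge0 // mulr_ge0.
Qed.

Lemma chainsS k prev cur :
  chains k.+1 prev cur = \sum_(y in D | y != prev) wt cur y * chains k cur y.
Proof.
rewrite /chains (reindex (fun z : 'I_n * k.-tuple 'I_n => [tuple of z.1 :: z.2])) /=; last first.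
  exists (fun t : k.+1.-tuple 'I_n => (thead t, [tuple of behead t])).
    by case=> y t _; congr (_, _); apply: val_inj.
  by move=> t _; rewrite -tuple_eta.
rewrite -(pair_big xpredT xpredT (fun y (t : k.-tuple 'I_n) => ((y \in D) && (y != prev))%:R * (wt cur y * chain cur y t))) /=.
rewrite [RHS]big_mkcond; apply: eq_bigr => y _; case: ifP => h.
  by rewrite mulr_sumr; apply: eq_bigr => t _; rewrite mul1r.
by rewrite big1 // => t _; rewrite mul0r.
Qed.

Lemma chains0 prev cur : chains 0 prev cur = T prev cur.
Proof.
rewrite /chains (big_pred1 [tuple]) // => t; apply/esym/eqP; exact: tuple0.
Qed.

Hypothesis T0 : forall u v, 0 <= T u v.

Lemma chain_ge0 prev cur ys : 0 <= chain prev cur ys.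
Proof.
by elim: ys prev cur => [|y ys IH] prev cur //=; rewrite !mulr_ge0 // ltW // wt_gt0.
Qed.

Let f : R := #|D|%:R.
Hypothesis f0 : 0 < f.
Variables (alpha : nat -> R) (B Cp Cm : nat -> nat -> R).
Hypotheses (al0 : forall k, 0 <= alpha k) (B0 : forall k i, 0 <= B k i)
  (Cp0 : forall k i, 0 <= Cp k i) (Cm0 : forall k i, 0 <= Cm k i).

(* [alpha] bounds the chains that leave from a vertex off the path, [B] those from
   a path vertex, [Cp] and [Cm] those that just moved one step up or down the path
   and hence, not backtracking, can follow it in one direction only. *)
Definition bounded_by k :=
  [/\ forall u v, v \notin hidden K n s -> chains k u v <= f ^+ k * alpha k,
      forall u (i : 'I_K), chains k u (s i) <= f ^+ k * B k i,
      forall i j : 'I_K, val j = (val i).+1 -> chains k (s i) (s j) <= f ^+ k * Cp k j &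
      forall i j : 'I_K, val i = (val j).+1 -> chains k (s i) (s j) <= f ^+ k * Cm k j].

Lemma sum_hidden (F : 'I_K -> R) (P : pred 'I_n) :
  \sum_(y in D | P y) \sum_(j : 'I_K) (y == s j)%:R * F j = \sum_(j | (s j \in D) && P (s j)) F j.
Proof.
rewrite exchange_big [RHS]big_mkcond /=; apply: eq_bigr => j _.
have [h|h] := boolP ((s j \in D) && P (s j)).
  rewrite (bigD1 (s j)) //= eqxx mul1r big1 ?addr0 // => y /andP[_ /negbTE ->]; by rewrite mul0r.
rewrite big1 // => y hy; case: eqP => [e|]; last by rewrite mul0r.
by rewrite -e hy in h.
Qed.

(** A step from a vertex off the path has weight [1] and may land on any path vertex in [D]. A step
    from a path vertex has weight [p^-1] only towards its two neighbours on the path, and when the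
    last move went along the path one of these is excluded as a return. The value [Cm k i.-1] at
    [i = 0] is a harmless default, as no neighbour lies below. *)
Lemma bounded_step k : bounded_by k ->
  f * alpha k + \sum_(j : 'I_K | s j \in D) B k j <= f * alpha k.+1 ->
  (forall i, f * alpha k.+1 + p^-1 * Cp k i.+1 + p^-1 * Cm k i.-1 <= f * B k.+1 i) ->
  (forall i, f * alpha k.+1 + p^-1 * Cp k i.+1 <= f * Cp k.+1 i) ->
  (forall i, f * alpha k.+1 + p^-1 * Cm k i.-1 <= f * Cm k.+1 i) ->
  bounded_by k.+1.
Proof.
move=> [hA hB hP hM] rA rB rP rM.
have fk : 0 <= f ^+ k by rewrite exprn_ge0 // ltW.
have i0 : 0 <= p^-1 by rewrite invr_ge0 ltW.
have plain cur y : chains k cur y <= f ^+ k * (alpha k + \sum_(j : 'I_K) (y == s j)%:R * B k j).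
  have [/imsetP[j _ ->]|hy] := boolP (y \in hidden K n s).
    apply: le_trans (hB _ _) _; rewrite ler_wpM2l // (bigD1 j) //= eqxx mul1r addrCA lerDl.
    by rewrite addr_ge0 // sumr_ge0 // => l _; rewrite mulr_ge0.
  apply: le_trans (hA _ _ hy) _; rewrite ler_wpM2l // lerDl sumr_ge0 // => l _.
  by rewrite mulr_ge0.
have sumB (Q : pred 'I_n) : \sum_(y in D | Q y) f ^+ k * (alpha k + \sum_(j : 'I_K) (y == s j)%:R * B k j)
    <= f ^+ k * (f * alpha k.+1).
  rewrite -mulr_sumr ler_wpM2l //; apply: le_trans rA; rewrite big_split /= lerD //.
    rewrite sumr_const -[_ *+ _]mulr_natl ler_wpM2r // ler_nat.
    by apply: subset_leq_card; apply/fintype.subsetP => y /andP[].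
  rewrite sum_hidden [leRHS](bigID (fun j => Q (s j))) /= lerDl sumr_ge0 //.
have near prev (i : 'I_K) : chains k.+1 prev (s i) <= f ^+ k * (f * alpha k.+1) +
   \sum_(y in D | y != prev) \sum_(j : 'I_K) (y == s j)%:R *
      (f ^+ k * p^-1 * ((val j == (val i).+1)%:R * Cp k j + (val i == (val j).+1)%:R * Cm k j)).
  rewrite chainsS; apply: le_trans (lerD (sumB (fun y => y != prev)) (lexx _)).
  rewrite -big_split /=; apply: ler_sum => y _.
  have S0 : 0 <= \sum_(j : 'I_K) (y == s j)%:R *
      (f ^+ k * p^-1 * ((val j == (val i).+1)%:R * Cp k j + (val i == (val j).+1)%:R * Cm k j)).
    apply: sumr_ge0 => j _; apply: mulr_ge0 => //; apply: mulr_ge0; first exact: mulr_ge0.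
    by rewrite addr_ge0 // mulr_ge0.
  case: (wt_in i y) => [->|[j [yj [hj ->]]]].
    by rewrite mul1r; apply: le_trans (plain _ _) _; rewrite lerDl.
  apply: (@le_trans _ _ (\sum_(j : 'I_K) (y == s j)%:R *
      (f ^+ k * p^-1 * ((val j == (val i).+1)%:R * Cp k j + (val i == (val j).+1)%:R * Cm k j)))); last first.
    rewrite lerDr mulr_ge0 // addr_ge0 // sumr_ge0 // => l _; by rewrite mulr_ge0.
  rewrite (bigD1 j) //= yj eqxx mul1r.
  apply: (@le_trans _ _ (f ^+ k * p^-1 * ((val j == (val i).+1)%:R * Cp k j + (val i == (val j).+1)%:R * Cm k j))).
    rewrite [f ^+ k * _]mulrC -mulrA ler_wpM2l //.
    case: hj => hj; rewrite hj eqxx mul1r.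
      apply: le_trans (hP _ _ hj) _; by rewrite ler_wpM2l // lerDl mulr_ge0.
    by apply: le_trans (hM _ _ hj) _; rewrite ler_wpM2l // lerDr mulr_ge0.
  rewrite lerDl sumr_ge0 // => l _; apply: mulr_ge0 => //; apply: mulr_ge0; first exact: mulr_ge0.
  by rewrite addr_ge0 // mulr_ge0.
have sP (i : 'I_K) (Q : pred 'I_K) : \sum_(j | Q j) f ^+ k * p^-1 * ((val j == (val i).+1)%:R * Cp k j)
     <= f ^+ k * (p^-1 * Cp k i.+1).
  rewrite -mulr_sumr -mulrA; apply: ler_wpM2l => //; apply: ler_wpM2l => //.
  rewrite (eq_bigr (fun j : 'I_K => (val j == (val i).+1)%:R * Cp k i.+1)); last first.
    by move=> j _; case: eqP => [->|]; rewrite ?mul0r.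
  rewrite -mulr_suml -[leRHS]mul1r; apply: ler_wpM2r => //.
  apply: sum_unique_le1 => x y.
  by move=> /eqP h1 /eqP h2; apply: val_inj; rewrite h1 h2.
have sM (i : 'I_K) (Q : pred 'I_K) : \sum_(j | Q j) f ^+ k * p^-1 * ((val i == (val j).+1)%:R * Cm k j)
     <= f ^+ k * (p^-1 * Cm k i.-1).
  rewrite -mulr_sumr -mulrA; apply: ler_wpM2l => //; apply: ler_wpM2l => //.
  rewrite (eq_bigr (fun j : 'I_K => (val i == (val j).+1)%:R * Cm k i.-1)); last first.
    by move=> j _; case: eqP => [->|]; rewrite ?mul0r.
  rewrite -mulr_suml -[leRHS]mul1r; apply: ler_wpM2r => //.
  apply: sum_unique_le1 => x y.
  by move=> /eqP h1 /eqP; rewrite h1 => -[] h2; exact: val_inj.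
split.
- move=> u v hv; rewrite chainsS exprSr -mulrA; apply: le_trans (sumB (fun y => y != u)).
  by apply: ler_sum => y _; rewrite wt_out // mul1r plain.
- move=> u i; apply: le_trans (near u i) _; rewrite sum_hidden exprSr -mulrA.
  apply: le_trans (ler_wpM2l fk (rB i)); rewrite -addrA mulrDr lerD2l.
  rewrite (eq_bigr (fun j : 'I_K => f ^+ k * p^-1 * ((val j == (val i).+1)%:R * Cp k j)
     + f ^+ k * p^-1 * ((val i == (val j).+1)%:R * Cm k j))); last by move=> j _; rewrite mulrDr.
  by rewrite big_split /= mulrDr; apply: lerD; [exact: sP|exact: sM].
- move=> i j ij; apply: le_trans (near (s i) j) _; rewrite sum_hidden exprSr -mulrA.
  apply: le_trans (ler_wpM2l fk (rP j)); rewrite mulrDr lerD2l.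
  rewrite (eq_bigr (fun l : 'I_K => f ^+ k * p^-1 * ((val l == (val j).+1)%:R * Cp k l))) //.
  move=> l /andP[_ /eqP h]; case: (eqVneq (val j) (val l).+1) => [e|_]; last by rewrite mul0r addr0.
  by case: h; congr (s _); apply: val_inj; move: e; rewrite ij => -[].
- move=> i j ij; apply: le_trans (near (s i) j) _; rewrite sum_hidden exprSr -mulrA.
  apply: le_trans (ler_wpM2l fk (rM j)); rewrite mulrDr lerD2l.
  rewrite (eq_bigr (fun l : 'I_K => f ^+ k * p^-1 * ((val j == (val l).+1)%:R * Cm k l))) //.
  move=> l /andP[_ /eqP h]; case: eqP => [e|_]; last by rewrite mul0r add0r.
  by case: h; congr (s _); apply: val_inj; rewrite e ij.
Qed.

End Chain.

(** * Edge intersections as products along the path *)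

Section PathProduct.
Context {R : realType}.
Variables (k n : nat) (p : R).
Hypothesis p01 : 0 < p <= 1.
Let p0 : 0 < p. Proof. by case/andP: p01. Qed.
Notation K := k.+1.
Variables (s1 s2 : {ffun 'I_K -> 'I_n}) (Bk : {set 'I_K}).

Definition at_pos (s : {ffun 'I_K -> 'I_n}) (i : nat) : 'I_n := s (inord i).

Lemma bplantT (s : {ffun 'I_K -> 'I_n}) : bplant finset.setT s = planted K n s.
Proof.
rewrite (planted_split finset.setT s).
suff -> : rplant finset.setT s = finset.set0 by rewrite finset.setU0.
apply/finset.setP => e; rewrite [in RHS]inE; apply/negbTE/negP => /imsetP[f].
rewrite inE => /andP[fp]; rewrite -setI_eq0 finset.setIT => /eqP f0 _.
move: fp; rewrite f0 inE => /existsP[i /existsP[j /andP[_ /eqP /finset.setP/(_ i)]]].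
by rewrite !inE eqxx.
Qed.

(** A common edge is a step of the second path that lies on the first and contributes [p^-1]. The
    right side may be larger, since it admits all edges of the first path and not only those meeting
    the block. *)
Lemma inter_le_prod : p ^- #|bplant Bk s1 :&: bplant Bk s2| <=
  \prod_(0 <= i < k | (inord i \in Bk) || (inord i.+1 \in Bk)) wt s1 p (at_pos s2 i) (at_pos s2 i.+1).
Proof.
pose P (i : nat) := ((inord i : 'I_K) \in Bk) || ((inord i.+1 : 'I_K) \in Bk).
pose e (i : 'I_k) := [set at_pos s2 i; at_pos s2 i.+1].
rewrite big_mkord (eq_bigr (fun i : 'I_k => p^-1 ^+ (e i \in planted K n s1))); last first.
  by move=> i _; rewrite /wt; case: ifP.
rewrite prodrXr -exprVn; apply: ler_weXn2l.
  by rewrite -invr1 lef_pV2 ?posrE //; case/andP: p01.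
rewrite -big_mkcondr sum1_card.
apply: (@leq_trans #|[set e i | i : 'I_k in [set i : 'I_k | P i & e i \in planted K n s1]]|); last first.
  apply: leq_trans (leq_imset_card _ _) _; apply: eq_leq; apply: eq_card => i.
  by rewrite [in LHS]inE.
apply: subset_leq_card; apply/fintype.subsetP => h; rewrite inE => /andP[h1 /imsetP[f]].
rewrite inE => /andP[]; rewrite inE => /existsP[i /existsP[j /andP[/eqP ij /eqP ef]]] hB hf.
have ik : (val i < k)%N by rewrite -ltnS -ij; exact: ltn_ord.
have ei : inord (val i) = i by apply: val_inj; rewrite /= inordK // ltnS ltnW.
have ej : inord (val i).+1 = j by apply: val_inj; rewrite /= inordK // -ij.
have hE : h = e (Ordinal ik).
  by rewrite hf ef /e /at_pos finset.imsetU1 finset.imset_set1 /= -[nat_of_ord i]/(val i) ei ej.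
apply/imsetP; exists (Ordinal ik) => //; rewrite inE -hE; apply/andP; split.
  rewrite /P /= -[nat_of_ord i]/(val i) ei ej; apply: contraR hB; rewrite negb_or => /andP[a b].
  by rewrite ef -setI_eq0 finset.setIUl finset.setU_eq0 !setI_eq0 !finset.disjoints1 a b.
by move: h1; rewrite (planted_split Bk) finset.in_setU => ->.
Qed.

Lemma chain_iota (D : {set 'I_n}) T (x : nat -> 'I_n) prev m t :
  (forall i, (m < i <= m + t)%N -> x i \in D) -> ((0 < t)%N -> prev != x m.+1) ->
  (forall i, (m <= i)%N -> (i.+2 <= m + t)%N -> x i != x i.+2) ->
  chain s1 p D T prev (x m) (map x (iota m.+1 t)) =
  (\prod_(m <= i < m + t) wt s1 p (x i) (x i.+1)) * T (if t is t'.+1 then x (m + t')%N else prev) (x (m + t)%N).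
Proof.
elim: t m prev => [|t IH] m prev hD hp hx /=.
  by rewrite addn0 big_geq // mul1r.
rewrite hD ?(eq_sym _ prev) ?hp //=; last by rewrite ltnSn /= addnS ltnS leq_addr.
rewrite IH; last first.
- by move=> i mi it; apply: hx; [exact: ltnW|move: it; rewrite addSnnS].
- by move=> t0; apply: hx => //; rewrite addnS ltnS; move: t0; clear; lia.
- by move=> i hi; apply: hD; move: hi; clear; lia.
rewrite mul1r -addSnnS mulrA; congr (_ * _).
  rewrite [RHS]big_ltn ?leq_addr //; clear; lia.
congr (T _ _); case: t {IH hD hp hx} => [|t]; first by rewrite addn0.
by rewrite addSnnS.
Qed.

End PathProduct.

(** * Second moment of the whole path *)

Lemma second_moment_arith1 (R : realType) (d e : R) : d <= e -> 0 <= e -> e <= 6^-1 ->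
  1 <= (1 - d) * (1 + 6 * e) * (1 - 2 * e).
Proof.
move=> de e0 e6; apply: (@le_trans _ _ ((1 - e) * (1 + 6 * e) * (1 - 2 * e))); last first.
  by rewrite ler_wpM2r ?ler_wpM2r //; lra.
have -> : (1 - e) * (1 + 6 * e) * (1 - 2 * e) = 1 + e * (3 - 16 * e + 12 * e ^+ 2) by ring.
rewrite lerDl mulr_ge0 //; have := sqr_ge0 e; lra.
Qed.

Lemma second_moment_arith2 (R : realType) (X Y c N d e : R) : 0 <= c -> d <= e -> e <= 6^-1 ->
  X <= c * (1 + 6 * e) -> N * (1 - 2 * d) <= Y -> c <= N -> X - Y <= c * (8 * e).
Proof.
move=> c0 de e6 h1 h2 h3.
have d2 : 0 <= 1 - 2 * d by lra.
have : c * (1 - 2 * d) <= Y by apply: le_trans h2; rewrite ler_wpM2r.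
have : c * d <= c * e by rewrite ler_wpM2l.
lra.
Qed.

Lemma bernoulli (R : realType) (x : R) m : 0 <= x <= 1 -> 1 - m%:R * x <= (1 - x) ^+ m.
Proof.
case/andP=> x0 x1; elim: m => [|m IH]; first by rewrite expr0; lra.
rewrite exprS; apply: (@le_trans _ _ ((1 - x) * (1 - m%:R * x))); last by rewrite ler_wpM2l // subr_ge0.
rewrite -natr1; have : 0 <= m%:R * (x * x) by rewrite !mulr_ge0.
by set y := m%:R; lra.
Qed.

(** Each of the [m] factors is at least [a - (m + c)], and Bernoulli's inequality bounds the power;
    [c] is the number of forbidden values. *)
Lemma ffact_ge (R : realType) (a c m : nat) : (m + c <= a)%N -> (0 < a)%N ->
  a%:R ^+ m * (1 - (m * (m + c))%:R / a%:R) <= ((a - c) ^_ m)%:R :> R.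
Proof.
move=> mca a0; have ar : 0 < a%:R :> R by rewrite ltr0n.
apply: (@le_trans _ _ ((a - (m + c))%:R ^+ m)); last first.
  rewrite -natrX ler_nat.
  have h : forall b l, (l <= b)%N -> ((b - l) ^ l <= b ^_ l)%N.
    move=> b l; elim: l b => [|l IH] [|b] // lb; rewrite ffactnS expnS /= leq_mul //.
      by rewrite subSS leqW // leq_subr.
    by rewrite subSS; exact: IH.
  by apply: leq_trans (h (a - c)%N m _); rewrite -?subnDA ?[(c + m)%N]addnC //; move: mca; clear; lia.
rewrite natrB // (_ : a%:R - (m + c)%:R = a%:R * (1 - (m + c)%:R / a%:R)); last by field; rewrite gt_eqF.
rewrite exprMn ler_wpM2l ?exprn_ge0 // natrM -mulrA; apply: bernoulli.
by rewrite divr_ge0 //= ler_pdivrMr // mul1r ler_nat.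
Qed.

Lemma card_est_hidden (R : realType) (K n : nat) (s : {ffun 'I_K -> 'I_n}) (E : {set 'I_n}) : injective s ->
  #|E :&: hidden K n s|%:R = \sum_(a : 'I_K) (s a \in E)%:R :> R.
Proof.
move=> si; rewrite -natr_sum; congr (_%:R); rewrite -sum1_card big_mkcond /=.
rewrite [RHS](eq_bigr (fun a => if s a \in E then 1%N else 0%N)); last by move=> a _; case: (_ \in E).
rewrite -[RHS]big_mkcond sum1_card -sum1_card -big_mkcond sum1_card sum1_card.
rewrite -(card_imset (mem [pred a | s a \in E]) si); apply: eq_card => y.
apply/idP/imsetP; first by rewrite inE => /andP[yE /imsetP[a _ e]]; exists a; rewrite // inE -e.
by case=> a; rewrite !inE => ha ->; rewrite ha imset_f.
Qed.

Section Full.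
Context {R : realType}.
Variables (lam : R) (k n : nat).
Notation K := k.+1.
Hypothesis Kn : (K <= n)%N.
Let p := edge_prob lam n.
Hypothesis (p01 : 0 < p <= 1).
Let p0 : 0 < p. Proof. by case/andP: p01. Qed.
Notation ff := {ffun 'I_K -> 'I_n}.
Let q := (p * n%:R)^-1.
Let n0 : 0 < n%:R :> R. Proof. by rewrite ltr0n (leq_trans _ Kn). Qed.
Let q0 : 0 < q. Proof. by rewrite invr_gt0 mulr_gt0. Qed.

Definition geom (m : nat) : R := \sum_(i < m.+1) (p * n%:R)^-1 ^+ i.
Variable g : R.
Hypothesis hg : forall m, (m <= K)%N -> geom m <= g.

Let geomS m : geom m.+1 = 1 + q * geom m.
Proof.
rewrite /geom big_ord_recl expr0 mulr_sumr; congr (_ + _); apply: eq_bigr => i _.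
by rewrite lift0 exprS.
Qed.

Let geom0 m : 0 <= geom m.
Proof. by apply: sumr_ge0 => i _; rewrite exprn_ge0 // ltW. Qed.

Let g1 : 1 <= g.
Proof. by have := hg (leq0n _); rewrite /geom big_ord_recl expr0 big_ord0 addr0. Qed.

(** Growth of the chain sum per step: a fresh vertex lies on the path with probability [K / n], and
    from there the path can be followed in two directions, each of total weight at most [g]. *)
Let A : R := 1 + 2 * (K%:R / n%:R) * g.
Let A1 : 1 <= A.
Proof. by rewrite lerDl mulr_ge0 // ?mulr_ge0 // ?divr_ge0 ?ltW // (lt_le_trans _ g1). Qed.
Let A0 : 0 <= A. Proof. exact: le_trans A1. Qed.

Lemma full_bounded (s : ff) m : injective s -> (m <= K)%N ->
  bounded_by s p finset.setT (fun _ _ => 1) (fun m => A ^+ m)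
   (fun m _ => 2 * (A ^+ m * geom m)) (fun m _ => A ^+ m * geom m) (fun m _ => A ^+ m * geom m) m.
Proof.
move=> si; have Ak j : 0 <= A ^+ j by rewrite exprn_ge0.
have Ag j : 0 <= A ^+ j * geom j by rewrite mulr_ge0.
have fT : #|[set: 'I_n]|%:R = n%:R :> R by rewrite cardsT card_ord.
have gm1 : geom 0 = 1 by rewrite /geom big_ord_recl expr0 big_ord0 addr0.
elim: m => [_|m IH mK].
  by split=> [u v _|u i|i j _|i j _]; rewrite chains0 ?expr0 ?gm1; lra.
have npq : n%:R * q = p^-1 by rewrite /q invfM mulrCA divff ?mulr1 // gt_eqF.
have key : n%:R * A ^+ m.+1 + p^-1 * (A ^+ m * geom m) <= n%:R * (A ^+ m.+1 * geom m.+1).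
  rewrite geomS mulrDr mulr1 mulrDr lerD2l; have -> : p^-1 * (A ^+ m * geom m) = n%:R * (A ^+ m * (q * geom m)).
    by rewrite -npq; ring.
  apply: ler_wpM2l; first exact: ltW.
  apply: ler_wpM2r; first by rewrite mulr_ge0 // ltW.
  by rewrite exprS ler_peMl.
apply: bounded_step => //.
- by move=> *; rewrite mulr_ge0.
- exact: (IH (ltnW mK)).
- rewrite fT; have -> : \sum_(j < K | s j \in [set: 'I_n]) 2 * (A ^+ m * geom m) = K%:R * (2 * (A ^+ m * geom m)).
    rewrite (eq_bigl (fun j => j \in [set: 'I_K])); last by move=> j; rewrite !finset.in_setT.
    by rewrite sumr_const cardsT card_ord -[LHS]mulr_natl.
  have -> : n%:R * A ^+ m.+1 = n%:R * A ^+ m + K%:R * (2 * (A ^+ m * g)).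
    by rewrite exprS {1}/A; field; rewrite gt_eqF.
  rewrite lerD2l.
  by rewrite ler_wpM2l // ler_wpM2l // ler_wpM2l // hg // ltnW.
- have hh (a b c : R) : 0 <= c -> c + b <= a -> c + b + b <= 2 * a by lra.
  move=> _; rewrite fT [leRHS]mulrCA; apply: hh => //; by rewrite mulr_ge0 // ltW.
- by move=> _; rewrite fT.
- by move=> _; rewrite fT.
Qed.

Lemma full_sum (s1 : ff) : injective s1 ->
  \sum_(s2 in injections K n) p ^- #|planted K n s1 :&: planted K n s2| <= n%:R ^+ K * A ^+ K.
Proof.
move=> si.
pose phi (s2 : ff) : 'I_n * k.-tuple 'I_n := (at_pos s2 0, [tuple of map (at_pos s2) (iota 1 k)]).
(* The first vertex acts as its own predecessor: this only forbids standing still, so no injective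
   placement is lost. *)
pose F (z : 'I_n * k.-tuple 'I_n) : R := chain s1 p finset.setT (fun _ _ => 1) z.1 z.1 z.2.
have phi_inj : injective phi.
  move=> s s' [e0 e]; apply/ffunP => i; have hi := ltn_ord i.
  have ei (u : ff) : u i = at_pos u i by rewrite /at_pos inord_val.
  rewrite !ei; case: (posnP (i : nat)) => [->//|i0].
  have e2 : nth (s i) (map (at_pos s) (iota 1 k)) i.-1 = nth (s i) (map (at_pos s') (iota 1 k)) i.-1.
    by rewrite e.
  move: e2; rewrite !(nth_map 0%N) ?size_iota ?nth_iota ?add1n ?prednK //.
have F0 z : 0 <= F z by apply: chain_ge0.
have step (s2 : ff) : s2 \in injections K n -> p ^- #|planted K n s1 :&: planted K n s2| <= F (phi s2).
  rewrite inE => /injectiveP si2; rewrite -!bplantT; apply: le_trans (inter_le_prod _ _ _ _) _ => //.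
  rewrite /F /= (@chain_iota R k n p s1 finset.setT _ (at_pos s2) _ 0) ?mulr1 ?add0n.
  - rewrite le_eqVlt; apply/orP; left; apply/eqP; apply: eq_bigl => i; by rewrite !inE.
  - by move=> i _; rewrite inE.
  - by move=> k0; apply/eqP => /si2 /(congr1 val) /=; rewrite !inordK.
  - move=> i _ hi; apply/eqP => /si2 /(congr1 val) /=; rewrite !inordK //; last by rewrite ltnW // ltnW.
    by clear; lia.
apply: le_trans (ler_sum _ step) _.
rewrite -(big_imset F) /=; last by move=> x y _ _; exact: phi_inj.
apply: (@le_trans _ _ (\sum_z F z)).
  by rewrite [leRHS](bigID (mem (phi @: injections K n))) /= lerDl sumr_ge0.
rewrite -(pair_big xpredT xpredT (fun y (t : k.-tuple 'I_n) => F (y, t))) /=.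
have [hA hB _ _] := full_bounded si (leqnSn k).
have fT : #|[set: 'I_n]|%:R = n%:R :> R by rewrite cardsT card_ord.
rewrite fT in hA hB.
have nk : 0 <= n%:R ^+ k :> R by rewrite exprn_ge0.
apply: (@le_trans _ _ (\sum_(y : 'I_n) (n%:R ^+ k * A ^+ k + \sum_(j < K) (y == s1 j)%:R * (n%:R ^+ k * (2 * (A ^+ k * g)))))).
  apply: ler_sum => y _; have [/imsetP[j _ ->]|hy] := boolP (y \in hidden K n s1).
    rewrite (bigD1 j) //= eqxx mul1r; apply: le_trans (hB (s1 j) j) _.
    apply: (@le_trans _ _ (n%:R ^+ k * (2 * (A ^+ k * g)))).
      by do 3 apply: ler_wpM2l => //; [rewrite exprn_ge0|rewrite hg].
    rewrite addrCA lerDl addr_ge0 ?mulr_ge0 ?exprn_ge0 // sumr_ge0 // => i _.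
    by rewrite !mulr_ge0 ?exprn_ge0 // (le_trans _ g1).
  apply: le_trans (hA y y hy) _; rewrite lerDl sumr_ge0 // => i _.
  by rewrite !mulr_ge0 ?exprn_ge0 // (le_trans _ g1).
rewrite big_split /= sumr_const card_ord -[_ *+ n]mulr_natl.
have := sum_hidden s1 finset.setT (fun _ => n%:R ^+ k * (2 * (A ^+ k * g))) xpredT.
rewrite [X in X = _ -> _](eq_bigl xpredT); last by move=> y; rewrite finset.in_setT.
move=> ->; rewrite (eq_bigl (fun j => j \in [set: 'I_K])); last by move=> y; rewrite !finset.in_setT.
rewrite sumr_const cardsT card_ord -[_ *+ K]mulr_natl.
rewrite le_eqVlt; apply/orP; left; apply/eqP; rewrite [in RHS]exprS [A ^+ k.+1]exprS {3}/A.
by field; rewrite gt_eqF.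
Qed.

Let dl : R := K%:R ^+ 2 / n%:R.
Let eta : R := dl * g.
Hypothesis eta6 : eta <= 6^-1.

Let dl0 : 0 <= dl. Proof. by rewrite divr_ge0 ?exprn_ge0 // ltW. Qed.
Let dl_eta : dl <= eta. Proof. by rewrite /eta ler_peMr. Qed.

Lemma K_small : (K + K <= n)%N.
Proof.
have h : dl <= 6^-1 by apply: le_trans eta6.
move: h; rewrite /dl ler_pdivrMr // -natrX => h.
have : (6 * K ^ 2 <= n)%N by rewrite -(ler_nat R) natrM; lra.
by rewrite expnS expn1; clear; nia.
Qed.

Lemma injections_ge : n%:R ^+ K * (1 - dl) <= #|injections K n|%:R.
Proof.
rewrite card_inj_ffuns !card_ord; have := @ffact_ge R n 0 K; rewrite addn0 subn0 => /(_ Kn (leq_trans _ Kn)).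
by rewrite natrM -expr2; apply.
Qed.

(** [A] is [1 + x] with [K x = 2 eta]. As [(1 + x) (1 - x) <= 1] and [(1 - x) ^+ K >= 1 - 2 eta],
    the power [A ^+ K] is at most [(1 - 2 eta)^-1]. Passing from all maps to injections costs the
    factor [1 - dl]. *)
Lemma full_mean (s1 : ff) : injective s1 ->
  \sum_(s2 in injections K n) p ^- #|planted K n s1 :&: planted K n s2| <=
    #|injections K n|%:R * (1 + 6 * eta).
Proof.
move=> si; apply: le_trans (full_sum si) _.
have e0 : 0 <= eta by apply: le_trans dl_eta.
have nK : 0 < n%:R ^+ K :> R by rewrite exprn_gt0.
have hA : A ^+ K * (1 - 2 * eta) <= 1.
  set x := 2 * (K%:R / n%:R) * g.
  have e : K%:R * x = 2 * eta by rewrite /x /eta /dl expr2; ring.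
  have x0 : 0 <= x by rewrite /x !mulr_ge0 // ?divr_ge0 // (le_trans _ g1).
  have x1 : x <= 1.
    apply: (@le_trans _ _ (K%:R * x)); first by rewrite ler_peMl // ler1n.
    by rewrite e; have := eta6; set y := eta; lra.
  rewrite -e; apply: (@le_trans _ _ (A ^+ K * (1 - x) ^+ K)).
    by rewrite ler_wpM2l ?exprn_ge0 // bernoulli // x0.
  rewrite -exprMn exprn_ile1 // /A -/x; last by nra.
  by rewrite mulr_ge0 ?subr_ge0 // addr_ge0.
have hi := injections_ge.
have hA' : A ^+ K <= (1 - 2 * eta)^-1 by rewrite -[leRHS]mul1r ler_pdivlMr //; have := eta6; set y := eta; lra.
apply: (@le_trans _ _ (n%:R ^+ K * ((1 - dl) * (1 + 6 * eta)))); last first.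
  by rewrite mulrA ler_wpM2r //; lra.
rewrite ler_wpM2l ?(ltW nK) //; apply: le_trans hA' _.
rewrite -[leLHS]mul1r ler_pdivrMr; last by have := eta6; set y := eta; lra.
exact: second_moment_arith1.
Qed.

Lemma full_TV eps : 0 < eps -> TV lam K n <= 4^-1 * (eps + eps^-1 * (6 * eta)).
Proof.
move=> e0; apply: le_trans (TV_le Kn p01 e0) _; rewrite ler_wpM2l ?invr_ge0 // lerD2l.
rewrite ler_wpM2l ?invr_ge0 ?(ltW e0) // lerBlDr addrC ex_lr2 //.
apply: (@le_trans _ _ (av (fun _ : ff => 1 + 6 * eta))); last by rewrite av_cst.
apply: av_le => s1 si.
rewrite /av ler_pdivrMl ?ltr0n ?inj_gt0 //; exact: full_mean.
Qed.

(** No new chain estimate is needed. The number of common vertices is at most [K], and zero on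
    disjoint placements; there the weight is at least [1]. So the weight carried by intersecting
    placements is at most the total weight minus the number of disjoint placements, and both are
    known up to a factor [1 + O(eta)]. *)
Lemma full_meet (s1 : ff) : injective s1 ->
  \sum_(s2 in injections K n) p ^- #|planted K n s1 :&: planted K n s2| * (meet finset.setT s1 s2)%:R <=
    #|injections K n|%:R * (K%:R * (8 * eta)).
Proof.
move=> si.
pose dj (s2 : ff) := [forall i, s2 i \notin hidden K n s1].
have meetK (s2 : ff) : s2 \in injections K n -> (meet finset.setT s1 s2)%:R <= K%:R * (~~ dj s2)%:R :> R.
  rewrite inE => /injectiveP si2; case: (boolP (dj s2)) => /= [/forallP hd|_].
    rewrite mulr0 /meet big1 // => a _; rewrite big1 // => b _.
    by case: eqP => // e; have := hd b; rewrite -e imset_f.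
  rewrite mulr1 /meet natr_sum; apply: (@le_trans _ _ (\sum_(a in [set: 'I_K]) 1)); last first.
    by rewrite sumr_const cardsT card_ord.
  apply: ler_sum => a _; rewrite natr_sum; apply: sum_unique_le1 => x y /eqP h /eqP h'.
  by apply: si2; rewrite -h.
apply: (@le_trans _ _ (K%:R * (\sum_(s2 in injections K n) p ^- #|planted K n s1 :&: planted K n s2| -
    \sum_(s2 in injections K n) (dj s2)%:R))).
  rewrite -sumrB mulr_sumr; apply: ler_sum => s2 hs2.
  have pp : 0 < p ^- #|planted K n s1 :&: planted K n s2| by rewrite invr_gt0 exprn_gt0.
  apply: (@le_trans _ _ (p ^- #|planted K n s1 :&: planted K n s2| * (K%:R * (~~ dj s2)%:R))).
    by rewrite ler_wpM2l ?(ltW pp) ?meetK.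
  rewrite mulrCA ler_wpM2l //; case: (dj s2); rewrite /= ?mulr0 ?mulr1 ?subr0 // subr_ge0.
  by rewrite invf_ge1 ?exprn_gt0 //; apply: exprn_ile1; [exact: ltW|case/andP: p01].
have cdj : n%:R ^+ K * (1 - 2 * dl) <= \sum_(s2 in injections K n) (dj s2)%:R.
  have hn : (0 < n)%N by apply: leq_trans Kn.
  have := ffact_ge R K_small hn; have -> : (K * (K + K))%:R / n%:R = 2 * dl :> R.
    by rewrite natrM natrD /dl expr2; ring.
  move=> h; apply: le_trans h _.
  have cD : #|~: hidden K n s1| = (n - K)%N by rewrite cardsCs finset.setCK card_imset // !card_ord.
  rewrite -natr_sum ler_nat -cD -[X in (_ ^_ X <= _)%N](card_ord K) -card_inj_ffuns_on -sum1_card.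
  rewrite big_mkcond [leqRHS]big_mkcond /=; apply: leq_sum => s2 _; rewrite !inE.
  case: ifP => // /andP[/ffun_onP h1 ->]; have -> // : dj s2.
  by apply/forallP => i; have := h1 i; rewrite inE.
have hle : #|injections K n|%:R <= n%:R ^+ K :> R.
  by rewrite -natrX ler_nat; apply: leq_trans (max_card _) _; rewrite card_ffun !card_ord.
have hm := full_mean si.
rewrite mulrCA ler_wpM2l //; move: hm cdj hle; move: dl_eta dl0.
set X := \sum_(s2 in _) _; set Y := \sum_(s2 in _) _; set c := #|_|%:R; set N := _ ^+ K => d1 d0 h1 h2 h3.
by apply: (second_moment_arith2 (N := N) (d := dl)) => //; rewrite ler0n.
Qed.

Lemma full_overlap (est : graph n -> {set 'I_n}) eps : (forall G, #|est G| = K) -> 0 < eps ->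
  overlap lam K n est <= 2^-1 * (eps * K%:R + eps^-1 * (K%:R * (8 * eta))).
Proof.
move=> he e0; rewrite overlapE.
have := @replica_overlap R lam K n Kn p01 finset.setT finset.setT est he eps (K%:R * (8 * eta)) e0.
have -> : av (fun s => Ex p (fun G => hits finset.setT est s (G :|: planted K n s))) =
  av (fun s => Ex p (fun G0 => #|est (G0 :|: planted K n s) :&: hidden K n s|%:R)) :> R.
  apply: av_ext => s si; apply: ex_ext => G; rewrite card_est_hidden //; apply: eq_bigl => a.
  by rewrite inE.
apply=> s si s1; have -> : cls finset.setT s = injections K n.
  apply/finset.setP => t; rewrite inE; case: (t \in _) => //=.
  by apply/forallP => i; rewrite inE.
rewrite inE => /injectiveP si1; apply: le_trans (full_meet si1).
by apply: ler_sum => s2 _; rewrite !bplantT.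
Qed.

End Full.

(** * Hiding a block of the path *)

Section HalfChain.
Context {R : realType}.
Variables (K n : nat) (s : {ffun 'I_K -> 'I_n}) (p : R) (D : {set 'I_n}) (l t : nat) (j1 : 'I_K).
Hypotheses (si : injective s) (p01 : 0 < p <= 1).
Let p0 : 0 < p. Proof. by case/andP: p01. Qed.
Let f : R := #|D|%:R.
Hypothesis f0 : 0 < f.
Let q := (p * f)^-1.
Hypothesis q1 : q < 1.
Hypothesis cardl : #|[set j : 'I_K | s j \in D]| = l.
Hypothesis ltf : 4 * t%:R * l%:R <= f * (1 - q).

(** The half chain starts at the centre of the window and must join the fixed path vertex [s j1]
    just outside it; this is the weight of that last step, set to zero where the step would go
    straight back. *)
Definition endpoint (u v : 'I_n) : R := if u == s j1 then 0 else wt s p v (s j1).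

Let q0 : 0 < q. Proof. by rewrite invr_gt0 mulr_gt0. Qed.
Let r0 : 0 < 1 - q. Proof. by rewrite subr_gt0. Qed.
Let fq : f * q = p^-1. Proof. by rewrite /q invfM mulrCA divff ?mulr1 // gt_eqF. Qed.
(** Chosen so that [al k + q D0 <= D0], that is [al k <= (1 - q) D0]. Half of the right side,
    [2 / (1 - q)], covers [1 + 2 q / (1 - q) = (1 + q) / (1 - q)]; the other half covers the
    accumulated [t c], which is what the condition on [4 t l] says. *)
Let D0 : R := 4 / (1 - q) ^+ 2.
Let D0_ge4 : 4 <= D0.
Proof.
rewrite /D0 ler_pdivlMr ?exprn_gt0 // ger_pMr //.
by apply: exprn_ile1; [exact: ltW|rewrite lerBlDr lerDl ltW].
Qed.
Let c : R := 2 * l%:R * D0 / f.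
(** Each step adds [c], for landing on one of the [l] window positions out of [f] with weight
    [2 D0], and [2 q ^+ k.+1], for landing on one of the two positions from which the path leads
    exactly to the endpoint. *)
Let al k : R := 1 + k%:R * c + 2 * q * (1 - q ^+ k) / (1 - q).
Let x k : R := q ^+ k / p.
Let Cp k (i : nat) : R := D0 + x k * (i + k.+1 == val j1)%N%:R.
Let Cm k (i : nat) : R := D0 + x k * (i == val j1 + k.+1)%N%:R.
Let B k (i : nat) : R := 2 * D0 + x k * (i + k.+1 == val j1)%N%:R + x k * (i == val j1 + k.+1)%N%:R.
Let D00 : 0 <= D0. Proof. by rewrite (le_trans _ D0_ge4). Qed.
Let x0 k : 0 <= x k. Proof. by rewrite divr_ge0 ?exprn_ge0 // ltW. Qed.
Let c0 : 0 <= c. Proof. by apply: divr_ge0; [apply: mulr_ge0; [exact: mulr_ge0|exact: D00]|exact: ltW]. Qed.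
Let al0 k : 0 <= al k.
Proof.
have h : 0 <= 1 - q ^+ k by rewrite subr_ge0 exprn_ile1 // ltW.
apply: addr_ge0; first by rewrite addr_ge0 // mulr_ge0.
by apply: divr_ge0; [apply: mulr_ge0; [apply: mulr_ge0; [|exact: ltW]|]|exact: ltW].
Qed.

Let al_le k : (k <= t)%N -> al k + q * D0 <= D0.
Proof.
move=> kt; suff : al k <= (1 - q) * D0 by rewrite mulrBl mul1r; set z := q * D0; lra.
have h1 : k%:R * c <= (1 - q) * D0 / 2.
  apply: (@le_trans _ _ (t%:R * c)); first by rewrite ler_wpM2r // ler_nat.
  rewrite /c mulrA ler_pdivrMr //.
  have -> : t%:R * (2 * l%:R * D0) = 4 * t%:R * l%:R * (D0 / 2) by field.
  apply: le_trans (ler_wpM2r _ ltf) _; first by rewrite divr_ge0.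
  by rewrite le_eqVlt; apply/orP; left; apply/eqP; field.
have h2 : 2 * q * (1 - q ^+ k) / (1 - q) <= 2 * q / (1 - q).
  rewrite ler_wpM2r ?invr_ge0 ?(ltW r0) // ger_pMr ?mulr_gt0 //.
  by rewrite lerBlDr lerDl exprn_ge0 // ltW.
have h3 : 1 + 2 * q / (1 - q) <= (1 - q) * D0 / 2.
  have -> : (1 - q) * D0 / 2 = 2 / (1 - q) by rewrite /D0; field; rewrite gt_eqF.
  have -> : 1 + 2 * q / (1 - q) = (1 + q) / (1 - q) by field; rewrite gt_eqF.
  by rewrite ler_wpM2r ?invr_ge0 ?(ltW r0) // -[2]/(1 + 1) lerD2l ltW.
move: h1 h2 h3; rewrite /al; set u := _ * c; set v := _ / _; set w := _ / _; set y := _ * D0.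
lra.
Qed.

Let alS k : al k.+1 = al k + c + 2 * q ^+ k.+1.
Proof. by rewrite /al -natr1 exprS; field; rewrite gt_eqF. Qed.

Let xS k : f * x k.+1 = p^-1 * x k.
Proof. by rewrite -fq /x exprS; ring. Qed.

(* A chain can reach [s j1] along the path only if it is at distance exactly
   [k + 1] from it; everything else is absorbed by the fixed point [D0]. *)
Lemma half_bounded k : (k <= t)%N -> bounded_by s p D endpoint al B Cp Cm k.
Proof.
have i0 : 0 <= p^-1 by rewrite invr_ge0 ltW.
elim: k => [_|k IH kt].
  have xz : x 0 = p^-1 by rewrite /x expr0 mul1r.
  have al1 : al 0 = 1 by rewrite /al expr0 subrr mulr0 !mul0r !addr0.
  split=> [u v hv|u i|i j ij|i j ij]; rewrite chains0 expr0 mul1r ?al1 /endpoint.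
  - by case: ifP => // _; rewrite wt_out.
  - apply: (@le_trans _ _ (wt s p (s i) (s j1))).
      by case: ifP => // _; rewrite ltW // wt_gt0.
    apply: le_trans (wt_le si p01 i j1) _; rewrite /B xz !addn1 -!addrA lerD2r.
    by have := D0_ge4; set z := D0; lra.
  - case: eqP => [_|ne]; first by rewrite addr_ge0 // mulr_ge0.
    apply: le_trans (wt_le si p01 j j1) _; rewrite /Cp xz !addn1.
    have -> : (val j == (val j1).+1) = false.
      apply/negP => /eqP e; apply: ne; congr (s _); apply: val_inj; move: ij; rewrite e => -[] //.
    by rewrite mulr0 addr0 lerD2r (le_trans _ D0_ge4) // ler1n.
  - case: eqP => [_|ne]; first by rewrite addr_ge0 // mulr_ge0.
    apply: le_trans (wt_le si p01 j j1) _; rewrite /Cm xz !addn1.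
    have -> : ((val j).+1 == (val j1)) = false.
      by apply/negP => /eqP e; apply: ne; congr (s _); apply: val_inj; rewrite ij e.
    by rewrite mulr0 addr0 lerD2r (le_trans _ D0_ge4) // ler1n.
have hD := al_le kt.
have fD : f * al k.+1 + p^-1 * D0 <= f * D0.
  by rewrite -fq -mulrA -mulrDr ler_wpM2l // ltW.
have eP i : p^-1 * Cp k i.+1 = p^-1 * D0 + f * (x k.+1 * (i + k.+2 == val j1)%N%:R).
  by rewrite /Cp mulrDr [p^-1 * (x k * _)]mulrA -xS addSnnS -mulrA.
have eM i : p^-1 * Cm k i.-1 <= p^-1 * D0 + f * (x k.+1 * (i == val j1 + k.+2)%N%:R).
  rewrite /Cm mulrDr [p^-1 * (x k * _)]mulrA -xS -mulrA lerD2l; apply: ler_wpM2l; first exact: ltW.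
  apply: ler_wpM2l => //; rewrite ler_nat; case: eqP => // e.
  have -> // : i == (val j1 + k.+2)%N by move: e; clear; case: i => [|i] /= e; apply/eqP; move: e; lia.
apply: bounded_step => //.
- by move=> k' i; rewrite /B !addr_ge0 // mulr_ge0.
- by move=> k' i; rewrite addr_ge0 // mulr_ge0.
- by move=> k' i; rewrite addr_ge0 // mulr_ge0.
- exact: (IH (ltnW kt)).
- rewrite -/f alS -[al k + c + _]addrA [f * (al k + _)]mulrDr lerD2l [f * (c + _)]mulrDr /B !big_split /= sumr_const -[_ *+ _]mulr_natl.
  have -> : #|[pred j | s j \in D]| = l by rewrite -cardl; apply: eq_card => j; rewrite !inE.
  rewrite -addrA; apply: lerD.
    by rewrite /c le_eqVlt; apply/orP; left; apply/eqP; field; rewrite gt_eqF.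
  have -> : f * (2 * q ^+ k.+1) = x k + x k by rewrite /x -fq exprS; ring.
  apply: lerD; rewrite -mulr_sumr -[leRHS]mulr1; apply: ler_wpM2l => //; apply: sum_unique_le1 => u v.
    by move=> /eqP e /eqP e'; apply: val_inj; move: e e'; clear; rewrite /=; lia.
  by move=> /eqP e /eqP e'; apply: val_inj; rewrite /= e e'.
- move=> i; rewrite -addrA; rewrite eP /B.
  have hh (a b d u v v' : R) : a + b <= d -> 0 <= a -> v' <= b + v -> a + ((b + u) + v') <= 2 * d + u + v by lra.
  rewrite -/f [leRHS]mulrDr [f * (2 * D0 + _)]mulrDr [f * (2 * D0)]mulrCA; apply: hh; [exact: fD| |exact: eM].
  by rewrite mulr_ge0 // ltW.
- by move=> i; rewrite -/f eP /Cp [leRHS]mulrDr addrA lerD2r.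
- by move=> i; apply: le_trans (lerD (lexx _) (eM i)) _; rewrite -/f /Cm [leRHS]mulrDr addrA lerD2r.
Qed.

(** Following the path from the centre to the end of the window has weight [q ^+ t / p], which the
    length of the window makes at most [1]: here the end of the window is forgotten. *)
Lemma half_chain_le u (i : 'I_K) : q ^+ t <= p -> (i + t.+1 = j1 \/ i = j1 + t.+1 :> nat)%N ->
  chains s p D endpoint t u (s i) <= f ^+ t * (2 * D0 + 1).
Proof.
move=> qt hi; have [_ hB _ _] := half_bounded (leqnn t).
apply: le_trans (hB _ _) _; apply: ler_wpM2l; first by rewrite exprn_ge0 // ltW.
rewrite /B -addrA lerD2l.
have x1 : x t <= 1 by rewrite /x ler_pdivrMr // mul1r.
case: hi => e.
  have -> : (val i == val j1 + t.+1)%N = false by apply/eqP; rewrite /= -e; clear; lia.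
  by rewrite mulr0 addr0 /= e eqxx mulr1.
have -> : (val i + t.+1 == val j1)%N = false by apply/eqP; rewrite /= e; clear; lia.
by rewrite mulr0 add0r /= e eqxx mulr1.
Qed.

End HalfChain.

Section Block.
Context {R : realType}.
Variables (lam : R) (k n t : nat).
Notation K := k.+1.
Hypothesis Kn : (K <= n)%N.
Let p := edge_prob lam n.
Hypothesis (p01 : 0 < p <= 1).
Let p0 : 0 < p. Proof. by case/andP: p01. Qed.
Let p01' : 0 <= p <= 1. Proof. by case/andP: p01 => h ->; rewrite ltW. Qed.
Notation ff := {ffun 'I_K -> 'I_n}.
Notation E0 := (@Ex R p n).
Let l := t.*2.+1.
Let f := (n - K + l)%N.
Let q := (p * f%:R)^-1.
Hypothesis q1 : q < 1.
Hypothesis ltf : 4 * t%:R * l%:R <= f%:R * (1 - q).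
Hypothesis qt : q ^+ t <= p.
Hypothesis l2f : (2 * l ^ 2 <= f)%N.
Let B : R := 2 * (4 / (1 - q) ^+ 2) + 1.

Let f_gt0 : (0 < f)%N. Proof. by rewrite /f addnS. Qed.

Section Position.
Variable a : nat.
Hypotheses (ta : (t < a)%N) (atk : (a + t < k)%N).

Definition block : {set 'I_K} := [set i : 'I_K | (a - t <= i <= a + t)%N].

Lemma block_card : #|block| = l.
Proof.
pose h (i : 'I_l) : 'I_K := inord (a - t + i).
have hv (i : 'I_l) : h i = (a - t + i)%N :> nat.
  by rewrite inordK //; have := ltn_ord i; move: ta atk; rewrite /l; clear; lia.
have h_inj : injective h.
  by move=> i j /(congr1 val) /=; rewrite !hv => e; apply: val_inj; move: e; clear; rewrite /=; lia.
rewrite -[RHS]card_ord -(card_imset predT h_inj); apply: eq_card => i; rewrite inE.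
apply/idP/imsetP => [hi|[j _ ->]]; last by rewrite hv; have := ltn_ord j; move: ta; rewrite /l; clear; lia.
have hi' : (i - (a - t) < l)%N by move: hi ta; rewrite /l; clear; lia.
by exists (Ordinal hi') => //; apply: val_inj; rewrite /= hv /=; move: hi; clear; lia.
Qed.

Variables (s1 : ff).
Hypothesis si : injective s1.

(** The vertices not occupied by the visible part of the path, hence the ones that a placement of
    the same class can use inside the window. *)
Definition avail : {set 'I_n} := ~: (s1 @: (~: block)).

Lemma avail_mem (i : 'I_K) : (s1 i \in avail) = (i \in block).
Proof. by rewrite inE (mem_imset _ _ si) inE negbK. Qed.

Lemma avail_card : #|avail| = f.
Proof.
rewrite cardsCs finset.setCK card_imset // cardsCs finset.setCK block_card !card_ord.
have : (l <= K)%N by rewrite /l; move: ta atk; clear; lia.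
by rewrite /f; move: Kn; clear; lia.
Qed.

Lemma cls_avail (s2 : ff) (i : 'I_K) : s2 \in cls block s1 -> i \in block -> s2 i \in avail.
Proof.
rewrite !inE => /andP[/injectiveP si2 /forallP hs] hi; apply/negP => /imsetP[j]; rewrite inE => hj e.
have := hs j; rewrite hj /= => /eqP e2; move: e; rewrite e2 => /si2 e; by rewrite -e inE hi in hj.
Qed.

(** The injections of the window into [avail] embed in the class, and [2 l ^ 2 <= f] makes them at
    least half of all maps. *)
Lemma cls_card : f%:R ^+ l <= 2 * #|cls block s1|%:R :> R.
Proof.
have fr : 0 < f%:R :> R by rewrite ltr0n.
have h1 : (f ^_ l <= #|cls block s1|)%N.
  rewrite -[l]card_ord -avail_card -card_inj_ffuns_on.
  pose g (h : {ffun 'I_l -> 'I_n}) : ff := [ffun i => if i \in block then h (inord (i - (a - t))) else s1 i].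
  have lb (i : 'I_K) : i \in block -> (i - (a - t) < l)%N.
    by rewrite inE => hi; move: hi ta; rewrite /l; clear; lia.
  rewrite -[leqLHS](@card_in_imset _ _ g); last first.
    move=> h h' _ _ e; apply/ffunP => j.
    have hj : (a - t + j < K)%N by have := ltn_ord j; move: ta atk; rewrite /l; clear; lia.
    have hB : inord (a - t + j) \in block.
      by rewrite inE inordK //; have := ltn_ord j; move: ta; rewrite /l; clear; lia.
    move/ffunP: e => /(_ (inord (a - t + j))); rewrite !ffunE hB inordK // addKn.
    by rewrite inord_val.
  apply: subset_leq_card; apply/fintype.subsetP => s /imsetP[h]; rewrite inE => /andP[/ffun_onP hD /injectiveP hi] ->.
  rewrite !inE; apply/andP; split; last first.
    by apply/forallP => i; apply/implyP => hi'; rewrite ffunE (negbTE hi').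
  apply/injectiveP => i j; rewrite !ffunE.
  case: (boolP (i \in block)) => bi; case: (boolP (j \in block)) => bj.
  - move/hi/(congr1 val); rewrite /= !inordK; try exact: lb.
    by move: bi bj; rewrite !inE => bi bj e; apply: val_inj; move: bi bj e; clear; rewrite /=; lia.
  - by move=> e; have := hD (inord (i - (a - t))); rewrite e avail_mem (negbTE bj).
  - by move=> e; have := hD (inord (j - (a - t))); rewrite -e avail_mem (negbTE bi).
  - exact: si.
have l2 : (l <= f)%N by apply: leq_trans l2f; rewrite expnS expn1; clear; nia.
have := @ffact_ge R f 0 l; rewrite addn0 subn0 => /(_ l2 f_gt0) h2.
have h3 : f%:R ^+ l <= 2 * (f%:R ^+ l * (1 - (l * l)%:R / f%:R)) :> R.
  rewrite mulrCA ler_peMr ?exprn_ge0 //.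
  have : (l * l)%:R / f%:R <= 2^-1 :> R.
    rewrite ler_pdivrMr // mulrC ler_pdivlMr // mulrC -natrM ler_nat.
    by move: l2f; rewrite expnS expn1.
  set z := _ / _; lra.
apply: le_trans h3 _; rewrite ler_wpM2l //; apply: le_trans h2 _; by rewrite ler_nat.
Qed.

(** Meeting at the centre fixes the vertex [v0] there; the rest of the window splits into two half
    chains that leave [v0] in opposite directions and end at the neighbours of the window. Each half
    sums to at most [f ^+ t * B], whereas the class has at least [f ^+ (2 t + 1) / 2] members, so a
    factor [1 / f] remains. *)
Lemma block_sum :
  \sum_(s2 in cls block s1) p ^- #|bplant block s1 :&: bplant block s2| * (meet [set inord a] s1 s2)%:R <=
    #|cls block s1|%:R * (2 * B ^+ 2 / f%:R).
Proof.
have aK : (a < K)%N by move: atk; clear; lia.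
have jrK : (a + t.+1 < K)%N by move: atk; clear; lia.
have jlK : (a - t.+1 < K)%N by move: atk; clear; lia.
pose jr : 'I_K := Ordinal jrK; pose jl : 'I_K := Ordinal jlK.
pose v0 := at_pos s1 a.
pose phi (s2 : ff) : t.-tuple 'I_n * t.-tuple 'I_n :=
  ([tuple of map (at_pos s2) (iota a.+1 t)], [tuple of map (fun i => at_pos s2 (a - i)) (iota 1 t)]).
pose Fr (u : t.-tuple 'I_n) : R := chain s1 p avail (endpoint s1 p jr) v0 v0 u.
pose Fl (u : t.-tuple 'I_n) : R := chain s1 p avail (endpoint s1 p jl) v0 v0 u.
have e0 j u v : 0 <= endpoint s1 p j u v by rewrite /endpoint; case: ifP => // _; rewrite ltW // wt_gt0.
have Fr0 u : 0 <= Fr u by apply: chain_ge0.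
have Fl0 u : 0 <= Fl u by apply: chain_ge0.
pose S := [set s2 in cls block s1 | at_pos s2 a == v0].
have at_eq (s2 : ff) (i : 'I_K) : at_pos s2 i = s2 i by rewrite /at_pos inord_val.
have phi_inj : {in S &, injective phi}.
  move=> s2 s3; rewrite inE => /andP[]; rewrite inE => /andP[_ /forallP h2] /eqP a2.
  rewrite inE => /andP[]; rewrite inE => /andP[_ /forallP h3] /eqP a3 [eR eL]; apply/ffunP => i.
  have [bi|bi] := boolP (i \in block); last first.
    by have := h2 i; have := h3 i; rewrite bi /= => /eqP <- /eqP <-.
  rewrite -!at_eq; have hi := ltn_ord i; move: bi; rewrite inE => bi.
  case: (ltngtP i a) => [lt|gt|->]; last by rewrite a2 a3.
  - have e2 : nth v0 (map (fun i => at_pos s2 (a - i)) (iota 1 t)) (a - i).-1 =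
        nth v0 (map (fun i => at_pos s3 (a - i)) (iota 1 t)) (a - i).-1 by rewrite eL.
    have lt' : ((a - i).-1 < t)%N by move: lt bi; clear; lia.
    move: e2; rewrite !(nth_map 0%N) ?size_iota // nth_iota //.
    by have -> : (a - (1 + (a - i).-1) = i)%N by move: lt; clear; lia.
  - have e2 : nth v0 (map (at_pos s2) (iota a.+1 t)) (i - a.+1) =
        nth v0 (map (at_pos s3) (iota a.+1 t)) (i - a.+1) by rewrite eR.
    have lt' : (i - a.+1 < t)%N by move: gt bi; clear; lia.
    move: e2; rewrite !(nth_map 0%N) ?size_iota // nth_iota //.
    by have -> : (a.+1 + (i - a.+1) = i)%N by move: gt; clear; lia.
have step (s2 : ff) : s2 \in S -> p ^- #|bplant block s1 :&: bplant block s2| <= Fr (phi s2).1 * Fl (phi s2).2.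
  rewrite inE => /andP[hc /eqP a2]; have := hc; rewrite inE => /andP[]; rewrite inE => /injectiveP si2 /forallP h2.
  have ne i j : (i < K)%N -> (j < K)%N -> i != j -> at_pos s2 i != at_pos s2 j.
    move=> hi hj; apply: contra => /eqP /si2 /(congr1 val) /=; rewrite !inordK // => ->; exact: eqxx.
  have inD i : (a - t <= i <= a + t)%N -> at_pos s2 i \in avail.
    move=> hi; apply: cls_avail hc _; rewrite inE inordK //; move: hi atk; clear; lia.
  have out i : (i < K)%N -> ~~ (a - t <= i <= a + t)%N -> at_pos s2 i = at_pos s1 i.
    move=> hi h; have := h2 (inord i); rewrite inE inordK // h /= => /eqP e; by rewrite /at_pos e.
  apply: le_trans (inter_le_prod p01 s1 s2 block) _.
  rewrite (big_nat_widen _ _ _ _ _ (leqnSn k)) /=.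
  have -> : \prod_(0 <= i < k.+1 | ((inord i \in block) || (inord i.+1 \in block)) && (i < k)%N)
       wt s1 p (at_pos s2 i) (at_pos s2 i.+1) =
     \prod_(a - t.+1 <= i < a + t.+1) wt s1 p (at_pos s2 i) (at_pos s2 i.+1).
    rewrite [RHS](big_nat_widenl _ 0%N) // [RHS](big_nat_widen _ _ k.+1); last exact: ltnW.
    rewrite [LHS]big_nat_cond [RHS]big_nat_cond; apply: eq_bigl => i /=.
    case: (ltnP i k.+1) => //= ik; case: (ltnP i k) => [ik'|ik']; rewrite ?andbT ?andbF /=.
      by rewrite !inE !inordK //; move: ta atk; clear; lia.
    by apply/esym/negbTE; move: ik' ik atk; clear; lia.
  rewrite (big_cat_nat (n := a)) /=; [|by clear; lia|by clear; lia].
  rewrite mulrC; apply: (@le_trans _ _ (Fr (phi s2).1 * Fl (phi s2).2)); last by [].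
  have zr : at_pos s2 (a + t.+1) = s1 jr.
    rewrite out //; last by clear; lia.
    by rewrite -[RHS]at_eq.
  have zl : at_pos s2 (a - t.+1) = s1 jl.
    rewrite out //; last by move: ta; clear; lia.
    by rewrite -[RHS]at_eq.
  have -> : Fr (phi s2).1 = \prod_(a <= i < a + t.+1) wt s1 p (at_pos s2 i) (at_pos s2 i.+1).
    rewrite /Fr /= -a2 (@chain_iota R k n p s1 avail _ (at_pos s2) _ a t).
    - rewrite addnS big_nat_recr ?leq_addr //=; congr (_ * _); rewrite /endpoint -zr -addnS.
      rewrite ifN //; case: (t) atk => [|t'] h; apply: ne => //; move: h; clear; try lia.
    - by move=> i hi; apply: inD; move: hi; clear; lia.
    - by move=> _; apply: ne => //; move: atk; clear; lia.
    - by move=> i hi hi2; apply: ne; move: hi2 atk; clear; lia.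
  have -> : Fl (phi s2).2 = \prod_(a - t.+1 <= i < a) wt s1 p (at_pos s2 i) (at_pos s2 i.+1).
    rewrite /Fl /= -a2 -{1 2}[a in at_pos s2 a](subn0 a).
    rewrite (@chain_iota R k n p s1 avail _ (fun i => at_pos s2 (a - i)) _ 0 t).
    - rewrite add0n; have -> : endpoint s1 p jl match t with 0%N => at_pos s2 (a - 0) | t'.+1 => at_pos s2 (a - (0 + t')) end
          (at_pos s2 (a - t)) = wt s1 p (at_pos s2 (a - t)) (at_pos s2 (a - t.+1)).
        rewrite /endpoint -zl ifN //; case: (t) ta => [|t'] h; apply: ne; move: h aK; clear; try lia.
      rewrite -(big_nat_recr t 0 (fun i => wt s1 p (at_pos s2 (a - i)) (at_pos s2 (a - i.+1)))) //.
      rewrite [RHS]big_nat_rev /= -{1}[(a - t.+1)%N]add0n [RHS]big_addn.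
      have -> : (a - (a - t.+1) = t.+1)%N by move: ta; clear; lia.
      rewrite !big_nat; apply: eq_bigr => i hi; rewrite wt_sym.
      congr (wt s1 p (at_pos s2 _) (at_pos s2 _)); move: hi ta; clear; lia.
    - by move=> i hi; apply: inD; move: hi ta; clear; lia.
    - by move=> h; apply: ne; move: aK ta h; clear; lia.
    - by move=> i hi hi2; apply: ne; move: hi2 atk ta; clear; lia.
  exact: lexx.
have q_e : (p * #|avail|%:R)^-1 = q by rewrite avail_card.
have half (j : 'I_K) : (a + t.+1 = j \/ a = j + t.+1 :> nat)%N ->
    chains s1 p avail (endpoint s1 p j) t v0 v0 <= f%:R ^+ t * B.
  move=> hj; have := @half_chain_le R K n s1 p avail l t j si p01 _ _ _ _ v0 (inord a).
  rewrite q_e avail_card -/v0; apply => //.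
  - by rewrite ltr0n.
  - by rewrite -block_card; apply: eq_card => i; rewrite inE avail_mem.
  - by rewrite inordK.
apply: (@le_trans _ _ (\sum_(s2 in S) Fr (phi s2).1 * Fl (phi s2).2)).
  rewrite [leLHS]big_mkcond [leRHS]big_mkcond; apply: ler_sum => s2 _.
  rewrite [s2 \in S]inE; case: ifP => //= hc; rewrite /meet !finset.big_set1.
  have [e|e] := boolP (at_pos s2 a == v0).
    rewrite -[s1 _]/v0 -(eqP e) eqxx mulr1; apply: step; by rewrite inE hc.
  by rewrite eq_sym -[s1 _]/v0 (negbTE e) mulr0.
rewrite -(big_imset (fun z => Fr z.1 * Fl z.2)) /=; last exact: phi_inj.
apply: (@le_trans _ _ (\sum_z Fr z.1 * Fl z.2)).
  by rewrite [leRHS](bigID (mem (phi @: S))) /= lerDl sumr_ge0 // => z _; rewrite mulr_ge0.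
rewrite -(pair_big xpredT xpredT (fun u v => Fr u * Fl v)) /=.
rewrite (eq_bigr (fun u => Fr u * \sum_v Fl v)); last by move=> u _; rewrite mulr_sumr.
rewrite -mulr_suml.
have hr := half jr (or_introl erefl).
have hl : chains s1 p avail (endpoint s1 p jl) t v0 v0 <= f%:R ^+ t * B.
  by apply: half; right; rewrite /=; move: ta; clear; lia.
apply: (@le_trans _ _ ((f%:R ^+ t * B) * (f%:R ^+ t * B))).
  by apply: ler_pM => //; apply: sumr_ge0.
have fr : 0 < f%:R :> R by rewrite ltr0n.
have -> : f%:R ^+ t * B * (f%:R ^+ t * B) = B ^+ 2 / f%:R * f%:R ^+ l.
  have pw (u b : R) : u != 0 -> u ^+ t * b * (u ^+ t * b) = b ^+ 2 / u * u ^+ t.*2.+1.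
    by move=> u0; rewrite [u ^+ t.*2.+1]exprS -addnn exprD; field.
  by apply: pw; rewrite gt_eqF.
have -> : #|cls block s1|%:R * (2 * B ^+ 2 / f%:R) = B ^+ 2 / f%:R * (2 * #|cls block s1|%:R) by ring.
apply: ler_wpM2l; last exact: cls_card.
by apply: divr_ge0; [exact: sqr_ge0|exact: ltW].
Qed.

End Position.

Variable est : graph n -> {set 'I_n}.
Hypothesis est_card : forall G, #|est G| = K.

Lemma block_position (a : nat) (eps : R) : (t < a)%N -> (a + t < k)%N -> 0 < eps ->
  av (fun s : ff => E0 (fun G => (s (inord a) \in est (G :|: planted K n s))%:R)) <=
    2^-1 * (eps * K%:R + eps^-1 * (2 * B ^+ 2 / f%:R)).
Proof.
move=> ta atk e0.
have := @replica_overlap R lam K n Kn p01 (block a) [set inord a] est est_card eps (2 * B ^+ 2 / f%:R) e0.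
have -> : av (fun s : ff => E0 (fun G => hits [set inord a] est s (G :|: planted K n s))) =
  av (fun s : ff => E0 (fun G => (s (inord a) \in est (G :|: planted K n s))%:R)) :> R.
  by apply: av_ext => s si; apply: ex_ext => G; rewrite /hits finset.big_set1.
apply=> s si s1 hs1.
have sim1 : sim (block a) s s1 by move: hs1; rewrite inE => /andP[].
rewrite (cls_eq sim1); apply: block_sum => //.
by move: hs1; rewrite !inE => /andP[/injectiveP].
Qed.

(** Positions within [t] of an end have no full window and are simply counted as recovered; there
    are at most [2 (t + 1)] of them. *)
Lemma block_overlap (eps : R) : 0 < eps ->
  overlap lam K n est <= (2 * t.+1)%:R + K%:R * (2^-1 * (eps * K%:R + eps^-1 * (2 * B ^+ 2 / f%:R))).
Proof.
move=> e0; rewrite overlapE; set Y := 2^-1 * _.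
have Y0 : 0 <= Y.
  apply: mulr_ge0; first by rewrite invr_ge0.
  apply: addr_ge0; first by rewrite mulr_ge0 // ltW.
  apply: mulr_ge0; first by rewrite invr_ge0 ltW.
  by apply: divr_ge0 => //; apply: mulr_ge0 => //; exact: sqr_ge0.
pose h (i : 'I_K) (s : ff) : R := E0 (fun G => (s i \in est (G :|: planted K n s))%:R).
have -> : av (fun s : ff => E0 (fun G => #|est (G :|: planted K n s) :&: hidden K n s|%:R)) = \sum_(i < K) av (h i).
  rewrite (av_ext (F' := fun s => \sum_(i < K) h i s)); last first.
    by move=> s si; rewrite /h -ex_sum; apply: ex_ext => G; rewrite card_est_hidden.
  by rewrite /av exchange_big mulr_sumr.
pose good (i : 'I_K) := (t < i)%N && (i + t < k)%N.
apply: (@le_trans _ _ (\sum_(i < K) ((~~ good i)%:R + Y))).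
  apply: ler_sum => i _; case: (boolP (good i)) => [/andP[h1 h2]|_] /=.
    rewrite add0r; have := block_position h1 h2 e0; rewrite -/Y inord_val; exact.
  apply: (@le_trans _ _ 1); last by rewrite lerDl.
  rewrite -[leRHS](av_cst Kn); apply: av_le => s si; rewrite -[leRHS](ex_cst p n 1).
  by apply: ex_le => // G; case: (_ \in _).
rewrite big_split /= sumr_const card_ord -[Y *+ _]mulr_natl lerD2r -natr_sum ler_nat.
have cnt m : (\sum_(0 <= i < m) (i <= t) = minn m t.+1)%N.
  elim: m => [|m IH]; first by rewrite big_geq.
  by rewrite big_nat_recr //= IH; clear; lia.
apply: (@leq_trans (\sum_(i < K) ((i <= t) + (k <= i + t)))%N).
  by apply: leq_sum => i _; rewrite /good; clear; lia.
rewrite big_split /= -(big_mkord xpredT (fun i => (i <= t) : nat)) -(big_mkord xpredT (fun i => (k <= i + t) : nat)).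
rewrite [X in (_ + X)%N]big_nat_rev /= [X in (_ + X)%N](eq_big_nat _ _ (F2 := fun i => (i <= t) : nat)); last first.
  by move=> i hi; congr nat_of_bool; move: hi; clear; lia.
by rewrite cnt; clear; lia.
Qed.

End Block.

Section Asymptotics.
Local Open Scope classical_set_scope.

(** * Asymptotic tools *)

Lemma eventuallyE (P : nat -> Prop) :
  (\forall n \near \oo, P n) <-> exists N, forall n, (N <= n)%N -> P n.
Proof. by split=> [[N _ h]|[N h]]; exists N => // n; exact: h. Qed.

Lemma eventually_and (P Q : nat -> Prop) :
  (exists N, forall n, (N <= n)%N -> P n) -> (exists N, forall n, (N <= n)%N -> Q n) ->
  exists N, forall n, (N <= n)%N -> P n /\ Q n.
Proof.
move=> [N h] [N' h']; exists (maxn N N') => n; rewrite geq_max => /andP[a b].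
by split; [exact: h|exact: h'].
Qed.

Section Tools.
Context {R : realType}.

Lemma cvg0E (u : nat -> R) : u @ \oo --> (0 : R) <->
  forall e, 0 < e -> exists N, forall n, (N <= n)%N -> `|u n| <= e.
Proof.
split=> [/cvgrPdist_le h e e0|h].
  have /eventuallyE[N hN] := h e e0; exists N => n /hN.
  by rewrite sub0r normrN.
apply/cvgrPdist_le => e e0; apply/eventuallyE; have [N hN] := h e e0.
by exists N => n /hN; rewrite sub0r normrN.
Qed.

Lemma cvgyE (u : nat -> R) : u @ \oo --> +oo ->
  forall A, exists N, forall n, (N <= n)%N -> A <= u n.
Proof. by move=> /cvgryPge h A; apply/eventuallyE; exact: h. Qed.

Lemma natr_large (A : R) : exists N, forall n, (N <= n)%N -> A <= n%:R.
Proof.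
exists (Num.truncn A).+1 => n hn; apply: ltW; apply: lt_le_trans (truncnS_gt A) _.
by rewrite ler_nat.
Qed.

(** With [y = - ln rho / (m + 1)], the power [rho ^+ n] is the inverse of [expR (n y) ^+ m.+1], and
    [expR z >= z] gains one power of [n] over the polynomial factor. *)
Lemma pow_geometric_le (rho C : R) m : 0 < rho < 1 ->
  exists N, forall n, (N <= n)%N -> C * (n.+1%:R ^+ m * rho ^+ n) <= 1.
Proof.
move=> /andP[r0 r1]; pose y := - ln rho / m.+1%:R.
have y0 : 0 < y by rewrite divr_gt0 // oppr_gt0 ln_lt0 // r0.
have [N hN] := natr_large (`|C| * 2 ^+ m / y ^+ m.+1).
exists N.+1 => n hn; have n0 : (0 < n)%N by apply: leq_trans hn.
have nr : 0 < n%:R :> R by rewrite ltr0n.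
have rE : rho ^+ n = (expR (n%:R * y) ^+ m.+1)^-1.
  have -> : rho ^+ n = expR (n%:R * ln rho) by rewrite expRM_natl lnK.
  rewrite -expRM_natl -expRN; congr expR; rewrite /y; field.
  by rewrite gt_eqF // (_ : 1 + m%:R = m.+1%:R) // -natr1 addrC.
have h1 : n%:R * y <= expR (n%:R * y) by apply: le_trans (expR_ge1Dx _); rewrite lerDr.
have ny : 0 < n%:R * y by rewrite mulr_gt0.
have h2 : rho ^+ n <= ((n%:R * y) ^+ m.+1)^-1.
  rewrite rE lef_pV2 ?posrE ?exprn_gt0 ?expR_gt0 //.
  by rewrite lerXn2r // ?nnegrE ?expR_ge0 // ltW.
apply: (@le_trans _ _ (`|C| * ((2 * n%:R) ^+ m * ((n%:R * y) ^+ m.+1)^-1))).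
  apply: (@le_trans _ _ (`|C| * (n.+1%:R ^+ m * rho ^+ n))).
    by rewrite ler_wpM2r ?ler_norm // mulr_ge0 ?exprn_ge0 // ltW.
  rewrite ler_wpM2l //; apply: ler_pM; rewrite ?exprn_ge0 ?(ltW r0) //.
  rewrite lerXn2r ?nnegrE // -?natrM ?ler_nat ?ler0n //; move: n0; clear; lia.
have -> : `|C| * ((2 * n%:R) ^+ m * ((n%:R * y) ^+ m.+1)^-1) = `|C| * 2 ^+ m / y ^+ m.+1 / n%:R.
  rewrite exprMn exprMn !exprS; field.
  by rewrite !expf_neq0 ?gt_eqF.
by rewrite ler_pdivrMr // mul1r hN // ltnW.
Qed.

Lemma edge_probE (lam : R) : 0 < lam -> exists N, forall n, (N <= n)%N ->
  edge_prob lam n = lam / n%:R /\ 0 < edge_prob lam n <= 1.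
Proof.
move=> l0; have [N hN] := natr_large lam; exists N.+1 => n hn.
have n0 : 0 < n%:R :> R by rewrite ltr0n (leq_trans _ hn).
have h : lam / n%:R <= 1 by rewrite ler_pdivrMr // mul1r hN // ltnW.
have -> : edge_prob lam n = lam / n%:R by rewrite /edge_prob; apply/min_idPr.
by split => //; rewrite h divr_gt0.
Qed.

End Tools.

(** * Impossibility *)

Section Impossible.
Context {R : realType}.
Variables (lam : R) (K : nat -> nat).
Hypotheses (lam0 : 0 < lam) (Kn : forall n, (K n <= n)%N).

Definition small_second_moment (e : R) (n : nat) := exists g : R,
  (forall m, (m <= K n)%N -> \sum_(i < m.+1) lam^-1 ^+ i <= g) /\ (K n)%:R ^+ 2 / n%:R * g <= e.

Lemma geom_edge_prob n m : (0 < n)%N -> edge_prob lam n = lam / n%:R ->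
  geom lam n m = \sum_(i < m.+1) lam^-1 ^+ i.
Proof.
move=> n0 pE; rewrite /geom pE; apply: eq_bigr => i _; congr (_^-1 ^+ _).
by rewrite mulrVK // unitfE pnatr_eq0 -lt0n.
Qed.

Lemma TV0_le n (eps : R) : 0 < edge_prob lam n <= 1 -> 0 < eps -> TV lam 0 n <= 4^-1 * eps.
Proof.
move=> p01 e0; apply: le_trans (TV_le (leq0n n) p01 e0) _; rewrite ex_lr2 //.
rewrite (av_ext (F' := fun _ => 1)) ?av_cst ?subrr ?mulr0 ?addr0 //.
move=> s _; rewrite (av_ext (F' := fun _ => 1)) ?av_cst // => s' _.
have -> : planted 0 n s = finset.set0.
  apply/finset.setP => e; rewrite [RHS]inE; apply/negbTE/negP => /imsetP[f].
  by rewrite inE => /existsP[[]].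
by rewrite finset.set0I cards0 expr0 invr1.
Qed.

Lemma TV_ge0 n : 0 <= TV lam (K n) n.
Proof. by rewrite /TV mulr_ge0 ?invr_ge0 // sumr_ge0. Qed.

Lemma second_moment_detection :
  (forall e, 0 < e -> exists N, forall n, (N <= n)%N -> small_second_moment e n) ->
  detection_impossible lam K.
Proof.
move=> h; apply/cvg0E => e e0.
have m0 : 0 < Num.min 6^-1 (e ^+ 2 / 6) by rewrite lt_min invr_gt0 ltr0n /= divr_gt0 // exprn_gt0.
have [N hN] := eventually_and (h _ m0) (edge_probE lam0).
exists N.+1 => n hn; have [[g [hg he]] [pE p01]] := hN n (ltnW hn).
have n0 : (0 < n)%N by apply: leq_trans hn.
rewrite ger0_norm ?TV_ge0 //; move: hg he; case kE : (K n) => [|k] hg he.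
  by apply: le_trans (TV0_le p01 e0) _; lra.
have Kn' : (k.+1 <= n)%N by rewrite -kE.
move: he; rewrite le_min => /andP[he1 he2].
have hg' m : (m <= k.+1)%N -> geom lam n m <= g by move=> hm; rewrite geom_edge_prob // hg.
apply: le_trans (full_TV Kn' p01 hg' he1 e0) _.
set eta := _ * g in he1 he2 *.
have : e^-1 * (6 * eta) <= e.
  rewrite ler_pdivrMl //; move: he2; rewrite expr2; lra.
lra.
Qed.

Lemma overlap0 n (est : graph n -> {set 'I_n}) : (forall G, #|est G| = 0%N) -> overlap lam 0 n est = 0.
Proof.
move=> h; rewrite /overlap big1 // => i _; rewrite big1 // => s _; rewrite big1 // => G _.
have /eqP := h (G :|: planted 0 n s); rewrite cards_eq0 => /eqP ->.
by rewrite finset.set0I inE mulr0.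
Qed.

Lemma second_moment_overlap n (eps : R) (est : graph n -> {set 'I_n}) : (0 < n)%N -> edge_prob lam n = lam / n%:R ->
  0 < edge_prob lam n <= 1 ->
  0 < eps -> small_second_moment (Num.min 6^-1 (eps ^+ 2 / 8)) n ->
  (forall G, #|est G| = K n) -> overlap lam (K n) n est <= eps * (K n)%:R.
Proof.
move=> n0 pE p01 e0 [g []]; move: (Kn n); case: (K n) => [|k] Kn' hg he hest.
  by rewrite overlap0 // mulr0.
move: he; rewrite le_min => /andP[he1 he2].
have hg' m : (m <= k.+1)%N -> geom lam n m <= g by move=> hm; rewrite geom_edge_prob // hg.
apply: le_trans (full_overlap Kn' p01 hg' he1 hest e0) _.
set eta := _ * g in he1 he2 *.
have : eps^-1 * (8 * eta) <= eps.
  rewrite ler_pdivrMl //; move: he2; rewrite expr2; lra.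
rewrite mulrCA => h; have := ler_wpM2l (ler0n R k.+1) h; lra.
Qed.

Lemma second_moment_reconstruction :
  (forall e, 0 < e -> exists N, forall n, (N <= n)%N -> small_second_moment e n) ->
  reconstruction_impossible lam K.
Proof.
move=> h est hest eps e0; apply/eventuallyE.
have m0 : 0 < Num.min 6^-1 (eps ^+ 2 / 8) by rewrite lt_min invr_gt0 ltr0n /= divr_gt0 // exprn_gt0.
have [N hN] := eventually_and (h _ m0) (edge_probE lam0).
exists N.+1 => n hn; have [hs [pE p01]] := hN n (ltnW hn).
by apply: second_moment_overlap => //; exact: leq_trans hn.
Qed.

Lemma subcritical_second_moment : lam < 1 ->
  (fun n : nat => (ln (n%:R : R) / ln (lam^-1) - (K n)%:R) / ln (ln (n%:R : R))) @ \oo --> +oo ->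
  forall e, 0 < e -> exists N, forall n, (N <= n)%N -> small_second_moment e n.
Proof.
move=> lam1 /cvgyE h e e0; set L := ln lam^-1 in h.
have L0 : 0 < L by rewrite /L ln_gt0 // invf_gt1.
have lnlarge (A : R) : exists N, forall n, (N <= n)%N -> A <= ln (n%:R : R).
  have [N hN] := natr_large (expR A); exists N => n /hN hA.
  by rewrite -[A]expRK ler_ln // posrE ?expR_gt0 // (lt_le_trans (expR_gt0 A)).
(* A margin of [4 / L] times [ln ln n] gives [lam ^- K <= n / (ln n) ^ 4]. Three of the four
   logarithms pay for the factor [K ^ 2 (K + 1)], and the fourth makes the product small. *)
have [N hN] := eventually_and (h (4 / L)) (lnlarge (Num.max 3 (2 / (L ^+ 3 * e)))).
exists N.+1 => n hn; have [h1 h2] := hN n (ltnW hn).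
have n0 : 0 < n%:R :> R by rewrite ltr0n (leq_trans _ hn).
set x := ln n%:R in h1 h2; set k := (K n)%:R in h1 *.
move: h2; rewrite ge_max => /andP[x3 h2].
have x0 : 0 < x by apply: lt_le_trans x3.
have lx0 : 0 < ln x by rewrite ln_gt0 // (lt_le_trans _ x3) // ltr1n.
have h3 : k * L <= x - 4 * ln x.
  move: h1; rewrite ler_pdivlMr // => h1.
  have := ler_wpM2r (ltW L0) h1.
  have -> : 4 / L * ln x * L = 4 * ln x by field; rewrite gt_eqF.
  have -> : (x / L - k) * L = x - k * L by field; rewrite gt_eqF.
  lra.
have kx : k <= x / L by rewrite ler_pdivlMr //; lra.
have il0 : 0 < lam^-1 by rewrite invr_gt0.
have il1 : 1 <= lam^-1 by rewrite invf_ge1 // ltW.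
have pw : lam^-1 ^+ K n <= n%:R / x ^+ 4.
  rewrite -{1}[lam^-1]lnK // -expRM_natl -/L -/k.
  apply: (@le_trans _ _ (expR (x - 4 * ln x))); first by rewrite ler_expR.
  by rewrite expRD expRN expRM_natl !lnK.
exists ((K n).+1%:R * (n%:R / x ^+ 4)); split.
  move=> m hm; apply: (@le_trans _ _ (\sum_(i < m.+1) (n%:R / x ^+ 4))).
    apply: ler_sum => i _; apply: le_trans pw; apply: ler_weXn2l => //.
    by apply: leq_trans hm; rewrite -ltnS.
  by rewrite sumr_const card_ord -[_ *+ _]mulr_natl ler_wpM2r ?ler_nat // divr_ge0 ?exprn_ge0 // ltW.
have -> : k ^+ 2 / n%:R * ((K n).+1%:R * (n%:R / x ^+ 4)) = k ^+ 2 * (K n).+1%:R / x ^+ 4.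
  by field; rewrite !gt_eqF.
have k0 : 0 <= k by rewrite ler0n.
have h4 : k ^+ 2 * (K n).+1%:R <= 2 * k ^+ 3.
  rewrite /k; case: (K n) => [|m]; first by rewrite !expr0n /= mul0r mulr0.
  rewrite [_ ^+ 3]exprSr [leRHS]mulrCA; apply: ler_wpM2l; first by rewrite exprn_ge0.
  by rewrite -natrM ler_nat; clear; lia.
apply: (@le_trans _ _ (2 * (x / L) ^+ 3 / x ^+ 4)).
  rewrite ler_wpM2r ?invr_ge0 ?exprn_ge0 ?(ltW x0) //; apply: le_trans h4 _.
  by rewrite ler_wpM2l // lerXn2r // nnegrE // divr_ge0 // ltW.
have -> : 2 * (x / L) ^+ 3 / x ^+ 4 = 2 / (L ^+ 3 * e) / x * e.
  by field; rewrite !gt_eqF.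
by rewrite -[leRHS]mul1r ler_wpM2r ?(ltW e0) // ler_pdivrMr // mul1r.
Qed.

Section Supercritical.
Hypothesis lam1 : 1 < lam.
Let r : R := lam^-1.
Let r0 : 0 < r. Proof. by rewrite invr_gt0. Qed.
Let r1 : r < 1. Proof. by rewrite invf_lt1. Qed.

Lemma geometric_le m : \sum_(i < m.+1) r ^+ i <= (1 - r)^-1.
Proof.
have r2 : 0 < 1 - r by rewrite subr_gt0.
rewrite -[leRHS]mul1r ler_pdivlMr //.
have -> : (\sum_(i < m.+1) r ^+ i) * (1 - r) = 1 - r ^+ m.+1.
  by rewrite mulrC -[1 - r ^+ m.+1]opprB subrX1 -mulNr opprB.
by rewrite lerBlDr lerDl exprn_ge0 // ltW.
Qed.

Lemma supercritical_second_moment :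
  (fun n : nat => (K n)%:R / Num.sqrt (n%:R : R)) @ \oo --> (0 : R) ->
  forall e, 0 < e -> exists N, forall n, (N <= n)%N -> small_second_moment e n.
Proof.
move=> /cvg0E h e e0.
have r2 : 0 < 1 - r by rewrite subr_gt0.
pose e' := Num.min 1 (e * (1 - r)).
have e'0 : 0 < e' by rewrite lt_min ltr01 mulr_gt0.
have [N hN] := h _ e'0; exists N => n /hN hn.
exists (1 - r)^-1; split; first by move=> m _; exact: geometric_le.
have -> : (K n)%:R ^+ 2 / n%:R = ((K n)%:R / Num.sqrt n%:R) ^+ 2 :> R.
  by rewrite exprMn exprVn sqr_sqrtr.
rewrite ger0_norm in hn; last by rewrite divr_ge0 // sqrtr_ge0.
set y := _ / _ in hn *; have y0 : 0 <= y by rewrite divr_ge0 // sqrtr_ge0.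
move: hn; rewrite le_min => /andP[y1 ye].
rewrite ler_pdivrMr //; apply: le_trans ye; by rewrite expr2 ler_piMl.
Qed.

Lemma eighth_root n : exists t, (t ^ 8 <= n < t.+1 ^ 8)%N.
Proof.
elim: n => [|n [t /andP[h1 h2]]]; first by exists 0%N.
have [h|h] := leqP (t.+1 ^ 8) n.+1; last by exists t; rewrite h andbT (leq_trans h1).
exists t.+1; rewrite h /=; apply: leq_ltn_trans h2 _; by rewrite ltn_exp2r.
Qed.

(** With only [f] vertices available the ratio [q] can exceed [1 / lam]; as long as
    [K <= (1 - r / rho) n] it stays below this midpoint between [1 / lam] and [1]. *)
Let rho : R := (1 + r) / 2.
Let rho0 : 0 < rho. Proof. by rewrite /rho; have := r0; set z := r; lra. Qed.
Let rho1 : rho < 1. Proof. by rewrite /rho; have := r1; set z := r; lra. Qed.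
Let B0 : R := 2 * (4 / (1 - rho) ^+ 2) + 1.

(** From [t ^ 8 <= n < K ^ 4] follows [t ^ 2 <= K], so the ends of the path are negligible;
    [n < (t + 1) ^ 8] turns the geometric condition into [q ^+ t <= p]; and [n >= 32 t ^ 3] leaves
    room for the quadratic conditions on the window. *)
Lemma block_regime (eps : R) n t (est : graph n -> {set 'I_n}) : 0 < eps -> edge_prob lam n = lam / n%:R ->
  0 < edge_prob lam n <= 1 -> (forall G, #|est G| = K n) ->
  (n < K n ^ 4)%N -> (t ^ 8 <= n < t.+1 ^ 8)%N -> (2 <= t)%N -> 24 <= t%:R * (1 - rho) -> 8 / eps <= t%:R ->
  r * (t.+1%:R ^+ 8 * rho ^+ t) <= 1 ->
  (K n)%:R <= Num.min 2^-1 (Num.min (1 - r / rho) (eps ^+ 2 / (16 * B0 ^+ 2))) * n%:R ->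
  overlap lam (K n) n est <= eps * (K n)%:R.
Proof.
move=> e0 pE p01; move: (Kn n); case: (K n) => [|k] Kn' hest hK /andP[ht1 ht2] t2 t24 te hgeo.
  by [].
rewrite !minr_pMl ?ler0n // !le_min => /andP[hd1 /andP[hd2 hd3]].
have t2r : 2 <= t%:R :> R by rewrite ler_nat.
have n0 : (0 < n)%N by apply: leq_trans Kn'.
have nr : 0 < n%:R :> R by rewrite ltr0n.
set l := t.*2.+1; set f := (n - k.+1 + l)%N.
have fn : n%:R - k.+1%:R <= f%:R :> R by rewrite /f natrD natrB // lerDl.
have f2 : n%:R / 2 <= f%:R :> R by apply: le_trans fn; lra.
have f0 : 0 < f%:R :> R by apply: lt_le_trans f2; rewrite divr_gt0.
have pf : rho^-1 <= edge_prob lam n * f%:R.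
  rewrite pE mulrAC ler_pdivlMr //; apply: (@le_trans _ _ (lam * (n%:R - k.+1%:R))); last by rewrite ler_pM2l.
  have : n%:R * (r / rho) <= n%:R - k.+1%:R by rewrite mulrC; lra.
  move=> h; have := ler_wpM2l (ltW lam0) h; rewrite (_ : lam * (n%:R * (r / rho)) = rho^-1 * n%:R) //.
  by rewrite /r; field; rewrite !gt_eqF.
set q := (edge_prob lam n * f%:R)^-1.
have qrho : q <= rho by rewrite /q -[rho]invrK lef_pV2 ?posrE ?invr_gt0 // mulr_gt0 //; case/andP: p01.
have q0 : 0 < q by rewrite invr_gt0 mulr_gt0 //; case/andP: p01.
have q1 : q < 1 by apply: le_lt_trans rho1.
have t8 : 32 * t%:R ^+ 3 <= n%:R :> R.
  apply: (@le_trans _ _ (t ^ 8)%:R); last by rewrite ler_nat.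
  rewrite (_ : 8 = 5 + 3)%N // expnD natrM [(t ^ 3)%:R]natrX; apply: ler_wpM2r; first by rewrite exprn_ge0.
  by rewrite -[32]/((2 ^ 5)%:R) ler_nat leq_exp2r.
have le : l%:R = 2 * t%:R + 1 :> R by rewrite /l -natr1 -mul2n natrM.
have ltf : 4 * t%:R * l%:R <= f%:R * (1 - q).
  apply: (@le_trans _ _ (f%:R * (1 - rho))); last by rewrite ler_wpM2l ?(ltW f0) // lerB.
  apply: (@le_trans _ _ (n%:R / 2 * (1 - rho))); last by rewrite ler_wpM2r // subr_ge0 ltW.
  apply: (@le_trans _ _ (16 * t%:R ^+ 3 * (1 - rho))); last first.
    by rewrite ler_wpM2r ?subr_ge0 ?(ltW rho1) //; lra.
  apply: (@le_trans _ _ (16 * t%:R ^+ 2 * 24)).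
    by rewrite le expr2; nra.
  by rewrite [_ ^+ 3]exprSr mulrA -[leRHS]mulrA ler_wpM2l // mulr_ge0 // exprn_ge0.
have qt : q ^+ t <= edge_prob lam n.
  apply: (@le_trans _ _ (rho ^+ t)); first by rewrite lerXn2r // nnegrE ltW.
  rewrite pE ler_pdivlMr //; apply: (@le_trans _ _ (t.+1%:R ^+ 8 * rho ^+ t)).
    by rewrite mulrC ler_wpM2r ?exprn_ge0 ?(ltW rho0) // -natrX ler_nat ltnW.
  by move: hgeo; rewrite /r ler_pdivrMl // mulr1.
have l2f : (2 * l ^ 2 <= f)%N.
  rewrite -(ler_nat R) natrM natrX le; apply: le_trans f2.
  have h : 16 * (t%:R * t%:R ^+ 2) <= n%:R / 2 :> R by move: t8; rewrite exprS; lra.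
  apply: le_trans h.
  have : t%:R ^+ 2 * 2 <= t%:R * t%:R ^+ 2 :> R by rewrite mulrC ler_wpM2r ?exprn_ge0.
  rewrite !expr2; nra.
have Kr : 0 < k.+1%:R :> R by rewrite ltr0n.
(* This parameter makes the first term of the bound a fixed fraction of [eps] per position and the
   second of order [K / n]. *)
have e'0 : 0 < eps / (2 * k.+1%:R) by rewrite divr_gt0 // mulr_gt0.
apply: le_trans (block_overlap Kn' p01 q1 ltf qt l2f hest e'0) _.
rewrite -/l -/f -/q; set B := 2 * _ + 1.
have Bge : 0 <= B by rewrite addr_ge0 // mulr_ge0 // divr_ge0 // exprn_ge0 // subr_ge0 ltW.
have BB : B <= B0.
  rewrite /B /B0 lerD2r ler_wpM2l // ler_wpM2l // lef_pV2 ?posrE ?exprn_gt0 ?subr_gt0 //.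
  by rewrite lerXn2r ?nnegrE ?subr_ge0 ?lerB // ltW.
have Kt : t%:R ^+ 2 <= k.+1%:R :> R.
  rewrite -natrX ler_nat -(leq_exp2r _ _ (isT : 0 < 4)%N) -expnM.
  by apply: ltnW; apply: leq_ltn_trans hK.
have part1 : (2 * t.+1)%:R <= eps / 2 * k.+1%:R.
  apply: (@le_trans _ _ (eps / 2 * t%:R ^+ 2)); last by rewrite ler_wpM2l // divr_ge0 // ltW.
  rewrite natrM -[t.+1%:R]natr1; move: te; rewrite ler_pdivrMr // => te.
  have : t%:R * 8 <= t%:R * (t%:R * eps) by rewrite ler_wpM2l.
  rewrite expr2; lra.
apply: (@le_trans _ _ (eps / 2 * k.+1%:R + k.+1%:R * (eps / 2))); last by lra.
apply: lerD => //; rewrite ler_wpM2l //.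
have -> : eps / (2 * k.+1%:R) * k.+1%:R = eps / 2 by field; rewrite gt_eqF // ltr0n.
rewrite invf_div.
suff : 2 * k.+1%:R / eps * (2 * B ^+ 2 / f%:R) <= eps / 2 by lra.
have Bp : 0 < 16 * B0 ^+ 2 by rewrite mulr_gt0 // exprn_gt0 // (lt_le_trans _ (_ : 1 <= _)) // lerDr mulr_ge0 // divr_ge0 // exprn_ge0 // subr_ge0 ltW.
have -> : 2 * k.+1%:R / eps * (2 * B ^+ 2 / f%:R) = 4 * (k.+1%:R * B ^+ 2) / (eps * f%:R).
  by field; rewrite !gt_eqF.
rewrite ler_pdivrMr ?mulr_gt0 //.
have h1 : k.+1%:R * B ^+ 2 <= k.+1%:R * B0 ^+ 2 by rewrite ler_wpM2l // lerXn2r // nnegrE (le_trans Bge).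
have h2 : k.+1%:R * B0 ^+ 2 * 16 <= eps ^+ 2 * n%:R.
  move: hd3; rewrite mulrAC ler_pdivlMr //; lra.
have h3 : eps ^+ 2 * n%:R <= 2 * (eps ^+ 2 * f%:R).
  by rewrite mulrCA ler_wpM2l ?sqr_ge0 //; lra.
move: h1 h2 h3; rewrite !expr2; lra.
Qed.

Lemma supercritical_reconstruction :
  (fun n : nat => (K n)%:R / (n%:R : R)) @ \oo --> (0 : R) -> reconstruction_impossible lam K.
Proof.
move=> /cvg0E h est hest eps e0; apply/eventuallyE.
set d := Num.min 2^-1 (Num.min (1 - r / rho) (eps ^+ 2 / (16 * B0 ^+ 2))).
have Bp : 0 < 16 * B0 ^+ 2 by rewrite mulr_gt0 // exprn_gt0 // (lt_le_trans _ (_ : 1 <= _)) // lerDr mulr_ge0 // divr_ge0 // exprn_ge0 // subr_ge0 ltW.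
have d0 : 0 < d.
  rewrite !lt_min invr_gt0 ltr0n /= divr_gt0 ?exprn_gt0 // andbT subr_gt0 ltr_pdivrMr // mul1r.
  by rewrite /rho; have := r1; set z := r; lra.
have rho01 : 0 < rho < 1 by rewrite rho0.
set m := Num.min 6^-1 (eps ^+ 2 / 8).
have m0 : 0 < m by rewrite lt_min invr_gt0 ltr0n /= divr_gt0 // exprn_gt0.
have r2 : 0 < 1 - r by rewrite subr_gt0.
have [N1 h1] := pow_geometric_le r 8 rho01.
have [N2 h2] := natr_large (24 / (1 - rho)).
have [N3 h3] := natr_large (8 / eps).
pose T := (2 + N1 + N2 + N3)%N.
have [N4 h4] := natr_large ((m * (1 - r)) ^- 2).
have [N hN] := eventually_and (h _ d0) (edge_probE lam0).
exists (N + N4 + T ^ 8).+1 => n hn.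
have hn' : (N <= n)%N by move: hn; clear; lia.
have [hd [pE p01]] := hN n hn'.
have n0 : (0 < n)%N by apply: leq_trans hn.
have nr : 0 < n%:R :> R by rewrite ltr0n.
have hK : (K n)%:R <= d * n%:R.
  by move: hd; rewrite ger0_norm ?divr_ge0 // ler_pdivrMr.
(* If [K ^ 4 <= n], then [K ^ 2 / n] is at most [n ^ (- 1/2)] and the global second moment applies;
   otherwise a window of about [n ^ (1/8)] positions is short compared with the path. *)
have [hs|hs] := leqP (K n ^ 4)%N n; last first.
  have [t /andP[ht1 ht2]] := eighth_root n.
  have Tt : (T <= t)%N.
    by rewrite -ltnS -(ltn_exp2r _ _ (isT : 0 < 8)%N); apply: leq_ltn_trans ht2; move: hn; clear; lia.
  apply: (block_regime (t := t)) => //.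
  - by rewrite ht1.
  - by move: Tt; rewrite /T; clear; lia.
  - by rewrite -ler_pdivrMr ?subr_gt0 //; apply: h2; move: Tt; rewrite /T; clear; lia.
  - by apply: h3; move: Tt; rewrite /T; clear; lia.
  - by apply: h1; move: Tt; rewrite /T; clear; lia.
apply: second_moment_overlap => //.
exists (1 - r)^-1; split; first by move=> j _; exact: geometric_le.
rewrite ler_pdivrMr // -/m; set z := m * (1 - r); have z0 : 0 < z by rewrite mulr_gt0.
have y0 : 0 <= (K n)%:R ^+ 2 / n%:R :> R by rewrite divr_ge0 ?exprn_ge0 // ltW.
rewrite -(@ler_pXn2r _ 2) // ?nnegrE ?(ltW z0) //.
apply: (@le_trans _ _ n%:R^-1).
  rewrite exprMn -exprM exprVn -natrX ler_pdivrMr ?exprn_gt0 // expr2 mulKf ?gt_eqF //.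
  by rewrite ler_nat.
rewrite -[leRHS]invrK lef_pV2 ?posrE ?invr_gt0 ?exprn_gt0 //; apply: h4; move: hn; clear; lia.
Qed.

End Supercritical.
End Impossible.

End Asymptotics.

(** * Expected numbers of paths and lollipops *)

Section PathEdges.
Variable n : nat.

Fixpoint pedges (t : seq 'I_n) : graph n :=
  if t is x :: t1 then (if t1 is y :: _ then [set x; y] |: pedges t1 else finset.set0) else finset.set0.

Lemma pedges_nth (t : seq 'I_n) d e : e \in pedges t ->
  exists i, (i.+1 < size t)%N /\ e = [set nth d t i; nth d t i.+1].
Proof.
elim: t => [|x [|y t] IH] /=; rewrite ?inE // => /orP[/eqP ->|/IH[i [hi ->]]]; first by exists 0%N.
by exists i.+1.
Qed.

Lemma pedges_notin (t : seq 'I_n) i j d : uniq t -> (i < size t)%N -> (j.+2 <= i)%N ->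
  [set nth d t i; nth d t j] \notin pedges t.
Proof.
move=> ut hi hj; apply/negP => /(pedges_nth d)[k [hk E]].
have h1 : nth d t i \in [set nth d t k; nth d t k.+1] by rewrite -E !inE eqxx.
have h2 : nth d t j \in [set nth d t k; nth d t k.+1] by rewrite -E !inE eqxx orbT.
have hjt : (j < size t)%N by move: hi hj; clear; lia.
have hk' : (k < size t)%N by exact: ltnW.
by move: h1 h2; rewrite !inE !nth_uniq //; move: hj; clear; lia.
Qed.

Lemma card_pedges (t : seq 'I_n) : uniq t -> #|pedges t| = (size t).-1.
Proof.
elim: t => [|x [|y t] IH] ut; rewrite ?cards0 //.
rewrite [pedges _]/= finset.cardsU1 -/(pedges (y :: t)) IH; last by case/andP: ut.
rewrite -[size (y :: t)]/(size t).+1 /=.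
suff -> : [set x; y] \notin pedges (y :: t) by rewrite add1n.
apply/negP => /(pedges_nth x)[i [hi E]].
have : x \in [set nth x (y :: t) i; nth x (y :: t) i.+1] by rewrite -E !inE eqxx.
rewrite !inE => hx; case/andP: ut => /negP xt _; apply: xt.
by case/orP: hx => /eqP ->; apply: mem_nth => //; exact: ltnW.
Qed.

Lemma pedges_pairs (t : seq 'I_n) : uniq t -> pedges t \subset pairs n.
Proof.
elim: t => [|x [|y t] IH] ut; rewrite ?finset.sub0set //.
rewrite [pedges _]/= finset.subUset -/(pedges (y :: t)) IH; last by case/andP: ut.
rewrite andbT finset.sub1set inE cards2; move: ut; rewrite /= inE negb_or -andbA => /andP[-> _] //.
Qed.

Lemma sorted_pedges (G : graph n) (t : seq 'I_n) : sorted (gadj G) t -> pedges t \subset G.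
Proof.
elim: t => [|x [|y t] IH]; rewrite ?finset.sub0set // => /andP[xy ht].
rewrite [pedges _]/= finset.subUset -/(pedges (y :: t)) IH // andbT finset.sub1set.
by case/andP: xy.
Qed.

End PathEdges.

Section Counts.
Context {R : realType}.
Variables (p : R) (n : nat).
Hypothesis p01 : 0 <= p <= 1.
Notation E0 := (@Ex R p n).

Definition pathb (G : graph n) (t : seq 'I_n) : bool := uniq t && sorted (gadj G) t.

Definition lollib (G : graph n) (j : nat) v (q : seq 'I_n) : bool :=
  [&& pathb G (v :: q), (j.+2 <= size q)%N & gadj G (last v q) (nth v (v :: q) j)].

Lemma path_prob (t : seq 'I_n) m : size t = m.+1 -> E0 (fun G => (pathb G t)%:R) <= p ^+ m.
Proof.
move=> st; case/andP: (p01) => p0 p1; rewrite /pathb.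
have [ut|ut] := boolP (uniq t); last by rewrite ex_cst exprn_ge0.
have <- : #|pedges t| = m by rewrite card_pedges // st.
rewrite -pr_sub ?pedges_pairs //; apply: ex_le => // G.
by rewrite ler_nat /=; case: (boolP (sorted _ _)) => // /sorted_pedges ->.
Qed.

Lemma lolli_prob j v (q : seq 'I_n) : E0 (fun G => (lollib G j v q)%:R) <= p ^+ (size q).+1.
Proof.
case/andP: (p01) => p0 p1; rewrite /lollib /pathb.
have [ut|ut] := boolP (uniq (v :: q)); last by rewrite ex_cst exprn_ge0.
have [jq|jq] := leqP j.+2 (size q); last first.
  apply: (@le_trans _ _ (E0 (fun _ => 0))); last by rewrite ex_cst exprn_ge0.
  by apply: ex_le => // G; rewrite andbF.
pose f := [set nth v (v :: q) (size q); nth v (v :: q) j].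
have fn : f \notin pedges (v :: q) by apply: pedges_notin.
have -> : (size q).+1 = #|f |: pedges (v :: q)| by rewrite finset.cardsU1 fn card_pedges.
have nz : nth v (v :: q) (size q) != nth v (v :: q) j.
  by rewrite nth_uniq //=; move: jq; clear; lia.
rewrite -pr_sub; last first.
  by rewrite finset.subUset pedges_pairs // andbT finset.sub1set inE cards2 nz.
apply: ex_le => // G; rewrite ler_nat finset.subUset finset.sub1set.
have -> : last v q = nth v (v :: q) (size q) by rewrite (last_nth v).
case: (boolP (sorted _ _)) => [/sorted_pedges ->|_]; last by [].
by case: (boolP (gadj _ _ _)) => [/andP[_]|//]; rewrite -/f => ->.
Qed.

Lemma sum_tuple_const m (c : R) (F : m.-tuple 'I_n -> R) : (forall t, F t <= c) ->
  \sum_t F t <= n%:R ^+ m * c.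
Proof.
move=> h; apply: (@le_trans _ _ (\sum_(t : m.-tuple 'I_n) c)); first by apply: ler_sum => t _.
by rewrite sumr_const card_tuple card_ord -[_ *+ _]mulr_natl natrX.
Qed.

(** These counts dominate the indicators of [cyc], [two_feet], [foot_and_tail] and [long_path], and
    their expectations are sums over vertex sequences. The index [i] in the next two is the place of
    [v] on the noise path. *)
Definition n_lolli (G : graph n) v : R :=
  \sum_(l < n) \sum_(j < l) \sum_(t : l.-tuple 'I_n) (lollib G j v t)%:R.
Definition n_two_feet (V : {set 'I_n}) (G : graph n) v : R :=
  \sum_(m < n) \sum_(i < m) \sum_(z1 in V) \sum_(z2 in V) \sum_(t : m.-tuple 'I_n)
    (pathb G (z1 :: rcons t z2) && (nth v t i == v))%:R.
Definition n_tail (V : {set 'I_n}) h (G : graph n) v : R :=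
  \sum_(i < n) \sum_(z in V) \sum_(t : (i.+1 + h).-tuple 'I_n) (pathb G (z :: t) && (nth v t i == v))%:R.
Definition n_long r (G : graph n) : R := \sum_(t : r.*2.+1.-tuple 'I_n) (pathb G t)%:R.

Lemma le_sum_term (I : finType) (P : pred I) (F : I -> R) i c : P i -> (forall i, 0 <= F i) -> c <= F i ->
  c <= \sum_(i | P i) F i.
Proof. by move=> Pi h hc; rewrite (bigD1 i) //=; apply: le_trans hc _; rewrite lerDl sumr_ge0. Qed.

Lemma n_lolli_ge0 G v : 0 <= n_lolli G v.
Proof. by do 3 (apply: sumr_ge0 => ? _). Qed.
Lemma n_two_feet_ge0 V G v : 0 <= n_two_feet V G v.
Proof. by do 5 (apply: sumr_ge0 => ? _). Qed.
Lemma n_tail_ge0 V h G v : 0 <= n_tail V h G v.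
Proof. by do 3 (apply: sumr_ge0 => ? _). Qed.
Lemma n_long_ge0 r G : 0 <= n_long r G.
Proof. by apply: sumr_ge0. Qed.

Lemma uniq_size_le (t : seq 'I_n) : uniq t -> (size t <= n)%N.
Proof. by move=> ut; rewrite -[leqRHS]card_ord -(card_uniqP ut); exact: max_card. Qed.

Lemma cyc_count (G : graph n) v : cyc (gadj G) v -> 1 <= n_lolli G v.
Proof.
move=> /(cyc_lolli (gadj_irr G))[q [u [hq uq uin eu hi]]].
have sn : (size q < n)%N by have := uniq_size_le uq.
have ji : (index u (v :: q) < size q)%N by apply: ltnW.
apply: (le_sum_term (i := Ordinal sn)) => //; first by move=> l; do 2 (apply: sumr_ge0 => ? _).
apply: (le_sum_term (i := Ordinal ji)) => //; first by move=> l; apply: sumr_ge0.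
apply: (le_sum_term (i := in_tuple q)) => //.
by rewrite /lollib /pathb uq /= hq hi nth_index // eu.
Qed.

Lemma two_feet_count K (G : graph n) (s : {ffun 'I_K -> 'I_n}) v : two_feet G s v ->
  1 <= n_two_feet (hidden K n s) G v.
Proof.
case=> a [b [z1 [z2 [h1 h2 hu hs]]]].
pose t := rev a ++ v :: b.
have E : rev (rcons a z1) ++ v :: rcons b z2 = z1 :: rcons t z2.
  by rewrite rev_rcons cat_cons /t rcons_cat.
have st : (size t < n)%N.
  by have := uniq_size_le hu; rewrite E /= size_rcons; move=> /ltnW.
have ai : (size a < size t)%N by rewrite /t size_cat size_rev /= addnS ltnS leq_addr.
apply: (le_sum_term (i := Ordinal st)) => //; first by move=> l; do 4 (apply: sumr_ge0 => ? _).
apply: (le_sum_term (i := Ordinal ai)) => //; first by move=> l; do 3 (apply: sumr_ge0 => ? _).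
apply: (le_sum_term (i := z1)) => //; first by move=> l; do 2 (apply: sumr_ge0 => ? _).
apply: (le_sum_term (i := z2)) => //; first by move=> l; apply: sumr_ge0.
apply: (le_sum_term (i := in_tuple t)) => //.
by rewrite /pathb -E hu hs /= /t nth_cat size_rev ltnn subnn /= eqxx.
Qed.

Lemma tail_count K (G : graph n) (s : {ffun 'I_K -> 'I_n}) v : foot_and_tail G s v ->
  1 <= n_tail (hidden K n s) (minn (troot K) K.-1./2) G v.
Proof.
case=> a [z [q [hz sq hu hs]]].
have E : rev (rcons a z) ++ v :: q = z :: (rev a ++ v :: q) by rewrite rev_rcons.
have an : (size a < n)%N.
  by have := uniq_size_le hu; rewrite size_cat size_rev size_rcons /=; clear; lia.
have st : size (rev a ++ v :: q) == ((size a).+1 + minn (troot K) K.-1./2)%N.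
  by rewrite size_cat size_rev /= sq addnS addSn.
apply: (le_sum_term (i := Ordinal an)) => //; first by move=> l; do 2 (apply: sumr_ge0 => ? _).
apply: (le_sum_term (i := z)) => //; first by move=> l; apply: sumr_ge0.
apply: (le_sum_term (i := Tuple st)) => //.
by rewrite /pathb -E hu hs /= nth_cat size_rev ltnn subnn /= eqxx.
Qed.

Lemma long_count K (G : graph n) : long_path K G -> 1 <= n_long K.-1./2 G.
Proof.
case=> t [st ut so]; have st' : size t == (K.-1./2).*2.+1 by apply/eqP.
by apply: (le_sum_term (i := Tuple st')) => //; rewrite /pathb ut so.
Qed.

Variable lam : R.
Hypotheses (l01 : 0 < lam < 1) (pn : p * n%:R = lam) (n0 : (0 < n)%N).
Let l0 : 0 < lam. Proof. by case/andP: l01. Qed.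
Let l1 : 0 < 1 - lam. Proof. by rewrite subr_gt0; case/andP: l01. Qed.
Let nr : 0 < n%:R :> R. Proof. by rewrite ltr0n. Qed.
Let p0 : 0 <= p. Proof. by case/andP: p01. Qed.

Lemma sum_geometric_le m : \sum_(i < m) lam ^+ i <= (1 - lam)^-1.
Proof.
rewrite -[leRHS]mul1r ler_pdivlMr // mulrC -[1 - lam]opprB mulNr -subrX1 opprB.
by rewrite lerBlDr lerDl exprn_ge0 // ltW.
Qed.

Lemma sum_arith_geometric_le m : \sum_(i < m) i%:R * lam ^+ i.+1 <= (1 - lam)^-2.
Proof.
have C0 : 0 <= (1 - lam)^-2 by rewrite invr_ge0 exprn_ge0 // ltW.
elim: m => [|m IH]; first by rewrite big_ord0.
rewrite big_ord_recl mul0r add0r.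
rewrite (eq_bigr (fun i : 'I_m => lam * (i%:R * lam ^+ i.+1) + lam ^+ 2 * lam ^+ i)); last first.
  by move=> i _; rewrite lift0 -natr1 !exprS; ring.
rewrite big_split /= -!mulr_sumr.
apply: (@le_trans _ _ (lam * (1 - lam)^-2 + lam ^+ 2 * (1 - lam)^-1)).
  apply: lerD; first by rewrite ler_wpM2l // ltW.
  by rewrite ler_wpM2l ?exprn_ge0 ?(ltW l0) // sum_geometric_le.
have -> : lam * (1 - lam)^-2 + lam ^+ 2 / (1 - lam) = (lam + lam ^+ 2 - lam ^+ 3) / (1 - lam) ^+ 2.
  by field; rewrite gt_eqF.
rewrite ler_pdivrMr ?exprn_gt0 // mulVf ?gt_eqF ?exprn_gt0 //.
have -> : lam + lam ^+ 2 - lam ^+ 3 = 1 - (1 - lam) * (1 - lam ^+ 2) by ring.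
rewrite gerBl mulr_ge0 ?(ltW l1) // subr_ge0 exprn_ile1 ?ltW //; by case/andP: l01.
Qed.

(** A lollipop on [l + 1] vertices needs [l + 1] edges and has at most [l] places where it closes,
    so the expected number is at most the sum of [l lam ^ (l + 1)], bounded uniformly in [n]. *)
Lemma ex_n_lolli : E0 (fun G => \sum_v n_lolli G v) <= (1 - lam)^-2.
Proof.
apply: le_trans (sum_arith_geometric_le n).
rewrite ex_sum; apply: (@le_trans _ _ (\sum_(v : 'I_n) \sum_(l < n) l%:R * (n%:R ^+ l * p ^+ l.+1))).
  apply: ler_sum => v _; rewrite ex_sum; apply: ler_sum => l _; rewrite ex_sum.
  apply: (@le_trans _ _ (\sum_(j < l) n%:R ^+ l * p ^+ l.+1)).
    apply: ler_sum => j _; rewrite ex_sum; apply: sum_tuple_const => t.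
    by apply: le_trans (lolli_prob _ _ _) _; rewrite size_tuple.
  by rewrite sumr_const card_ord mulr_natl.
rewrite sumr_const card_ord -[_ *+ _]mulr_natl mulr_sumr; apply: ler_sum => l _.
by rewrite -pn exprMn [n%:R ^+ l.+1]exprS; rewrite le_eqVlt; apply/orP; left; apply/eqP; ring.
Qed.

Lemma sum_nth_eq m (t : m.-tuple 'I_n) (i : 'I_m) : \sum_v (nth v t i == v)%:R = 1 :> R.
Proof.
rewrite (bigD1 (tnth t i)) //= -tnth_nth eqxx big1 ?addr0 // => v hv.
by rewrite -tnth_nth eq_sym (negbTE hv).
Qed.

(** Summing over [v] first removes it, as it is determined by its place. Fixing both ends in [V]
    leaves [m] free vertices for [m + 1] edges, which saves a factor [n]. *)
Lemma ex_n_two_feet (V : {set 'I_n}) : E0 (fun G => \sum_v n_two_feet V G v) <=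
  #|V|%:R ^+ 2 / n%:R * (1 - lam)^-2.
Proof.
have V0 : 0 <= #|V|%:R ^+ 2 / n%:R :> R by rewrite divr_ge0 ?exprn_ge0 // ltW.
apply: le_trans (ler_wpM2l V0 (sum_arith_geometric_le n)).
rewrite (ex_ext _ (psi := fun G => \sum_(m < n) \sum_(i < m) \sum_(z1 in V) \sum_(z2 in V) \sum_(t : m.-tuple 'I_n)
    (pathb G (z1 :: rcons t z2))%:R)); last first.
  move=> G; rewrite /n_two_feet exchange_big; apply: eq_bigr => m _.
  rewrite exchange_big; apply: eq_bigr => i _; rewrite exchange_big; apply: eq_bigr => z1 _.
  rewrite exchange_big; apply: eq_bigr => z2 _; rewrite exchange_big; apply: eq_bigr => t _.
  rewrite (eq_bigr (fun v => (pathb G (z1 :: rcons t z2))%:R * (nth v t i == v)%:R)); last first.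
    by move=> v _; rewrite -mulnb natrM.
  by rewrite -mulr_sumr sum_nth_eq mulr1.
rewrite ex_sum mulr_sumr; apply: ler_sum => m _; rewrite ex_sum.
apply: (@le_trans _ _ (\sum_(i < m) \sum_(z1 in V) \sum_(z2 in V) n%:R ^+ m * p ^+ m.+1)).
  apply: ler_sum => i _; rewrite ex_sum; apply: ler_sum => z1 _; rewrite ex_sum; apply: ler_sum => z2 _.
  rewrite ex_sum; apply: sum_tuple_const => t; apply: path_prob.
  by rewrite /= size_rcons size_tuple.
have e4 (x : R) (a b d : nat) : x *+ a *+ b *+ d = d%:R * (b%:R * (a%:R * x)) by rewrite !mulr_natl.
rewrite !sumr_const card_ord e4 -pn exprMn [n%:R ^+ m.+1]exprS; rewrite le_eqVlt; apply/orP; left; apply/eqP.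
by field; rewrite gt_eqF.
Qed.

(** Here one end is fixed, so vertices and edges balance, and the gain is [lam ^ h] from the [h]
    vertices beyond [v]. *)
Lemma ex_n_tail (V : {set 'I_n}) h : E0 (fun G => \sum_v n_tail V h G v) <=
  #|V|%:R * (lam ^+ h * (1 - lam)^-1).
Proof.
rewrite (ex_ext _ (psi := fun G => \sum_(i < n) \sum_(z in V) \sum_(t : (i.+1 + h).-tuple 'I_n) (pathb G (z :: t))%:R));
  last first.
  move=> G; rewrite /n_tail exchange_big; apply: eq_bigr => i _.
  rewrite exchange_big; apply: eq_bigr => z _; rewrite exchange_big; apply: eq_bigr => t _.
  rewrite (eq_bigr (fun v => (pathb G (z :: t))%:R * (nth v t i == v)%:R)); last first.
    by move=> v _; rewrite -mulnb natrM.
  have hi : (i < i.+1 + h)%N by rewrite addSn ltnS leq_addr.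
  by rewrite -mulr_sumr (sum_nth_eq t (Ordinal hi)) mulr1.
apply: (@le_trans _ _ (\sum_(i < n) #|V|%:R * (lam ^+ h * lam ^+ i))).
  rewrite ex_sum; apply: ler_sum => i _; rewrite ex_sum.
  apply: (@le_trans _ _ (\sum_(z in V) n%:R ^+ (i.+1 + h) * p ^+ (i.+1 + h))).
    apply: ler_sum => z _; rewrite ex_sum; apply: sum_tuple_const => t; apply: path_prob.
    by rewrite /= size_tuple.
  rewrite sumr_const -[_ *+ _]mulr_natl ler_wpM2l // -exprMn [n%:R * p]mulrC pn -exprD.
  apply: ler_wiXn2l; rewrite ?ltW //; first by case/andP: l01.
  by clear; lia.
rewrite -!mulr_sumr ler_wpM2l // ler_wpM2l ?exprn_ge0 ?(ltW l0) //; exact: sum_geometric_le.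
Qed.

Lemma ex_n_long r : E0 (n_long r) <= n%:R * lam ^+ r.*2.
Proof.
rewrite /n_long ex_sum; apply: le_trans (sum_tuple_const (c := p ^+ r.*2) _) _.
  by move=> t; apply: path_prob; rewrite size_tuple.
by rewrite exprS -pn exprMn; rewrite le_eqVlt; apply/orP; left; apply/eqP; ring.
Qed.

End Counts.

(** * Subcritical detection and reconstruction *)

Lemma score_null (n K : nat) (G : graph n) v : (0 < K.-1./2)%N -> v \in path_score G K ->
  cyc (gadj G) v \/ long_path K G.
Proof.
move=> r0; rewrite inE => /andP[_ /existsP[b /andP[br bv]]].
have es := gadj_symm G; have ei := gadj_irr G.
have [P [Q [sP sQ pP pQ [nP nQ PQ]]]] := peel_two_walks r0 br.
have P0 : P != [::] by rewrite -size_eq0 sP -lt0n.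
have Q0 : Q != [::] by rewrite -size_eq0 sQ -lt0n.
case: (theta_walks es pP nP pQ nQ P0 Q0 PQ) => [cb|u]; [left|right].
  by case/connectP: bv => q hq ->; apply: cyc_path cb.
exists (rev P ++ b :: Q); split=> //; last exact: sorted_two_walks.
by rewrite size_cat size_rev /= sP sQ addnS addnn.
Qed.

Section Bounds.
Context {R : realType}.
Variables (lam : R) (n K : nat).
Hypotheses (l01 : 0 < lam < 1) (n0 : (0 < n)%N).
Let p := edge_prob lam n.
Hypotheses (p01 : 0 <= p <= 1) (pn : p * n%:R = lam).
Let r := K.-1./2.
Let h := minn (troot K) r.
Hypothesis h0 : (0 < h)%N.
Let r0 : (0 < r)%N. Proof. by apply: leq_trans h0 _; exact: geq_minr. Qed.
(** Without a long path, each selected vertex can reach a cycle, and the expected number of such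
    vertices stays bounded; Markov's inequality at the growing level [troot K] does the rest. *)
Lemma null_score_prob : Ex p (fun G : graph n => (troot K <= #|path_score G K|)%N%:R) <=
  n%:R * lam ^+ r.*2 + (troot K)%:R^-1 * (1 - lam)^-2.
Proof.
have tr : 0 < (troot K)%:R :> R by rewrite ltr0n; apply: leq_trans h0 _; exact: geq_minl.
apply: (@le_trans _ _ (Ex p (fun G : graph n => n_long r G + (troot K)%:R^-1 * \sum_v n_lolli G v))); last first.
  rewrite exD exZ; apply: lerD; first exact: ex_n_long.
  by rewrite ler_wpM2l ?invr_ge0 ?ler0n //; exact: ex_n_lolli.
apply: ex_le => // G.
have s0 : 0 <= \sum_v n_lolli G v :> R by apply: sumr_ge0 => v _; exact: n_lolli_ge0.
have l0 : 0 <= n_long r G :> R by exact: n_long_ge0.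
case: leqP => // hle; last by rewrite addr_ge0 // mulr_ge0 // invr_ge0 ltW.
have [hl|nl] := pselect (long_path K G).
  have hl' : 1 <= n_long r G :> R by exact: long_count.
  by apply: (@le_trans _ _ (n_long r G)) => //; rewrite lerDl mulr_ge0 // invr_ge0 ltW.
apply: (@le_trans _ _ ((troot K)%:R^-1 * \sum_v n_lolli G v)); last by rewrite lerDr.
rewrite ler_pdivlMl // mulr1; apply: (@le_trans _ _ #|path_score G K|%:R); first by rewrite ler_nat.
rewrite -sum1_card natr_sum big_mkcond; apply: ler_sum => v _; case: ifP => [vS|_]; last exact: n_lolli_ge0.
by apply: cyc_count; case: (score_null r0 vS).
Qed.

Variable o : graph n -> {set 'I_n}.
Hypotheses (Kn : (K <= n)%N) (o_card : forall G, #|o G| = K)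
  (o_sub : forall G, (K <= #|path_score G K|)%N -> o G \subset path_score G K)
  (o_sup : forall G, (#|path_score G K| <= K)%N -> path_score G K \subset o G).

(** If the score has at least [K] vertices, the output lies inside it and misses [V] only in
    selected vertices off the path; if it has fewer, the output contains every selected path vertex.
    The term with [n_long] makes the left side nonpositive when the noise contains a long path. *)
Lemma overlap_pointwise (s : {ffun 'I_K -> 'I_n}) (G0 : graph n) : injective s ->
  K%:R - (h.*2)%:R - \sum_v (n_lolli G0 v + n_two_feet (hidden K n s) G0 v + n_tail (hidden K n s) h G0 v)
    - K%:R * n_long r G0 <= #|o (G0 :|: planted K n s) :&: hidden K n s|%:R :> R.
Proof.
move=> si; set G := G0 :|: planted K n s; set V := hidden K n s; set S := path_score G K.
have x0 v : 0 <= n_lolli G0 v + n_two_feet V G0 v + n_tail V h G0 v :> R.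
  by rewrite !addr_ge0 ?n_lolli_ge0 ?n_two_feet_ge0 ?n_tail_ge0.
have s0 : 0 <= \sum_v (n_lolli G0 v + n_two_feet V G0 v + n_tail V h G0 v) :> R by apply: sumr_ge0.
have l0 : 0 <= n_long r G0 :> R by exact: n_long_ge0.
have c0 : 0 <= #|o G :&: V|%:R :> R by rewrite ler0n.
have [hl|nl] := pselect (long_path K G0).
  have hl' : 1 <= n_long r G0 :> R by exact: long_count.
  apply: le_trans c0; have : K%:R <= K%:R * n_long r G0 :> R by rewrite ler_peMr.
  have : 0 <= (h.*2)%:R :> R by rewrite ler0n.
  lra.
have hout : #|S :\: V|%:R <= \sum_v (n_lolli G0 v + n_two_feet V G0 v + n_tail V h G0 v) :> R.
  rewrite -sum1_card natr_sum big_mkcond; apply: ler_sum => v _; case: ifP => // .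
  rewrite finset.in_setD => /andP[vV vS].
  case: (score_outside h0 vS vV) => [c|c|c|//].
  - by apply: (@le_trans _ _ (n_lolli G0 v)); [exact: cyc_count|rewrite -addrA lerDl addr_ge0 ?n_two_feet_ge0 ?n_tail_ge0].
  - apply: (@le_trans _ _ (n_two_feet V G0 v)); first exact: two_feet_count.
    by rewrite addrAC lerDr addr_ge0 ?n_lolli_ge0 ?n_tail_ge0.
  - apply: (@le_trans _ _ (n_tail V h G0 v)); first exact: tail_count.
    by rewrite lerDr addr_ge0 ?n_lolli_ge0 ?n_two_feet_ge0.
have hin : (#|V :\: S| <= h.*2)%N by exact: card_hidden_missed.
have cV : #|V| = K by rewrite card_imset // card_ord.
have hl0 : 0 <= K%:R * n_long r G0 :> R by rewrite mulr_ge0.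
suff : (K <= h.*2 + #|S :\: V| + #|o G :&: V|)%N.
  rewrite -(ler_nat R) !natrD; lra.
have [KS|SK] := leqP K #|S|.
  have := o_sub KS => sub; have e1 := finset.cardsID V (o G); rewrite o_card in e1.
  have : (#|o G :\: V| <= #|S :\: V|)%N by apply: subset_leq_card; apply: finset.setSD.
  by move: e1; clear; lia.
have sup := o_sup (ltnW SK); have e1 := finset.cardsID S V; rewrite cV in e1.
have : (#|V :&: S| <= #|o G :&: V|)%N.
  by apply: subset_leq_card; rewrite finset.setIC; apply: finset.setSI.
by move: e1 hin; clear; lia.
Qed.

Lemma overlap_lower :
  K%:R - (h.*2)%:R - ((1 - lam)^-2 + K%:R ^+ 2 / n%:R * (1 - lam)^-2 + K%:R * (lam ^+ h * (1 - lam)^-1))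
    - K%:R * (n%:R * lam ^+ r.*2) <= overlap lam K n o.
Proof.
rewrite overlapE -/p -[leLHS](av_cst Kn); apply: av_le => s si.
apply: le_trans (ex_le p01 (fun G => overlap_pointwise G si)).
rewrite (ex_ext _ (psi := fun G => (K%:R - (h.*2)%:R) +
   ((-1) * (\sum_v n_lolli G v + (\sum_v n_two_feet (hidden K n s) G v + \sum_v n_tail (hidden K n s) h G v))
     + (- K%:R) * n_long r G))); last first.
  by move=> G; rewrite !big_split /=; ring.
have cV : #|hidden K n s| = K by rewrite card_imset // card_ord.
rewrite exD ex_cst exD !exZ !exD.
have h1 := ex_n_lolli p01 l01 pn; have h2 := ex_n_two_feet p01 l01 pn n0 (hidden K n s).
have h3 := ex_n_tail p01 l01 pn (hidden K n s) h; have h4 := ex_n_long p01 pn r.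
rewrite cV in h2 h3; have h5 := ler_wpM2l (ler0n R K) h4.
move: h1 h2 h3 h5; rewrite [X in _ + (_ + X)]mulNr; set a := Ex _ _; set b := Ex _ _; set c := Ex _ _; set d := K%:R * Ex _ _; lra.
Qed.

End Bounds.

Lemma troot_ge (A K : nat) : (A.+1 ^ 2 <= K)%N -> (A <= troot K)%N.
Proof.
move=> hA; rewrite leqNgt; apply/negP => hlt; have /andP[_ h2] := trootP K.
have : ((troot K).+1 * (troot K).+2 <= A * A.+1)%N by apply: leq_mul.
by move: hA h2; rewrite expnS expn1; clear; nia.
Qed.

(** Then [K - 2 * troot K >= troot K]: what peeling leaves of the planted path passes the detection
    threshold. *)
Lemma troot3 (K : nat) : (15 <= K)%N -> (3 * troot K <= K)%N.
Proof. by move=> hK; have /andP[h1 _] := trootP K; move: hK h1; move: (troot K) => h; clear; nia. Qed.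

Section Subcritical.
Local Open Scope classical_set_scope.
Local Open Scope ring_scope.
Context {R : realType}.
Variables (lam : R) (K : nat -> nat).
Hypotheses (l0 : 0 < lam) (l1 : lam < 1) (Kn : forall n, (K n <= n)%N).
Hypothesis Klarge : (fun n : nat => (K n)%:R - ln (n%:R : R) / ln (lam^-1)) @ \oo --> +oo.
Let L : R := ln lam^-1.
Let L0 : 0 < L. Proof. by rewrite /L ln_gt0 // invf_gt1. Qed.
Let l01 : 0 < lam < 1. Proof. by rewrite l0. Qed.

Lemma K_large (A : nat) : exists N, forall n, (N <= n)%N -> (A <= K n)%N.
Proof.
have [N hN] := cvgyE Klarge A%:R; exists N.+1 => n hn.
have := hN n (ltnW hn); rewrite -/L => h; rewrite -(ler_nat R); apply: le_trans h _.
rewrite gerBl divr_ge0 ?(ltW L0) // ln_ge0 // ler1n; exact: leq_trans hn.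
Qed.

Lemma long_path_small (e : R) : 0 < e ->
  exists N, forall n, (N <= n)%N -> n%:R * lam ^+ ((K n).-1./2).*2 <= e.
Proof.
(* The factor [lam ^+ 2] pays for the vertices lost in [(K.-1./2).*2 >= K - 2]. *)
move=> e0; pose A := - ln (e * lam ^+ 2) / L.
have el : 0 < e * lam ^+ 2 by rewrite mulr_gt0 // exprn_gt0.
have [N hN] := eventually_and (cvgyE Klarge A) (K_large 2); exists N.+1 => n hn.
have [h1 h2] := hN n (ltnW hn); rewrite -/L in h1.
have nr : 0 < n%:R :> R by rewrite ltr0n (leq_trans _ hn).
rewrite -(ler_pM2r (_ : 0 < lam ^+ 2)) ?exprn_gt0 // -mulrA -exprD.
apply: (@le_trans _ _ (n%:R * lam ^+ K n)).
  rewrite ler_wpM2l ?(ltW nr) //; apply: ler_wiXn2l; rewrite ?ltW //; move: h2; clear; lia.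
have -> : n%:R * lam ^+ K n = expR (ln n%:R - (K n)%:R * L).
  rewrite expRD expRN expRM_natl /L lnV ?posrE // expRN exprVn invrK !lnK //.
rewrite -[leRHS]lnK ?posrE // ler_expR.
have h3 : A * L <= ((K n)%:R - ln n%:R / L) * L by rewrite ler_wpM2r // ltW.
move: h3; rewrite /A mulrVK ?unitfE ?gt_eqF // mulrBl mulrVK ?unitfE ?gt_eqF //; lra.
Qed.

Lemma half_troot_large (A : nat) : exists N, forall n, (N <= n)%N -> (A <= minn (troot (K n)) (K n).-1./2)%N.
Proof.
have [N hN] := K_large (A.+1 ^ 2 + A.*2.+1); exists N => n /hN hK.
rewrite leq_min troot_ge /=; [move: hK; clear; lia|exact: leq_trans (leq_addr _ _) hK].
Qed.

Lemma edge_prob_props : exists N, forall n, (N <= n)%N ->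
  [/\ (0 < n)%N, 0 <= edge_prob lam n <= 1 & edge_prob lam n * n%:R = lam].
Proof.
have [N hN] := edge_probE l0; exists N.+1 => n hn; have [pE /andP[p0 p1]] := hN n (ltnW hn).
have n0 : (0 < n)%N by apply: leq_trans hn.
by split=> //; [rewrite ltW|rewrite pE mulrVK // unitfE pnatr_eq0 -lt0n].
Qed.

Lemma subcritical_detection : detection_easy lam K.
Proof.
have [M [a [d hM]]] := tm_detection; exists M, a, d; split.
  by move=> n G; case: (hM n (K n) G (Kn n)).
split; apply/cvg0E => e e0.
  have e2 : 0 < e / 2 by rewrite divr_gt0.
  have [B hB] := natr_large (2 / e * (1 - lam)^-2).
  have [N hN] := eventually_and (long_path_small e2) (eventually_and (half_troot_large B.+1) edge_prob_props).
  exists N => n hn; have [h1 [h2 [n0 p01 pn]]] := hN n hn.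
  rewrite err0E ger0_norm; last by apply: ex_ge0.
  have h0 : (0 < minn (troot (K n)) (K n).-1./2)%N by apply: leq_trans h2.
  have K0 : (0 < K n)%N by move: h0; case: (K n); rewrite ?minn0.
  apply: (@le_trans _ _ (Ex (edge_prob lam n) (fun G : graph n => (troot (K n) <= #|path_score G (K n)|)%N%:R))).
    by apply: ex_le => // G; case: (hM n (K n) G (Kn n)) => _ ->.
  apply: le_trans (null_score_prob l01 p01 pn h0) _.
  have t0 : (B.+1 <= troot (K n))%N by apply: leq_trans h2 _; exact: geq_minl.
  have tr : 0 < (troot (K n))%:R :> R by rewrite ltr0n; apply: leq_trans t0.
  have : (troot (K n))%:R^-1 * (1 - lam)^-2 <= e / 2.
    rewrite ler_pdivrMl // mulrC -ler_pdivrMl // invf_div; apply: hB.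
    exact: ltnW.
  lra.
(* On the planted side the test never errs once [K >= 15], whatever the noise: enough path vertices
   always survive. *)
have [N hN] := eventually_and (K_large 15) edge_prob_props.
exists N => n hn; have [h1 [n0 p01 pn]] := hN n hn.
rewrite err1E (av_ext (F' := fun _ => 0)) ?av_cst ?normr0 ?ltW // => s si.
rewrite -[RHS](ex_cst (edge_prob lam n) n 0); apply: ex_ext => G.
have K0 : (0 < K n)%N by apply: leq_trans h1.
case: (hM n (K n) (G :|: planted (K n) n s) (Kn n)) => _ ->//.
suff -> : (troot (K n) <= #|path_score (G :|: planted (K n) n s) (K n)|)%N by [].
have hm := card_hidden_missed G si; set S := path_score _ _ in hm *.
have cV : #|hidden (K n) n s| = K n by rewrite card_imset // card_ord.
have := finset.cardsID S (hidden (K n) n s); rewrite cV.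
have : (#|hidden (K n) n s :&: S| <= #|S|)%N by apply: subset_leq_card; exact: finset.subsetIr.
have := troot3 h1; have : (minn (troot (K n)) (K n).-1./2 <= troot (K n))%N by exact: geq_minl.
by move: hm; clear; lia.
Qed.

Lemma subcritical_reconstruction :
  (fun n : nat => (K n)%:R * ln (n%:R : R) / n%:R) @ \oo --> (0 : R) -> reconstruction_easy lam K.
Proof.
move=> /cvg0E Ksmall.
have [M [a [d hM]]] := tm_reconstruction; exists M, a, d; split.
  by move=> n G; case: (hM n (K n) G (Kn n)).
split; first by move=> n G; case: (hM n (K n) G (Kn n)).
move=> eps e0; apply/eventuallyE.
have r0 : 0 < 1 - lam by rewrite subr_gt0.
set C := (1 - lam)^-2; have C0 : 0 < C by rewrite invr_gt0 exprn_gt0.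
(* Five losses share [eps]: the ends of the path, cycles, noise paths between two path vertices,
   tails, and long noise paths. *)
pose e := eps / 5; have e5 : 0 < e by rewrite divr_gt0.
have eC : 0 < e / C by rewrite divr_gt0.
have [A1 hA1] := natr_large (C / e).
have [A2 hA2] := natr_large (16 / e ^+ 2).
have [A3 hA3] := pow_geometric_le (1 / (e * (1 - lam))) 0 l01.
have [N1 hN1] := eventually_and (long_path_small e5) (eventually_and (half_troot_large A3.+1) edge_prob_props).
have [N2 hN2] := eventually_and (K_large (A1 + A2).+1) (Ksmall _ eC).
have [N3 hN3] := natr_large (expR 1 : R).
exists (N1 + N2 + N3)%N => n hn.
have hn1 : (N1 <= n)%N by move: hn; clear; lia.
have hn2 : (N2 <= n)%N by move: hn; clear; lia.
have hn3 : (N3 <= n)%N by move: hn; clear; lia.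
have [h1 [h2 [n0 p01 pn]]] := hN1 n hn1; have [h3 h4] := hN2 n hn2; have h5 := hN3 n hn3.
have nr : 0 < n%:R :> R by rewrite ltr0n.
have h0 : (0 < minn (troot (K n)) (K n).-1./2)%N by apply: leq_trans h2.
have K0 : (0 < K n)%N by apply: leq_trans h3.
have Kr : 0 < (K n)%:R :> R by rewrite ltr0n.
have ln1 : 1 <= ln (n%:R : R) by rewrite -[leLHS]expRK ler_ln ?posrE ?expR_gt0.
have Kn1 : (K n)%:R / n%:R <= e / C.
  apply: le_trans h4; rewrite ger0_norm; last by rewrite divr_ge0 ?mulr_ge0 ?(le_trans _ ln1) // ltW.
  by rewrite ler_wpM2r ?invr_ge0 ?(ltW nr) // ler_peMr.
set o := fun G : graph n => _.
have oc (G : graph n) : #|o G| = K n by case: (hM n (K n) G (Kn n)).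
have osub (G : graph n) : (K n <= #|path_score G (K n)|)%N -> o G \subset path_score G (K n).
  by case: (hM n (K n) G (Kn n)) => _ _ h _; exact: h.
have osup (G : graph n) : (#|path_score G (K n)| <= K n)%N -> path_score G (K n) \subset o G.
  by case: (hM n (K n) G (Kn n)) => _ _ _; exact.
apply: le_trans (overlap_lower l01 n0 p01 pn h0 (Kn n) oc osub osup).
set h := minn _ _ in h0 h2 *.
have part1 : (h.*2)%:R <= e * (K n)%:R.
  have ht : (h * h <= 4 * K n)%N.
    have /andP[t1 _] := trootP (K n); have : (h <= troot (K n))%N by exact: geq_minl.
    by move: t1 K0; move: (troot (K n)) => t; clear; nia.
  rewrite -(@ler_pXn2r _ 2) // ?nnegrE ?ler0n ?mulr_ge0 // ?(ltW e0) //.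
  apply: (@le_trans _ _ (16 * (K n)%:R)).
    by rewrite -natrX -natrM ler_nat; move: ht; rewrite expnS expn1; clear; lia.
  rewrite exprMn [(K n)%:R ^+ 2]expr2 mulrA ler_wpM2r // -ler_pdivrMl ?exprn_gt0 // mulrC; apply: hA2.
  by move: h3; clear; lia.
have part2 : C <= e * (K n)%:R.
  by rewrite -ler_pdivrMl // mulrC; apply: hA1; move: h3; clear; lia.
have part3 : (K n)%:R ^+ 2 / n%:R * C <= e * (K n)%:R.
  move: Kn1; rewrite ler_pdivlMr // => hk; have := ler_wpM2l (ltW Kr) hk; rewrite expr2.
  by rewrite [e * _]mulrC !mulrA.
have part4 : (K n)%:R * (lam ^+ h * (1 - lam)^-1) <= e * (K n)%:R.
  rewrite mulrC ler_wpM2r ?(ltW Kr) // ler_pdivrMr //.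
  have := hA3 h (ltnW h2); rewrite expr0 mul1r mul1r ler_pdivrMl ?mulr_gt0 // mulr1 //.
have part5 := ler_wpM2l (ltW Kr) h1.
move: part1 part2 part3 part4 part5; rewrite -/C /e; lra.
Qed.

End Subcritical.

(** * The wedge statistic *)

Definition touch n (e f : {set 'I_n}) : bool := (e != f) && ~~ [disjoint e & f].

Lemma touch_sym n (e f : {set 'I_n}) : touch e f = touch f e.
Proof. by rewrite /touch eq_sym disjoint_sym. Qed.

(** * From the edge list of the machine to sets of edges *)

Section EdgeList.
Variables (n' : nat).
Notation n := n'.+1.
Variable G : graph n.
Let E := edges n (adjn G).

Definition pair_set (x : nat * nat) : {set 'I_n} := [set inord x.1; inord x.2].

Lemma edges_lt x : x \in E -> (x.1 < x.2 < n)%N.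
Proof. by case: x => a b; rewrite /E mem_edges => /and3P[-> ->]. Qed.

Lemma pair_set_inj : {in E &, injective pair_set}.
Proof.
move=> [a b] [c d] /edges_lt /= /andP[ab bn] /edges_lt /= /andP[cd dn] /finset.setP h.
have hm (i j : nat) : (i < n)%N -> (j < n)%N -> (inord i == inord j :> 'I_n) = (i == j).
  by move=> hi hj; apply/eqP/eqP => [/(congr1 val)|->//]; rewrite /= !inordK.
have an := ltn_trans ab bn; have cn := ltn_trans cd dn.
have h1 := h (inord a); have h2 := h (inord b); have h3 := h (inord c); have h4 := h (inord d).
move: h1 h2 h3 h4; rewrite !inE !hm // !eqxx ?orbT => h1 h2 h3 h4.
have [e1 e2] : a = c /\ b = d by move: h1 h2 h3 h4 ab cd; rewrite /=; clear; lia.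
by rewrite e1 e2.
Qed.

Lemma mem_pair_sets (e : {set 'I_n}) : (e \in map pair_set E) = (e \in G :&: pairs n).
Proof.
apply/mapP/idP => [[[a b] hE ->]|].
  have := edges_lt hE => /= /andP[ab bn]; have an := ltn_trans ab bn.
  move: hE; rewrite /E mem_edges => /and3P[_ _]; rewrite /adjn !insubT /= => hG.
  rewrite finset.in_setI inE /pair_set /=.
  have -> : inord a = Ordinal an by apply: val_inj; rewrite /= inordK.
  have -> : inord b = Ordinal bn by apply: val_inj; rewrite /= inordK.
  by rewrite hG cards2; apply/eqP; case: eqP => // /(congr1 val) /= ee; move: ab; rewrite ee ltnn.
rewrite finset.in_setI inE => /andP[eG /cards2P[i [j [ij ee]]]].
wlog lt : i j ij ee / (i < j)%N.
  move=> W; case: (ltngtP i j) => hij; [exact: (W i j)| |by rewrite (val_inj hij) eqxx in ij].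
  by apply: (W j i) => //; [rewrite eq_sym|rewrite finset.setUC].
exists (i : nat, j : nat); last by rewrite ee /pair_set /= !inord_val.
by rewrite /E mem_edges lt ltn_ord adjn_ord -ee eG.
Qed.

Lemma uniq_pair_sets : uniq (map pair_set E).
Proof. by rewrite map_inj_in_uniq; [exact: uniq_edges|exact: pair_set_inj]. Qed.

Lemma size_edgesE : size E = #|G :&: pairs n|.
Proof.
rewrite -(size_map pair_set) -(card_uniqP uniq_pair_sets); apply: eq_card => e; exact: mem_pair_sets.
Qed.

Lemma sum_edgesE (F : {set 'I_n} -> nat) :
  (\sum_(x <- E) F (pair_set x) = \sum_(e in G :&: pairs n) F e)%N.
Proof.
rewrite -(big_map pair_set xpredT F) big_uniq ?uniq_pair_sets //=; apply: eq_bigl => e.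
exact: mem_pair_sets.
Qed.

Lemma incident_touch x y : x \in E -> y \in E -> incident x y = touch (pair_set x) (pair_set y).
Proof.
move=> hx hy; rewrite /incident /touch (inj_in_eq pair_set_inj) //; congr (_ && _).
move: (edges_lt hx) (edges_lt hy) => /andP[x1 x2] /andP[y1 y2].
have hm (i j : nat) : (i < n)%N -> (j < n)%N -> (inord i == inord j :> 'I_n) = (i == j).
  by move=> hi hj; apply/eqP/eqP => [/(congr1 val)|->//]; rewrite /= !inordK.
have x3 := ltn_trans x1 x2; have y3 := ltn_trans y1 y2.
rewrite /pair_set -setI_eq0 finset.setIUl finset.setU_eq0 !setI_eq0 !finset.disjoints1 !inE !hm //.
by clear; lia.
Qed.

Lemma wedge_sumE : sumn [seq count (incident e) E | e <- E] =
  (\sum_(e in G :&: pairs n) \sum_(f in G :&: pairs n) touch e f)%N.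
Proof.
rewrite sumnE big_map -sum_edgesE big_seq [RHS]big_seq; apply: eq_bigr => x hx.
rewrite -sum_edgesE -sum1_count big_mkcond big_seq [RHS]big_seq; apply: eq_bigr => y hy.
by rewrite incident_touch //; case: (touch _ _).
Qed.

End EdgeList.

Section PairCounts.
Variable n : nat.

Lemma card_pairs : #|pairs n| = 'C(n, 2).
Proof.
rewrite -[n in RHS]card_ord -cardsT -cards_draws; apply: eq_card => e; rewrite !inE.
by rewrite finset.subsetT.
Qed.

(** Besides [e] itself and the pairs inside the complement of [e], which has [n - 2] vertices, all
    pairs touch [e]. *)
Lemma card_touch (e : {set 'I_n}) : e \in pairs n -> (#|[set f in pairs n | touch e f]| = 2 * (n - 2))%N.
Proof.
move=> ep; have ce : #|e| = 2%N by move: ep; rewrite inE => /eqP.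
have n2 : (2 <= n)%N by rewrite -ce -[leqRHS]card_ord; exact: max_card.
have dis : #|[set f in pairs n | [disjoint e & f]]| = 'C(n - 2, 2).
  have <- : #|~: e| = (n - 2)%N by rewrite cardsCs finset.setCK card_ord ce.
  rewrite -cards_draws; apply: eq_card => f; rewrite !inE andbC; congr (_ && _).
  by rewrite disjoint_sym finset.disjoints_subset.
have H : pairs n = [set f in pairs n | touch e f] :|: (e |: [set f in pairs n | [disjoint e & f]]).
  have mA f : (f \in [set f in pairs n | touch e f]) = (f \in pairs n) && touch e f by rewrite inE.
  have mB f : (f \in [set f in pairs n | [disjoint e & f]]) = (f \in pairs n) && [disjoint e & f] by rewrite inE.
  apply/finset.setP => f; rewrite finset.in_setU mA finset.in_setU1 mB /touch.
  have [<-|ne] := eqVneq e f; first by rewrite ep orbT.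
  by rewrite /=; case: (f \in pairs n) => //=; case: [disjoint _ & _].
have D1 : [set f in pairs n | touch e f] :&: (e |: [set f in pairs n | [disjoint e & f]]) = finset.set0.
  apply/finset.setP => f; rewrite finset.in_setI finset.in_setU1 !inE /touch.
  by case: (eqVneq e f) => [_|_]; rewrite ?andbF //=; case: [disjoint _ & _]; rewrite ?andbF.
have en : e \notin [set f in pairs n | [disjoint e & f]].
  by rewrite inE ep /= -setI_eq0 finset.setIid -cards_eq0 ce.
have := finset.cardsU [set f in pairs n | touch e f] (e |: [set f in pairs n | [disjoint e & f]]).
rewrite -H D1 cards0 subn0 finset.cardsU1 en dis card_pairs.
have b1 := bin2 n; have b2 := bin2 (n - 2); move: b1 b2 n2 => -> -> n2.
have e1 : (n * n.-1)./2.*2 = (n * n.-1)%N.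
  by rewrite -[RHS]odd_double_half (_ : odd _ = false) //; case: (n) => // m; rewrite /= oddM /=; case: (odd m).
have e2 : ((n - 2) * (n - 2).-1)./2.*2 = ((n - 2) * (n - 2).-1)%N.
  by rewrite -[RHS]odd_double_half (_ : odd _ = false) //; case: (n - 2)%N => // m; rewrite /= oddM /=; case: (odd m).
move=> e3; have : (n * n.-1 = #|[set f in pairs n | touch e f]|.*2 + 2 + (n - 2) * (n - 2).-1)%N.
  by rewrite -e1 -e2 e3; clear; lia.
move: (#|_|) n2 => c n2; move: n2; clear; case: (n) => [|[|m]] //=; rewrite ?subSS ?subn0; nia.
Qed.

End PairCounts.

(** * Moments of linear and quadratic forms in centred edge indicators *)

Section Moments.
Context {R : realType}.
Variables (p : R) (n : nat).
Hypothesis p01 : 0 <= p <= 1.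
Notation E0 := (@Ex R p n).
Let p0 : 0 <= p. Proof. by case/andP: p01. Qed.
Let p1 : p <= 1. Proof. by case/andP: p01. Qed.
Let v : R := p * (1 - p).
Let v0 : 0 <= v. Proof. by rewrite mulr_ge0 // subr_ge0. Qed.
Let vp : v <= p. Proof. by rewrite /v -[leRHS]mulr1 ler_wpM2l // gerBl. Qed.

Lemma ex_ZZ (e f : {set 'I_n}) : e \in pairs n -> E0 (fun G => Z p e G * Z p f G) = v * (e == f)%:R.
Proof.
move=> ep; have [<-|ef] := eqVneq e f; last by rewrite mulr0; apply: ex_Z0 => //; exact: indep_Z.
rewrite mulr1 -[RHS]mulr1 -[1](ex_cst p n) -(ex_Z2 p ep); last exact: indep_cst.
by apply: ex_ext => G; rewrite mulr1 expr2.
Qed.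

(** Unless the unordered pairs [{e, f}] and [{g, h}] agree, some edge occurs exactly once, and its
    centred factor makes the expectation vanish. *)
Lemma ex_ZZZZ (e f g h : {set 'I_n}) : e \in pairs n -> f \in pairs n -> g \in pairs n -> h \in pairs n ->
  e != f -> g != h ->
  E0 (fun G => (Z p e G * Z p f G) * (Z p g G * Z p h G)) =
  v ^+ 2 * (((e == g) && (f == h))%:R + ((e == h) && (f == g))%:R).
Proof.
move=> ep fp gp hp ef gh.
have both a b c : a \in pairs n -> b \in pairs n -> a != b -> a != c ->
    E0 (fun G => Z p a G ^+ 2 * (Z p b G * Z p c G)) = v ^+ 2 * (b == c)%:R.
  move=> ap bp ab ac; rewrite ex_Z2 //; last by apply: indepM; apply: indep_Z.
  by rewrite ex_ZZ // -/v mulrA -expr2.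
have [eg|eg] := eqVneq e g.
  subst g; rewrite (negbTE gh) /= addr0 -(both e f h) //.
  by apply: ex_ext => G; ring.
have [eh|eh] := eqVneq e h.
  subst h; rewrite /= add0r -(both e f g) //.
  by apply: ex_ext => G; ring.
rewrite /= addr0 mulr0 -(ex_Z0 p (e := e) (phi := fun G => Z p f G * (Z p g G * Z p h G))) //.
  by apply: ex_ext => G; ring.
by apply: indepM; [exact: indep_Z|apply: indepM; exact: indep_Z].
Qed.

Lemma linear_moment (S : {set {set 'I_n}}) (b : {set 'I_n} -> R) : S \subset pairs n ->
  E0 (fun G => (\sum_(e in S) b e * Z p e G) ^+ 2) = v * \sum_(e in S) b e ^+ 2.
Proof.
move=> /fintype.subsetP sS.
rewrite (ex_ext _ (psi := fun G => \sum_(e in S) \sum_(f in S) (b e * b f) * (Z p e G * Z p f G))); last first.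
  move=> G; rewrite expr2 mulr_suml; apply: eq_bigr => e _; rewrite mulr_sumr; apply: eq_bigr => f _.
  ring.
rewrite ex_sum mulr_sumr; apply: eq_bigr => e eS; rewrite ex_sum (bigD1 e) //= big1 ?addr0.
  by rewrite exZ ex_ZZ ?sS // eqxx mulr1; ring.
by move=> f /andP[fS fe]; rewrite exZ ex_ZZ ?sS // eq_sym (negbTE fe) !mulr0.
Qed.

Lemma quadratic_moment (S : {set {set 'I_n}}) (c : {set 'I_n} -> {set 'I_n} -> R) : S \subset pairs n ->
  (forall e, c e e = 0) -> (forall e f, c e f = c f e) ->
  E0 (fun G => (\sum_(e in S) \sum_(f in S) c e f * (Z p e G * Z p f G)) ^+ 2) =
  2 * v ^+ 2 * \sum_(e in S) \sum_(f in S) c e f ^+ 2.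
Proof.
move=> /fintype.subsetP sS c0 cs.
rewrite (ex_ext _ (psi := fun G => \sum_(e in S) \sum_(f in S) \sum_(g in S) \sum_(h in S)
   (c e f * c g h) * ((Z p e G * Z p f G) * (Z p g G * Z p h G)))); last first.
  move=> G; rewrite expr2 mulr_suml; apply: eq_bigr => e _; rewrite mulr_suml; apply: eq_bigr => f _.
  rewrite mulr_sumr; apply: eq_bigr => g _; rewrite mulr_sumr; apply: eq_bigr => h _; ring.
rewrite ex_sum mulr_sumr; apply: eq_bigr => e eS; rewrite ex_sum mulr_sumr; apply: eq_bigr => f fS.
rewrite ex_sum (eq_bigr (fun g => \sum_(h in S) (c e f * v ^+ 2) * (c g h * ((e == g) && (f == h))%:R +
   c g h * ((e == h) && (f == g))%:R))); last first.
  move=> g gS; rewrite ex_sum; apply: eq_bigr => h hS; rewrite exZ.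
  have [ef|ef] := eqVneq e f; first by rewrite ef c0 !mul0r.
  have [gh|gh] := eqVneq g h; first by rewrite gh c0 !mul0r addr0 !mulr0 mul0r.
  by rewrite ex_ZZZZ ?sS //; ring.
under eq_bigr => g gS do rewrite -mulr_sumr big_split /=.
rewrite -mulr_sumr big_split /=.
have -> : \sum_(g in S) \sum_(h in S) c g h * ((e == g) && (f == h))%:R = c e f.
  rewrite (bigD1 e) //= (bigD1 f) //= !eqxx mulr1 big1 ?addr0; last first.
    by move=> h /andP[_ hf]; rewrite eq_sym (negbTE hf) mulr0.
  rewrite big1 ?addr0 // => g /andP[_ ge]; rewrite big1 // => h _.
  by rewrite eq_sym (negbTE ge) mulr0.
have -> : \sum_(g in S) \sum_(h in S) c g h * ((e == h) && (f == g))%:R = c e f.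
  rewrite (bigD1 f) //= (bigD1 e) //= !eqxx mulr1 big1 ?addr0; last first.
    by move=> h /andP[_ he]; rewrite eq_sym (negbTE he) mulr0.
  rewrite big1 ?addr0 => [|g /andP[_ gf]]; first exact: cs.
  by rewrite big1 // => h _; rewrite [f == g]eq_sym (negbTE gf) andbF mulr0.
ring.
Qed.

Lemma chebyshev_ex (B : graph n -> bool) (X : graph n -> R) (d : R) : 0 < d ->
  (forall G : graph n, G \subset pairs n -> B G -> d <= `|X G|) ->
  E0 (fun G => (B G)%:R) <= d ^- 2 * E0 (fun G => X G ^+ 2).
Proof.
move=> d0 h; rewrite -exZ; apply: ex_le_supp => // G sG.
case: (boolP (B G)) => [/(h G sG) hd|_]; last by rewrite mulr_ge0 ?sqr_ge0 // invr_ge0 exprn_ge0 // ltW.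
rewrite ler_pdivlMl ?exprn_gt0 // mulr1 -[X in _ <= X]real_normK ?num_real //.
by rewrite lerXn2r // ?nnegrE // ltW.
Qed.

End Moments.

(** * The corrected wedge count as a degenerate quadratic form *)

Section Statistic.
Context {R : realType}.
Variables (lam p : R) (n : nat).
Hypotheses (p01 : 0 <= p <= 1) (pn : p * n%:R = lam) (l0 : 0 < lam) (n2 : (2 <= n)%N).
Notation E0 := (@Ex R p n).
Let p0 : 0 <= p. Proof. by case/andP: p01. Qed.
Let p1 : p <= 1. Proof. by case/andP: p01. Qed.
Let nr : 0 < n%:R :> R. Proof. by rewrite ltr0n (leq_trans _ n2). Qed.
Let k4 : R := 4 / n.+1%:R.

(* The constant [4 / (n + 1)] makes every row sum vanish ([wcoef_row]). *)
Definition wcoef (e f : {set 'I_n}) : R := (touch e f)%:R - 4 / n.+1%:R * (e != f)%:R.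
Definition nedges (G : graph n) : nat := #|G :&: pairs n|.
Definition nwedges (G : graph n) : nat := \sum_(e in G :&: pairs n) \sum_(f in G :&: pairs n) touch e f.
Definition wstat (G : graph n) : R :=
  (nwedges G)%:R - 4 / n.+1%:R * ((nedges G)%:R * ((nedges G)%:R - 1)).

Lemma wcoef_diag e : wcoef e e = 0.
Proof. by rewrite /wcoef /touch eqxx mulr0 subrr. Qed.

Lemma wcoef_sym e f : wcoef e f = wcoef f e.
Proof. by rewrite /wcoef touch_sym eq_sym. Qed.

Lemma sum_neq (S : {set {set 'I_n}}) e : e \in S -> \sum_(f in S) (e != f)%:R = #|S|%:R - 1 :> R.
Proof.
move=> eS; rewrite (bigD1 e) //= eqxx add0r (eq_bigr (fun _ => 1)); last first.
  by move=> f /andP[_ fe]; rewrite eq_sym fe.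
by rewrite (cardsD1 e) eS natrD addrC addKr -sum1_card natr_sum; apply: eq_bigl => f; rewrite !inE andbC.
Qed.

Lemma card_pairs_real : #|pairs n|%:R = n%:R * (n%:R - 1) / 2 :> R.
Proof.
have e1 : (#|pairs n| * 2 = n * n.-1)%N by rewrite card_pairs bin2 muln2 -[RHS]odd_double_half
  (_ : odd _ = false) //; case: (n) => // m; rewrite /= oddM /=; case: (odd m).
have : (#|pairs n| * 2)%:R = (n * n.-1)%:R :> R by rewrite e1.
rewrite !natrM; have -> : n.-1%:R = n%:R - 1 :> R by rewrite -subn1 natrB // (leq_trans _ n2).
by move=> <-; rewrite mulfK // pnatr_eq0.
Qed.

Lemma sum_touch e : e \in pairs n -> \sum_(f in pairs n) (touch e f)%:R = 2 * (n%:R - 2) :> R.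
Proof.
move=> ep; have := card_touch ep; rewrite -sum1_card => /(congr1 (fun m => m%:R : R)).
rewrite natrM natrB // => <-; rewrite natr_sum [RHS]big_mkcond [LHS]big_mkcond; apply: eq_bigr => f _.
by rewrite !inE; case: (_ == _) => //=; case: (touch e f).
Qed.

(** An edge touches [2 (n - 2)] of the [(n - 2) (n + 1) / 2] other pairs, and the ratio of these
    numbers is [4 / (n + 1)]. *)
Lemma wcoef_row e : e \in pairs n -> \sum_(f in pairs n) wcoef e f = 0.
Proof.
move=> ep; rewrite /wcoef sumrB -mulr_sumr sum_touch // sum_neq // card_pairs_real -[n.+1%:R]natr1.
have nn : n%:R + 1 != 0 :> R by rewrite natr1 pnatr_eq0.
by field.
Qed.

Lemma wcoef_row_sq e : e \in pairs n -> \sum_(f in pairs n) wcoef e f ^+ 2 <= 2 * n%:R + 8.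
Proof.
move=> ep; have n1 : 0 < n.+1%:R :> R by rewrite ltr0n.
have k0 : 0 <= k4 by rewrite divr_ge0.
apply: (@le_trans _ _ (\sum_(f in pairs n) ((touch e f)%:R + k4 ^+ 2 * (e != f)%:R))).
  apply: ler_sum => f _; rewrite /wcoef -/k4 /touch; case: (e != f); rewrite /= ?mulr0 ?subr0 ?addr0 ?mulr1.
    by case: (~~ _) => /=; rewrite ?sub0r ?sqrrN ?add0r //; nra.
  by rewrite expr0n.
rewrite big_split /= -mulr_sumr sum_touch // sum_neq // card_pairs_real.
have -> : k4 ^+ 2 * (n%:R * (n%:R - 1) / 2 - 1) = 8 * ((n%:R - 2) / n.+1%:R).
  have nn : n%:R + 1 != 0 :> R by rewrite natr1 pnatr_eq0.
  by rewrite /k4 -[n.+1%:R]natr1; field.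
have : (n%:R - 2) / n.+1%:R <= 1 :> R by rewrite ler_pdivrMr // mul1r -[n.+1%:R]natr1; lra.
by set z := _ / _; lra.
Qed.

(** Because the rows of [wcoef] sum to zero, the indicators may be shifted by any constant [c]. At
    [c = p] they are centred, so the null statistic has neither mean nor linear part, although its
    definition does not mention [p]. *)
Lemma wstatE (G : graph n) (c : R) : wstat G =
  \sum_(e in pairs n) \sum_(f in pairs n) wcoef e f * (((e \in G)%:R - c) * ((f \in G)%:R - c)).
Proof.
pose x (e : {set 'I_n}) : R := (e \in G)%:R.
have sx (F : {set 'I_n} -> R) : \sum_(e in pairs n) F e * x e = \sum_(e in G :&: pairs n) F e.
  rewrite [RHS]big_mkcond [LHS]big_mkcond; apply: eq_bigr => e _; rewrite finset.in_setI /x.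
  by case: (e \in G); case: (e \in pairs n); rewrite /= ?mulr1 ?mulr0.
transitivity (\sum_(e in pairs n) \sum_(f in pairs n) wcoef e f * (x e * x f)).
  transitivity (\sum_(e in G :&: pairs n) \sum_(f in G :&: pairs n) wcoef e f).
    rewrite /wcoef; under eq_bigr => e eG do rewrite sumrB -mulr_sumr sum_neq //.
    rewrite sumrB; congr (_ - _).
      by rewrite /nwedges natr_sum; apply: eq_bigr => e _; rewrite natr_sum.
    by rewrite sumr_const -[RHS]mulr_natl /nedges mulrCA.
  rewrite -sx; apply: eq_bigr => e _; rewrite -sx mulr_suml; apply: eq_bigr => f _; ring.
have row0 : \sum_(e in pairs n) \sum_(f in pairs n) wcoef e f * (x e * c) = 0.
  rewrite big1 // => e ep; rewrite -mulr_suml wcoef_row ?mul0r //.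
have row1 : \sum_(e in pairs n) \sum_(f in pairs n) wcoef e f * (x f * c) = 0.
  rewrite exchange_big big1 // => e ep; rewrite -mulr_suml /=.
  by under eq_bigr => f _ do rewrite wcoef_sym; rewrite wcoef_row ?mul0r.
have row2 : \sum_(e in pairs n) \sum_(f in pairs n) wcoef e f * (c * c) = 0.
  by rewrite big1 // => e ep; rewrite -mulr_suml wcoef_row ?mul0r.
transitivity (\sum_(e in pairs n) \sum_(f in pairs n) wcoef e f * (x e * x f)
   - \sum_(e in pairs n) \sum_(f in pairs n) wcoef e f * (x e * c)
   - \sum_(e in pairs n) \sum_(f in pairs n) wcoef e f * (x f * c)
   + \sum_(e in pairs n) \sum_(f in pairs n) wcoef e f * (c * c)).
  by rewrite row0 row1 row2 !subr0 addr0.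
rewrite -!sumrB -big_split; apply: eq_bigr => e _; rewrite -!sumrB -big_split; apply: eq_bigr => f _ /=.
rewrite /x; ring.
Qed.

Variable P : graph n.
Hypothesis sP : P \subset pairs n.
Let S : graph n := pairs n :\: P.
Let sS : S \subset pairs n. Proof. exact: finset.subsetDl. Qed.

Lemma sum_pairs_split (F : {set 'I_n} -> R) :
  \sum_(e in pairs n) F e = \sum_(e in P) F e + \sum_(e in S) F e.
Proof.
rewrite (bigID (mem P)) /=; congr (_ + _); apply: eq_bigl => e.
  by apply/andP/idP => [[]//|eP]; split=> //; apply: (fintype.subsetP sP).
by rewrite finset.in_setD andbC.
Qed.

(** The mean of [wstat (G :|: P)]: planted edges have the fixed centred value [1 - p], and all terms
    with a random edge have mean zero. *)
Definition wmean : R := (1 - p) ^+ 2 * \sum_(e in P) \sum_(f in P) wcoef e f.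

Hypothesis bP : forall e, e \in S -> `|\sum_(f in P) wcoef e f| <= 4.

(** After centring, the deviation is a quadratic form in the random edges plus a linear form whose
    coefficients are the row sums over [P]. The bound [4] on these keeps the variance [O(n)]
    whatever the size of [P]. *)
Lemma wstat_moment : E0 (fun G => (wstat (G :|: P) - wmean) ^+ 2) <= (64 * lam + 20 * lam ^+ 2) * n%:R.
Proof.
pose b e := \sum_(f in P) wcoef e f.
pose lin G := \sum_(e in S) b e * Z p e G.
pose quad G := \sum_(e in S) \sum_(f in S) wcoef e f * (Z p e G * Z p f G).
have dec (G : graph n) : wstat (G :|: P) - wmean = 2 * (1 - p) * lin G + quad G.
  rewrite (wstatE _ p) sum_pairs_split.
  have hP e : e \in P -> (e \in G :|: P)%:R - p = 1 - p by move=> eP; rewrite finset.in_setU eP orbT.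
  have hS e : e \in S -> (e \in G :|: P)%:R - p = Z p e G.
    by rewrite finset.in_setD finset.in_setU => /andP[/negbTE -> _]; rewrite orbF.
  have -> : \sum_(e in P) \sum_(f in pairs n) wcoef e f * (((e \in G :|: P)%:R - p) * ((f \in G :|: P)%:R - p))
      = wmean + (1 - p) * lin G.
    under eq_bigr => e eP do rewrite sum_pairs_split.
    rewrite big_split /=; congr (_ + _).
      rewrite /wmean mulr_sumr; apply: eq_bigr => e eP; rewrite mulr_sumr; apply: eq_bigr => f fP.
      by rewrite !hP //; ring.
    rewrite exchange_big /lin mulr_sumr; apply: eq_bigr => f fS /=; rewrite /b mulr_suml mulr_sumr.
    by apply: eq_bigr => e eP; rewrite (hP e) // (hS f) // wcoef_sym; ring.
  have -> : \sum_(e in S) \sum_(f in pairs n) wcoef e f * (((e \in G :|: P)%:R - p) * ((f \in G :|: P)%:R - p))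
      = (1 - p) * lin G + quad G.
    under eq_bigr => e eS do rewrite sum_pairs_split.
    rewrite big_split /=; congr (_ + _).
      rewrite /lin mulr_sumr; apply: eq_bigr => e eS; rewrite /b mulr_suml mulr_sumr.
      by apply: eq_bigr => f fP; rewrite (hP f) // (hS e) //; ring.
    by apply: eq_bigr => e eS; apply: eq_bigr => f fS; rewrite !hS.
  ring.
apply: (@le_trans _ _ (E0 (fun G => 8 * lin G ^+ 2 + 2 * quad G ^+ 2))).
  apply: ex_le => // G; rewrite dec; set y := lin G; set z := quad G.
  have h1 : (2 * (1 - p) * y + z) ^+ 2 <= 2 * (2 * (1 - p) * y) ^+ 2 + 2 * z ^+ 2.
    by have := sqr_ge0 (2 * (1 - p) * y - z); nra.
  apply: le_trans h1 _; rewrite lerD2r.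
  have -> : 2 * (2 * (1 - p) * y) ^+ 2 = 8 * y ^+ 2 * (1 - p) ^+ 2 by ring.
  rewrite -[leRHS]mulr1; apply: ler_wpM2l; first by rewrite mulr_ge0 ?sqr_ge0.
  by apply: exprn_ile1; rewrite ?subr_ge0 ?gerBl.
rewrite exD !exZ linear_moment // quadratic_moment //; [|exact: wcoef_diag|exact: wcoef_sym].
have cS : #|S|%:R <= n%:R ^+ 2 / 2 :> R.
  apply: (@le_trans _ _ #|pairs n|%:R); first by rewrite ler_nat subset_leq_card.
  by rewrite card_pairs_real ler_wpM2r // expr2 ler_wpM2l ?(ltW nr) // gerBl.
have hb : \sum_(e in S) b e ^+ 2 <= 16 * (n%:R ^+ 2 / 2).
  apply: (@le_trans _ _ (\sum_(e in S) 16)).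
    apply: ler_sum => e eS; rewrite -[b e ^+ 2]real_normK ?num_real //.
    by rewrite -[16]/((4 ^ 2)%:R) natrX lerXn2r ?nnegrE // bP.
  by rewrite sumr_const -[_ *+ _]mulr_natr ler_wpM2l.
have hq : \sum_(e in S) \sum_(f in S) wcoef e f ^+ 2 <= (n%:R ^+ 2 / 2) * (2 * n%:R + 8).
  apply: (@le_trans _ _ (\sum_(e in S) (2 * n%:R + 8))); last first.
    by rewrite sumr_const -[_ *+ _]mulr_natl ler_wpM2r // addr_ge0 // mulr_ge0 // ltW.
  apply: ler_sum => e eS; apply: le_trans (wcoef_row_sq (fintype.subsetP sS _ eS)).
  rewrite [leRHS]sum_pairs_split lerDr sumr_ge0 // => f _; exact: sqr_ge0.
have v0 : 0 <= p * (1 - p) by rewrite mulr_ge0 // subr_ge0.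
have vp : p * (1 - p) <= p by rewrite -[leRHS]mulr1 ler_wpM2l // gerBl.
have h1 : p * (1 - p) * \sum_(e in S) b e ^+ 2 <= p * (16 * (n%:R ^+ 2 / 2)).
  apply: ler_pM => //; apply: sumr_ge0 => e _; exact: sqr_ge0.
have h2 : (p * (1 - p)) ^+ 2 * \sum_(e in S) \sum_(f in S) wcoef e f ^+ 2 <= p ^+ 2 * ((n%:R ^+ 2 / 2) * (2 * n%:R + 8)).
  apply: ler_pM; rewrite ?sqr_ge0 //; last by rewrite lerXn2r // nnegrE.
  by apply: sumr_ge0 => e _; apply: sumr_ge0 => f _; exact: sqr_ge0.
have e1 : p * (16 * (n%:R ^+ 2 / 2)) = 8 * lam * n%:R by rewrite -pn; field.
have e2 : p ^+ 2 * (n%:R ^+ 2 / 2 * (2 * n%:R + 8)) = lam ^+ 2 * (n%:R + 4) by rewrite -pn; field.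
have n2r : 2 <= n%:R :> R by rewrite ler_nat.
have l2 : 0 <= lam ^+ 2 by exact: sqr_ge0.
rewrite e1 in h1; rewrite e2 in h2.
have h3 : lam ^+ 2 * 2 <= lam ^+ 2 * n%:R by rewrite ler_wpM2l.
have fin (x y z : R) : x <= 8 * lam * n%:R -> y <= lam ^+ 2 * (n%:R + 4) -> z = 2 * y ->
    8 * x + 2 * z <= (64 * lam + 20 * lam ^+ 2) * n%:R.
  by move=> a1 a2 ->; lra.
by apply: fin h1 h2 _ => //; rewrite mulrA.
Qed.

Definition emean : R := #|P|%:R + p * #|S|%:R.

Lemma nedges_moment : E0 (fun G => ((nedges (G :|: P))%:R - emean) ^+ 2) <= lam * n%:R.
Proof.
rewrite (ex_ext _ (psi := fun G => (\sum_(e in S) 1 * Z p e G) ^+ 2)); last first.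
  move=> G; congr (_ ^+ 2); rewrite /nedges -sum1_card natr_sum.
  have -> : \sum_(e in (G :|: P) :&: pairs n) 1 = \sum_(e in pairs n) (e \in G :|: P)%:R :> R.
    rewrite big_mkcond [RHS]big_mkcond; apply: eq_bigr => e _; rewrite finset.in_setI.
    by case: (e \in G :|: P); case: (e \in pairs n).
  rewrite sum_pairs_split (eq_bigr (fun _ => 1)); last by move=> e eP; rewrite finset.in_setU eP orbT.
  have -> : \sum_(e in P) 1 = #|P|%:R :> R by rewrite -sum1_card natr_sum.
  rewrite /emean opprD addrACA subrr add0r.
  have -> : p * #|S|%:R = \sum_(e in S) p by rewrite sumr_const -[RHS]mulr_natr.
  rewrite -sumrB; apply: eq_bigr => e; rewrite finset.in_setD => /andP[/negbTE eP _].
  by rewrite finset.in_setU eP orbF mul1r.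
rewrite linear_moment //.
rewrite (eq_bigr (fun _ => 1)) ?expr1n //.
have -> : \sum_(e in S) 1 = #|S|%:R :> R by rewrite -sum1_card natr_sum.
have v0 : 0 <= p * (1 - p) by rewrite mulr_ge0 // subr_ge0.
have vp : p * (1 - p) <= p by rewrite -[leRHS]mulr1 ler_wpM2l // gerBl.
have cS : #|S|%:R <= n%:R ^+ 2 :> R.
  apply: (@le_trans _ _ #|pairs n|%:R); first by rewrite ler_nat subset_leq_card.
  rewrite card_pairs_real; have n2r : 2 <= n%:R :> R by rewrite ler_nat.
  by rewrite ler_pdivrMr //; nra.
apply: (@le_trans _ _ (p * n%:R ^+ 2)); first by apply: ler_pM.
by rewrite -pn expr2 mulrA.
Qed.

End Statistic.

(** * The planted path in the wedge statistic *)

Section PlantedEdges.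
Context {R : realType}.
Variables (k n : nat) (s : {ffun 'I_k.+1 -> 'I_n}).
Notation K := k.+1.
Hypotheses (si : injective s) (Kn : (K <= n)%N).
Notation P := (planted K n s).

Definition path_edge (i : 'I_k) : {set 'I_n} := [set at_pos s i; at_pos s i.+1].

Lemma at_pos_eq i j : (i < K)%N -> (j < K)%N -> (at_pos s i == at_pos s j) = (i == j).
Proof.
move=> hi hj; rewrite /at_pos (inj_eq si); apply/eqP/eqP => [/(congr1 val)|->//].
by rewrite /= !inordK.
Qed.

Lemma planted_image : P = [set path_edge i | i : 'I_k].
Proof.
apply/finset.setP => e; apply/imsetP/imsetP => -[].
  move=> f; rewrite inE => /existsP[i /existsP[j /andP[/eqP ij /eqP ->]]] ->.
  have ik : (i < k)%N by rewrite -ltnS -[X in (X < _)%N]ij; exact: ltn_ord.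
  exists (Ordinal ik) => //; rewrite finset.imsetU1 finset.imset_set1 /path_edge /at_pos /= inord_val.
  by congr [set _; s _]; apply: val_inj; rewrite /= inordK // ij.
move=> i _ ->; have ik := ltn_ord i.
exists [set inord i; inord i.+1]; last by rewrite finset.imsetU1 finset.imset_set1.
rewrite inE; apply/existsP; exists (inord i); apply/existsP; exists (inord i.+1).
by rewrite eqxx andbT /= !inordK // ltnS ltnW.
Qed.

Lemma path_edge_inj : injective path_edge.
Proof.
move=> i j /finset.setP h; have ik := ltn_ord i; have jk := ltn_ord j.
have h1 := h (at_pos s i); have h2 := h (at_pos s i.+1); have h3 := h (at_pos s j); have h4 := h (at_pos s j.+1).
move: h1 h2 h3 h4; rewrite !inE !at_pos_eq; try (move: ik jk; clear; lia).
by move=> h1 h2 h3 h4; apply: val_inj; move: h1 h2 h3 h4; clear; rewrite /=; lia.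
Qed.

Lemma card_planted : #|P| = k.
Proof. by rewrite planted_image card_imset ?card_ord //; exact: path_edge_inj. Qed.

Lemma sum_planted (F : {set 'I_n} -> R) : \sum_(e in P) F e = \sum_(i < k) F (path_edge i).
Proof.
rewrite planted_image big_imset /=; last by move=> i j _ _; exact: path_edge_inj.
by apply: eq_bigl => i; rewrite inE.
Qed.

Lemma planted_degree (u : 'I_n) : \sum_(f in P) (u \in f)%:R <= 2 :> R.
Proof.
rewrite sum_planted; apply: (@le_trans _ _ (\sum_(i < k) ((at_pos s i == u)%:R + (at_pos s i.+1 == u)%:R))).
  apply: ler_sum => i _; rewrite /path_edge !inE !(eq_sym u) -natrD ler_nat.
  by case: (_ == u); case: (_ == u).
rewrite big_split /= -[2]/(1 + 1); apply: lerD; apply: sum_unique_le1 => i j /eqP h1 /eqP h2.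
  have /eqP : at_pos s i == at_pos s j by rewrite h1 h2.
  by move/eqP; rewrite at_pos_eq ?ltnS ?(ltnW (ltn_ord _)) // => /eqP; exact: val_inj.
have /eqP : at_pos s i.+1 == at_pos s j.+1 by rewrite h1 h2.
by move/eqP; rewrite at_pos_eq ?ltnS ?ltn_ord // eqSS => /eqP; exact: val_inj.
Qed.

Lemma planted_touch e : e \in pairs n -> \sum_(f in P) (touch e f)%:R <= 4 :> R.
Proof.
rewrite inE => /cards2P[u [v [_ ->]]].
apply: (@le_trans _ _ (\sum_(f in P) ((u \in f)%:R + (v \in f)%:R))).
  apply: ler_sum => f _; rewrite /touch -natrD ler_nat -setI_eq0 finset.setIUl finset.setU_eq0 !setI_eq0 !finset.disjoints1.
  by case: (_ != f); case: (u \in f); case: (v \in f).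
by rewrite big_split /=; have := planted_degree u; have := planted_degree v; lra.
Qed.

(** The number of path edges touching [e], at most two per end of [e], and the correction both lie
    between [0] and [4], hence so does the modulus of their difference. *)
Lemma planted_row e : e \in pairs n -> `|\sum_(f in P) wcoef e f| <= 4 :> R.
Proof.
move=> ep; rewrite /wcoef sumrB -mulr_sumr.
have h1 := planted_touch ep; have h0 : 0 <= \sum_(f in P) (touch e f)%:R :> R by apply: sumr_ge0.
have h2 : 0 <= \sum_(f in P) (e != f)%:R :> R by apply: sumr_ge0.
have h3 : \sum_(f in P) (e != f)%:R <= k%:R :> R.
  have -> : k%:R = \sum_(f in P) 1 :> R by rewrite sumr_const card_planted.
  by apply: ler_sum => f _; case: (_ != _).
have n1 : 0 < n.+1%:R :> R by rewrite ltr0n.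
have h4 : 4 / n.+1%:R * \sum_(f in P) (e != f)%:R <= 4 :> R.
  rewrite mulrAC ler_pdivrMr // ler_wpM2l //; apply: le_trans h3 _; rewrite ler_nat.
  by move: Kn; clear; lia.
have h5 : 0 <= 4 / n.+1%:R * \sum_(f in P) (e != f)%:R :> R by rewrite mulr_ge0 // divr_ge0.
move: h1 h0 h4 h5; rewrite ler_norml; set a := \sum_(f in P) (touch e f)%:R; set b := 4 / _ * _ => h1 h0 h4 h5.
by clear -h1 h0 h4 h5; apply/andP; split; lra.
Qed.

Lemma planted_wcoef_le : \sum_(e in P) \sum_(f in P) wcoef e f <= 4 * k%:R :> R.
Proof.
rewrite -[X in _ * X%:R]card_planted mulr_natr -sumr_const; apply: ler_sum => e eP.
have ep := fintype.subsetP (planted_pairs si) _ eP.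
by apply: le_trans (ler_norm _) (planted_row ep).
Qed.

(** The [k - 1] pairs of consecutive edges are counted in both orders, and for [4 K <= n] the
    correction takes back at most half of this. *)
Lemma planted_wcoef_ge : (4 * K <= n)%N -> k.-1%:R <= \sum_(e in P) \sum_(f in P) wcoef e f :> R.
Proof.
move=> K4.
have e1 : \sum_(e in P) \sum_(f in P) wcoef e f =
    \sum_(e in P) \sum_(f in P) (touch e f)%:R - 4 / n.+1%:R * (k%:R * (k%:R - 1)) :> R.
  rewrite /wcoef; under eq_bigr => e eP do rewrite sumrB -mulr_sumr sum_neq // card_planted.
  by rewrite sumrB sumr_const card_planted -[_ *+ k]mulr_natl [k%:R * (4 / _ * _)]mulrCA.
have e2 : 2 * k.-1%:R <= \sum_(e in P) \sum_(f in P) (touch e f)%:R :> R.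
  rewrite sum_planted; under eq_bigr => i _ do rewrite sum_planted.
  apply: (@le_trans _ _ (\sum_(i < k) \sum_(j < k) ((j == i.+1 :> nat)%:R + (i == j.+1 :> nat)%:R))).
    under eq_bigr => i _ do rewrite big_split /=.
    rewrite big_split /= [X in _ + X]exchange_big /=.
    have cnt : k.-1%:R <= \sum_(i < k) \sum_(j < k) (j == i.+1 :> nat)%:R :> R.
      case: (k) => [|m]; first by rewrite big_ord0.
      rewrite big_ord_recr /= -[leLHS]addr0; apply: lerD; last by apply: sumr_ge0.
      have {1}-> : m%:R = \sum_(i < m) 1 :> R by rewrite sumr_const card_ord.
      apply: ler_sum => i _; have im : (i.+1 < m.+1)%N by rewrite ltnS.
      by rewrite (bigD1 (Ordinal im)) //= eqxx lerDl sumr_ge0.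
    by rewrite mulr_natl mulr2n; apply: lerD.
  apply: ler_sum => i _; apply: ler_sum => j _; have ik := ltn_ord i; have jk := ltn_ord j.
  have tch (a b : 'I_k) : b = a.+1 :> nat -> touch (path_edge a) (path_edge b).
    move=> ab; rewrite /touch (inj_eq path_edge_inj); apply/andP; split.
      by apply/eqP => E; move: ab; rewrite E; clear; lia.
    apply/negP => /pred0P /(_ (at_pos s b)); rewrite /= /path_edge !inE -ab !eqxx orbT //.
  rewrite -natrD ler_nat; case: eqP => [h|_].
    rewrite (tch i j) // ; by have -> : (i == j.+1 :> nat) = false by apply/eqP; rewrite h; clear; lia.
  by rewrite add0n; case: eqP => // h; rewrite touch_sym (tch j i).
have n1 : 0 < n.+1%:R :> R by rewrite ltr0n.
rewrite e1; case: (posnP k) => [k0|k0].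
  have -> : k.-1%:R = 0 :> R by rewrite k0.
  have -> : k%:R = 0 :> R by rewrite k0.
  by rewrite mul0r mulr0 subr0 sumr_ge0 // => e _; apply: sumr_ge0.
have ek : k.-1%:R = k%:R - 1 :> R by rewrite -subn1 natrB.
rewrite ek in e2 *.
have h : 4 / n.+1%:R * (k%:R * (k%:R - 1)) <= k%:R - 1 :> R.
  rewrite mulrA -[leRHS]mul1r ler_wpM2r ?subr_ge0 ?ler1n // mulrAC ler_pdivrMr // mul1r -natrM ler_nat.
  by move: K4; clear; lia.
by move: h e2; set a := 4 / _ * _; set b := \sum_(e in P) _; clear; lra.
Qed.

End PlantedEdges.

(** * Supercritical detection *)

Definition wedge_test (n K u N : nat) (G : graph n) : bool :=
  (K + 8 * (nedges G * (nedges G).-1 %/ n.+1) <= (nwedges G).*2 < N)%N || (u * n.-1 <= 16 * nedges G < N)%N.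

(** Chebyshev bounds at distance [K / 4] for the wedge statistic and [n / 32] for the number of
    edges. *)
Definition wedge_err (R : realType) (lam : R) (n K : nat) : R :=
  (K%:R / 4) ^- 2 * ((64 * lam + 20 * lam ^+ 2) * n%:R) + (n%:R / 32) ^- 2 * (lam * n%:R).

(** Common to both kinds of error: [P] is empty under the null law and the planted path
    otherwise. *)
Lemma wedge_deviation (R : realType) (lam p : R) (n K : nat) (P : graph n) (B : graph n -> bool) :
  0 <= p <= 1 -> p * n%:R = lam -> (2 <= n)%N -> (0 < K)%N -> P \subset pairs n ->
  (forall e, e \in pairs n :\: P -> `|\sum_(f in P) wcoef e f : R| <= 4) ->
  (forall G : graph n, B G -> K%:R / 4 <= `|wstat (G :|: P) - wmean p P| \/
      n%:R / 32 <= `|(nedges (G :|: P))%:R - emean p P|) ->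
  Ex p (fun G => (B G)%:R) <= wedge_err lam n K.
Proof.
move=> p01 pn n2 K0 sP bP hB; have nr : 0 < n%:R :> R by rewrite ltr0n (leq_trans _ n2).
have hm := wstat_moment p01 pn n2 sP bP; have he := nedges_moment p01 pn n2 sP.
have d1 : 0 < K%:R / 4 :> R by rewrite divr_gt0 // ltr0n.
have d2 : 0 < n%:R / 32 :> R by rewrite divr_gt0.
pose B1 (G : graph n) := K%:R / 4 <= `|wstat (G :|: P) - wmean p P|.
pose B2 (G : graph n) := n%:R / 32 <= `|(nedges (G :|: P))%:R - emean p P|.
apply: (@le_trans _ _ (Ex p (fun G => (B1 G)%:R + (B2 G)%:R))).
  apply: ex_le => // G; case: (boolP (B G)) => [/hB[h|h]|_]; last by rewrite addr_ge0.
    by rewrite /B1 h lerDl.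
  by rewrite /B2 h lerDr.
rewrite exD; apply: lerD.
  have := @chebyshev_ex R p n p01 B1 (fun G => wstat (G :|: P) - wmean p P) _ d1 (fun G _ h => h).
  move=> h; apply: le_trans h _; rewrite ler_wpM2l // invr_ge0 exprn_ge0 // ltW.
have := @chebyshev_ex R p n p01 B2 (fun G => (nedges (G :|: P))%:R - emean p P) _ d2 (fun G _ h => h).
by move=> h; apply: le_trans h _; rewrite ler_wpM2l // invr_ge0 exprn_ge0 // ltW.
Qed.

Lemma falling_quotient (R : realType) (n m : nat) : let q := (m * m.-1 %/ n.+1)%N in
  q%:R * n.+1%:R <= m%:R * (m%:R - 1) :> R /\ m%:R * (m%:R - 1) <= (q%:R + 1) * n.+1%:R :> R.
Proof.
have mm : (m * m.-1)%:R = m%:R * (m%:R - 1) :> R.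
  case: m => [|m]; first by rewrite !mul0r.
  by rewrite natrM -[m.+1%:R - 1]/(m.+1%:R - 1%:R) -natrB // subn1.
split; rewrite -mm; first by rewrite -natrM ler_nat leq_trunc_div.
by rewrite natr1 -natrM ler_nat ltnW // ltn_ceil.
Qed.

(** Rounding the quotient down costs at most [4] in the statistic, so acceptance means
    [wstat >= K / 2 - 4], which is at least [K / 4] because [K >= 16]. For the edge count,
    [16 m >= (8 lam + 1) (n - 1)] exceeds sixteen times the mean by [n - 1]. *)
Lemma wedge_null (R : realType) (lam p : R) (n K u N : nat) : 0 <= p <= 1 -> p * n%:R = lam ->
  (16 <= K)%N -> (K <= n)%N -> 8 * lam + 1 <= u%:R ->
  Ex p (fun G : graph n => (wedge_test K u N G)%:R) <= wedge_err lam n K.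
Proof.
move=> p01 pn K16 Kn u1.
have n2 : (2 <= n)%N by apply: leq_trans Kn; apply: leq_trans K16.
have nr : 0 < n%:R :> R by rewrite ltr0n (leq_trans _ n2).
have n16 : 16 <= n%:R :> R by rewrite ler_nat (leq_trans K16).
have npred : n.-1%:R = n%:R - 1 :> R by rewrite -subn1 natrB // (leq_trans _ n2).
apply: (@wedge_deviation _ _ _ _ _ finset.set0) => //; first exact: leq_trans K16.
- exact: finset.sub0set.
- by move=> e _; rewrite big_set0 normr0.
move=> G.
have -> : wmean p (finset.set0 : graph n) = 0 :> R by rewrite /wmean big1 ?mulr0 // => e; rewrite inE.
have -> : emean p (finset.set0 : graph n) = lam * (n%:R - 1) / 2 :> R.
  by rewrite /emean cards0 add0r finset.setD0 card_pairs_real // -pn; field.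
rewrite finset.setU0 subr0 => /orP[/andP[h _]|/andP[h _]]; [left|right].
  have [q1 q2] := falling_quotient R n (nedges G); move: h q1 q2; set q := (_ %/ _)%N; set m := nedges G; set A := nwedges G => h q1 q2.
  have h' : K%:R + 8 * q%:R <= 2 * A%:R :> R by rewrite -!natrM -natrD ler_nat mul2n.
  have n1 : 0 < n.+1%:R :> R by rewrite ltr0n.
  have q3 : m%:R * (m%:R - 1) / n.+1%:R <= q%:R + 1 :> R by rewrite ler_pdivrMr.
  have K16r : 16 <= K%:R :> R by rewrite ler_nat.
  apply: le_trans (ler_norm _); rewrite /wstat -/A -/m.
  have -> : 4 / n.+1%:R * (m%:R * (m%:R - 1)) = 4 * (m%:R * (m%:R - 1) / n.+1%:R) :> R by ring.
  by move: q3 h' K16r; set z := _ / n.+1%:R; clear; lra.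
apply: le_trans (ler_norm _); have h' : u%:R * (n%:R - 1) <= 16 * (nedges G)%:R :> R.
  by rewrite -npred -!natrM ler_nat.
have h2 : (8 * lam + 1) * (n%:R - 1) <= u%:R * (n%:R - 1) by rewrite ler_wpM2r //; lra.
move: h' h2 n16; rewrite [(8 * lam + 1) * _]mulrDl mul1r; set a := u%:R * _; set b := (nedges G)%:R.
rewrite -[8 * lam * _]mulrA; set c := lam * (_ - 1); clear; lra.
Qed.

(** For [4 K <= n] the mean is at least [(15 / 16) (K - 2) >= 3 K / 4], so a deviation below [K / 4]
    keeps the statistic above [K / 2]. For larger [K] the path adds nearly [n / 4] edges, more than
    the gap of about [n / 8] left by [u <= 8 lam + 2]. The bound [p <= 1 / 32] serves
    [(1 - p) ^ 2 >= 15 / 16]. *)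
Lemma wedge_planted (R : realType) (lam p : R) (n k u N : nat) (s : {ffun 'I_k.+1 -> 'I_n}) :
  0 <= p <= 1 -> p * n%:R = lam -> 0 < lam ->
  (16 <= k.+1)%N -> (k.+1 <= n)%N -> u%:R <= 8 * lam + 2 -> injective s -> p <= 32^-1 ->
  (n%:R * (n%:R - 1) / 2 <= N%:R :> R) ->
  20 + 32 * (lam / 2 + 2) + 16 * (lam / 2 + 2) ^+ 2 < n%:R - 1 ->
  Ex p (fun G : graph n => (~~ wedge_test k.+1 u N (G :|: planted k.+1 n s))%:R) <= wedge_err lam n k.+1.
Proof.
move=> p01 pn l0 K16 Kn u2 si p32 hN hn; set P := planted k.+1 n s; set K := k.+1 in K16 Kn *.
have n2 : (2 <= n)%N by apply: leq_trans Kn; apply: leq_trans K16.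
have nr : 0 < n%:R :> R by rewrite ltr0n (leq_trans _ n2).
have n16 : 16 <= n%:R :> R by rewrite ler_nat (leq_trans K16).
have npred : n.-1%:R = n%:R - 1 :> R by rewrite -subn1 natrB // (leq_trans _ n2).
have [p0 p1] : 0 <= p /\ p <= 1 by apply/andP.
have sP : P \subset pairs n by exact: planted_pairs.
have cP : #|P| = k by exact: card_planted.
apply: (@wedge_deviation _ _ _ _ _ P) => //.
  by move=> e; rewrite finset.in_setD => /andP[_ ep]; exact: planted_row.
move=> G.
set m := nedges (G :|: P); set A := nwedges (G :|: P).
set mu := wmean p P; set em := emean p P; set W := wstat (G :|: P).
move=> hB; apply/orP; apply: contraR hB; rewrite negb_or -!ltNge => /andP[dW dm].
have emE : em = k%:R * (1 - p) + lam * (n%:R - 1) / 2.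
  by rewrite /em /emean cardsD (finset.setIidPr sP) natrB ?subset_leq_card // card_pairs_real // cP -pn; field.
have kn : k%:R <= n%:R - 1 :> R by rewrite -npred ler_nat; move: Kn; clear; lia.
have B0 : 0 < lam / 2 + 2 by move: l0; clear; lra.
have em_le : em <= n%:R + lam / 2 * n%:R.
  have a1 : k%:R * (1 - p) <= k%:R by rewrite ler_piMr // gerBl.
  have a2 : lam * (n%:R - 1) <= lam * n%:R by rewrite ler_wpM2l ?(ltW l0) // gerBl.
  by rewrite emE; move: a1 a2 kn; set x := k%:R * _; set y := lam * (_ - _); clear; lra.
have m_le : m%:R <= (lam / 2 + 2) * n%:R.
  move: dm; rewrite ltr_norml => /andP[_ dm]; rewrite mulrDl.
  by move: dm em_le nr; set x := lam / 2 * _; clear; lra.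
have n1 : 0 < n.+1%:R :> R by rewrite ltr0n.
(* The machine compares only values below its number of cells, at least of order [n ^ 2 / 2]; all
   counters involved are [O(n)], with these constants. *)
have Nbig : 10 * n%:R + 16 * ((lam / 2 + 2) * n%:R) + 8 * ((lam / 2 + 2) ^+ 2 * n%:R) < N%:R.
  apply: lt_le_trans hN; have := hn; rewrite -(ltr_pM2l nr); lra.
have m0 : 0 <= m%:R :> R by rewrite ler0n.
rewrite /wedge_test -/m -/A; have [K4|K4] := leqP (4 * K) n; apply/orP; [left|right].
  have [q1 _] := falling_quotient R n m; move: q1; set q := (_ %/ _)%N => q1.
  have q3 : q%:R <= m%:R * (m%:R - 1) / n.+1%:R :> R by rewrite ler_pdivlMr.
  have WE : W = A%:R - 4 * (m%:R * (m%:R - 1) / n.+1%:R) by rewrite /W /wstat -/A -/m; ring.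
  have sq : m%:R * (m%:R - 1) / n.+1%:R <= (lam / 2 + 2) ^+ 2 * n%:R :> R.
    rewrite ler_pdivrMr //; apply: (@le_trans _ _ (m%:R * m%:R)); first by rewrite ler_wpM2l // gerBl.
    apply: (@le_trans _ _ (((lam / 2 + 2) * n%:R) * ((lam / 2 + 2) * n%:R))); first exact: ler_pM.
    have -> : (lam / 2 + 2) * n%:R * ((lam / 2 + 2) * n%:R) = (lam / 2 + 2) ^+ 2 * n%:R * n%:R :> R by ring.
    by apply: ler_wpM2l; [rewrite mulr_ge0 ?sqr_ge0 ?(ltW nr)|rewrite ler_nat].
  have s1 : k.-1%:R <= \sum_(e in P) \sum_(f in P) wcoef e f :> R by exact: planted_wcoef_ge.
  have s2 : \sum_(e in P) \sum_(f in P) wcoef e f <= 4 * k%:R :> R by exact: planted_wcoef_le.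
  have K16r : 16 <= K%:R :> R by rewrite ler_nat.
  have kK : k%:R = K%:R - 1 :> R by rewrite -[K%:R]natr1 addrK.
  have k1K : k.-1%:R = K%:R - 2 :> R.
    rewrite -subn1 natrB; first by rewrite kK; ring.
    by move: K16; clear; lia.
  have om : 15 / 16 <= (1 - p) ^+ 2 by rewrite expr2; nra.
  have om1 : (1 - p) ^+ 2 <= 1 by apply: exprn_ile1; rewrite ?subr_ge0 ?gerBl.
  have mu1 : 3 / 4 * K%:R <= mu.
    apply: (@le_trans _ _ (15 / 16 * (K%:R - 2))); first by move: K16r; clear; lra.
    by rewrite /mu /wmean; apply: ler_pM => //; [move: K16r; clear; lra|rewrite -k1K].
  have mu2 : mu <= 4 * K%:R.
    rewrite /mu /wmean; apply: (@le_trans _ _ (1 * (4 * k%:R))); last by rewrite mul1r kK; move: K16r; clear; lra.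
    apply: ler_pM => //; first exact: sqr_ge0.
    by apply: le_trans s1; rewrite ler0n.
  move: dW; rewrite ltr_norml => /andP[dW1 dW2].
  have KnR : K%:R <= n%:R :> R by rewrite ler_nat.
  move: q3 sq WE; set z := _ / n.+1%:R => q3 sq WE.
  apply/andP; split.
    rewrite -(ler_nat R) natrD natrM -mul2n natrM.
    by move: dW1 mu1 q3 WE K16r; rewrite -/W -/mu; clear; lra.
  rewrite -(ltr_nat R) -mul2n natrM; apply: le_lt_trans Nbig.
  have : 0 <= (lam / 2 + 2) * n%:R by rewrite mulr_ge0 ?(ltW B0) ?(ltW nr).
  by move: dW2 mu2 sq WE KnR nr; rewrite -/W -/mu; set y := (lam / 2 + 2) ^+ 2 * _; set y' := (lam / 2 + 2) * _; clear; lra.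
apply/andP; split; last first.
  rewrite -(ltr_nat R) natrM; apply: le_lt_trans Nbig.
  have : 0 <= (lam / 2 + 2) ^+ 2 * n%:R by rewrite mulr_ge0 ?sqr_ge0 ?(ltW nr).
  by move: m_le nr; set y := (lam / 2 + 2) ^+ 2 * _; set y' := (lam / 2 + 2) * _; clear; lra.
rewrite -(ler_nat R) !natrM npred.
apply: (@le_trans _ _ ((8 * lam + 2) * (n%:R - 1))); first by rewrite ler_wpM2r //; move: n16; clear; lra.
have kq : n%:R - 4 <= 4 * k%:R :> R.
  have : n%:R <= (4 * K)%:R :> R by rewrite ler_nat ltnW.
  by rewrite natrM -[K%:R]natr1; clear; lra.
have kp : k%:R * (31 / 32) <= k%:R * (1 - p) by rewrite ler_wpM2l //; move: p32; clear; lra.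
move: dm; rewrite ltr_norml emE => /andP[dm _].
rewrite mulrDl -[8 * lam * _]mulrA.
by move: dm kp kq n16; set y := k%:R * (1 - p); set y' := lam * (_ - _); clear; lra.
Qed.

Section Supercritical.
Local Open Scope classical_set_scope.
Local Open Scope ring_scope.

Lemma supercritical_detection (R : realType) (lam : R) (K : nat -> nat) : 0 < lam ->
  (forall n, (K n <= n)%N) ->
  (fun n : nat => (K n)%:R / Num.sqrt (n%:R : R)) @ \oo --> +oo -> detection_easy lam K.
Proof.
move=> l0 Kn /cvgyE Klarge.
(* The only trace of [lam] in the program: an integer between [8 lam + 1] and [8 lam + 2]. *)
pose u := (Num.truncn (8 * lam)).+2.
have u1 : 8 * lam + 1 <= u%:R by rewrite /u -[X in _ <= X]natr1 lerD2r ltW // truncnS_gt.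
have u2 : u%:R <= 8 * lam + 2.
  by rewrite /u -addn2 natrD lerD2r truncn_le // mulr_ge0 // ltW.
have [M [a [d hM]]] := tm_wedge u; exists M, a, d; split.
  by move=> n G; case: (hM n (K n) G (Kn n)).
pose C1 := 16 * (64 * lam + 20 * lam ^+ 2).
have C10 : 0 < C1 by rewrite mulr_gt0 // addr_gt0 // mulr_gt0 // exprn_gt0.
suff main (e : R) : 0 < e -> exists N, forall n, (N <= n)%N ->
    err0 lam n (fun G : graph n => tm_accepts M (a * n.+1 ^ d) (encode (K n) n G)) <= e /\
    err1 lam (K n) n (fun G : graph n => tm_accepts M (a * n.+1 ^ d) (encode (K n) n G)) <= e.
  have [N1 hN1] := edge_prob_props l0.
  split; apply/cvg0E => e e0; have [N hN] := main e e0; exists (N + N1)%N => n hn.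
    have hn1 : (N1 <= n)%N by move: hn; clear; lia.
    have [_ p01 _] := hN1 n hn1; rewrite ger0_norm; last by rewrite err0E; apply: ex_ge0.
    have hn0 : (N <= n)%N by move: hn; clear; lia.
    by have [] := hN n hn0.
  have hn1 : (N1 <= n)%N by move: hn; clear; lia.
  have [_ p01 _] := hN1 n hn1; rewrite ger0_norm.
    have hn0 : (N <= n)%N by move: hn; clear; lia.
    by have [] := hN n hn0.
  rewrite err1E -(av_cst (Kn n) 0); apply: av_le => s si; exact: ex_ge0.
move=> e0.
pose e' := e / 2; have e'0 : 0 < e' by rewrite divr_gt0.
have [N1 hN1] := eventually_and (edge_prob_props l0) (Klarge (Num.max 16 (C1 / e' + 1))).
pose B := lam / 2 + 2.
have [N2 hN2] := natr_large (20 + 32 * B + 16 * B ^+ 2 + 2).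
have [N3 hN3] := natr_large (1024 * lam / e').
have [N4 hN4] := natr_large (32 * lam).
exists (N1 + N2 + N3 + N4 + 4)%N => n hn.
have hn1 : (N1 <= n)%N by move: hn; clear; lia.
have [[n0 p01 pn] hK] := hN1 n hn1.
have nr : 0 < n%:R :> R by rewrite ltr0n.
have n1 : 1 <= n%:R :> R by rewrite ler1n.
have sn0 : 0 < Num.sqrt (n%:R : R) by rewrite sqrtr_gt0.
have sn1 : 1 <= Num.sqrt (n%:R : R) by rewrite -[leLHS]sqrtr1 ler_wsqrtr.
move: hK; rewrite ge_max => /andP[hK1 hK2].
have K16 : (16 <= K n)%N.
  rewrite -(ler_nat R); move: hK1; rewrite ler_pdivlMr // => h; apply: le_trans h.
  by rewrite ler_peMr.
have Kr : 0 < (K n)%:R :> R by rewrite ltr0n; apply: leq_trans K16.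
have err_le : wedge_err lam n (K n) <= e.
  have part1 : (((K n)%:R / 4) ^- 2) * ((64 * lam + 20 * lam ^+ 2) * n%:R) <= e'.
    have -> : (((K n)%:R / 4) ^- 2) * ((64 * lam + 20 * lam ^+ 2) * n%:R) = C1 * (n%:R / (K n)%:R ^+ 2).
      by rewrite /C1; field; rewrite gt_eqF.
    set y := (K n)%:R / Num.sqrt n%:R in hK1 hK2; have y0 : 0 < y by rewrite divr_gt0.
    have -> : n%:R / (K n)%:R ^+ 2 = y ^- 2 :> R.
      by rewrite /y expr_div_n sqr_sqrtr // invf_div.
    rewrite ler_pdivrMr ?exprn_gt0 // mulrC -ler_pdivrMr //.
    have y1 : 1 <= y by apply: le_trans hK2; rewrite lerDr divr_ge0 // ltW.
    apply: (@le_trans _ _ y); first by apply: le_trans hK2; rewrite lerDl.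
    by rewrite expr2 ler_peMr // ltW.
  have part2 : ((n%:R / 32) ^- 2) * (lam * n%:R) <= e'.
    have -> : ((n%:R / 32) ^- 2) * (lam * n%:R) = 1024 * lam / n%:R by field; rewrite gt_eqF.
    rewrite ler_pdivrMr // [leRHS]mulrC -ler_pdivrMr //; apply: hN3; move: hn; clear; lia.
  have -> : e = e' + e' by rewrite /e'; field.
  exact: lerD.
have n4 : (3 < n)%N by move: hn; clear; lia.
pose Nn := ((K n).+1 + size (upto n n))%N.
have acc (G : graph n) : tm_accepts M (a * n.+1 ^ d) (encode (K n) n G) = wedge_test (K n) u Nn G.
  case: (hM n (K n) G (Kn n)) => _ /(_ n4) ->; rewrite /wedge_test /nedges /nwedges -/Nn.
  by case: (n) n4 G => // n' _ G; rewrite size_edgesE wedge_sumE.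
split.
  rewrite err0E; apply: le_trans err_le; under ex_ext do rewrite acc.
  exact: wedge_null.
rewrite err1E -[leRHS](av_cst (Kn n)); apply: av_le => s si; apply: le_trans err_le.
under ex_ext do rewrite acc.
case: (K n) (Kn n) K16 s si {acc Kr hK1 hK2} @Nn => [//|k] Kn' K16 s si Nn.
apply: (wedge_planted (lam := lam)) => //.
- rewrite -(ler_pM2r nr) pn ler_pdivlMl //; apply: hN4; move: hn; clear; lia.
- have tu : (size (upto n n)).*2 = (n * n.-1)%N by exact: (tri_upto 0 n (fun _ _ => false)).
  have npred : n.-1%:R = n%:R - 1 :> R by rewrite -subn1 natrB.
  rewrite ler_pdivrMr // -npred -!natrM ler_nat /Nn -tu -muln2; clear; lia.
- have h : 20 + 32 * B + 16 * B ^+ 2 + 2 <= n%:R by apply: hN2; move: hn; clear; lia.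
  by rewrite -/B; lra.
Qed.

End Supercritical.

Local Open Scope classical_set_scope.
Local Open Scope ring_scope.

Theorem theorem2 (R : realType) (lam : R) (K : nat -> nat) :
  0 < lam ->
  (forall n, (K n <= n)%N) ->
  (lam < 1 ->
     ((fun n : nat => (ln (n%:R : R) / ln (lam^-1) - (K n)%:R) / ln (ln (n%:R : R)))
        @ \oo --> +oo ->
      detection_impossible lam K /\ reconstruction_impossible lam K) /\
     ((fun n : nat => (K n)%:R - ln (n%:R : R) / ln (lam^-1)) @ \oo --> +oo ->
      (fun n : nat => (K n)%:R * ln (n%:R : R) / n%:R) @ \oo --> (0 : R) ->
      detection_easy lam K /\ reconstruction_easy lam K)) /\
  (1 < lam ->
     ((fun n : nat => (K n)%:R / Num.sqrt (n%:R : R)) @ \oo --> (0 : R) ->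
      detection_impossible lam K /\ reconstruction_impossible lam K) /\
     ((fun n : nat => (K n)%:R / Num.sqrt (n%:R : R)) @ \oo --> +oo ->
      detection_easy lam K) /\
     ((fun n : nat => (K n)%:R / (n%:R : R)) @ \oo --> (0 : R) ->
      reconstruction_impossible lam K)).
Proof.
move=> l0 Kn; split=> [l1|l1].
  split=> [h|h1 h2].
    have m := subcritical_second_moment l0 l1 h.
    by split; [exact: second_moment_detection|exact: second_moment_reconstruction].
  by split; [exact: subcritical_detection|exact: subcritical_reconstruction].
split=> [h|].
  have m := supercritical_second_moment l0 l1 h.
  by split; [exact: second_moment_detection|exact: second_moment_reconstruction].
split=> h; [exact: supercritical_detection|exact: supercritical_reconstruction].
Qed.
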